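(* Assume the Generalized Riemann Hypothesis for all the Hecke $L$-functions $L(s,\Xi_k)$, $k\in\mathbb Z$ (including $k=0$, the Dedekind zeta function of $\mathbb Q(i)$). Let $g:[2,\infty)\to(0,\infty)$ be any function with $g(K)\to\infty$ as $K\to\infty$, and put $X=X(K)=K(\log K)^2 g(K)$. Then the Lebesgue measure of the set of $\theta\in[0,\pi/2)$ for which there is no prime ideal $\mathfrak p\subset\mathbb Z[i]$ with $\mathrm{N}\mathfrak p\le X$ and $\theta_{\mathfrak p}\in I_K(\theta)$ tends to $0$ as $K\to\infty$. (Informally: almost all arcs of length $\pi/(2K)$ contain an angle $\theta_{\mathfrak p}$ of a prime ideal of norm at most $K(\log K)^{2+o(1)}$.)
   Context: For a nonzero ideal $\mathfrak a\subset\mathbb Z[i]$, write $\mathfrak a=\langle a+ib\rangle$ with $a>0$, $b\ge 0$ (such a generator is unique), and let $\theta_{\mathfrak a}\in[0,\pi/2)$ be the argument of $a+ib$; equivalently $e^{4i\theta_{\mathfrak a}}=(\alpha/\bar\alpha)^2$ for any generator $\alpha$. $\mathrm{N}\mathfrak a=a^2+b^2$ is the norm. For $K\ge1$ and $\theta\in\mathbb R$, $I_K(\theta)=[\theta-\frac{\pi}{4K},\theta+\frac{\pi}{4K}]$, viewed as an arc in $\mathbb R/(\pi/2)\mathbb Z$ (so ''$\theta_{\mathfrak p}\in I_K(\theta)$'' is understood modulo $\pi/2$). The Hecke characters are $\Xi_k(\mathfrak a)=e^{4ik\theta_{\mathfrak a}}$ and $L(s,\Xi_k)=\sum_{\mathfrak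 a\neq0}\Xi_k(\mathfrak a)\mathrm{N}\mathfrak a^{-s}$; GRH asserts that all nontrivial zeros of these functions have real part $1/2$. *)

(* Defs.v *)
From Stdlib Require Import Reals ZArith Lia Lra.
Open Scope R_scope.

Definition gauss := (Z * Z)%type.
Definition gmul (x y : gauss) : gauss :=
  ((fst x * fst y - snd x * snd y)%Z, (fst x * snd y + snd x * fst y)%Z).
Definition in_ideal (x y : gauss) : Prop := exists z : gauss, y = gmul x z.
Definition prime_ideal_gen (x : gauss) : Prop :=
  x <> (0%Z, 0%Z) /\ ~ in_ideal x (1%Z, 0%Z) /\
  forall y z : gauss, in_ideal x (gmul y z) -> in_ideal x y \/ in_ideal x z.

(* Norm of <a+ib> and its angle theta in [0, pi/2) for the normalized
   generator a > 0, b >= 0 (argument of a + i b). *)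
Definition gnorm (a b : Z) : R := IZR a ^ 2 + IZR b ^ 2.
Definition theta_gen (a b : Z) : R := atan (IZR b / IZR a).

Definition in_arc (K theta theta' : R) : Prop :=
  exists m : Z, Rabs (theta' + IZR m * (PI / 2) - theta) <= PI / (4 * K).

Definition outer_measure_lt (S : R -> Prop) (eps : R) : Prop :=
  exists (lo hi : nat -> R) (l : R),
    (forall n, lo n <= hi n) /\
    (forall x, S x -> exists n, lo n < x < hi n) /\
    infinite_sum (fun n => hi n - lo n) l /\ l < eps.

Record C := mkC { Re : R; Im : R }.
Definition Cadd (z w : C) : C := mkC (Re z + Re w) (Im z + Im w).
Definition Csub (z w : C) : C := mkC (Re z - Re w) (Im z - Im w).
Definition Cmul (z w : C) : C :=
  mkC (Re z * Re w - Im z * Im w) (Re z * Im w + Im z * Re w).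
Definition Cnorm (z : C) : R := sqrt (Re z ^ 2 + Im z ^ 2).
Definition Cinv (z : C) : C :=
  mkC (Re z / (Re z ^ 2 + Im z ^ 2)) (- Im z / (Re z ^ 2 + Im z ^ 2)).
Definition Cdiv (z w : C) : C := Cmul z (Cinv w).
Definition C0 : C := mkC 0 0.

Definition C_differentiable_at (F : C -> C) (z : C) : Prop :=
  exists F' : C, forall eps : R, 0 < eps -> exists delta : R, 0 < delta /\
    forall h : C, h <> C0 -> Cnorm h < delta ->
      Cnorm (Csub (Cdiv (Csub (F (Cadd z h)) (F z)) h) F') < eps.

Definition holomorphic_off_1 (F : C -> C) : Prop :=
  forall z : C, z <> mkC 1 0 -> C_differentiable_at F z.

Definition npow_neg (n : nat) (s : C) : C :=
  mkC (exp (- Re s * ln (INR n)) * cos (Im s * ln (INR n)))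
      (- exp (- Re s * ln (INR n)) * sin (Im s * ln (INR n))).

Definition Xi (k : Z) (a b : Z) : C :=
  mkC (cos (4 * IZR k * theta_gen a b)) (sin (4 * IZR k * theta_gen a b)).

(* coefficient c_k(n) = sum over nonzero ideals <a+ib> (a>0, b>=0) of norm n
   of Xi_k; such a, b satisfy a, b <= n. *)
Definition ideal_weight (k : Z) (n a b : nat) : C :=
  if ((1 <=? a)%nat && (a * a + b * b =? n)%nat)%bool
  then Xi k (Z.of_nat a) (Z.of_nat b) else C0.
Definition coef (k : Z) (n : nat) : C :=
  mkC (sum_f_R0 (fun a => sum_f_R0 (fun b => Re (ideal_weight k n a b)) n) n)
      (sum_f_R0 (fun a => sum_f_R0 (fun b => Im (ideal_weight k n a b)) n) n).

Fixpoint Lpartial (k : Z) (s : C) (N : nat) : C :=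
  match N with
  | O => C0
  | S m => Cadd (Lpartial k s m) (Cmul (coef k (S m)) (npow_neg (S m) s))
  end.

Definition L_series_to (k : Z) (s : C) (v : C) : Prop :=
  forall eps : R, 0 < eps -> exists N0 : nat, forall N : nat, (N0 <= N)%nat ->
    Cnorm (Csub (Lpartial k s N) v) < eps.

Definition GRH_Xi (k : Z) : Prop :=
  exists F : C -> C,
    holomorphic_off_1 F /\
    (forall s : C, 1 < Re s -> L_series_to k s (F s)) /\
    (forall s : C, 0 < Re s < 1 -> F s = C0 -> Re s = 1 / 2).

Definition bad_set (K X : R) (theta : R) : Prop :=
  0 <= theta < PI / 2 /\
  ~ (exists a b : Z, (0 < a)%Z /\ (0 <= b)%Z /\ prime_ideal_gen (a, b) /\
       gnorm a b <= X /\ in_arc K theta (theta_gen a b)).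

(* Main.v *)
(* Write S_k for the sum over ideals of Lambda(a) Xi_k(a) N(a)^-sigma exp(-log^2(Y/N(a))/4), with sigma = 1/2 + 1/log Y.
   Under GRH the local zeros of L(s, Xi_k) push Re(L'/L) up to the right of the critical line, so Re(-L'/L) is at most
   C log(k + |t| + 3) on Re s = sigma.  A one-sided bound is enough: as 2 Re h = h + conj h, the Gaussian contour integral
   of -L'/L against Y^{it} is bounded by the integral of |Re(-L'/L)| plus the integral against Y^{-it}, and the latter
   is small after moving the contour to Re s = 3.  Hence S_k = O(log k) for k >= 1, while the pole makes S_0 of order Y^{1/2}.
   On a fine grid of rotations consider the average of a trigonometric polynomial |P|^2 of degree of order K, peaked at the
   grid angle, against the measure whose Fourier coefficients are the S_k.  Its variance is O(K log^2 K / Y) relative to the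
   squared mean, whereas in a cell whose arc contains no prime angle nearly all of the mean is missing; proper prime powers and
   primes of norm larger than X = Y e^b contribute little.  So few cells are bad.
   The continuation of L(s, Xi_k) to Re s > 0 with polynomial growth comes from the tiling of Z[i] by the translates of the
   cross {0, 1, -1, i, -i} by multiples of 2 + i: up to an explicit Euler-like factor, L is a convergent series of
   second-order differences. *)

Require Import Defs.
From Stdlib Require Import Reals ZArith Lia Lra Psatz List ClassicalEpsilon Permutation Wf_nat.
From Coquelicot Require Import Coquelicot.
Import ListNotations.
Open Scope R_scope.

(** The hypothesis [GRH_Xi] is thin: a function holomorphic off 1 that agrees with the series for Re
    s > 1, and the location of its zeros in the open strip. It gives no growth bound, no functional
    equation, no control of the singularity at 1 and nothing about zeros on Re s = 1. Growth and the
    nature of the point 1 come from the tiling, the line Re s = 1 from the 3-4-1 inequality and the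
    divergence of the sum of 1/N. The obstacle that shapes the proof is one logarithm. At distance
    1/log Y from the critical line a single zero can add log Y to |L'/L|, so only log k log Y is
    available for the modulus, and a variance built on it would need log^4 K in place of log^2 K.
    The real part of 1/(s - rho) is nonnegative there, so one-sided estimates lose nothing; the
    large two-sided bound serves only to discard horizontal edges at infinity. The grid turns
    orthogonality into that of roots of unity, so all averages are finite sums, and measure enters
    only at the end, by counting cells. *)

Ltac positive := solve [auto | lra | apply exp_pos | apply Rinv_0_lt_compat; positive | apply Rdiv_lt_0_compat; positive
  | apply pow_lt; positive | apply Rmult_lt_0_compat; positive].

(** * Inequalities for the complex modulus *)

Lemma Cmod_minus_sym (z w : C) : Cmod (z - w) = Cmod (w - z).
Proof. rewrite <- Cmod_opp. f_equal. ring. Qed.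

Lemma Cmod_triangle3 (x y z : C) : Cmod (x - z) <= Cmod (x - y) + Cmod (y - z).
Proof. replace (x - z)%C with ((x - y) + (y - z))%C by ring. apply Cmod_triangle. Qed.

Lemma Cmod_triangle_sub (x y : C) : Cmod x - Cmod y <= Cmod (x - y).
Proof.
  assert (H := Cmod_triangle (x - y) y). replace (x - y + y)%C with x in H by ring. lra.
Qed.

Lemma Cmod_triangle_minus (x y : C) : Cmod (x - y) <= Cmod x + Cmod y.
Proof. unfold Cminus. eapply Rle_trans. apply Cmod_triangle. rewrite Cmod_opp. lra. Qed.

Lemma Cmod_Re (z : C) : Rabs (fst z) <= Cmod z.
Proof. eapply Rle_trans; [|apply Rmax_Cmod]. apply Rmax_l. Qed.
Lemma Cmod_Im (z : C) : Rabs (snd z) <= Cmod z.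
Proof. eapply Rle_trans; [|apply Rmax_Cmod]. apply Rmax_r. Qed.
Lemma Re_le_Cmod (z : C) : fst z <= Cmod z.
Proof. eapply Rle_trans; [apply Rle_abs|apply Cmod_Re]. Qed.

Lemma Cmod_sqr (z : C) : Cmod z ^ 2 = fst z ^ 2 + snd z ^ 2.
Proof. unfold Cmod. rewrite pow2_sqrt; nra. Qed.

Lemma Cmod_le_sum (z : C) : Cmod z <= Rabs (fst z) + Rabs (snd z).
Proof.
  replace z with (RtoC (fst z) + Ci * RtoC (snd z))%C at 1
    by (destruct z; unfold RtoC, Ci, Cplus, Cmult; simpl; f_equal; ring).
  eapply Rle_trans; [apply Cmod_triangle|]. rewrite Cmod_mult, Cmod_Ci, !Cmod_R. lra.
Qed.

Lemma Cmod_lt_of_sqr (z : C) (r : R) : 0 < r -> fst z ^ 2 + snd z ^ 2 < r ^ 2 -> Cmod z < r.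
Proof.
  intros Hr H. rewrite <- Cmod_sqr in H. apply Rnot_le_lt. intros Hn. nra.
Qed.

Lemma sqr_lt_of_Cmod (z : C) (r : R) : Cmod z < r -> fst z ^ 2 + snd z ^ 2 < r ^ 2.
Proof. intros H. rewrite <- Cmod_sqr. assert (0 <= Cmod z) by apply Cmod_ge_0. nra. Qed.

Lemma Cmod_le_of_sqr (z : C) (r : R) : 0 <= r -> fst z ^ 2 + snd z ^ 2 <= r ^ 2 -> Cmod z <= r.
Proof.
  intros Hr H. rewrite <- Cmod_sqr in H. apply Rnot_lt_le. intros Hn. nra.
Qed.

Lemma Ceq_pair (z w : C) : fst z = fst w -> snd z = snd w -> z = w.
Proof. destruct z, w; simpl; intros; subst; reflexivity. Qed.

Ltac csolve := apply Ceq_pair; simpl; ring.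

Lemma Cmod_zero_all (z : C) : (forall eps, 0 < eps -> Cmod z <= eps) -> z = 0%C.
Proof.
  intros H. apply Cmod_eq_0. apply Rle_antisym; [|apply Cmod_ge_0]. apply le_epsilon. intros e He. rewrite Rplus_0_l. auto.
Qed.

(** * Complex differentiability *)

(** The error form without a quotient keeps [w = z] inside the quantifier, so products and
    compositions need no case distinction. *)
Definition cder (f : C -> C) (z d : C) : Prop :=
  forall eps, 0 < eps -> exists delta, 0 < delta /\
    forall w, Cmod (w - z) < delta ->
      Cmod (f w - f z - d * (w - z)) <= eps * Cmod (w - z).

Definition ccont (f : C -> C) (z : C) : Prop :=
  forall eps, 0 < eps -> exists delta, 0 < delta /\
    forall w, Cmod (w - z) < delta -> Cmod (f w - f z) < eps.

Lemma cder_ext_loc (f g : C -> C) (z d : C) (r : R) :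
  0 < r -> (forall w, Cmod (w - z) < r -> f w = g w) -> cder f z d -> cder g z d.
Proof.
  intros Hr Hfg Hf eps He. destruct (Hf eps He) as [de [Hd H]]. exists (Rmin de r). split; [apply Rmin_pos; auto|].
  intros w Hw. rewrite <- !Hfg.
  - apply H. eapply Rlt_le_trans; [exact Hw|apply Rmin_l].
  - replace (z - z)%C with (RtoC 0) by ring. rewrite Cmod_0; auto.
  - eapply Rlt_le_trans; [exact Hw|apply Rmin_r].
Qed.

Lemma cder_ext (f g : C -> C) (z d : C) : (forall w, f w = g w) -> cder f z d -> cder g z d.
Proof. intros H. apply (cder_ext_loc f g z d 1); auto; lra. Qed.

Lemma cder_ccont (f : C -> C) (z d : C) : cder f z d -> ccont f z.
Proof.
  intros H eps He. destruct (H 1 Rlt_0_1) as [de [Hd Hf]]. assert (Hc : 0 < 1 + Cmod d) by (assert (0 <= Cmod d) by apply Cmod_ge_0; lra).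
  exists (Rmin de (eps / (1 + Cmod d))). split.
  { apply Rmin_pos; auto. apply Rdiv_lt_0_compat; auto. }
  intros w Hw. assert (H1 := Hf w (Rlt_le_trans _ _ _ Hw (Rmin_l _ _))). assert (H2 := Rlt_le_trans _ _ _ Hw (Rmin_r _ _)).
  replace (f w - f z)%C with ((f w - f z - d * (w - z)) + d * (w - z))%C by ring.
  eapply Rle_lt_trans; [apply Cmod_triangle|]. rewrite Cmod_mult. apply Rle_lt_trans with ((1 + Cmod d) * Cmod (w - z)); [lra|].
  apply Rlt_le_trans with ((1 + Cmod d) * (eps / (1 + Cmod d))).
  - apply Rmult_lt_compat_l; auto.
  - right. field. lra.
Qed.

Lemma cder_const (a z : C) : cder (fun _ => a) z 0.
Proof.
  intros eps He. exists 1. split; [lra|]. intros w _. replace (a - a - 0 * (w - z))%C with (RtoC 0) by ring. rewrite Cmod_0.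
  assert (0 <= Cmod (w - z)) by apply Cmod_ge_0. nra.
Qed.

Lemma cder_id (z : C) : cder (fun w => w) z 1.
Proof.
  intros eps He. exists 1. split; [lra|]. intros w _. replace (w - z - 1 * (w - z))%C with (RtoC 0) by ring. rewrite Cmod_0.
  assert (0 <= Cmod (w - z)) by apply Cmod_ge_0. nra.
Qed.

Lemma cder_plus (f g : C -> C) (z a b : C) :
  cder f z a -> cder g z b -> cder (fun w => f w + g w)%C z (a + b)%C.
Proof.
  intros Hf Hg eps He. destruct (Hf (eps / 2)) as [d1 [H1 K1]]; [lra|]. destruct (Hg (eps / 2)) as [d2 [H2 K2]]; [lra|].
  exists (Rmin d1 d2). split; [apply Rmin_pos; auto|]. intros w Hw. assert (L1 := K1 w (Rlt_le_trans _ _ _ Hw (Rmin_l _ _))).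
  assert (L2 := K2 w (Rlt_le_trans _ _ _ Hw (Rmin_r _ _))).
  replace (f w + g w - (f z + g z) - (a + b) * (w - z))%C with
    ((f w - f z - a * (w - z)) + (g w - g z - b * (w - z)))%C by ring.
  eapply Rle_trans; [apply Cmod_triangle|]. lra.
Qed.

Lemma cder_mult (f g : C -> C) (z a b : C) :
  cder f z a -> cder g z b -> cder (fun w => f w * g w)%C z (a * g z + f z * b)%C.
Proof.
  intros Hf Hg eps He. set (A := Cmod a). set (B := Cmod (g z)). set (F := Cmod (f z)).
  assert (HA : 0 <= A) by apply Cmod_ge_0. assert (HB : 0 <= B) by apply Cmod_ge_0. assert (HF : 0 <= F) by apply Cmod_ge_0.
  (* f w g w - f z g z - ... = (f w - f z - a h) g w + a h (g w - g z) + f z (g w - g z - b h) *)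
  set (e := Rmin 1 (eps / (A + B + F + 2))). assert (He' : 0 < e) by (apply Rmin_pos; [lra|positive]). assert (e1 : e <= 1) by apply Rmin_l.
  assert (e2 : e * (A + B + F + 2) <= eps).
  { apply Rle_trans with (eps / (A + B + F + 2) * (A + B + F + 2)). apply Rmult_le_compat_r; [lra|apply Rmin_r]. right; field; lra. }
  destruct (Hf e He') as [d1 [H1 K1]]. destruct (Hg e He') as [d2 [H2 K2]]. destruct (cder_ccont g z b Hg e He') as [d3 [H3 K3]].
  exists (Rmin d1 (Rmin d2 d3)). split; [repeat apply Rmin_pos; auto|]. intros w Hw.
  assert (L1 := K1 w (Rlt_le_trans _ _ _ Hw (Rmin_l _ _))). assert (Hw2 := Rlt_le_trans _ _ _ Hw (Rmin_r _ _)).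
  assert (L2 := K2 w (Rlt_le_trans _ _ _ Hw2 (Rmin_l _ _))). assert (L3 := K3 w (Rlt_le_trans _ _ _ Hw2 (Rmin_r _ _))).
  replace (f w * g w - f z * g z - (a * g z + f z * b) * (w - z))%C with
    ((f w - f z - a * (w - z)) * (g z + (g w - g z)) + a * (w - z) * (g w - g z)
       + f z * (g w - g z - b * (w - z)))%C by ring.
  assert (Hh : 0 <= Cmod (w - z)) by apply Cmod_ge_0. set (h := Cmod (w - z)) in *. assert (T := Cmod_triangle (g z) (g w - g z)).
  assert (P1 : Cmod ((f w - f z - a * (w - z)) * (g z + (g w - g z))) <= e * h * (B + 1)).
  { rewrite Cmod_mult. apply Rmult_le_compat; try apply Cmod_ge_0; auto. unfold B; lra. }
  assert (P2 : Cmod (a * (w - z) * (g w - g z)) <= A * h * e).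
  { rewrite !Cmod_mult. apply Rmult_le_compat; try apply Cmod_ge_0; try lra. apply Rmult_le_pos; apply Cmod_ge_0. unfold A, h; lra. }
  assert (P3 : Cmod (f z * (g w - g z - b * (w - z))) <= F * (e * h)).
  { rewrite Cmod_mult. apply Rmult_le_compat_l; auto. }
  eapply Rle_trans; [apply Cmod_triangle|].
  assert (T2 := Cmod_triangle ((f w - f z - a * (w - z)) * (g z + (g w - g z))) (a * (w - z) * (g w - g z))).
  apply Rle_trans with (e * (A + B + F + 2) * h); [nra|]. apply Rmult_le_compat_r; auto.
Qed.

Lemma cder_comp (f g : C -> C) (z a b : C) :
  cder f (g z) a -> cder g z b -> cder (fun w => f (g w)) z (a * b)%C.
Proof.
  intros Hf Hg eps He. set (A := Cmod a). set (B := Cmod b).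
  assert (HA : 0 <= A) by apply Cmod_ge_0. assert (HB : 0 <= B) by apply Cmod_ge_0. set (e := Rmin 1 (eps / (A + B + 2))).
  assert (He' : 0 < e) by (apply Rmin_pos; [lra|positive]). assert (e1 : e <= 1) by apply Rmin_l. assert (e2 : e * (A + B + 2) <= eps).
  { apply Rle_trans with (eps / (A + B + 2) * (A + B + 2)). apply Rmult_le_compat_r; [lra|apply Rmin_r]. right; field; lra. }
  destruct (Hf e He') as [d1 [H1 K1]]. destruct (Hg e He') as [d2 [H2 K2]]. destruct (cder_ccont g z b Hg d1 H1) as [d3 [H3 K3]].
  exists (Rmin d2 d3). split; [repeat apply Rmin_pos; auto|]. intros w Hw. assert (L2 := K2 w (Rlt_le_trans _ _ _ Hw (Rmin_l _ _))).
  assert (L3 := K3 w (Rlt_le_trans _ _ _ Hw (Rmin_r _ _))). assert (L1 := K1 (g w) L3).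
  replace (f (g w) - f (g z) - a * b * (w - z))%C with
    ((f (g w) - f (g z) - a * (g w - g z)) + a * (g w - g z - b * (w - z)))%C by ring.
  assert (Hh : 0 <= Cmod (w - z)) by apply Cmod_ge_0. assert (Hg2 : Cmod (g w - g z) <= (1 + B) * Cmod (w - z)).
  { replace (g w - g z)%C with ((g w - g z - b * (w - z)) + b * (w - z))%C by ring.
    eapply Rle_trans; [apply Cmod_triangle|]. rewrite Cmod_mult. fold B.
    assert (e * Cmod (w - z) <= 1 * Cmod (w - z)) by (apply Rmult_le_compat_r; lra). lra. }
  eapply Rle_trans; [apply Cmod_triangle|]. rewrite Cmod_mult. fold A. apply Rle_trans with (e * (A + B + 2) * Cmod (w - z)); [nra|].
  apply Rmult_le_compat_r; auto.
Qed.

Lemma cder_inv_id (z : C) : z <> 0%C -> cder Cinv z (- / (z * z))%C.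
Proof.
  intros Hz eps He. assert (Hm : 0 < Cmod z) by (apply Cmod_gt_0; auto). set (m := Cmod z) in *.
  exists (Rmin (m / 2) (eps * (m ^ 3) / 2)). split.
  { apply Rmin_pos. lra. assert (0 < m ^ 3) by (apply pow_lt; auto). nra. }
  intros w Hw. assert (L1 := Rlt_le_trans _ _ _ Hw (Rmin_l _ _)). assert (L2 := Rlt_le_trans _ _ _ Hw (Rmin_r _ _)).
  assert (Hw0 : m / 2 < Cmod w).
  { assert (T := Cmod_triangle_sub z w). rewrite Cmod_minus_sym in T. fold m in T. lra. }
  assert (w <> 0%C) by (intros ->; rewrite Cmod_0 in Hw0; lra).
  replace (/ w - / z - - / (z * z) * (w - z))%C with ((w - z) * (w - z) / (w * (z * z)))%C by (field; auto).
  rewrite Cmod_div by (repeat apply Cmult_neq_0; auto). rewrite !Cmod_mult. fold m.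
  assert (Hh : 0 <= Cmod (w - z)) by apply Cmod_ge_0. set (h := Cmod (w - z)) in *.
  assert (0 < Cmod w * (m * m)) by (apply Rmult_lt_0_compat; nra). apply Rmult_le_reg_r with (Cmod w * (m * m)); auto.
  unfold Rdiv. rewrite Rmult_assoc, Rinv_l by lra. rewrite Rmult_1_r.
  apply Rle_trans with (h * (eps * m ^ 3 / 2)); [apply Rmult_le_compat_l; lra|].
  replace (h * (eps * m ^ 3 / 2)) with (eps * h * (m / 2 * (m * m))) by (simpl; field).
  apply Rmult_le_compat_l; [nra|]. apply Rmult_le_compat_r; nra.
Qed.

Lemma cder_eq (f : C -> C) (z d d' : C) : cder f z d -> d = d' -> cder f z d'.
Proof. intros H <-; exact H. Qed.

Lemma cder_scal (a : C) (f : C -> C) (z d : C) : cder f z d -> cder (fun w => a * f w)%C z (a * d)%C.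
Proof.
  intros H. eapply cder_eq; [apply (cder_mult (fun _ => a) f z 0 d (cder_const a z) H)|]. ring.
Qed.

Lemma cder_opp (f : C -> C) (z d : C) : cder f z d -> cder (fun w => - f w)%C z (- d)%C.
Proof.
  intros H. apply cder_ext with (fun w => (- (1)) * f w)%C. intros; ring. eapply cder_eq; [apply cder_scal; exact H|]. ring.
Qed.

Lemma cder_minus (f g : C -> C) (z a b : C) :
  cder f z a -> cder g z b -> cder (fun w => f w - g w)%C z (a - b)%C.
Proof. intros Hf Hg. apply cder_plus; auto. apply cder_opp; auto. Qed.

Lemma cder_inv (f : C -> C) (z d : C) : f z <> 0%C -> cder f z d ->
  cder (fun w => / f w)%C z (- d / (f z * f z))%C.
Proof.
  intros Hz H. eapply cder_eq; [apply (cder_comp Cinv f z _ d (cder_inv_id _ Hz) H)|]. field. auto.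
Qed.

Lemma cder_div (f g : C -> C) (z a b : C) : g z <> 0%C -> cder f z a -> cder g z b ->
  cder (fun w => f w / g w)%C z ((a * g z - f z * b) / (g z * g z))%C.
Proof.
  intros Hz Hf Hg. eapply cder_eq; [apply (cder_mult f (fun w => / g w)%C z a _ Hf (cder_inv g z b Hz Hg))|]. field. auto.
Qed.

Lemma cder_unique (f : C -> C) (z a b : C) : cder f z a -> cder f z b -> a = b.
Proof.
  intros Ha Hb. apply Ceq_minus. apply Cmod_zero_all. intros eps He. destruct (Ha (eps / 2)) as [d1 [H1 K1]]; [lra|].
  destruct (Hb (eps / 2)) as [d2 [H2 K2]]; [lra|]. set (h := Rmin d1 d2 / 2). assert (Hm : 0 < Rmin d1 d2) by (apply Rmin_pos; auto).
  assert (Hh : 0 < h) by (unfold h; lra). assert (E : Cmod (z + RtoC h - z) = h).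
  { replace (z + RtoC h - z)%C with (RtoC h) by ring. rewrite Cmod_R, Rabs_right; lra. }
  assert (L1 := K1 (z + RtoC h)%C). assert (L2 := K2 (z + RtoC h)%C). rewrite E in L1, L2. assert (h < Rmin d1 d2) by (unfold h; lra).
  specialize (L1 (Rlt_le_trans _ _ _ H (Rmin_l _ _))). specialize (L2 (Rlt_le_trans _ _ _ H (Rmin_r _ _))).
  assert (T := Cmod_triangle_minus (f (z + RtoC h)%C - f z - b * (z + RtoC h - z)) (f (z + RtoC h)%C - f z - a * (z + RtoC h - z))).
  replace (f (z + RtoC h)%C - f z - b * (z + RtoC h - z) - (f (z + RtoC h)%C - f z - a * (z + RtoC h - z)))%C
    with ((a - b) * RtoC h)%C in T by ring.
  rewrite Cmod_mult, Cmod_R, Rabs_right in T by lra. apply Rmult_le_reg_r with h; auto. lra.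
Qed.

Definition diff_at (f : C -> C) (z : C) : Prop := exists d, cder f z d.

Lemma diff_at_ccont (f : C -> C) (z : C) : diff_at f z -> ccont f z.
Proof. intros [d H]. apply (cder_ccont _ _ _ H). Qed.

(* The derivative operator, meaningful where [f] is differentiable. *)
Definition Cderiv (f : C -> C) (z : C) : C := epsilon (inhabits (RtoC 0)) (fun d => cder f z d).

Lemma Cderiv_spec (f : C -> C) (z : C) : diff_at f z -> cder f z (Cderiv f z).
Proof. intros H. exact (epsilon_spec (inhabits (RtoC 0)) (fun d => cder f z d) H). Qed.

Lemma Cderiv_eq (f : C -> C) (z d : C) : cder f z d -> Cderiv f z = d.
Proof. intros H. eapply cder_unique; [apply Cderiv_spec; exists d; auto|auto]. Qed.

(** * Complex exponential *)

Definition cexp (z : C) : C := (exp (fst z) * cos (snd z), exp (fst z) * sin (snd z)).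

Lemma cexp_plus (z w : C) : cexp (z + w) = (cexp z * cexp w)%C.
Proof.
  unfold cexp, Cplus, Cmult; simpl. rewrite exp_plus, cos_plus, sin_plus. f_equal; ring.
Qed.

Lemma cexp_0 : cexp 0 = 1%C.
Proof. unfold cexp; simpl. rewrite exp_0, cos_0, sin_0. unfold RtoC. f_equal; ring. Qed.

Lemma Cmod_cexp (z : C) : Cmod (cexp z) = exp (fst z).
Proof.
  assert (0 < exp (fst z)) by apply exp_pos. assert (E : Cmod (cexp z) ^ 2 = exp (fst z) ^ 2).
  { rewrite Cmod_sqr. unfold cexp; simpl. assert (T := sin2_cos2 (snd z)). unfold Rsqr in T. nra. }
  assert (0 <= Cmod (cexp z)) by apply Cmod_ge_0. nra.
Qed.

Lemma cexp_neq_0 (z : C) : cexp z <> 0%C.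
Proof. intros H. assert (E := Cmod_cexp z). rewrite H, Cmod_0 in E. assert (0 < exp (fst z)) by apply exp_pos. lra. Qed.

Lemma cexp_opp (z : C) : cexp (- z) = (/ cexp z)%C.
Proof.
  assert (H := cexp_neq_0 z). assert (cexp z * cexp (- z) = 1)%C.
  { rewrite <- cexp_plus. replace (z + - z)%C with (RtoC 0) by ring. apply cexp_0. }
  replace (/ cexp z)%C with (/ cexp z * (cexp z * cexp (- z)))%C by (rewrite H0; ring). field; auto.
Qed.

Lemma cexp_RtoC (x : R) : cexp (RtoC x) = RtoC (exp x).
Proof. unfold cexp, RtoC; simpl. rewrite cos_0, sin_0. f_equal; ring. Qed.

Lemma cexp_conj (z : C) : cexp (Cconj z) = Cconj (cexp z).
Proof. unfold cexp, Cconj; simpl. rewrite cos_neg, sin_neg. f_equal; ring. Qed.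

Lemma cexp_nat (n : nat) (z : C) : cexp (RtoC (INR n) * z) = (cexp z ^ n)%C.
Proof.
  induction n as [|n IH].
  - simpl. rewrite <- cexp_0. f_equal. ring.
  - rewrite Cpow_S, <- IH, <- cexp_plus. f_equal. rewrite S_INR, RtoC_plus. ring.
Qed.

(** The lower bound is 1 + x <= e^x. The upper bound is the same inequality at -x/2, squared: e^x (1
    - x/2)^2 <= 1. *)
Lemma exp_taylor1 (x : R) : Rabs x <= 1 -> Rabs (exp x - 1 - x) <= 2 * x ^ 2.
Proof.
  intros Hx. apply Rabs_le_between in Hx. assert (L := exp_ineq1_le x). assert (U : exp x * (1 - x / 2) ^ 2 <= 1).
  { assert (A := exp_ineq1_le (- (x / 2))). assert (B : exp (- (x / 2)) ^ 2 * exp x = 1).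
    { simpl. rewrite Rmult_1_r, <- !exp_plus. replace (- (x / 2) + - (x / 2) + x) with 0 by field. apply exp_0. }
    assert ((1 - x / 2) ^ 2 <= exp (- (x / 2)) ^ 2) by (apply pow_incr; lra). nra. }
  rewrite Rabs_right by lra. assert (Q : 1 <= (1 + x + 2 * x ^ 2) * (1 - x / 2) ^ 2).
  { replace ((1 + x + 2 * x ^ 2) * (1 - x / 2) ^ 2) with (1 + x ^ 2 * ((1 - x) * (5 / 4 - x / 2))) by field.
    assert (0 <= (1 - x) * (5 / 4 - x / 2)) by (apply Rmult_le_pos; lra). nra. }
  nra.
Qed.

Lemma Rabs_sin_le (y : R) : Rabs (sin y) <= Rabs y.
Proof.
  destruct (MVT_gen sin 0 y cos) as [c [Hc E]].
  - intros x _. auto_derive; auto; ring.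
  - intros x _. apply continuity_sin.
  - rewrite sin_0, !Rminus_0_r in E. rewrite E, Rabs_mult. assert (Rabs (cos c) <= 1) by (apply Rabs_le; apply COS_bound).
    assert (0 <= Rabs y) by apply Rabs_pos. nra.
Qed.

Lemma one_minus_cos (y : R) : 0 <= 1 - cos y <= y ^ 2 / 2.
Proof.
  assert (E : cos y = 1 - 2 * (sin (y / 2)) ^ 2).
  { replace y with (2 * (y / 2)) at 1 by field. rewrite cos_2a_sin. ring. }
  assert (H := Rabs_sin_le (y / 2)). assert (sin (y / 2) ^ 2 <= (y / 2) ^ 2).
  { rewrite <- (pow2_abs (sin _)), <- (pow2_abs (y / 2)). apply pow_incr. split; [apply Rabs_pos|auto]. }
  nra.
Qed.

Lemma sin_taylor1 (y : R) : Rabs y <= 1 -> Rabs (sin y - y) <= y ^ 2.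
Proof.
  intros Hy. destruct (MVT_gen (fun t => sin t - t) 0 y (fun t => cos t - 1)) as [c [Hc E]].
  - intros x _. auto_derive; auto; ring.
  - intros x _. apply continuity_pt_minus; [apply continuity_sin|apply continuity_pt_id].
  - rewrite sin_0, !Rminus_0_r in E. rewrite E, Rabs_mult. assert (B := one_minus_cos c). assert (Hc2 : Rabs c <= Rabs y).
    { unfold Rmin, Rmax in Hc. destruct (Rle_dec 0 y); unfold Rabs; destruct (Rcase_abs c), (Rcase_abs y); lra. }
    assert (0 <= Rabs c) by apply Rabs_pos. assert (c ^ 2 <= Rabs y).
    { rewrite <- (pow2_abs c). nra. }
    rewrite Rabs_left1 by lra. rewrite <- (pow2_abs y). nra.
Qed.

Lemma cexp_taylor1 (h : C) : Cmod h <= 1 -> Cmod (cexp h - 1 - h) <= 10 * Cmod h ^ 2.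
Proof.
  intros Hh. assert (Hx := Rle_trans _ _ _ (Cmod_Re h) Hh). assert (Hy := Rle_trans _ _ _ (Cmod_Im h) Hh).
  destruct h as [x y]. rewrite Cmod_sqr. simpl fst in *; simpl snd in *.
  assert (A := exp_taylor1 x Hx). assert (B := one_minus_cos y). assert (D := sin_taylor1 y Hy). assert (S := Rabs_sin_le y).
  eapply Rle_trans; [apply Cmod_le_sum|]. unfold cexp, Cminus, Cplus, Copp, RtoC; simpl. assert (E3 : exp x <= 4).
  { apply Rabs_le_between in A. apply Rabs_le_between in Hx. nra. }
  assert (E0 := exp_pos x). assert (P1 : Rabs (exp x * cos y + - (1) + - x) <= 2 * x ^ 2 + 2 * y ^ 2).
  { replace (exp x * cos y + - (1) + - x) with ((exp x - 1 - x) + - (exp x * (1 - cos y))) by ring.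
    eapply Rle_trans; [apply Rabs_triang|]. rewrite Rabs_Ropp, (Rabs_right (exp x * _)) by nra. nra. }
  assert (P2 : Rabs (exp x * sin y + - 0 + - y) <= 3 * Rabs x * Rabs y + y ^ 2).
  { replace (exp x * sin y + - 0 + - y) with ((exp x - 1 - x) * sin y + x * sin y + (sin y - y)) by ring.
    eapply Rle_trans; [apply Rabs_triang|]. eapply Rle_trans; [apply Rplus_le_compat_r, Rabs_triang|]. rewrite !Rabs_mult.
    assert (X0 := Rabs_pos x). assert (S0 := Rabs_pos (sin y)).
    assert (A2 : Rabs (exp x - 1 - x) <= 2 * Rabs x) by (rewrite <- (pow2_abs x) in A; nra). nra. }
  assert (X0 := pow2_abs x). assert (Y0 := pow2_abs y). nra.
Qed.

Lemma cder_cexp (z : C) : cder cexp z (cexp z).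
Proof.
  intros eps He. assert (E0 : 0 < exp (fst z)) by apply exp_pos. exists (Rmin 1 (eps / (10 * exp (fst z)))). split.
  { apply Rmin_pos; [lra|]. positive. }
  intros w Hw. assert (L1 := Rlt_le_trans _ _ _ Hw (Rmin_l _ _)). assert (L2 := Rlt_le_trans _ _ _ Hw (Rmin_r _ _)).
  replace (cexp w) with (cexp z * cexp (w - z))%C by (rewrite <- cexp_plus; f_equal; ring).
  replace (cexp z * cexp (w - z) - cexp z - cexp z * (w - z))%C with (cexp z * (cexp (w - z) - 1 - (w - z)))%C by ring.
  rewrite Cmod_mult, Cmod_cexp. assert (T := cexp_taylor1 (w - z) (Rlt_le _ _ L1)). assert (H0 : 0 <= Cmod (w - z)) by apply Cmod_ge_0.
  apply Rle_trans with (exp (fst z) * (10 * Cmod (w - z) ^ 2)); [apply Rmult_le_compat_l; lra|].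
  assert (Cmod (w - z) * (10 * exp (fst z)) <= eps).
  { apply Rle_trans with (eps / (10 * exp (fst z)) * (10 * exp (fst z))). apply Rmult_le_compat_r; lra. right; field; lra. }
  nra.
Qed.

Lemma cder_cexp_comp (f : C -> C) (z d : C) : cder f z d -> cder (fun w => cexp (f w)) z (cexp (f z) * d)%C.
Proof. intros H. exact (cder_comp cexp f z _ d (cder_cexp (f z)) H). Qed.

(** * Integrals of complex-valued functions of a real variable *)

Definition rcont (g : R -> C) (t : R) : Prop :=
  forall eps, 0 < eps -> exists delta, 0 < delta /\
    forall s, Rabs (s - t) < delta -> Cmod (g s - g t) < eps.

Definition rder (g : R -> C) (t : R) (d : C) : Prop :=
  forall eps, 0 < eps -> exists delta, 0 < delta /\
    forall s, Rabs (s - t) < delta -> Cmod (g s - g t - d * RtoC (s - t)) <= eps * Rabs (s - t).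

Definition rcont_on (g : R -> C) (a b : R) : Prop := forall t, Rmin a b <= t <= Rmax a b -> rcont g t.

Definition CI (g : R -> C) (a b : R) : C :=
  (RInt (fun t => fst (g t)) a b, RInt (fun t => snd (g t)) a b).

Lemma continuous_eps (h : R -> R) (t : R) :
  (forall eps, 0 < eps -> exists delta, 0 < delta /\ forall s, Rabs (s - t) < delta -> Rabs (h s - h t) < eps) ->
  continuous h t.
Proof.
  intros H. apply continuity_pt_filterlim. intros eps He. destruct (H eps He) as [d [Hd K]].
  exists d. split; auto. intros x [_ Hx]. apply K. exact Hx.
Qed.

Lemma rcont_fst (g : R -> C) (t : R) : rcont g t -> continuous (fun s => fst (g s)) t.
Proof.
  intros H. apply continuous_eps. intros eps He. destruct (H eps He) as [d [Hd K]].
  exists d. split; auto. intros s Hs. eapply Rle_lt_trans; [|exact (K s Hs)]. apply (Cmod_Re (g s - g t)).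
Qed.

Lemma rcont_snd (g : R -> C) (t : R) : rcont g t -> continuous (fun s => snd (g s)) t.
Proof.
  intros H. apply continuous_eps. intros eps He. destruct (H eps He) as [d [Hd K]].
  exists d. split; auto. intros s Hs. eapply Rle_lt_trans; [|exact (K s Hs)]. apply (Cmod_Im (g s - g t)).
Qed.

Lemma rcont_on_ex (g : R -> C) (a b : R) : rcont_on g a b ->
  ex_RInt (fun t => fst (g t)) a b /\ ex_RInt (fun t => snd (g t)) a b.
Proof.
  intros H. split; apply (ex_RInt_continuous (V := R_CompleteNormedModule)); intros z Hz.
  - apply rcont_fst; auto.
  - apply rcont_snd; auto.
Qed.

Lemma rder_rcont (g : R -> C) (t : R) (d : C) : rder g t d -> rcont g t.
Proof.
  intros H eps He. destruct (H 1 Rlt_0_1) as [de [Hd Hf]]. assert (Hc : 0 < 1 + Cmod d) by (assert (0 <= Cmod d) by apply Cmod_ge_0; lra).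
  exists (Rmin de (eps / (1 + Cmod d))). split.
  { apply Rmin_pos; auto. apply Rdiv_lt_0_compat; auto. }
  intros w Hw. assert (H1 := Hf w (Rlt_le_trans _ _ _ Hw (Rmin_l _ _))). assert (H2 := Rlt_le_trans _ _ _ Hw (Rmin_r _ _)).
  replace (g w - g t)%C with ((g w - g t - d * RtoC (w - t)) + d * RtoC (w - t))%C by ring.
  eapply Rle_lt_trans; [apply Cmod_triangle|]. rewrite Cmod_mult, Cmod_R. apply Rle_lt_trans with ((1 + Cmod d) * Rabs (w - t)); [lra|].
  apply Rlt_le_trans with ((1 + Cmod d) * (eps / (1 + Cmod d))).
  - apply Rmult_lt_compat_l; auto.
  - right. field. lra.
Qed.

Lemma rcont_comp (f : C -> C) (g : R -> C) (t : R) : ccont f (g t) -> rcont g t -> rcont (fun s => f (g s)) t.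
Proof.
  intros Hf Hg eps He. destruct (Hf eps He) as [d [Hd K]]. destruct (Hg d Hd) as [d' [Hd' K']]. exists d'. split; auto.
Qed.

Lemma rcont_plus (f g : R -> C) (t : R) : rcont f t -> rcont g t -> rcont (fun s => f s + g s)%C t.
Proof.
  intros Hf Hg eps He. destruct (Hf (eps / 2)) as [d1 [H1 K1]]; [lra|]. destruct (Hg (eps / 2)) as [d2 [H2 K2]]; [lra|].
  exists (Rmin d1 d2). split; [apply Rmin_pos; auto|]. intros s Hs. assert (L1 := K1 s (Rlt_le_trans _ _ _ Hs (Rmin_l _ _))).
  assert (L2 := K2 s (Rlt_le_trans _ _ _ Hs (Rmin_r _ _))). replace (f s + g s - (f t + g t))%C with ((f s - f t) + (g s - g t))%C by ring.
  eapply Rle_lt_trans; [apply Cmod_triangle|]. lra.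
Qed.

Lemma rcont_const (c : C) (t : R) : rcont (fun _ => c) t.
Proof.
  intros eps He. exists 1. split; [lra|]. intros s _. replace (c - c)%C with (RtoC 0) by ring. rewrite Cmod_0; auto.
Qed.

Lemma rcont_mult (f g : R -> C) (t : R) : rcont f t -> rcont g t -> rcont (fun s => f s * g s)%C t.
Proof.
  intros Hf Hg eps He. set (A := Cmod (f t)). set (B := Cmod (g t)).
  assert (HA : 0 <= A) by apply Cmod_ge_0. assert (HB : 0 <= B) by apply Cmod_ge_0. set (e := Rmin 1 (eps / (A + B + 2))).
  assert (He' : 0 < e) by (apply Rmin_pos; [lra|positive]). assert (e1 : e <= 1) by apply Rmin_l. assert (e2 : e * (A + B + 2) <= eps).
  { apply Rle_trans with (eps / (A + B + 2) * (A + B + 2)). apply Rmult_le_compat_r; [lra|apply Rmin_r]. right; field; lra. }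
  destruct (Hf e He') as [d1 [H1 K1]]. destruct (Hg e He') as [d2 [H2 K2]].
  exists (Rmin d1 d2). split; [apply Rmin_pos; auto|]. intros s Hs. assert (L1 := K1 s (Rlt_le_trans _ _ _ Hs (Rmin_l _ _))).
  assert (L2 := K2 s (Rlt_le_trans _ _ _ Hs (Rmin_r _ _))).
  replace (f s * g s - f t * g t)%C with
    ((f s - f t) * (g s - g t) + (f s - f t) * g t + f t * (g s - g t))%C by ring.
  eapply Rle_lt_trans; [apply Cmod_triangle|]. eapply Rle_lt_trans; [apply Rplus_le_compat_r, Cmod_triangle|]. rewrite !Cmod_mult. fold A B.
  assert (0 <= Cmod (f s - f t)) by apply Cmod_ge_0. nra.
Qed.

Lemma rcont_RtoC (h : R -> R) (t : R) : continuous h t -> rcont (fun s => RtoC (h s)) t.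
Proof.
  intros H eps He. apply continuity_pt_filterlim in H. destruct (H eps He) as [d [Hd K]]. exists d. split; auto. intros s Hs.
  rewrite <- RtoC_minus, Cmod_R. destruct (Req_dec t s) as [->|Hn]. { rewrite Rminus_diag. rewrite Rabs_R0. auto. }
  apply (K s). split; [split; [exact I|auto]|exact Hs].
Qed.

Lemma rcont_scal (c : C) (f : R -> C) (t : R) : rcont f t -> rcont (fun s => c * f s)%C t.
Proof. intros H. apply rcont_mult; auto. apply rcont_const. Qed.

Lemma rcont_minus (f g : R -> C) (t : R) : rcont f t -> rcont g t -> rcont (fun s => f s - g s)%C t.
Proof.
  intros Hf Hg. assert (H := rcont_plus f _ t Hf (rcont_scal (-(1)) g t Hg)).
  intros eps He. destruct (H eps He) as [d [Hd K]]. exists d; split; auto. intros s Hs. specialize (K s Hs). simpl in K.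
  replace (f s - g s - (f t - g t))%C with (f s + -(1) * g s - (f t + -(1) * g t))%C by ring. auto.
Qed.

Lemma rcont_ext (f g : R -> C) (t : R) : (forall s, f s = g s) -> rcont f t -> rcont g t.
Proof.
  intros E H eps He. destruct (H eps He) as [d [Hd K]]. exists d; split; auto. intros s Hs. rewrite <- !E. auto.
Qed.

Lemma CI_ext (f g : R -> C) (a b : R) :
  (forall t, Rmin a b < t < Rmax a b -> f t = g t) -> CI f a b = CI g a b.
Proof.
  intros H. unfold CI. f_equal; apply (RInt_ext (V := R_CompleteNormedModule)); intros; rewrite H; auto.
Qed.

Lemma CI_plus (f g : R -> C) (a b : R) : rcont_on f a b -> rcont_on g a b ->
  CI (fun t => f t + g t)%C a b = (CI f a b + CI g a b)%C.
Proof.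
  intros Hf Hg. destruct (rcont_on_ex f a b Hf). destruct (rcont_on_ex g a b Hg).
  unfold CI, Cplus; simpl. f_equal; apply (RInt_plus (V := R_CompleteNormedModule)); auto.
Qed.

Lemma CI_scal (c : C) (f : R -> C) (a b : R) : rcont_on f a b ->
  CI (fun t => c * f t)%C a b = (c * CI f a b)%C.
Proof.
  intros Hf. destruct (rcont_on_ex f a b Hf) as [H1 H2]. destruct c as [x y]. unfold CI, Cmult; simpl.
  assert (S : forall (k : R) (h : R -> R), ex_RInt h a b -> ex_RInt (fun t => k * h t) a b)
    by (intros k h Hh; apply (ex_RInt_scal (V := R_NormedModule) h a b k Hh)).
  assert (S' : forall (k : R) (h : R -> R), ex_RInt h a b -> RInt (fun t => k * h t) a b = k * RInt h a b)
    by (intros k h Hh; apply (RInt_scal (V := R_CompleteNormedModule) h a b k Hh)).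
  f_equal.
  - rewrite <- (S' x), <- (S' y) by auto.
    apply (RInt_minus (V := R_CompleteNormedModule) (fun t => x * fst (f t)) (fun t => y * snd (f t))); auto.
  - rewrite <- (S' x), <- (S' y) by auto.
    apply (RInt_plus (V := R_CompleteNormedModule) (fun t => x * snd (f t)) (fun t => y * fst (f t))); auto.
Qed.

Lemma rcont_on_scal (c : C) (f : R -> C) (a b : R) : rcont_on f a b -> rcont_on (fun t => c * f t)%C a b.
Proof. intros H t Ht. apply rcont_scal; auto. Qed.
Lemma rcont_on_plus (f g : R -> C) (a b : R) : rcont_on f a b -> rcont_on g a b -> rcont_on (fun t => f t + g t)%C a b.
Proof. intros H1 H2 t Ht. apply rcont_plus; auto. Qed.
Lemma CI_minus (f g : R -> C) (a b : R) : rcont_on f a b -> rcont_on g a b ->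
  CI (fun t => f t - g t)%C a b = (CI f a b - CI g a b)%C.
Proof.
  intros Hf Hg. rewrite (CI_ext _ (fun t => f t + (-(1)) * g t)%C) by (intros; ring).
  rewrite CI_plus; auto using rcont_on_scal. rewrite CI_scal; auto. ring.
Qed.

Lemma CI_point (f : R -> C) (a : R) : CI f a a = 0%C.
Proof. unfold CI. rewrite !(RInt_point (V := R_CompleteNormedModule)). reflexivity. Qed.

Lemma CI_const (c : C) (a b : R) : CI (fun _ => c) a b = (c * RtoC (b - a))%C.
Proof.
  unfold CI. rewrite !(RInt_const (V := R_CompleteNormedModule)). unfold scal; simpl; unfold mult; simpl. csolve.
Qed.

Lemma CI_Chasles (f : R -> C) (a b c : R) : rcont_on f a b -> rcont_on f b c ->
  (CI f a b + CI f b c)%C = CI f a c.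
Proof.
  intros H1 H2. destruct (rcont_on_ex f a b H1). destruct (rcont_on_ex f b c H2).
  unfold CI, Cplus; simpl. f_equal; apply (RInt_Chasles (V := R_CompleteNormedModule)); auto.
Qed.

Lemma rcont_on_sym (f : R -> C) (a b : R) : rcont_on f a b -> rcont_on f b a.
Proof. intros H t Ht. apply H. rewrite Rmin_comm, Rmax_comm. auto. Qed.

Lemma CI_swap (f : R -> C) (a b : R) : rcont_on f a b -> CI f b a = (- CI f a b)%C.
Proof.
  intros H. assert (E := CI_Chasles f a b a H (rcont_on_sym _ _ _ H)). rewrite CI_point in E.
  replace (CI f b a) with ((CI f a b + CI f b a) - CI f a b)%C by ring. rewrite E. ring.
Qed.

(** Rotate by a unimodular constant that makes the integral real and nonnegative; the real part of
    the rotated integrand is at most its modulus. *)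
Lemma CI_norm_le (f : R -> C) (h : R -> R) (a b : R) : a <= b -> rcont_on f a b -> ex_RInt h a b ->
  (forall t, a < t < b -> Cmod (f t) <= h t) -> Cmod (CI f a b) <= RInt h a b.
Proof.
  intros Hab Hf Hh Hle. set (I := CI f a b). assert (key : forall c, Cmod c = 1 -> fst (c * I)%C <= RInt h a b).
  { intros c Hc. unfold I. rewrite <- CI_scal by auto. simpl. apply RInt_le; auto.
    - exact (proj1 (rcont_on_ex _ a b (rcont_on_scal c f a b Hf))).
    - intros t Ht. eapply Rle_trans; [apply (Re_le_Cmod (c * f t)%C)|]. rewrite Cmod_mult, Hc, Rmult_1_l. auto. }
  destruct (Ceq_dec I 0) as [E|E].
  - rewrite E, Cmod_0. specialize (key 1%C Cmod_1). rewrite E in key. simpl in key. lra.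
  - assert (0 < Cmod I) by (apply Cmod_gt_0; auto). specialize (key (Cconj I / RtoC (Cmod I))%C).
    replace (Cconj I / RtoC (Cmod I) * I)%C with (RtoC (Cmod I)) in key.
    + apply key. rewrite Cmod_div, Cmod_conj, Cmod_R, Rabs_right; try lra.
      * field. lra.
      * intros Z. apply RtoC_inj in Z. lra.
    + assert (Z : RtoC (Cmod I) <> 0%C) by (intros Z; apply RtoC_inj in Z; lra).
      replace (Cconj I / RtoC (Cmod I) * I)%C with ((I * Cconj I) / RtoC (Cmod I))%C by (field; auto).
      rewrite <- Cmod2_conj, RtoC_pow. field. auto.
Qed.

Lemma CI_bound (f : R -> C) (a b M : R) : rcont_on f a b ->
  (forall t, Rmin a b <= t <= Rmax a b -> Cmod (f t) <= M) -> Cmod (CI f a b) <= M * Rabs (b - a).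
Proof.
  assert (core : forall a b, a <= b -> rcont_on f a b ->
    (forall t, Rmin a b <= t <= Rmax a b -> Cmod (f t) <= M) -> Cmod (CI f a b) <= M * Rabs (b - a)).
  { clear a b. intros a b Hab Hf HM. rewrite Rabs_right by lra. replace (M * (b - a)) with (RInt (fun _ => M) a b).
    - apply CI_norm_le; auto. apply ex_RInt_const. intros t Ht. apply HM. rewrite Rmin_left, Rmax_right; lra.
    - rewrite (RInt_const (V := R_CompleteNormedModule)). unfold scal; simpl; unfold mult; simpl. ring. }
  intros Hf HM. destruct (Rle_dec a b) as [H|H]; [apply core; auto|].
  rewrite CI_swap by (apply rcont_on_sym; auto). rewrite Cmod_opp, Rabs_minus_sym.
  apply core; [lra|apply rcont_on_sym; auto|]. intros t Ht. apply HM. rewrite Rmin_comm, Rmax_comm; auto.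
Qed.

Lemma is_derive_eps (h : R -> R) (t d : R) :
  (forall eps, 0 < eps -> exists delta, 0 < delta /\ forall s, Rabs (s - t) < delta ->
     Rabs (h s - h t - d * (s - t)) <= eps * Rabs (s - t)) -> is_derive h t d.
Proof.
  intros H. apply is_derive_Reals. intros eps He.
  destruct (H (eps / 2)) as [de [Hd K]]; [lra|]. exists (mkposreal de Hd). intros k Hk Hkd. simpl in Hkd.
  specialize (K (t + k)). replace (t + k - t) with k in K by ring. specialize (K Hkd).
  replace ((h (t + k) - h t) / k - d) with ((h (t + k) - h t - d * k) / k) by (field; auto).
  assert (0 < Rabs k) by (apply Rabs_pos_lt; auto). unfold Rdiv. rewrite Rabs_mult, Rabs_inv. apply Rle_lt_trans with (eps / 2); [|lra].
  apply Rmult_le_reg_r with (Rabs k); auto. rewrite Rmult_assoc, Rinv_l by lra. lra.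
Qed.

Lemma rder_fst (g : R -> C) (t : R) (d : C) : rder g t d -> is_derive (fun s => fst (g s)) t (fst d).
Proof.
  intros H. apply is_derive_eps. intros eps He. destruct (H eps He) as [de [Hd K]].
  exists de. split; auto. intros s Hs. eapply Rle_trans; [|exact (K s Hs)].
  replace (fst (g s) - fst (g t) - fst d * (s - t)) with (fst (g s - g t - d * RtoC (s - t))%C)
    by (destruct (g s), (g t), d; simpl; ring).
  apply Cmod_Re.
Qed.

Lemma rder_snd (g : R -> C) (t : R) (d : C) : rder g t d -> is_derive (fun s => snd (g s)) t (snd d).
Proof.
  intros H. apply is_derive_eps. intros eps He. destruct (H eps He) as [de [Hd K]].
  exists de. split; auto. intros s Hs. eapply Rle_trans; [|exact (K s Hs)].
  replace (snd (g s) - snd (g t) - snd d * (s - t)) with (snd (g s - g t - d * RtoC (s - t))%C)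
    by (destruct (g s), (g t), d; simpl; ring).
  apply Cmod_Im.
Qed.

Lemma CI_FTC (g dg : R -> C) (a b : R) : (forall t, Rmin a b <= t <= Rmax a b -> rder g t (dg t)) ->
  rcont_on dg a b -> CI dg a b = (g b - g a)%C.
Proof.
  intros Hd Hc. apply Ceq_pair; simpl.
  - apply is_RInt_unique. apply (is_RInt_derive (V := R_CompleteNormedModule) (fun s => fst (g s)) (fun s => fst (dg s))).
    + intros t Ht. apply rder_fst; auto.
    + intros t Ht. apply rcont_fst; auto.
  - apply is_RInt_unique. apply (is_RInt_derive (V := R_CompleteNormedModule) (fun s => snd (g s)) (fun s => snd (dg s))).
    + intros t Ht. apply rder_snd; auto.
    + intros t Ht. apply rcont_snd; auto.
Qed.

Lemma rder_comp (f : C -> C) (g : R -> C) (t : R) (a b : C) :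
  cder f (g t) a -> rder g t b -> rder (fun s => f (g s)) t (a * b)%C.
Proof.
  intros Hf Hg eps He. set (A := Cmod a). set (B := Cmod b).
  assert (HA : 0 <= A) by apply Cmod_ge_0. assert (HB : 0 <= B) by apply Cmod_ge_0. set (e := Rmin 1 (eps / (A + B + 2))).
  assert (He' : 0 < e) by (apply Rmin_pos; [lra|positive]). assert (e1 : e <= 1) by apply Rmin_l. assert (e2 : e * (A + B + 2) <= eps).
  { apply Rle_trans with (eps / (A + B + 2) * (A + B + 2)). apply Rmult_le_compat_r; [lra|apply Rmin_r]. right; field; lra. }
  destruct (Hf e He') as [d1 [H1 K1]]. destruct (Hg e He') as [d2 [H2 K2]]. destruct (rder_rcont g t b Hg d1 H1) as [d3 [H3 K3]].
  exists (Rmin d2 d3). split; [repeat apply Rmin_pos; auto|]. intros s Hw. assert (L2 := K2 s (Rlt_le_trans _ _ _ Hw (Rmin_l _ _))).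
  assert (L3 := K3 s (Rlt_le_trans _ _ _ Hw (Rmin_r _ _))). assert (L1 := K1 (g s) L3).
  replace (f (g s) - f (g t) - a * b * RtoC (s - t))%C with
    ((f (g s) - f (g t) - a * (g s - g t)) + a * (g s - g t - b * RtoC (s - t)))%C by ring.
  assert (Hh : 0 <= Rabs (s - t)) by apply Rabs_pos. assert (Hg2 : Cmod (g s - g t) <= (1 + B) * Rabs (s - t)).
  { replace (g s - g t)%C with ((g s - g t - b * RtoC (s - t)) + b * RtoC (s - t))%C by ring.
    eapply Rle_trans; [apply Cmod_triangle|]. rewrite Cmod_mult, Cmod_R. fold B.
    assert (e * Rabs (s - t) <= 1 * Rabs (s - t)) by (apply Rmult_le_compat_r; lra). lra. }
  eapply Rle_trans; [apply Cmod_triangle|]. rewrite Cmod_mult. fold A. apply Rle_trans with (e * (A + B + 2) * Rabs (s - t)); [nra|].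
  apply Rmult_le_compat_r; auto.
Qed.

Lemma rder_affine (p q : C) (t : R) : rder (fun s => p + RtoC s * q)%C t q.
Proof.
  intros eps He. exists 1. split; [lra|]. intros s _.
  replace (p + RtoC s * q - (p + RtoC t * q) - q * RtoC (s - t))%C with (RtoC 0)
    by (rewrite RtoC_minus; ring).
  rewrite Cmod_0. assert (0 <= Rabs (s - t)) by apply Rabs_pos. nra.
Qed.

Lemma rder_ext (f g : R -> C) (t : R) (d : C) : (forall s, f s = g s) -> rder f t d -> rder g t d.
Proof.
  intros E H eps He. destruct (H eps He) as [de [Hd K]]. exists de; split; auto. intros s Hs. rewrite <- !E. auto.
Qed.

Lemma rder_hor (y t : R) : rder (fun x => (x, y)) t 1.
Proof.
  apply rder_ext with (fun s => RtoC 0 + Ci * RtoC y + RtoC s * 1)%C; [|apply rder_affine]. intros s. csolve.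
Qed.

Lemma rder_ver (x t : R) : rder (fun y => (x, y)) t Ci.
Proof.
  apply rder_ext with (fun s => RtoC x + RtoC s * Ci)%C; [|apply rder_affine]. intros s. csolve.
Qed.

Lemma rcont_hor (f : C -> C) (y t : R) : ccont f (t, y) -> rcont (fun x => f (x, y)) t.
Proof. intros H. apply (rcont_comp f (fun x => (x, y))); auto. eapply rder_rcont, rder_hor. Qed.

Lemma rcont_ver (f : C -> C) (x t : R) : ccont f (x, t) -> rcont (fun y => f (x, y)) t.
Proof. intros H. apply (rcont_comp f (fun y => (x, y))); auto. eapply rder_rcont, rder_ver. Qed.

(** * Rectangles and Goursat's theorem *)

(** The contour integral along the boundary of [a,b] x [c,d], counterclockwise. *)
Definition rect (f : C -> C) (a b c d : R) : C :=
  (CI (fun x => f (x, c)) a b + Ci * CI (fun y => f (b, y)) c d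
   - CI (fun x => f (x, d)) a b - Ci * CI (fun y => f (a, y)) c d)%C.

Definition inrect (a b c d : R) (z : C) : Prop := a <= fst z <= b /\ c <= snd z <= d.

Lemma rect_hsplit (f : C -> C) (a m b c d : R) : a <= m <= b -> c <= d ->
  (forall z, inrect a b c d z -> ccont f z) ->
  rect f a b c d = (rect f a m c d + rect f m b c d)%C.
Proof.
  intros Hm Hcd H. unfold rect. rewrite <- (CI_Chasles (fun x => f (x, c)) a m b), <- (CI_Chasles (fun x => f (x, d)) a m b).
  - ring.
  - intros t. rewrite Rmin_left, Rmax_right by lra. intros. apply rcont_hor, H. split; simpl; lra.
  - intros t. rewrite Rmin_left, Rmax_right by lra. intros. apply rcont_hor, H. split; simpl; lra.
  - intros t. rewrite Rmin_left, Rmax_right by lra. intros. apply rcont_hor, H. split; simpl; lra.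
  - intros t. rewrite Rmin_left, Rmax_right by lra. intros. apply rcont_hor, H. split; simpl; lra.
Qed.

Lemma rect_vsplit (f : C -> C) (a b c m d : R) : a <= b -> c <= m <= d ->
  (forall z, inrect a b c d z -> ccont f z) ->
  rect f a b c d = (rect f a b c m + rect f a b m d)%C.
Proof.
  intros Hm Hcd H. unfold rect. rewrite <- (CI_Chasles (fun x => f (b, x)) c m d), <- (CI_Chasles (fun x => f (a, x)) c m d).
  - ring.
  - intros t. rewrite Rmin_left, Rmax_right by lra. intros. apply rcont_ver, H. split; simpl; lra.
  - intros t. rewrite Rmin_left, Rmax_right by lra. intros. apply rcont_ver, H. split; simpl; lra.
  - intros t. rewrite Rmin_left, Rmax_right by lra. intros. apply rcont_ver, H. split; simpl; lra.
  - intros t. rewrite Rmin_left, Rmax_right by lra. intros. apply rcont_ver, H. split; simpl; lra.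
Qed.

Lemma rect_bound (f : C -> C) (a b c d M : R) : a <= b -> c <= d ->
  (forall z, inrect a b c d z -> ccont f z) -> (forall z, inrect a b c d z -> Cmod (f z) <= M) ->
  Cmod (rect f a b c d) <= 2 * M * ((b - a) + (d - c)).
Proof.
  intros Hab Hcd H HM. unfold rect. assert (E1 : Cmod (CI (fun x => f (x, c)) a b) <= M * Rabs (b - a)).
  { apply CI_bound; intros t; rewrite Rmin_left, Rmax_right by lra; intros.
    apply rcont_hor, H; split; simpl; lra. apply HM; split; simpl; lra. }
  assert (E2 : Cmod (CI (fun x => f (x, d)) a b) <= M * Rabs (b - a)).
  { apply CI_bound; intros t; rewrite Rmin_left, Rmax_right by lra; intros.
    apply rcont_hor, H; split; simpl; lra. apply HM; split; simpl; lra. }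
  assert (E3 : Cmod (Ci * CI (fun x => f (a, x)) c d) <= M * Rabs (d - c)).
  { rewrite Cmod_mult, Cmod_Ci, Rmult_1_l. apply CI_bound; intros t; rewrite Rmin_left, Rmax_right by lra; intros.
    apply rcont_ver, H; split; simpl; lra. apply HM; split; simpl; lra. }
  assert (E4 : Cmod (Ci * CI (fun x => f (b, x)) c d) <= M * Rabs (d - c)).
  { rewrite Cmod_mult, Cmod_Ci, Rmult_1_l. apply CI_bound; intros t; rewrite Rmin_left, Rmax_right by lra; intros.
    apply rcont_ver, H; split; simpl; lra. apply HM; split; simpl; lra. }
  rewrite Rabs_right in * by lra. eapply Rle_trans; [apply Cmod_triangle_minus|].
  eapply Rle_trans; [apply Rplus_le_compat_r, Cmod_triangle_minus|].
  eapply Rle_trans; [apply Rplus_le_compat_r, Rplus_le_compat_r, Cmod_triangle|]. lra.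
Qed.

Lemma rect_primitive (F f : C -> C) (a b c d : R) : a <= b -> c <= d ->
  (forall z, inrect a b c d z -> cder F z (f z)) -> (forall z, inrect a b c d z -> ccont f z) ->
  rect f a b c d = 0%C.
Proof.
  intros Hab Hcd HF Hf. unfold rect. assert (Hh : forall y, c <= y <= d -> CI (fun x => f (x, y)) a b = (F (b, y) - F (a, y))%C).
  { intros y Hy. apply (CI_FTC (fun x => F (x, y))); intros t; rewrite Rmin_left, Rmax_right by lra; intros.
    - replace (f (t, y)) with (f (t, y) * 1)%C by ring. apply (rder_comp F (fun x => (x, y))); [apply HF; split; simpl; lra|apply rder_hor].
    - apply rcont_hor, Hf; split; simpl; lra. }
  assert (Hv : forall x, a <= x <= b -> (Ci * CI (fun y => f (x, y)) c d)%C = (F (x, d) - F (x, c))%C).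
  { intros x Hx. rewrite <- CI_scal.
    - apply (CI_FTC (fun y => F (x, y))); intros t; rewrite Rmin_left, Rmax_right by lra; intros.
      + rewrite Cmult_comm. apply (rder_comp F (fun y => (x, y))); [apply HF; split; simpl; lra|apply rder_ver].
      + apply rcont_scal, rcont_ver, Hf; split; simpl; lra.
    - intros t; rewrite Rmin_left, Rmax_right by lra; intros. apply rcont_ver, Hf; split; simpl; lra. }
  rewrite !Hh, !Hv by lra. ring.
Qed.

Lemma rect_minus (f g : C -> C) (a b c d : R) : a <= b -> c <= d ->
  (forall z, inrect a b c d z -> ccont f z) -> (forall z, inrect a b c d z -> ccont g z) ->
  rect (fun z => f z - g z)%C a b c d = (rect f a b c d - rect g a b c d)%C.
Proof.
  intros Hab Hcd Hf Hg. unfold rect.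
  rewrite (CI_minus (fun x => f (x, c)) (fun x => g (x, c))), (CI_minus (fun x => f (x, d)) (fun x => g (x, d))),
    (CI_minus (fun x => f (a, x)) (fun x => g (a, x))), (CI_minus (fun x => f (b, x)) (fun x => g (b, x)));
    try (intros t; rewrite Rmin_left, Rmax_right by lra; intros;
      first [apply rcont_hor | apply rcont_ver]; first [apply Hf | apply Hg]; split; simpl; lra).
  ring.
Qed.

Record quad := mkquad { qa : R; qb : R; qc : R; qd : R }.
Definition qrect (f : C -> C) (q : quad) : C := rect f (qa q) (qb q) (qc q) (qd q).

(** The fallback [q4] needs no test: if three quarters each carry less than a fourth of the modulus,
    the last one carries at least a fourth. *)
Definition quarter (f : C -> C) (q : quad) : quad :=
  let m := (qa q + qb q) / 2 in let n := (qc q + qd q) / 2 in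
  let r := Cmod (qrect f q) / 4 in
  let q1 := mkquad (qa q) m (qc q) n in let q2 := mkquad m (qb q) (qc q) n in
  let q3 := mkquad (qa q) m n (qd q) in let q4 := mkquad m (qb q) n (qd q) in
  if Rle_dec r (Cmod (qrect f q1)) then q1 else
  if Rle_dec r (Cmod (qrect f q2)) then q2 else
  if Rle_dec r (Cmod (qrect f q3)) then q3 else q4.

Fixpoint quarters (f : C -> C) (q : quad) (n : nat) : quad :=
  match n with O => q | S n => quarter f (quarters f q n) end.

Lemma quarter_spec (f : C -> C) (q : quad) : qa q <= qb q -> qc q <= qd q ->
  (forall z, inrect (qa q) (qb q) (qc q) (qd q) z -> ccont f z) ->
  let q' := quarter f q in
  qa q <= qa q' /\ qb q' <= qb q /\ qc q <= qc q' /\ qd q' <= qd q /\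
  qb q' - qa q' = (qb q - qa q) / 2 /\ qd q' - qc q' = (qd q - qc q) / 2 /\
  Cmod (qrect f q) / 4 <= Cmod (qrect f q').
Proof.
  intros Hab Hcd Hf. destruct q as [a b c d]; simpl in *. unfold quarter; simpl.
  assert (S : qrect f (mkquad a b c d) =
    (qrect f (mkquad a ((a + b) / 2) c ((c + d) / 2)) + qrect f (mkquad ((a + b) / 2) b c ((c + d) / 2)) +
     (qrect f (mkquad a ((a + b) / 2) ((c + d) / 2) d) + qrect f (mkquad ((a + b) / 2) b ((c + d) / 2) d)))%C).
  { unfold qrect; simpl. rewrite (rect_vsplit f a b c ((c + d) / 2) d) by (auto; lra).
    rewrite (rect_hsplit f a ((a + b) / 2) b c ((c + d) / 2)), (rect_hsplit f a ((a + b) / 2) b ((c + d) / 2) d); try lra.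
    - reflexivity.
    - intros z [H1 H2]. apply Hf. split; lra.
    - intros z [H1 H2]. apply Hf. split; lra. }
  destruct (Rle_dec _ _) as [L1|L1]; [simpl; lra|]. destruct (Rle_dec _ _) as [L2|L2]; [simpl; lra|].
  destruct (Rle_dec _ _) as [L3|L3]; [simpl; lra|]. simpl. repeat split; try lra. rewrite S in L1, L2, L3 |- *.
  set (X1 := qrect f (mkquad a ((a + b) / 2) c ((c + d) / 2))) in *. set (X2 := qrect f (mkquad ((a + b) / 2) b c ((c + d) / 2))) in *.
  set (X3 := qrect f (mkquad a ((a + b) / 2) ((c + d) / 2) d)) in *. set (X4 := qrect f (mkquad ((a + b) / 2) b ((c + d) / 2) d)) in *.
  assert (T1 := Cmod_triangle (X1 + X2) (X3 + X4)). assert (T2 := Cmod_triangle X1 X2). assert (T3 := Cmod_triangle X3 X4). lra.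
Qed.

Lemma nested_point (u v : nat -> R) : (forall n, u n <= u (S n)) -> (forall n, v (S n) <= v n) ->
  (forall n, u n <= v n) -> exists x, forall n, u n <= x <= v n.
Proof.
  intros Hu Hv Huv. assert (Um : forall n k, u n <= u (n + k)%nat).
  { intros n k; induction k; [rewrite Nat.add_0_r; lra|rewrite Nat.add_succ_r]. specialize (Hu (n + k)%nat); lra. }
  assert (Vm : forall n k, v (n + k)%nat <= v n).
  { intros n k; induction k; [rewrite Nat.add_0_r; lra|rewrite Nat.add_succ_r]. specialize (Hv (n + k)%nat); lra. }
  assert (UV : forall n m, u n <= v m).
  { intros n m. specialize (Um n m). specialize (Vm m n). rewrite Nat.add_comm in Vm. specialize (Huv (n + m)%nat). lra. }
  destruct (completeness (fun x => exists n, x = u n)) as [x [H1 H2]].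
  - exists (v 0%nat). intros x [n ->]. apply UV.
  - exists (u 0%nat). exists 0%nat; auto.
  - exists x. intros n. split; [apply H1; exists n; auto|]. apply H2. intros y [m ->]. apply UV.
Qed.

(** Under repeated quartering the sides shrink by 2^-n and the integral by at most 4^-n. Near the
    common point [f] differs from an affine function by at most e |z - z0|, and the affine part has
    a primitive, so the n-th integral is at most 2 e L^2 4^-n. *)
Lemma goursat (f : C -> C) (a b c d : R) : a <= b -> c <= d ->
  (forall z, inrect a b c d z -> diff_at f z) -> rect f a b c d = 0%C.
Proof.
  intros Hab Hcd Hf. assert (Hc : forall z, inrect a b c d z -> ccont f z) by (intros z Hz; apply diff_at_ccont; auto).
  set (q := quarters f (mkquad a b c d)).
  assert (Inv : forall n, a <= qa (q n) /\ qb (q n) <= b /\ c <= qc (q n) /\ qd (q n) <= d /\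
     qb (q n) - qa (q n) = (b - a) * (/ 2) ^ n /\ qd (q n) - qc (q n) = (d - c) * (/ 2) ^ n /\
     Cmod (rect f a b c d) * (/ 4) ^ n <= Cmod (qrect f (q n)) /\
     qa (q n) <= qa (q (S n)) /\ qb (q (S n)) <= qb (q n) /\ qc (q n) <= qc (q (S n)) /\ qd (q (S n)) <= qd (q n)).
  { assert (pos : forall n, 0 < (/ 2) ^ n) by (intros; apply pow_lt; lra). induction n as [|n IH].
    - assert (S := quarter_spec f (mkquad a b c d)). simpl in S. destruct S as (S1 & S2 & S3 & S4 & S5 & S6 & S7); auto.
      unfold q; simpl. repeat split; try lra; auto. unfold qrect; simpl. lra.
    - destruct IH as (I1 & I2 & I3 & I4 & I5 & I6 & I7 & _).
      assert (P1 : 0 <= (b - a) * (/ 2) ^ n) by (apply Rmult_le_pos; [lra|left; apply pos]).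
      assert (P2 : 0 <= (d - c) * (/ 2) ^ n) by (apply Rmult_le_pos; [lra|left; apply pos]).
      assert (S := quarter_spec f (q n)). destruct S as (S1 & S2 & S3 & S4 & S5 & S6 & S7); try lra.
      { intros z [Z1 Z2]. apply Hc. split; lra. }
      change (quarter f (q n)) with (q (S n)) in *.
      assert (S5' : qb (q (S n)) - qa (q (S n)) = (b - a) * (/ 2) ^ S n) by (rewrite S5, I5; simpl; field).
      assert (S6' : qd (q (S n)) - qc (q (S n)) = (d - c) * (/ 2) ^ S n) by (rewrite S6, I6; simpl; field).
      assert (T := quarter_spec f (q (S n))). destruct T as (T1 & T2 & T3 & T4 & _); try lra.
      { intros z [Z1 Z2]. apply Hc. split; lra. }
      change (quarter f (q (S n))) with (q (S (S n))) in *. repeat split; try lra. simpl pow. lra. }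
  assert (pos : forall n, 0 < (/ 2) ^ n) by (intros; apply pow_lt; lra).
  destruct (nested_point (fun n => qa (q n)) (fun n => qb (q n))) as [x Hx]; try (intros n; apply (Inv n)).
  { intros n. destruct (Inv n) as (_ & _ & _ & _ & I5 & _). assert (0 <= (b - a) * (/ 2) ^ n) by (apply Rmult_le_pos; [lra|left; apply pos]). lra. }
  destruct (nested_point (fun n => qc (q n)) (fun n => qd (q n))) as [y Hy]; try (intros n; apply (Inv n)).
  { intros n. destruct (Inv n) as (_ & _ & _ & _ & _ & I6 & _). assert (0 <= (d - c) * (/ 2) ^ n) by (apply Rmult_le_pos; [lra|left; apply pos]). lra. }
  destruct (Hf (x, y)) as [D HD].
  { specialize (Hx 0%nat). specialize (Hy 0%nat). simpl in Hx, Hy. split; simpl; lra. }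
  set (L := (b - a) + (d - c)). apply Cmod_zero_all. intros eps He. destruct (HD (eps / (2 * L ^ 2 + 1))) as [de [Hde K]].
  { apply Rdiv_lt_0_compat; auto. assert (0 <= L ^ 2) by apply pow2_ge_0. lra. }
  set (e := eps / (2 * L ^ 2 + 1)) in *.
  assert (He' : 0 < e) by (unfold e; apply Rdiv_lt_0_compat; [auto|assert (0 <= L ^ 2) by apply pow2_ge_0; lra]).
  assert (HL : 0 <= L) by (unfold L; lra). destruct (pow_lt_1_zero (/ 2)) with (y := de / (L + 1)) as [n Hn].
  { rewrite Rabs_right; lra. } { positive. }
  specialize (Hn n (le_n n)). rewrite Rabs_right in Hn by (left; apply pos).
  destruct (Inv n) as (I1 & I2 & I3 & I4 & I5 & I6 & I7 & _). specialize (Hx n). specialize (Hy n). assert (HLn : L * (/ 2) ^ n < de).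
  { apply Rle_lt_trans with ((L + 1) * (/ 2) ^ n). apply Rmult_le_compat_r; [left; apply pos|lra].
    apply Rlt_le_trans with ((L + 1) * (de / (L + 1))); [apply Rmult_lt_compat_l; lra|right; field; lra]. }
  set (z0 := (x, y) : C) in *. set (aff := (fun w => f z0 + D * (w - z0))%C).
  assert (Haff : forall z, cder (fun w => f z0 * w + D / 2 * ((w - z0) * (w - z0)))%C z (aff z)).
  { intros z. eapply cder_eq.
    - apply cder_plus. apply cder_scal, cder_id. apply cder_scal, cder_mult; apply cder_minus; try apply cder_id; apply cder_const.
    - unfold aff. field. }
  assert (Haffc : forall z, ccont aff z).
  { intros z. apply (cder_ccont aff z (0 + D * (1 - 0))%C). apply cder_plus; [apply cder_const|]. apply cder_scal, cder_minus; [apply cder_id|apply cder_const]. }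
  assert (R0 : qrect f (q n) = rect (fun z => f z - aff z)%C (qa (q n)) (qb (q n)) (qc (q n)) (qd (q n))).
  { rewrite rect_minus; try lra; auto.
    - rewrite (rect_primitive (fun w => f z0 * w + D / 2 * ((w - z0) * (w - z0)))%C aff); try lra; [unfold qrect; ring| intros; apply Haff |auto].
    - intros z [Z1 Z2]; apply Hc; split; lra. }
  assert (B : Cmod (qrect f (q n)) <= 2 * (e * (L * (/ 2) ^ n)) * (L * (/ 2) ^ n)).
  { rewrite R0. replace (L * (/ 2) ^ n) with ((qb (q n) - qa (q n)) + (qd (q n) - qc (q n))) at 2 by (unfold L; lra).
    apply rect_bound; try lra.
    - intros z [Z1 Z2]. destruct (Hf z) as [dz Hdz]; [split; lra|]. eapply cder_ccont. apply cder_minus; [exact Hdz|].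
      apply cder_plus; [apply cder_const|]. apply cder_scal, cder_minus; [apply cder_id|apply cder_const].
    - intros z [Z1 Z2]. assert (M : Cmod (z - z0) <= L * (/ 2) ^ n).
      { eapply Rle_trans; [apply Cmod_le_sum|]. unfold z0; simpl. unfold L.
        assert (Rabs (fst z + - x) <= qb (q n) - qa (q n)) by (apply Rabs_le; lra).
        assert (Rabs (snd z + - y) <= qd (q n) - qc (q n)) by (apply Rabs_le; lra). lra. }
      unfold aff. replace (f z - (f z0 + D * (z - z0)))%C with (f z - f z0 - D * (z - z0))%C by ring.
      eapply Rle_trans; [apply K; lra|]. apply Rmult_le_compat_l; lra. }
  assert (Q : (/ 4) ^ n = (/ 2) ^ n * (/ 2) ^ n) by (rewrite <- Rpow_mult_distr; f_equal; field).
  assert (HH : Cmod (rect f a b c d) <= 2 * e * L ^ 2).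
  { rewrite Q in I7. apply Rmult_le_reg_r with ((/ 2) ^ n * (/ 2) ^ n); [apply Rmult_lt_0_compat; apply pos|].
    eapply Rle_trans; [exact I7|]. eapply Rle_trans; [exact B|]. right; ring. }
  eapply Rle_trans; [apply HH|]. unfold e. assert (0 <= L ^ 2) by apply pow2_ge_0. apply Rmult_le_reg_r with (2 * L ^ 2 + 1); [lra|]. 
  replace (2 * (eps / (2 * L ^ 2 + 1)) * L ^ 2 * (2 * L ^ 2 + 1)) with (2 * L ^ 2 * eps) by (field; lra). nra.
Qed.

Lemma rect_width0 (f : C -> C) (a c d : R) : rect f a a c d = 0%C.
Proof. unfold rect. rewrite !CI_point. ring. Qed.

Lemma rect_height0 (f : C -> C) (a b c : R) : rect f a b c c = 0%C.
Proof. unfold rect. rewrite !CI_point. ring. Qed.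

(** Mere continuity at [p] is enough: the four rectangles around a small one containing [p]
    contribute nothing, and the small one contributes O(e). This covers difference quotients
    completed by the derivative. *)
Lemma goursat_except (f : C -> C) (p : C) (a b c d : R) : a <= b -> c <= d ->
  (forall z, inrect a b c d z -> ccont f z) ->
  (forall z, inrect a b c d z -> z <> p -> diff_at f z) -> rect f a b c d = 0%C.
Proof.
  intros Hab Hcd Hc Hf. destruct (excluded_middle_informative (inrect a b c d p)) as [Hp|Hp].
  2:{ apply goursat; auto. intros z Hz. apply Hf; auto. intros ->; auto. }
  destruct Hp as [Hp1 Hp2]. destruct p as [p1 p2]; simpl in Hp1, Hp2.
  destruct (Hc (p1, p2)) with (eps := 1) as [de [Hde K]]; [split; simpl; lra|lra|]. set (M := Cmod (f (p1, p2)) + 1).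
  assert (HM : 0 < M) by (unfold M; assert (0 <= Cmod (f (p1, p2))) by apply Cmod_ge_0; lra). apply Cmod_zero_all. intros eps He.
  set (e := Rmin (de / 4) (eps / (8 * M))). assert (He1 : 0 < e) by (apply Rmin_pos; [lra|positive]).
  assert (He2 : e <= de / 4) by apply Rmin_l. assert (He3 : e * (8 * M) <= eps).
  { apply Rle_trans with (eps / (8 * M) * (8 * M)). apply Rmult_le_compat_r; [lra|apply Rmin_r]. right; field; lra. }
  (* The square around [p] is clipped to the rectangle, since [p] may lie on its boundary; strips
     that degenerate have zero integral. *)
  set (a' := Rmax a (p1 - e)). set (b' := Rmin b (p1 + e)). set (c' := Rmax c (p2 - e)). set (d' := Rmin d (p2 + e)).
  assert (Ha' : a <= a' <= p1 /\ p1 - e <= a') by (unfold a', Rmax; destruct Rle_dec; lra).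
  assert (Hb' : p1 <= b' <= b /\ b' <= p1 + e) by (unfold b', Rmin; destruct Rle_dec; lra).
  assert (Hc' : c <= c' <= p2 /\ p2 - e <= c') by (unfold c', Rmax; destruct Rle_dec; lra).
  assert (Hd' : p2 <= d' <= d /\ d' <= p2 + e) by (unfold d', Rmin; destruct Rle_dec; lra). assert (Z1 : rect f a a' c d = 0%C).
  { unfold a', Rmax. destruct Rle_dec; [|apply rect_width0]. destruct (Req_dec a (p1 - e)) as [<-|]; [apply rect_width0|].
    apply goursat; try lra. intros z [Z1 Z2]. apply Hf; [split; lra|]. intros ->. simpl in *. lra. }
  assert (Z2 : rect f b' b c d = 0%C).
  { unfold b', Rmin. destruct Rle_dec; [apply rect_width0|].
    apply goursat; try lra. intros z [Z2 Z3]. apply Hf; [split; lra|]. intros ->. simpl in *. lra. }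
  assert (Z3 : rect f a' b' c c' = 0%C).
  { unfold c', Rmax. destruct Rle_dec; [|apply rect_height0].
    apply goursat; try lra. intros z [Z3 Z4]. apply Hf; [split; lra|]. intros ->. simpl in *. lra. }
  assert (Z4 : rect f a' b' d' d = 0%C).
  { unfold d', Rmin. destruct Rle_dec; [apply rect_height0|].
    apply goursat; try lra. intros z [Z4 Z5]. apply Hf; [split; lra|]. intros ->. simpl in *. lra. }
  rewrite (rect_hsplit f a a' b c d), (rect_hsplit f a' b' b c d), (rect_vsplit f a' b' c c' d),
    (rect_vsplit f a' b' c' d' d); try lra; auto;
    try (intros z [Q1 Q2]; apply Hc; split; lra).
  rewrite Z1, Z2, Z3, Z4. replace (0 + (0 + (rect f a' b' c' d' + 0) + 0))%C with (rect f a' b' c' d') by ring.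
  eapply Rle_trans; [apply (rect_bound f a' b' c' d' M); try lra|].
  - intros z [Q1 Q2]; apply Hc; split; lra.
  - intros z [Q1 Q2]. unfold M. assert (Cmod (z - (p1, p2)) < de).
    { eapply Rle_lt_trans; [apply Cmod_le_sum|]. simpl. assert (Rabs (fst z + - p1) <= e) by (apply Rabs_le; lra).
      assert (Rabs (snd z + - p2) <= e) by (apply Rabs_le; lra). lra. }
    specialize (K z H). assert (T := Cmod_triangle_sub (f z) (f (p1, p2))). lra.
  - apply Rle_trans with (2 * M * (4 * e)); [|lra]. apply Rmult_le_compat_l; lra.
Qed.

Lemma rect_swap_h (f : C -> C) (a b c d : R) : rcont_on (fun x => f (x, c)) a b -> rcont_on (fun x => f (x, d)) a b ->
  rect f b a c d = (- rect f a b c d)%C.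
Proof. intros H1 H2. unfold rect. rewrite (CI_swap _ a b H1), (CI_swap _ a b H2). ring. Qed.

Lemma rect_swap_v (f : C -> C) (a b c d : R) : rcont_on (fun x => f (a, x)) c d -> rcont_on (fun x => f (b, x)) c d ->
  rect f a b d c = (- rect f a b c d)%C.
Proof. intros H1 H2. unfold rect. rewrite (CI_swap _ c d H1), (CI_swap _ c d H2). ring. Qed.

Lemma between_abs (a b t x r : R) : Rmin a b <= t <= Rmax a b -> Rabs (a - x) <= r -> Rabs (b - x) <= r -> Rabs (t - x) <= r.
Proof.
  unfold Rmin, Rmax. intros H H1 H2. apply Rabs_le_between in H1. apply Rabs_le_between in H2. apply Rabs_le. destruct Rle_dec; lra.
Qed.

Lemma between_sqr (a b t x r : R) : Rmin a b <= t <= Rmax a b -> (a - x) ^ 2 <= r -> (b - x) ^ 2 <= r -> (t - x) ^ 2 <= r.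
Proof.
  unfold Rmin, Rmax. intros H H1 H2. destruct (Rle_dec t x); destruct Rle_dec; nra.
Qed.

Lemma primitive_disc (f : C -> C) (c : C) (R0 : R) :
  (forall z, Cmod (z - c) < R0 -> ccont f z) ->
  (forall a b p q, a <= b -> p <= q -> (forall z, inrect a b p q z -> Cmod (z - c) < R0) -> rect f a b p q = 0%C) ->
  exists P, forall z, Cmod (z - c) < R0 -> cder P z (f z).
Proof.
  intros Hc Hr. destruct c as [cx cy].
  set (P := fun z : C => (CI (fun t => f (t, cy)) cx (fst z) + Ci * CI (fun t => f (fst z, t)) cy (snd z))%C).
  (* Sides in either order are needed because the point may lie on any side of the centre. *)
  assert (Hr' : forall a b p q, (forall x y, Rmin a b <= x <= Rmax a b -> Rmin p q <= y <= Rmax p q -> Cmod ((x, y) - (cx, cy)) < R0) ->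
     rect f a b p q = 0%C).
  { assert (H0 : forall a b p q, a <= b -> (forall x y, Rmin a b <= x <= Rmax a b -> Rmin p q <= y <= Rmax p q -> Cmod ((x, y) - (cx, cy)) < R0) ->
       rect f a b p q = 0%C).
    { intros a b p q Hab H. destruct (Rle_dec p q) as [L|L].
      - apply Hr; auto. intros [x y] [Z1 Z2]; simpl in *. apply H; rewrite ?Rmin_left, ?Rmax_right; lra.
      - rewrite rect_swap_v.
        + rewrite Hr; try lra; [ring|]. intros [x y] [Z1 Z2]; simpl in *. apply H.
          rewrite ?Rmin_left, ?Rmax_right; lra. rewrite ?Rmin_right, ?Rmax_left; lra.
        + intros t Ht. apply rcont_ver, Hc, H. rewrite ?Rmin_left, ?Rmax_right; lra. rewrite Rmin_comm, Rmax_comm; auto.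
        + intros t Ht. apply rcont_ver, Hc, H. rewrite ?Rmin_left, ?Rmax_right; lra. rewrite Rmin_comm, Rmax_comm; auto. }
    intros a b p q H. destruct (Rle_dec a b) as [L|L]; [apply H0; auto|]. rewrite rect_swap_h.
    - rewrite H0; [ring|lra|]. intros x y Hx Hy. apply H; auto. rewrite Rmin_comm, Rmax_comm; auto.
    - intros t Ht. apply rcont_hor, Hc, H. rewrite Rmin_comm, Rmax_comm; auto. split; [apply Rmin_l|apply Rmax_l].
    - intros t Ht. apply rcont_hor, Hc, H. rewrite Rmin_comm, Rmax_comm; auto. split; [apply Rmin_r|apply Rmax_r]. }
  exists P. intros [x y] Hz eps He. destruct (Hc _ Hz (eps / 2)) as [d1 [Hd1 K]]; [lra|]. set (rho := Cmod ((x, y) - (cx, cy))) in *.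
  exists (Rmin d1 (R0 - rho)). split; [apply Rmin_pos; lra|]. intros [x' y'] Hw.
  assert (W1 := Rlt_le_trans _ _ _ Hw (Rmin_l _ _)). assert (W2 := Rlt_le_trans _ _ _ Hw (Rmin_r _ _)).
  assert (Hx' : Rabs (x' - x) <= Cmod ((x', y') - (x, y))) by apply (Cmod_Re ((x', y') - (x, y))%C).
  assert (Hy' : Rabs (y' - y) <= Cmod ((x', y') - (x, y))) by apply (Cmod_Im ((x', y') - (x, y))%C).
  assert (HR0 : 0 < R0) by (assert (0 <= rho) by apply Cmod_ge_0; lra). assert (InZ := sqr_lt_of_Cmod _ _ Hz). simpl in InZ.
  assert (InX : Cmod ((x', y) - (cx, cy)) < R0).
  { eapply Rle_lt_trans; [apply (Cmod_triangle3 (x', y) (x, y))|]. fold rho.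
    replace ((x', y) - (x, y))%C with (RtoC (x' - x)) by (csolve). rewrite Cmod_R. lra. }
  apply sqr_lt_of_Cmod in InX. simpl in InX. assert (InW : Cmod ((x', y') - (cx, cy)) < R0).
  { eapply Rle_lt_trans; [apply (Cmod_triangle3 (x', y') (x, y))|]. fold rho. lra. }
  apply sqr_lt_of_Cmod in InW. simpl in InW.
  assert (InD : forall s t, (s - cx) ^ 2 + (t - cy) ^ 2 < R0 ^ 2 -> Cmod ((s, t) - (cx, cy)) < R0).
  { intros s t H. apply Cmod_lt_of_sqr; auto. }
  assert (Sq0 : forall t : R, 0 <= t ^ 2) by (intros; apply pow2_ge_0).
  assert (E1 : (CI (fun t => f (t, cy)) cx x + CI (fun t => f (t, cy)) x x')%C = CI (fun t => f (t, cy)) cx x').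
  { apply CI_Chasles; intros t Ht; apply rcont_hor, Hc, InD.
    - assert ((t - cx) ^ 2 <= (x - cx) ^ 2).
      { apply between_sqr with cx x; auto; try lra. rewrite Rminus_diag. simpl. specialize (Sq0 (x - cx)). simpl in Sq0. lra. }
      specialize (Sq0 (y - cy)). replace ((cy - cy) ^ 2) with 0 by ring. unfold Rminus in *; simpl in *; lra.
    - assert ((t - cx) ^ 2 <= Rmax ((x - cx) ^ 2) ((x' - cx) ^ 2)).
      { apply between_sqr with x x'; auto; [apply Rmax_l|apply Rmax_r]. }
      specialize (Sq0 (y - cy)). replace ((cy - cy) ^ 2) with 0 by ring.
      unfold Rmax in H. destruct Rle_dec; unfold Rminus in *; simpl in *; lra. }
  assert (E2 : (CI (fun t => f (x', t)) cy y + CI (fun t => f (x', t)) y y')%C = CI (fun t => f (x', t)) cy y').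
  { apply CI_Chasles; intros t Ht; apply rcont_ver, Hc, InD.
    - assert ((t - cy) ^ 2 <= (y - cy) ^ 2).
      { apply between_sqr with cy y; auto; try lra. rewrite Rminus_diag. simpl. specialize (Sq0 (y - cy)). simpl in Sq0. lra. }
      unfold Rminus in *; simpl in *; lra.
    - assert ((t - cy) ^ 2 <= Rmax ((y - cy) ^ 2) ((y' - cy) ^ 2)).
      { apply between_sqr with y y'; auto; [apply Rmax_l|apply Rmax_r]. }
      unfold Rmax in H. destruct Rle_dec; unfold Rminus in *; simpl in *; lra. }
  assert (E3 : rect f x x' cy y = 0%C).
  { apply Hr'. intros s t Hs Ht. apply InD. assert ((s - cx) ^ 2 <= Rmax ((x - cx) ^ 2) ((x' - cx) ^ 2)).
    { apply between_sqr with x x'; auto; [apply Rmax_l|apply Rmax_r]. }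
    assert ((t - cy) ^ 2 <= (y - cy) ^ 2).
    { apply between_sqr with cy y; auto; try lra. rewrite Rminus_diag. simpl. specialize (Sq0 (y - cy)). simpl in Sq0. lra. }
    unfold Rmax in H. destruct Rle_dec; unfold Rminus in *; simpl in *; lra. }
  assert (Cx : rcont_on (fun t => f (t, y)) x x').
  { intros t Ht; apply rcont_hor, Hc, InD. assert ((t - cx) ^ 2 <= Rmax ((x - cx) ^ 2) ((x' - cx) ^ 2)).
    { apply between_sqr with x x'; auto; [apply Rmax_l|apply Rmax_r]. }
    unfold Rmax in H. destruct Rle_dec; unfold Rminus in *; simpl in *; lra. }
  assert (Cy : rcont_on (fun t => f (x', t)) y y').
  { intros t Ht; apply rcont_ver, Hc, InD. assert ((t - cy) ^ 2 <= Rmax ((y - cy) ^ 2) ((y' - cy) ^ 2)).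
    { apply between_sqr with y y'; auto; [apply Rmax_l|apply Rmax_r]. }
    unfold Rmax in H. destruct Rle_dec; unfold Rminus in *; simpl in *; lra. }
  assert (D : (P (x', y') - P (x, y) - f (x, y) * ((x', y') - (x, y)))%C =
    (CI (fun t => f (t, y) - f (x, y))%C x x' + Ci * CI (fun t => f (x', t) - f (x, y))%C y y')%C).
  { rewrite (CI_minus (fun t => f (t, y)) (fun _ => f (x, y))), (CI_minus (fun t => f (x', t)) (fun _ => f (x, y)));
      auto; try (intros t _; apply rcont_const).
    rewrite !CI_const. unfold P; simpl fst; simpl snd. rewrite <- E1, <- E2.
    replace (CI (fun t => f (t, cy)) x x') with (rect f x x' cy y - Ci * CI (fun t => f (x', t)) cy y + CI (fun t => f (t, y)) x x'
        + Ci * CI (fun t => f (x, t)) cy y)%C by (unfold rect; ring).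
    rewrite E3. replace ((x', y') - (x, y))%C with (RtoC (x' - x) + Ci * RtoC (y' - y))%C by (csolve). ring. }
  rewrite D. eapply Rle_trans; [apply Cmod_triangle|]. rewrite Cmod_mult, Cmod_Ci, Rmult_1_l.
  assert (B1 : Cmod (CI (fun t => f (t, y) - f (x, y))%C x x') <= eps / 2 * Rabs (x' - x)).
  { apply CI_bound. intros t Ht. apply rcont_minus; [auto|apply rcont_const].
    intros t Ht. left. apply K. eapply Rle_lt_trans; [|exact W1]. eapply Rle_trans; [|exact Hx'].
    replace ((t, y) - (x, y))%C with (RtoC (t - x)) by (csolve). rewrite Cmod_R.
    apply (between_abs x x' t); auto. rewrite Rminus_diag, Rabs_R0. apply Rabs_pos. lra. }
  assert (B2 : Cmod (CI (fun t => f (x', t) - f (x, y))%C y y') <= eps / 2 * Rabs (y' - y)).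
  { apply CI_bound. intros t Ht. apply rcont_minus; [auto|apply rcont_const].
    intros t Ht. left. apply K. eapply Rle_lt_trans; [|exact W1]. apply Cmod_le_of_sqr; [apply Cmod_ge_0|]. rewrite Cmod_sqr. simpl.
    assert ((t - y) ^ 2 <= (y' - y) ^ 2).
    { apply (between_sqr y y'); auto; [|lra]. rewrite Rminus_diag. simpl. specialize (Sq0 (y' - y)). simpl in Sq0. lra. }
    unfold Rminus in *; simpl in *; lra. }
  nra.
Qed.

(** * Averages over circles and Cauchy's formula *)

Definition cis (x : R) : C := (cos x, sin x).
Definition circ (c : C) (r : R) (x : R) : C := (c + RtoC r * cis x)%C.
(** The mean over a circle stands for the contour integral: dw/(2 pi i) equals (w - c) dx/(2 pi),
    which is why factors [w - c] accompany the integrands below. *)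
Definition cavg (g : C -> C) (c : C) (r : R) : C := (RtoC (/ (2 * PI)) * CI (fun x => g (circ c r x)) 0 (2 * PI))%C.
Definition rcirc (g : C -> C) (c : C) (r : R) : Prop := forall x, rcont (fun x => g (circ c r x)) x.

Lemma cis_cexp (x : R) : cis x = cexp (Ci * RtoC x).
Proof. unfold cis, cexp; simpl. replace (0 * x - 1 * 0) with 0 by ring. replace (0 * 0 + 1 * x) with x by ring. rewrite exp_0. f_equal; ring. Qed.

Lemma Cmod_cis (x : R) : Cmod (cis x) = 1.
Proof. rewrite cis_cexp, Cmod_cexp. simpl. replace (0 * x - 1 * 0) with 0 by ring. apply exp_0. Qed.

Lemma rder_cis_lin (k x : R) : rder (fun x => cis (k * x)) x (Ci * RtoC k * cis (k * x))%C.
Proof.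
  apply rder_ext with (fun x => cexp (RtoC 0 + RtoC x * (Ci * RtoC k))%C).
  { intros s. rewrite cis_cexp. f_equal. rewrite RtoC_mult. ring. }
  replace (Ci * RtoC k * cis (k * x))%C with (cexp (RtoC 0 + RtoC x * (Ci * RtoC k)) * (Ci * RtoC k))%C.
  - apply (rder_comp cexp (fun x => RtoC 0 + RtoC x * (Ci * RtoC k))%C); [apply cder_cexp|apply rder_affine].
  - rewrite cis_cexp, RtoC_mult. rewrite (Cmult_comm (cexp _)). f_equal. f_equal. ring.
Qed.

Lemma rder_cis (x : R) : rder cis x (Ci * cis x)%C.
Proof.
  apply rder_ext with (fun x => cis (1 * x)); [intros; f_equal; ring|].
  replace (Ci * cis x)%C with (Ci * RtoC 1 * cis (1 * x))%C by (rewrite Rmult_1_l; ring). apply rder_cis_lin.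
Qed.

Lemma rder_circ (c : C) (r x : R) : rder (circ c r) x (Ci * (circ c r x - c))%C.
Proof.
  unfold circ. replace (Ci * (c + RtoC r * cis x - c))%C with (RtoC r * (Ci * cis x))%C by ring.
  apply (rder_comp (fun z => c + RtoC r * z)%C cis); [|apply rder_cis].
  eapply cder_eq. apply cder_plus; [apply cder_const|apply cder_scal, cder_id]. ring.
Qed.

Lemma Cmod_circ (c : C) (r x : R) : 0 <= r -> Cmod (circ c r x - c) = r.
Proof.
  intros Hr. unfold circ. replace (c + RtoC r * cis x - c)%C with (RtoC r * cis x)%C by ring.
  rewrite Cmod_mult, Cmod_cis, Cmod_R, Rabs_right; lra.
Qed.

Lemma rcirc_ccont (g : C -> C) (c : C) (r : R) : 0 <= r -> (forall z, Cmod (z - c) = r -> ccont g z) -> rcirc g c r.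
Proof.
  intros Hr H x. apply rcont_comp; [apply H, Cmod_circ; auto|]. eapply rder_rcont, rder_circ.
Qed.

Lemma rcirc_on (g : C -> C) (c : C) (r a b : R) : rcirc g c r -> rcont_on (fun x => g (circ c r x)) a b.
Proof. intros H t _. apply H. Qed.

Lemma cavg_ext (f g : C -> C) (c : C) (r : R) : 0 <= r -> (forall z, Cmod (z - c) = r -> f z = g z) -> cavg f c r = cavg g c r.
Proof. intros Hr H. unfold cavg. f_equal. apply CI_ext. intros. apply H, Cmod_circ; auto. Qed.

Lemma cavg_plus (f g : C -> C) (c : C) (r : R) : rcirc f c r -> rcirc g c r ->
  cavg (fun z => f z + g z)%C c r = (cavg f c r + cavg g c r)%C.
Proof. intros Hf Hg. unfold cavg. rewrite (CI_plus (fun x => f (circ c r x)) (fun x => g (circ c r x))) by (apply rcirc_on; auto). ring. Qed.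

Lemma cavg_scal (k : C) (f : C -> C) (c : C) (r : R) : rcirc f c r ->
  cavg (fun z => k * f z)%C c r = (k * cavg f c r)%C.
Proof. intros Hf. unfold cavg. rewrite (CI_scal k (fun x => f (circ c r x))) by (apply rcirc_on; auto). ring. Qed.

Lemma rcirc_scal (k : C) (f : C -> C) (c : C) (r : R) : rcirc f c r -> rcirc (fun z => k * f z)%C c r.
Proof. intros H x. apply rcont_scal, H. Qed.
Lemma rcirc_mult (f g : C -> C) (c : C) (r : R) : rcirc f c r -> rcirc g c r -> rcirc (fun z => f z * g z)%C c r.
Proof. intros H H' x. apply (rcont_mult (fun x => f (circ c r x)) (fun x => g (circ c r x))); auto. Qed.
Lemma rcirc_plus (f g : C -> C) (c : C) (r : R) : rcirc f c r -> rcirc g c r -> rcirc (fun z => f z + g z)%C c r.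
Proof. intros H H' x. apply (rcont_plus (fun x => f (circ c r x)) (fun x => g (circ c r x))); auto. Qed.
Lemma rcirc_minus (f g : C -> C) (c : C) (r : R) : rcirc f c r -> rcirc g c r -> rcirc (fun z => f z - g z)%C c r.
Proof. intros H H' x. apply (rcont_minus (fun x => f (circ c r x)) (fun x => g (circ c r x))); auto. Qed.

Lemma cavg_minus (f g : C -> C) (c : C) (r : R) : rcirc f c r -> rcirc g c r ->
  cavg (fun z => f z - g z)%C c r = (cavg f c r - cavg g c r)%C.
Proof. intros Hf Hg. unfold cavg. rewrite (CI_minus (fun x => f (circ c r x)) (fun x => g (circ c r x))) by (apply rcirc_on; auto). ring. Qed.

Lemma two_pi_pos : 0 < 2 * PI.
Proof. assert (H := PI_RGT_0). lra. Qed.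

Lemma cavg_const (k c : C) (r : R) : cavg (fun _ => k) c r = k.
Proof.
  unfold cavg. rewrite CI_const, Rminus_0_r.
  replace (RtoC (/ (2 * PI)) * (k * RtoC (2 * PI)))%C with (k * (RtoC (/ (2 * PI)) * RtoC (2 * PI)))%C by ring.
  rewrite <- RtoC_mult, Rinv_l; [ring|]. assert (H := two_pi_pos). lra.
Qed.

Lemma cavg_norm_le (f : C -> C) (h : C -> R) (c : C) (r : R) : 0 <= r -> rcirc f c r -> rcirc (fun z => RtoC (h z)) c r ->
  (forall z, Cmod (z - c) = r -> Cmod (f z) <= h z) -> Cmod (cavg f c r) <= fst (cavg (fun z => RtoC (h z)) c r).
Proof.
  intros Hr Hf Hh H. unfold cavg. assert (T := two_pi_pos). rewrite Cmod_mult, Cmod_R, Rabs_right by (left; positive).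
  simpl. rewrite Rmult_0_l, Rminus_0_r. apply Rmult_le_compat_l; [left; apply Rinv_0_lt_compat; auto|].
  apply CI_norm_le; [lra|apply rcirc_on; auto| |].
  - exact (proj1 (rcont_on_ex _ _ _ (rcirc_on _ c r 0 (2 * PI) Hh))).
  - intros. apply H, Cmod_circ; auto.
Qed.

Lemma cavg_bound (f : C -> C) (c : C) (r M : R) : 0 <= r -> rcirc f c r ->
  (forall z, Cmod (z - c) = r -> Cmod (f z) <= M) -> Cmod (cavg f c r) <= M.
Proof.
  intros Hr Hf H. eapply Rle_trans; [apply (cavg_norm_le f (fun _ => M)); auto|].
  - intros x. apply rcont_const.
  - rewrite (cavg_const (RtoC M)). simpl. lra.
Qed.

Lemma rcirc_const (k c : C) (r : R) : rcirc (fun _ => k) c r.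
Proof. intros x. apply rcont_const. Qed.
Lemma rcirc_id (c : C) (r : R) : rcirc (fun w => w) c r.
Proof. intros x. eapply rder_rcont, rder_circ. Qed.
Lemma rcirc_sub (c z : C) (r : R) : rcirc (fun w => w - z)%C c r.
Proof. apply rcirc_minus; [apply rcirc_id|apply rcirc_const]. Qed.

Lemma rcirc_inv (f : C -> C) (c : C) (r : R) : 0 <= r -> rcirc f c r -> (forall z, Cmod (z - c) = r -> f z <> 0%C) ->
  rcirc (fun z => / f z)%C c r.
Proof.
  intros Hr H Hn x. apply (rcont_comp Cinv (fun x => f (circ c r x))); auto. eapply cder_ccont, cder_inv_id. apply Hn, Cmod_circ; auto.
Qed.
Lemma rcirc_ext (f g : C -> C) (c : C) (r : R) : (forall z, f z = g z) -> rcirc f c r -> rcirc g c r.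
Proof. intros E H x. apply rcont_ext with (fun x => f (circ c r x)); auto. Qed.
Lemma rcirc_pow (f : C -> C) (c : C) (r : R) (n : nat) : rcirc f c r -> rcirc (fun z => f z ^ n)%C c r.
Proof. intros H. induction n. exact (rcirc_const 1 c r). apply (rcirc_mult f (fun z => f z ^ n)%C); auto. Qed.

(** Along the circle g(w)(w - c) dx is -i dP, and P returns to its starting value. *)
Lemma cavg_exact (P g : C -> C) (c : C) (r : R) : 0 <= r ->
  (forall z, Cmod (z - c) = r -> cder P z (g z)) -> rcirc g c r ->
  cavg (fun w => g w * (w - c))%C c r = 0%C.
Proof.
  intros Hr HP Hg. unfold cavg. assert (E : CI (fun x => g (circ c r x) * (Ci * (circ c r x - c)))%C 0 (2 * PI) = 0%C).
  { rewrite (CI_FTC (fun x => P (circ c r x))).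
    - assert (circ c r (2 * PI) = circ c r 0) as ->; [|ring]. unfold circ, cis. rewrite cos_2PI, sin_2PI, cos_0, sin_0. reflexivity.
    - intros t _. apply (rder_comp P (circ c r)); [apply HP, Cmod_circ; auto|apply rder_circ].
    - intros t _. apply (rcont_mult (fun x => g (circ c r x))); auto. apply rcont_scal, rcont_minus; [apply rcirc_id|apply rcont_const]. }
  assert (E2 : (Ci * CI (fun x => g (circ c r x) * (circ c r x - c)) 0 (2 * PI))%C = 0%C).
  { rewrite <- CI_scal. rewrite <- E. apply CI_ext. intros; ring. intros t _. apply (rcont_mult (fun x => g (circ c r x))); auto.
    apply rcont_minus; [apply rcirc_id|apply rcont_const]. }
  replace (CI (fun x => g (circ c r x) * (circ c r x - c)) 0 (2 * PI))%C with
    (- Ci * (Ci * CI (fun x => g (circ c r x) * (circ c r x - c)) 0 (2 * PI)))%C.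
  rewrite E2; ring.
  replace (- Ci * (Ci * CI (fun x => g (circ c r x) * (circ c r x - c)) 0 (2 * PI)))%C with
   (- (Ci * Ci) * (CI (fun x => g (circ c r x) * (circ c r x - c)) 0 (2 * PI)))%C by ring.
  replace (Ci * Ci)%C with (- (1))%C by (csolve). ring.
Qed.

Lemma circ_neq (c z w : C) (r : R) : Cmod (z - c) < r -> Cmod (w - c) = r -> (w - z)%C <> 0%C.
Proof. intros H1 H2 E. apply Ceq_minus in E. subst. lra. Qed.

Lemma circ_dist (c z w : C) (r : R) : Cmod (w - c) = r -> r - Cmod (z - c) <= Cmod (w - z).
Proof.
  intros H. assert (T := Cmod_triangle3 w z c). lra.
Qed.

(* [w - c = r e^{ix}] and the powers [(w - c)^{-n}], [n >= 1], integrate to zero. *)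
Lemma cavg_inv_pow (c : C) (r : R) (n : nat) : 0 < r -> cavg (fun w => (/ (w - c)) ^ S n)%C c r = 0%C.
Proof.
  intros Hr. assert (Hnz : forall w, Cmod (w - c) = r -> (w - c)%C <> 0%C).
  { intros w Hw E. rewrite E, Cmod_0 in Hw. lra. }
  rewrite (cavg_ext _ (fun w => (/ (w - c)) ^ S (S n) * (w - c))%C).
  - assert (Hn : RtoC (INR (S n)) <> 0%C) by (intros E; apply RtoC_inj in E; apply (not_0_INR (S n)); auto).
    apply (cavg_exact (fun w => (- / RtoC (INR (S n))) * (/ (w - c)) ^ S n)%C); [lra| |].
    + intros z Hz. specialize (Hnz z Hz). assert (P : forall m, cder (fun w => (/ (w - c)) ^ m)%C z (- RtoC (INR m) * (/ (z - c)) ^ S m)%C).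
      { induction m as [|m IH].
        - eapply cder_eq; [apply (cder_const 1%C)|]. simpl. ring.
        - eapply cder_eq.
          + apply (cder_mult (fun w => / (w - c))%C (fun w => (/ (w - c)) ^ m)%C); [|exact IH].
            apply (cder_inv (fun w => w - c)%C); auto. apply cder_minus; [apply cder_id|apply cder_const].
          + rewrite S_INR, RtoC_plus. simpl. field. auto. }
      eapply cder_eq; [apply cder_scal, P|]. simpl Cpow. field. auto.
    + apply rcirc_pow, rcirc_inv; auto; try lra. apply rcirc_sub.
  - lra.
  - intros z Hz. specialize (Hnz z Hz). simpl. field. auto.
Qed.

(** The geometric series in (z - c)/(w - c) is peeled off one term at a time: every power but the
    zeroth has mean zero, and the remainder tends to zero because |z - c| < r. No exchange of sum
    and integral occurs. *)
Lemma cavg_kernel (c z : C) (r : R) : Cmod (z - c) < r -> cavg (fun w => (w - c) / (w - z))%C c r = 1%C.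
Proof.
  intros Hz. assert (Hr : 0 < r) by (assert (0 <= Cmod (z - c)) by apply Cmod_ge_0; lra).
  assert (Hnz : forall w, Cmod (w - c) = r -> (w - c)%C <> 0%C).
  { intros w Hw E. rewrite E, Cmod_0 in Hw. lra. }
  set (E := fun n => cavg (fun w => ((z - c) * / (w - c)) ^ n * ((w - c) / (w - z)))%C c r).
  assert (R1 : rcirc (fun w => (z - c) * / (w - c))%C c r).
  { apply rcirc_scal, rcirc_inv; auto; try lra. apply rcirc_sub. }
  assert (R2 : rcirc (fun w => (w - c) / (w - z))%C c r).
  { apply rcirc_mult. apply rcirc_sub. apply rcirc_inv; try lra. apply rcirc_sub. intros w Hw. apply (circ_neq c z w r); auto. }
  assert (Step : forall n, E n = (cavg (fun w => ((z - c) * / (w - c)) ^ n)%C c r + E (S n))%C).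
  { intros n. unfold E. rewrite <- (cavg_plus (fun w => ((z - c) * / (w - c)) ^ n)%C).
    - apply cavg_ext; [lra|]. intros w Hw. simpl. field. split; [apply (circ_neq c z w r); auto|auto].
    - apply rcirc_pow; auto.
    - apply rcirc_mult; auto. apply rcirc_pow; auto. }
  assert (Z : forall n, cavg (fun w => ((z - c) * / (w - c)) ^ S n)%C c r = 0%C).
  { intros n. rewrite (cavg_ext _ (fun w => (z - c) ^ S n * (/ (w - c)) ^ S n)%C); [|lra|].
    - rewrite cavg_scal, cavg_inv_pow; auto; [ring|]. apply rcirc_pow, rcirc_inv; auto; try lra. apply rcirc_sub.
    - intros w Hw. rewrite Cpow_mult_l. reflexivity. }
  assert (C1 : forall n, E (S n) = E 1%nat).
  { induction n; auto. rewrite <- IHn, (Step (S n)), Z. ring. }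
  assert (E1 : E 1%nat = 0%C).
  { apply Cmod_zero_all. intros eps He. set (q := Cmod (z - c) / r). assert (Hq : 0 <= q < 1).
    { unfold q. split. apply Rmult_le_pos; [apply Cmod_ge_0|left; apply Rinv_0_lt_compat; auto].
      apply Rmult_lt_reg_r with r; auto. unfold Rdiv. rewrite Rmult_assoc, Rinv_l; lra. }
    destruct (pow_lt_1_zero q) with (y := eps * (r - Cmod (z - c)) / r) as [n Hn].
    { rewrite Rabs_right; lra. } { apply Rdiv_lt_0_compat; auto. positive. }
    specialize (Hn (S n) ltac:(lia)). rewrite <- (C1 n).
    assert (Hq2 : 0 <= q ^ S n) by (apply pow_le; lra). rewrite Rabs_right in Hn by lra.
    unfold E. apply (cavg_bound (fun w => ((z - c) * / (w - c)) ^ S n * ((w - c) / (w - z)))%C); [lra| |].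
    - apply (rcirc_mult (fun w => ((z - c) * / (w - c)) ^ S n)%C (fun w => (w - c) / (w - z))%C); auto. apply rcirc_pow; auto.
    - intros w Hw. rewrite Cmod_mult, Cmod_pow, Cmod_mult, Cmod_inv, Cmod_div, Hw by (auto; apply (circ_neq c z w r); auto).
      fold (Cmod (z - c) / r). fold q. assert (Hd := circ_dist c z w r Hw).
      apply Rle_trans with (eps * (r - Cmod (z - c)) / r * (r / (r - Cmod (z - c)))).
      + apply Rmult_le_compat; try lra. apply Rmult_le_pos; [lra|left; positive].
        apply Rmult_le_compat_l; [lra|]. apply Rinv_le_contravar; lra.
      + right. field. lra. }
  assert (E0 : E 0%nat = 1%C).
  { rewrite Step, E1. rewrite (cavg_ext _ (fun _ => 1%C)); [rewrite cavg_const; ring|lra|reflexivity]. }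
  rewrite <- E0. unfold E. apply cavg_ext; [lra|]. intros w Hw. simpl. ring.
Qed.

Definition holo (f : C -> C) (c : C) (R0 : R) : Prop := forall z, Cmod (z - c) < R0 -> diff_at f z.

(** The difference quotient at [z], completed by the derivative, is holomorphic off [z] and
    continuous at [z], so it has a primitive and its integral vanishes. The kernel of mean 1 then
    isolates f(z). *)
Lemma cauchy_formula (f : C -> C) (c z : C) (r R0 : R) : holo f c R0 -> Cmod (z - c) < r -> r < R0 ->
  f z = cavg (fun w => f w * (w - c) / (w - z))%C c r.
Proof.
  intros Hf Hz HrR. assert (Hr : 0 < r) by (assert (0 <= Cmod (z - c)) by apply Cmod_ge_0; lra). destruct (Hf z) as [d Hd]; [lra|].
  set (g := fun w => if Ceq_dec w z then d else ((f w - f z) / (w - z))%C).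
  assert (Hg : forall w, w <> z -> Cmod (w - c) < R0 -> diff_at g w).
  { intros w Hwz Hw. destruct (Hf w Hw) as [dw Hdw]. assert (Hn : (w - z)%C <> 0%C) by (intros E; apply Ceq_minus in E; auto).
    eexists. apply (cder_ext_loc (fun w => (f w - f z) / (w - z))%C g w _ (Cmod (w - z))).
    - apply Cmod_gt_0; auto.
    - intros v Hv. unfold g. destruct (Ceq_dec v z) as [->|]; auto. rewrite Cmod_minus_sym in Hv. lra.
    - apply (cder_div (fun w => f w - f z)%C (fun w => w - z)%C); [auto| |].
      apply cder_minus; [exact Hdw|apply cder_const]. apply cder_minus; [apply cder_id|apply cder_const]. }
  assert (Hgc : forall w, Cmod (w - c) < R0 -> ccont g w).
  { intros w Hw. destruct (Ceq_dec w z) as [->|Hn]; [|apply diff_at_ccont; auto].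
    intros eps He. destruct (Hd (eps / 2)) as [de [Hde K]]; [lra|]. exists de. split; auto. intros v Hv.
    unfold g at 2. destruct (Ceq_dec z z) as [_|N]; [|congruence]. unfold g. destruct (Ceq_dec v z) as [->|N].
    - replace (d - d)%C with (RtoC 0) by ring. rewrite Cmod_0; auto.
    - assert (Hn : (v - z)%C <> 0%C) by (intros E; apply Ceq_minus in E; auto).
      replace ((f v - f z) / (v - z) - d)%C with ((f v - f z - d * (v - z)) / (v - z))%C by (field; auto).
      assert (0 < Cmod (v - z)) by (apply Cmod_gt_0; auto). rewrite Cmod_div by auto. apply Rle_lt_trans with (eps / 2); [|lra].
      apply Rmult_le_reg_r with (Cmod (v - z)); auto. unfold Rdiv at 1. rewrite Rmult_assoc, Rinv_l by lra.
      rewrite Rmult_1_r. apply K; auto. }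
  destruct (primitive_disc g c R0 Hgc) as [P HP].
  { intros a b p q Hab Hpq Hin. apply (goursat_except g z); auto. }
  assert (E := cavg_exact P g c r (Rlt_le _ _ Hr)).
  rewrite (cavg_ext _ (fun w => f w * (w - c) / (w - z) - f z * ((w - c) / (w - z)))%C) in E; [| lra|].
  - rewrite cavg_minus, cavg_scal, cavg_kernel in E; auto.
    + symmetry. rewrite Cmult_1_r in E. apply Ceq_minus. apply E. intros v Hv. apply HP; lra.
      apply rcirc_ccont; [lra|]. intros v Hv. apply Hgc; lra.
    + apply rcirc_mult. apply rcirc_sub. apply rcirc_inv; try lra. apply rcirc_sub. intros w Hw. apply (circ_neq c z w r); auto.
    + apply rcirc_mult. apply rcirc_mult. apply rcirc_ccont; [lra|]. intros v Hv. apply diff_at_ccont, Hf; lra. apply rcirc_sub.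
      apply rcirc_inv; try lra. apply rcirc_sub. intros w Hw. apply (circ_neq c z w r); auto.
    + apply rcirc_scal. apply rcirc_mult. apply rcirc_sub. apply rcirc_inv; try lra. apply rcirc_sub.
      intros w Hw. apply (circ_neq c z w r); auto.
  - intros w Hw. unfold g. assert (N := circ_neq c z w r Hz Hw). destruct (Ceq_dec w z) as [->|].
    + exfalso; apply N; ring.
    + field; auto.
Qed.

Lemma rcont_Cmod (g : R -> C) (t : R) : rcont g t -> rcont (fun s => RtoC (Cmod (g s))) t.
Proof.
  intros H eps He. destruct (H eps He) as [d [Hd K]]. exists d; split; auto. intros s Hs.
  rewrite <- RtoC_minus, Cmod_R. eapply Rle_lt_trans; [|exact (K s Hs)].
  assert (T1 := Cmod_triangle_sub (g s) (g t)). assert (T2 := Cmod_triangle_sub (g t) (g s)).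
  rewrite (Cmod_minus_sym (g t)) in T2. apply Rabs_le; lra.
Qed.

Lemma rcont_conj (g : R -> C) (t : R) : rcont g t -> rcont (fun s => Cconj (g s)) t.
Proof.
  intros H eps He. destruct (H eps He) as [d [Hd K]]. exists d; split; auto. intros s Hs. rewrite <- Cminus_conj, Cmod_conj. auto.
Qed.

Lemma cavg_mult_bound (f k : C -> C) (c : C) (r M : R) : 0 <= r -> rcirc f c r -> rcirc k c r ->
  (forall z, Cmod (z - c) = r -> Cmod (k z) <= M) ->
  Cmod (cavg (fun z => f z * k z)%C c r) <= fst (cavg (fun z => RtoC (Cmod (f z))) c r) * M.
Proof.
  intros Hr Hf Hk H. assert (Ha : rcirc (fun z => RtoC (Cmod (f z))) c r) by (intros x; apply (rcont_Cmod (fun x => f (circ c r x))); auto).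
  eapply Rle_trans. apply (cavg_norm_le _ (fun z => M * Cmod (f z))); auto.
  - apply (rcirc_mult f k); auto.
  - apply rcirc_ext with (fun z => RtoC M * RtoC (Cmod (f z)))%C; [intros; rewrite RtoC_mult; auto|]. apply rcirc_scal; auto.
  - intros z Hz. rewrite Cmod_mult, Rmult_comm. apply Rmult_le_compat_r; [apply Cmod_ge_0|auto].
  - rewrite (cavg_ext _ (fun z => RtoC M * RtoC (Cmod (f z)))%C); auto.
    + rewrite cavg_scal; auto. simpl. right; ring.
    + intros z Hz. rewrite RtoC_mult; auto.
Qed.

Lemma cavg_abs_nonneg (f : C -> C) (c : C) (r : R) : 0 <= r -> rcirc f c r -> 0 <= fst (cavg (fun z => RtoC (Cmod (f z))) c r).
Proof.
  intros Hr Hf. eapply Rle_trans; [apply Cmod_ge_0|apply (cavg_norm_le f (fun z => Cmod (f z)))]; auto.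
  - intros x; apply (rcont_Cmod (fun x => f (circ c r x))); auto.
  - intros; lra.
Qed.

Lemma rcirc_inv_sub (c z : C) (r : R) : Cmod (z - c) < r -> rcirc (fun w => / (w - z))%C c r.
Proof.
  intros Hz. assert (0 <= Cmod (z - c)) by apply Cmod_ge_0. apply rcirc_inv; [lra| |]. apply rcirc_sub.
  intros w Hw. apply (circ_neq c z w r); auto.
Qed.

Lemma cder_of_quadratic (f : C -> C) (z d : C) (B de : R) : 0 <= B -> 0 < de ->
  (forall h, Cmod h < de -> Cmod (f (z + h)%C - f z - d * h) <= B * Cmod h ^ 2) -> cder f z d.
Proof.
  intros HB Hd H eps He. exists (Rmin de (eps / (B + 1))). split.
  { apply Rmin_pos; auto. positive. }
  intros w Hw. assert (L1 := Rlt_le_trans _ _ _ Hw (Rmin_l _ _)). assert (L2 := Rlt_le_trans _ _ _ Hw (Rmin_r _ _)).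
  specialize (H (w - z)%C L1). replace (z + (w - z))%C with w in H by ring. eapply Rle_trans; [exact H|]. assert (P := Cmod_ge_0 (w - z)).
  assert (Cmod (w - z) * (B + 1) <= eps).
  { apply Rle_trans with (eps / (B + 1) * (B + 1)); [apply Rmult_le_compat_r; lra|right; field; lra]. }
  simpl. nra.
Qed.

(** * Derivatives of Cauchy integrals and Cauchy's estimates *)

Lemma cauchy_type_cder1 (f : C -> C) (c z : C) (r : R) : rcirc f c r -> Cmod (z - c) < r ->
  cder (fun z => cavg (fun w => f w * / (w - z))%C c r) z (cavg (fun w => f w * (/ (w - z)) ^ 2)%C c r).
Proof.
  intros Hf Hz. assert (H0 := Cmod_ge_0 (z - c)). set (p := r - Cmod (z - c)). assert (Hp : 0 < p) by (unfold p; lra).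
  apply cder_of_quadratic with (B := fst (cavg (fun z => RtoC (Cmod (f z))) c r) * (2 / p ^ 3)) (de := p / 2); [|lra|].
  { apply Rmult_le_pos; [apply cavg_abs_nonneg; auto; lra|]. left. positive. }
  intros h Hh. assert (Hzh : Cmod (z + h - c) < r).
  { replace (z + h - c)%C with ((z - c) + h)%C by ring. eapply Rle_lt_trans; [apply Cmod_triangle|]. unfold p in Hh; lra. }
  assert (I1 := rcirc_inv_sub c z r Hz). assert (I2 := rcirc_inv_sub c (z + h) r Hzh).
  assert (J1 : rcirc (fun w => f w * / (w - z))%C c r) by (apply (rcirc_mult f); auto).
  assert (J2 : rcirc (fun w => f w * / (w - (z + h)))%C c r) by (apply (rcirc_mult f); auto).
  assert (J3 : rcirc (fun w => f w * (/ (w - z)) ^ 2)%C c r) by (apply (rcirc_mult f); auto; apply rcirc_pow; auto).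
  rewrite (Cmult_comm _ h), <- cavg_scal, <- !cavg_minus; auto.
  2:{ apply rcirc_minus; auto. } 2:{ apply rcirc_scal; auto. }
  rewrite (cavg_ext _ (fun w => f w * (h ^ 2 * ((/ (w - z)) ^ 2 * / (w - (z + h)))))%C).
  - replace (fst (cavg (fun z0 : C => RtoC (Cmod (f z0))) c r) * (2 / p ^ 3) * Cmod h ^ 2) with
     (fst (cavg (fun z0 : C => RtoC (Cmod (f z0))) c r) * (Cmod h ^ 2 * (2 / p ^ 3))) by ring.
    apply cavg_mult_bound; [lra|auto| |].
    + apply rcirc_scal, (rcirc_mult (fun w => (/ (w - z)) ^ 2)%C); auto. apply rcirc_pow; auto.
    + intros w Hw. assert (N1 := circ_neq c z w r Hz Hw). assert (N2 := circ_neq c (z + h)%C w r Hzh Hw).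
      rewrite !Cmod_mult, !Cmod_pow, !Cmod_inv by auto. apply Rmult_le_compat_l; [apply pow_le, Cmod_ge_0|].
      assert (D1 := circ_dist c z w r Hw). fold p in D1. assert (D2 : p / 2 <= Cmod (w - (z + h))).
      { assert (T := Cmod_triangle_sub (w - z) h). replace (w - z - h)%C with (w - (z + h))%C in T by ring. lra. }
      replace (2 / p ^ 3) with ((/ p) ^ 2 * (/ (p / 2))) by (simpl; field; lra). apply Rmult_le_compat.
      * apply pow_le. left. positive.
      * left. positive.
      * apply pow_incr. split; [left; positive|apply Rinv_le_contravar; lra].
      * apply Rinv_le_contravar; lra.
  - lra.
  - intros w Hw. assert (N1 := circ_neq c z w r Hz Hw). assert (N2 := circ_neq c (z + h)%C w r Hzh Hw). simpl. field. split; auto.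
Qed.

(** Since [cauchy_deriv] writes the derivative as an integral of this type, the derivative of a
    holomorphic function is again holomorphic. *)
Lemma cauchy_type_cder2 (f : C -> C) (c z : C) (r : R) : rcirc f c r -> Cmod (z - c) < r ->
  diff_at (fun z => cavg (fun w => f w * (/ (w - z)) ^ 2)%C c r) z.
Proof.
  intros Hf Hz. assert (H0 := Cmod_ge_0 (z - c)). set (p := r - Cmod (z - c)). assert (Hp : 0 < p) by (unfold p; lra).
  exists (cavg (fun w => f w * (2 * (/ (w - z)) ^ 3))%C c r).
  apply cder_of_quadratic with (B := fst (cavg (fun z => RtoC (Cmod (f z))) c r) * (16 / p ^ 4)) (de := p / 2); [|lra|].
  { apply Rmult_le_pos; [apply cavg_abs_nonneg; auto; lra|]. left. positive. }
  intros h Hh. assert (Hzh : Cmod (z + h - c) < r).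
  { replace (z + h - c)%C with ((z - c) + h)%C by ring. eapply Rle_lt_trans; [apply Cmod_triangle|]. unfold p in Hh; lra. }
  assert (I1 := rcirc_inv_sub c z r Hz). assert (I2 := rcirc_inv_sub c (z + h) r Hzh).
  assert (J1 : rcirc (fun w => f w * (/ (w - z)) ^ 2)%C c r) by (apply (rcirc_mult f); auto; apply rcirc_pow; auto).
  assert (J2 : rcirc (fun w => f w * (/ (w - (z + h))) ^ 2)%C c r) by (apply (rcirc_mult f); auto; apply rcirc_pow; auto).
  assert (J3 : rcirc (fun w => f w * (2 * (/ (w - z)) ^ 3))%C c r) by (apply (rcirc_mult f); auto; apply rcirc_scal, rcirc_pow; auto).
  rewrite (Cmult_comm _ h), <- cavg_scal, <- !cavg_minus; auto.
  2:{ apply rcirc_minus; auto. } 2:{ apply rcirc_scal; auto. }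
  rewrite (cavg_ext _ (fun w => f w * (h ^ 2 * ((3 * (w - z) - 2 * h) * ((/ (w - z)) ^ 3 * (/ (w - (z + h))) ^ 2))))%C).
  - replace (fst (cavg (fun z0 : C => RtoC (Cmod (f z0))) c r) * (16 / p ^ 4) * Cmod h ^ 2) with
     (fst (cavg (fun z0 : C => RtoC (Cmod (f z0))) c r) * (Cmod h ^ 2 * (16 / p ^ 4))) by ring.
    apply cavg_mult_bound; [lra|auto| |].
    + apply rcirc_scal. apply (rcirc_mult (fun w => 3 * (w - z) - 2 * h)%C (fun w => (/ (w - z)) ^ 3 * (/ (w - (z + h))) ^ 2)%C).
      * apply rcirc_minus; [apply rcirc_scal, rcirc_minus; [apply rcirc_id|apply rcirc_const]|apply rcirc_const].
      * apply (rcirc_mult (fun w => (/ (w - z)) ^ 3)%C); apply rcirc_pow; auto.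
    + intros w Hw. assert (N1 := circ_neq c z w r Hz Hw). assert (N2 := circ_neq c (z + h)%C w r Hzh Hw).
      rewrite !Cmod_mult, !Cmod_pow, !Cmod_inv by auto. apply Rmult_le_compat_l; [apply pow_le, Cmod_ge_0|].
      assert (D1 := circ_dist c z w r Hw). fold p in D1. assert (D2 : p / 2 <= Cmod (w - (z + h))).
      { assert (T := Cmod_triangle_sub (w - z) h). replace (w - z - h)%C with (w - (z + h))%C in T by ring. lra. }
      assert (D3 : Cmod (3 * (w - z) - 2 * h) <= 4 * Cmod (w - z)).
      { eapply Rle_trans; [apply Cmod_triangle_minus|]. rewrite !Cmod_mult, !Cmod_R, !Rabs_right; lra. }
      set (u := Cmod (w - z)) in *. replace (16 / p ^ 4) with (4 * ((/ p) ^ 2 * (/ (p / 2)) ^ 2)) by (simpl; field; lra).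
      apply Rle_trans with (4 * u * ((/ u) ^ 3 * (/ Cmod (w - (z + h))) ^ 2)).
      { apply Rmult_le_compat_r; auto. apply Rmult_le_pos; apply pow_le; left; positive. }
      replace (4 * u * ((/ u) ^ 3 * (/ Cmod (w - (z + h))) ^ 2)) with (4 * ((/ u) ^ 2 * (/ Cmod (w - (z + h))) ^ 2)) by (simpl; field; lra).
      apply Rmult_le_compat_l; [lra|]. apply Rmult_le_compat.
      * apply pow_le. left. positive.
      * apply pow_le. left. positive.
      * apply pow_incr. split; [left; positive|apply Rinv_le_contravar; lra].
      * apply pow_incr. split; [left; positive|apply Rinv_le_contravar; lra].
  - lra.
  - intros w Hw. assert (N1 := circ_neq c z w r Hz Hw). assert (N2 := circ_neq c (z + h)%C w r Hzh Hw). simpl. field. split; auto.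
Qed.

Lemma holo_rcirc (f : C -> C) (c : C) (r R0 : R) : holo f c R0 -> 0 <= r -> r < R0 -> rcirc f c r.
Proof. intros H Hr HR. apply rcirc_ccont; auto. intros z Hz. apply diff_at_ccont, H. lra. Qed.

Lemma holo_weaken (f : C -> C) (c : C) (r R0 : R) : holo f c R0 -> r <= R0 -> holo f c r.
Proof. intros H Hr z Hz. apply H. lra. Qed.

Lemma open_disc_near (c z : C) (r : R) : Cmod (z - c) < r -> forall w, Cmod (w - z) < r - Cmod (z - c) -> Cmod (w - c) < r.
Proof. intros H w Hw. assert (T := Cmod_triangle3 w z c). lra. Qed.

Lemma cauchy_deriv (f : C -> C) (c z : C) (r R0 : R) : holo f c R0 -> Cmod (z - c) < r -> r < R0 ->
  cder f z (cavg (fun w => f w * (w - c) * (/ (w - z)) ^ 2)%C c r).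
Proof.
  intros Hf Hz HR. assert (H0 := Cmod_ge_0 (z - c)).
  apply (cder_ext_loc (fun z => cavg (fun w => (f w * (w - c)) * / (w - z))%C c r) f z _ (r - Cmod (z - c))); [lra| |].
  - intros w Hw. symmetry. apply (cauchy_formula f c w r R0); auto. apply (open_disc_near c z r); auto.
  - apply (cauchy_type_cder1 (fun w => f w * (w - c))%C); auto. apply (rcirc_mult f); [apply holo_rcirc with R0; auto; lra|apply rcirc_sub].
Qed.

Lemma holo_Cderiv (f : C -> C) (c : C) (R0 : R) : holo f c R0 -> holo (Cderiv f) c R0.
Proof.
  intros Hf z Hz. assert (H0 := Cmod_ge_0 (z - c)). set (r := (Cmod (z - c) + R0) / 2).
  destruct (cauchy_type_cder2 (fun w => f w * (w - c))%C c z r) as [d Hd].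
  - apply (rcirc_mult f); [apply holo_rcirc with R0; auto; unfold r; lra|apply rcirc_sub].
  - unfold r; lra.
  - exists d. eapply cder_ext_loc; [| |exact Hd]; [instantiate (1 := r - Cmod (z - c)); unfold r; lra|].
    intros w Hw. symmetry. apply Cderiv_eq. apply (cauchy_deriv f c w r R0); auto; [|unfold r; lra].
    apply (open_disc_near c z r); auto. unfold r; lra.
Qed.

Lemma cauchy_center (f : C -> C) (c : C) (r R0 : R) : holo f c R0 -> 0 < r -> r < R0 -> f c = cavg f c r.
Proof.
  intros Hf Hr HR. rewrite (cauchy_formula f c c r R0) at 1; auto.
  - apply cavg_ext; [lra|]. intros w Hw. assert ((w - c)%C <> 0%C) by (intros E; rewrite E, Cmod_0 in Hw; lra). field; auto.
  - replace (c - c)%C with (RtoC 0) by ring. rewrite Cmod_0; auto.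
Qed.

Lemma cauchy_center_bound (f : C -> C) (c : C) (r R0 M : R) : holo f c R0 -> 0 < r -> r < R0 ->
  (forall z, Cmod (z - c) = r -> Cmod (f z) <= M) -> Cmod (f c) <= M.
Proof.
  intros Hf Hr HR HM. rewrite (cauchy_center f c r R0); auto. apply cavg_bound; auto; [lra|]. apply holo_rcirc with R0; auto; lra.
Qed.

Lemma cauchy_disc_bound (f : C -> C) (c z : C) (r R0 M : R) : holo f c R0 -> Cmod (z - c) < r -> r < R0 ->
  (forall z, Cmod (z - c) = r -> Cmod (f z) <= M) -> Cmod (f z) <= M * r / (r - Cmod (z - c)).
Proof.
  intros Hf Hz HR HM. assert (H0 := Cmod_ge_0 (z - c)). rewrite (cauchy_formula f c z r R0) at 1; auto. apply cavg_bound; [lra| |].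
  - apply (rcirc_mult (fun w => f w * (w - c))%C); [|apply rcirc_inv_sub; auto].
    apply (rcirc_mult f); [apply holo_rcirc with R0; auto; lra|apply rcirc_sub].
  - intros w Hw. rewrite Cmod_div, Cmod_mult, Hw by (apply (circ_neq c z w r); auto).
    assert (D := circ_dist c z w r Hw). assert (B := HM w Hw). assert (0 <= Cmod (f w)) by apply Cmod_ge_0.
    unfold Rdiv. apply Rmult_le_compat; [apply Rmult_le_pos; lra|left; positive| |].
    apply Rmult_le_compat_r; lra. apply Rinv_le_contravar; lra.
Qed.

Lemma cauchy_deriv_bound (f : C -> C) (c : C) (r R0 M : R) : holo f c R0 -> 0 < r -> r < R0 ->
  (forall z, Cmod (z - c) = r -> Cmod (f z) <= M) -> Cmod (Cderiv f c) <= M / r.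
Proof.
  intros Hf Hr HR HM. assert (Hc : Cmod (c - c) < r) by (replace (c - c)%C with (RtoC 0) by ring; rewrite Cmod_0; auto).
  rewrite (Cderiv_eq _ _ _ (cauchy_deriv f c c r R0 Hf Hc HR)). apply cavg_bound; [lra| |].
  - apply (rcirc_mult (fun w => f w * (w - c))%C); [|apply rcirc_pow, rcirc_inv_sub; auto].
    apply (rcirc_mult f); [apply holo_rcirc with R0; auto; lra|apply rcirc_sub].
  - intros w Hw. assert (N := circ_neq c c w r Hc Hw). rewrite !Cmod_mult, Cmod_pow, Cmod_inv, Hw by auto.
    replace (Cmod (f w) * r * (/ r) ^ 2) with (Cmod (f w) / r) by (simpl; field; lra).
    unfold Rdiv. apply Rmult_le_compat_r; [left; apply Rinv_0_lt_compat; auto|auto].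
Qed.

Lemma cauchy_taylor1 (f : C -> C) (c h : C) (r R0 M : R) : holo f c R0 -> 0 < r -> r < R0 ->
  (forall z, Cmod (z - c) = r -> Cmod (f z) <= M) -> Cmod h <= r / 2 ->
  Cmod (f (c + h)%C - f c - Cderiv f c * h) <= M * (2 / r ^ 2) * Cmod h ^ 2.
Proof.
  intros Hf Hr HR HM Hh. assert (Hc : Cmod (c - c) < r) by (replace (c - c)%C with (RtoC 0) by ring; rewrite Cmod_0; auto).
  assert (Hch : Cmod (c + h - c) < r) by (replace (c + h - c)%C with h by ring; lra).
  rewrite (Cderiv_eq _ _ _ (cauchy_deriv f c c r R0 Hf Hc HR)).
  rewrite (cauchy_formula f c (c + h)%C r R0), (cauchy_formula f c c r R0) at 1; auto.
  assert (If := holo_rcirc f c r R0 Hf (Rlt_le _ _ Hr) HR).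
  assert (I1 := rcirc_inv_sub c c r Hc). assert (I2 := rcirc_inv_sub c (c + h) r Hch).
  assert (I3 : rcirc (fun w => f w * (w - c))%C c r) by (apply (rcirc_mult f); auto; apply rcirc_sub).
  assert (J1 : rcirc (fun w => f w * (w - c) / (w - c))%C c r) by (apply (rcirc_mult (fun w => f w * (w - c))%C); auto).
  assert (J2 : rcirc (fun w => f w * (w - c) / (w - (c + h)))%C c r) by (apply (rcirc_mult (fun w => f w * (w - c))%C); auto).
  assert (J3 : rcirc (fun w => f w * (w - c) * (/ (w - c)) ^ 2)%C c r) by (apply (rcirc_mult (fun w => f w * (w - c))%C); auto; apply rcirc_pow; auto).
  rewrite (Cmult_comm _ h), <- cavg_scal, <- !cavg_minus; auto.
  2:{ apply rcirc_minus; auto. } 2:{ apply rcirc_scal; auto. }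
  apply cavg_bound; [lra| |].
  - apply rcirc_minus; [apply rcirc_minus|apply rcirc_scal]; auto.
  - intros w Hw. assert (N1 := circ_neq c c w r Hc Hw). assert (N2 := circ_neq c (c + h)%C w r Hch Hw).
    replace (f w * (w - c) / (w - (c + h)) - f w * (w - c) / (w - c) - h * (f w * (w - c) * (/ (w - c)) ^ 2))%C
      with (f w * (h ^ 2 * (/ (w - c) * / (w - (c + h)))))%C by (simpl; field; auto).
    rewrite !Cmod_mult, !Cmod_inv, Cmod_pow, Hw by auto. assert (D2 : r / 2 <= Cmod (w - (c + h))).
    { assert (T := Cmod_triangle_sub (w - c) h). replace (w - c - h)%C with (w - (c + h))%C in T by ring. lra. }
    replace (M * (2 / r ^ 2) * Cmod h ^ 2) with (M * (Cmod h ^ 2 * (/ r * / (r / 2)))) by (simpl; field; lra).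
    assert (0 <= Cmod h ^ 2) by (apply pow_le, Cmod_ge_0). assert (0 <= Cmod (f w)) by apply Cmod_ge_0.
    assert (0 < / r) by positive. assert (0 < / Cmod (w - (c + h))) by positive.
    apply Rmult_le_compat; auto. apply Rmult_le_pos; auto. apply Rmult_le_pos; lra.
    apply Rmult_le_compat_l; auto. apply Rmult_le_compat_l; [lra|]. apply Rinv_le_contravar; lra.
Qed.

(** * Factoring out zeros, identity principle, logarithms *)

(** Dividing f(w) by w - rho under the Cauchy integral gives the quotient on a disc around [rho],
    the point [rho] included; elsewhere the plain quotient serves. *)
Lemma holo_factor (f : C -> C) (c rho : C) (R0 : R) : holo f c R0 -> Cmod (rho - c) < R0 -> f rho = 0%C ->
  exists g, holo g c R0 /\ forall z, Cmod (z - c) < R0 -> f z = ((z - rho) * g z)%C.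
Proof.
  intros Hf Hrho Hz. assert (H0 := Cmod_ge_0 (rho - c)).
  set (r := (Cmod (rho - c) + R0) / 2). assert (Hr : Cmod (rho - c) < r < R0) by (unfold r; lra).
  set (G := fun z => cavg (fun w => (f w * (w - c) * / (w - rho)) * / (w - z))%C c r).
  set (g := fun z => if Ceq_dec z rho then G rho else (f z / (z - rho))%C). assert (If := holo_rcirc f c r R0 Hf ltac:(lra) ltac:(lra)).
  assert (I3 : rcirc (fun w => f w * (w - c))%C c r) by (apply (rcirc_mult f); auto; apply rcirc_sub).
  assert (I4 : rcirc (fun w => f w * (w - c) * / (w - rho))%C c r).
  { apply (rcirc_mult (fun w => f w * (w - c))%C); auto. apply rcirc_inv_sub; lra. }
  assert (HG : forall z, Cmod (z - c) < r -> f z = ((z - rho) * G z)%C).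
  { intros z Hzr. unfold G. rewrite <- cavg_scal.
    - rewrite (cavg_ext _ (fun w => f w * (w - c) / (w - z) - f w * (w - c) / (w - rho))%C).
      + rewrite cavg_minus.
        * rewrite <- (cauchy_formula f c z r R0), <- (cauchy_formula f c rho r R0); auto; try lra. rewrite Hz. ring.
        * apply (rcirc_mult (fun w => f w * (w - c))%C); auto. apply rcirc_inv_sub; lra.
        * apply I4.
      + lra.
      + intros w Hw. assert (N1 := circ_neq c z w r Hzr Hw). assert (N2 := circ_neq c rho w r (proj1 Hr) Hw). field. auto.
    - apply (rcirc_mult (fun w => f w * (w - c) * / (w - rho))%C); auto. apply rcirc_inv_sub; lra. }
  assert (Hg : forall z, Cmod (z - c) < R0 -> f z = ((z - rho) * g z)%C).
  { intros z Hzr. unfold g. destruct (Ceq_dec z rho) as [->|N]; [rewrite Hz; ring|]. field. intros E. apply Ceq_minus in E. auto. }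
  exists g. split; auto. intros z Hzr. destruct (Ceq_dec z rho) as [->|N].
  - exists (cavg (fun w => (f w * (w - c) * / (w - rho)) * (/ (w - rho)) ^ 2)%C c r).
    apply (cder_ext_loc G g rho _ (r - Cmod (rho - c))); [lra| |exact (cauchy_type_cder1 (fun w => f w * (w - c) * / (w - rho))%C c rho r I4 (proj1 Hr))].
    intros w Hw. unfold g. destruct (Ceq_dec w rho) as [->|N]; auto.
    assert (Nw : (w - rho)%C <> 0%C) by (intros E; apply Ceq_minus in E; auto).
    rewrite HG by (apply (open_disc_near c rho r); auto; lra). field; auto.
  - destruct (Hf z Hzr) as [d Hd]. assert (Nw : (z - rho)%C <> 0%C) by (intros E; apply Ceq_minus in E; auto).
    eexists. apply (cder_ext_loc (fun z => f z / (z - rho))%C g z _ (Cmod (z - rho))).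
    + apply Cmod_gt_0; auto.
    + intros v Hv. unfold g. destruct (Ceq_dec v rho) as [->|]; auto. rewrite Cmod_minus_sym in Hv. lra.
    + apply (cder_div f (fun z => z - rho)%C); auto. exact Hd. apply cder_minus; [apply cder_id|apply cder_const].
Qed.

Lemma ccont_zero (g : C -> C) (c : C) (e : R) : 0 < e -> ccont g c ->
  (forall z, Cmod (z - c) < e -> z <> c -> g z = 0%C) -> g c = 0%C.
Proof.
  intros He Hg H. apply Cmod_zero_all. intros eps Heps. destruct (Hg eps Heps) as [d [Hd K]].
  set (h := Rmin d e / 2). assert (Hm : 0 < Rmin d e) by (apply Rmin_pos; auto).
  assert (Rmin d e <= d) by apply Rmin_l. assert (Rmin d e <= e) by apply Rmin_r. assert (E : Cmod (c + RtoC h - c) = h).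
  { replace (c + RtoC h - c)%C with (RtoC h) by ring. rewrite Cmod_R, Rabs_right; unfold h; lra. }
  specialize (K (c + RtoC h)%C). rewrite E in K. specialize (K ltac:(unfold h; lra)). rewrite H in K.
  - rewrite Cmod_minus_sym in K. replace (g c - 0)%C with (g c) in K by ring. lra.
  - rewrite E. unfold h; lra.
  - intros F. rewrite F in E. replace (c - c)%C with (RtoC 0) in E by ring. rewrite Cmod_0 in E. unfold h in E; lra.
Qed.

(** A function vanishing near the centre is divisible by (w - c)^n for every n. Cauchy's formula for
    the quotient on a circle of radius r bounds |f(z)| by (|z - c|/r)^n D with D independent of
    n. *)
Lemma identity_disc (f : C -> C) (c : C) (R0 e : R) : holo f c R0 -> 0 < e ->
  (forall z, Cmod (z - c) < e -> f z = 0%C) -> forall z, Cmod (z - c) < R0 -> f z = 0%C.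
Proof.
  intros Hf He Hz z Hzr. assert (H0 := Cmod_ge_0 (z - c)). set (e' := Rmin e R0). assert (He' : 0 < e') by (apply Rmin_pos; lra).
  assert (F : forall n, exists g, holo g c R0 /\ (forall w, Cmod (w - c) < e' -> g w = 0%C) /\
     forall w, Cmod (w - c) < R0 -> f w = ((w - c) ^ n * g w)%C).
  { induction n as [|n (g & G1 & G2 & G3)].
    - exists f. repeat split; auto. intros w Hw. apply Hz. eapply Rlt_le_trans; [exact Hw|apply Rmin_l]. intros; simpl; ring.
    - assert (Hcc : Cmod (c - c) = 0) by (replace (c - c)%C with (RtoC 0) by ring; apply Cmod_0).
      destruct (holo_factor g c c R0) as (h & H1 & H2); auto; [lra|apply G2; lra|]. exists h. split; auto.
      assert (Hne : forall w, Cmod (w - c) < e' -> w <> c -> h w = 0%C).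
      { intros w Hw N. assert (E := H2 w (Rlt_le_trans _ _ _ Hw (Rmin_r _ _))). rewrite G2 in E by auto.
        assert ((w - c)%C <> 0%C) by (intros E'; apply Ceq_minus in E'; auto).
        replace (h w) with (((w - c) * h w) / (w - c))%C by (field; auto). rewrite <- E. field; auto. }
      split.
      + intros w Hw. destruct (Ceq_dec w c) as [->|N]; auto. apply (ccont_zero h c e'); auto. apply diff_at_ccont, H1. lra.
      + intros w Hw. rewrite G3, H2 by auto. simpl. ring. }
  set (r := (Cmod (z - c) + R0) / 2). assert (Hr : Cmod (z - c) < r < R0) by (unfold r; lra).
  assert (Irf := holo_rcirc f c r R0 Hf ltac:(lra) ltac:(lra)). set (A := fst (cavg (fun z => RtoC (Cmod (f z))) c r)).
  assert (HA : 0 <= A) by (apply cavg_abs_nonneg; auto; lra). set (D := A * (r / (r - Cmod (z - c)))).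
  assert (HD : 0 <= D) by (apply Rmult_le_pos; auto; apply Rmult_le_pos; [lra|left; positive]).
  assert (B : forall n, Cmod (f z) <= (Cmod (z - c) / r) ^ n * D).
  { intros n. destruct (F n) as (g & G1 & G2 & G3). rewrite G3, Cmod_mult, Cmod_pow by auto.
    assert (Bg : Cmod (g z) <= A * ((/ r) ^ n * (r / (r - Cmod (z - c))))).
    { rewrite (cauchy_formula g c z r R0) by (auto; lra). rewrite (cavg_ext _ (fun w => f w * ((/ (w - c)) ^ n * ((w - c) / (w - z))))%C).
      - apply cavg_mult_bound; [lra|auto| |].
        + apply (rcirc_mult (fun w => (/ (w - c)) ^ n)%C (fun w => (w - c) / (w - z))%C).
          * apply rcirc_pow, rcirc_inv_sub. replace (c - c)%C with (RtoC 0) by ring. rewrite Cmod_0. lra.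
          * apply (rcirc_mult (fun w => w - c)%C); [apply rcirc_sub|apply rcirc_inv_sub; lra].
        + intros w Hw. assert ((w - c)%C <> 0%C) by (intros E; rewrite E, Cmod_0 in Hw; lra).
          rewrite Cmod_mult, Cmod_pow, Cmod_inv, Cmod_div, Hw by (auto; apply (circ_neq c z w r); auto; lra).
          apply Rmult_le_compat_l; [apply pow_le; left; positive|].
          apply Rmult_le_compat_l; [lra|]. apply Rinv_le_contravar; [lra|apply circ_dist; auto].
      - lra.
      - intros w Hw. assert ((w - c)%C <> 0%C) by (intros E; rewrite E, Cmod_0 in Hw; lra).
        rewrite (G3 w) by lra. rewrite Cpow_inv by auto. field. split; [apply (circ_neq c z w r); auto; lra|apply Cpow_nz; auto]. }
    unfold Rdiv. rewrite Rpow_mult_distr. unfold D, Rdiv.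
    replace (Cmod (z - c) ^ n * (/ r) ^ n * (A * (r * / (r - Cmod (z - c))))) with
      (Cmod (z - c) ^ n * (A * ((/ r) ^ n * (r / (r - Cmod (z - c)))))) by (unfold Rdiv; ring).
    apply Rmult_le_compat_l; auto. apply pow_le; auto. }
  apply Cmod_zero_all. intros eps Heps. destruct (pow_lt_1_zero (Cmod (z - c) / r)) with (y := eps / (D + 1)) as [n Hn].
  { assert (0 <= Cmod (z - c) / r) by (apply Rmult_le_pos; [lra|left; positive]).
    rewrite Rabs_right by lra. apply Rmult_lt_reg_r with r; [lra|]. unfold Rdiv. rewrite Rmult_assoc, Rinv_l; lra. }
  { positive. }
  specialize (Hn n (le_n n)). assert (Hn' := Rle_lt_trans _ _ _ (Rle_abs _) Hn). eapply Rle_trans; [apply (B n)|].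
  apply Rle_trans with (eps / (D + 1) * D); [apply Rmult_le_compat_r; lra|].
  apply Rle_trans with (eps / (D + 1) * (D + 1)); [|right; field; lra]. apply Rmult_le_compat_l; [left; positive|lra].
Qed.

(** A chain of discs of radius [del] at steps of at most del/2: each contains the disc of radius
    del/2 around the next centre, which starts the identity principle there. *)
Lemma identity_segment (f : C -> C) (a b : C) (del e : R) : 0 < del -> 0 < e ->
  (forall t, 0 <= t <= 1 -> holo f (a + RtoC t * (b - a)) del) ->
  (forall z, Cmod (z - a) < e -> f z = 0%C) ->
  forall z, Cmod (z - b) < del -> f z = 0%C.
Proof.
  intros Hd He Hf Hz. destruct (nfloor_ex (2 * Cmod (b - a) / del)) as [N HN].
  { apply Rmult_le_pos; [assert (H := Cmod_ge_0 (b - a)); lra|left; apply Rinv_0_lt_compat; auto]. }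
  set (M := INR (S N)). assert (HM : 0 < M) by (apply lt_0_INR; lia). assert (Hstep : Cmod (b - a) / M <= del / 2).
  { apply Rmult_le_reg_r with M; auto. unfold Rdiv at 1. rewrite Rmult_assoc, Rinv_l, Rmult_1_r by lra.
    destruct HN as [_ HN]. unfold M. rewrite S_INR. apply Rmult_lt_compat_r with (r := del) in HN; auto.
    unfold Rdiv in HN. rewrite Rmult_assoc, Rinv_l in HN; lra. }
  set (pt := fun j : nat => (a + RtoC (INR j / M) * (b - a))%C). assert (Hpt : forall j, (j <= S N)%nat -> holo f (pt j) del).
  { intros j Hj. apply Hf. split. apply Rmult_le_pos; [apply pos_INR|left; apply Rinv_0_lt_compat; auto].
    apply Rmult_le_reg_r with M; auto. unfold Rdiv. rewrite Rmult_assoc, Rinv_l by lra. apply le_INR in Hj. unfold M; lra. }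
  assert (Ind : forall j, (j <= S N)%nat -> forall z, Cmod (z - pt j) < del -> f z = 0%C).
  { induction j as [|j IH]; intros Hj.
    - apply identity_disc with e; auto. intros z Hz'. apply Hz.
      replace a with (pt 0%nat); auto. unfold pt. simpl. unfold Rdiv. rewrite Rmult_0_l. ring.
    - apply identity_disc with (del / 2); auto; [lra|]. intros z Hz'. apply IH; [lia|]. assert (T := Cmod_triangle3 z (pt (S j)) (pt j)).
      replace (pt (S j) - pt j)%C with (RtoC (/ M) * (b - a))%C in T.
      + rewrite Cmod_mult, Cmod_R, Rabs_right in T by (left; positive). unfold Rdiv in Hstep. lra.
      + unfold pt. rewrite S_INR. unfold Rdiv. rewrite Rmult_plus_distr_r, RtoC_plus, !RtoC_mult. ring. }
  intros z Hz'. apply (Ind (S N)); auto. replace (pt (S N)) with b; auto. unfold pt, M. unfold Rdiv. rewrite Rinv_r by (fold M; lra). ring.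
Qed.

Lemma cder_zero_const (f : C -> C) (c : C) (R0 : R) : (forall z, Cmod (z - c) < R0 -> cder f z 0) ->
  forall z, Cmod (z - c) < R0 -> f z = f c.
Proof.
  intros H z Hz. apply Ceq_minus. assert (E := CI_FTC (fun t => f (c + RtoC t * (z - c))%C) (fun _ => RtoC 0) 0 1).
  cbv beta in E. replace (c + 1 * (z - c))%C with z in E by ring. replace (c + 0 * (z - c))%C with c in E by ring. rewrite <- E.
  - rewrite CI_const. ring.
  - intros t Ht. rewrite Rmin_left, Rmax_right in Ht by lra. replace (RtoC 0) with (RtoC 0 * (z - c))%C by ring.
    apply (rder_comp f (fun t => c + RtoC t * (z - c))%C); [|apply rder_affine]. replace (RtoC 0 * (z - c))%C with (RtoC 0) by ring.
    apply H. replace (c + RtoC t * (z - c) - c)%C with (RtoC t * (z - c))%C by ring.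
    rewrite Cmod_mult, Cmod_R, Rabs_right by lra. assert (P := Cmod_ge_0 (z - c)). nra.
  - intros t _. apply rcont_const.
Qed.

Lemma holo_primitive (f : C -> C) (c : C) (R0 : R) : holo f c R0 ->
  exists P, forall z, Cmod (z - c) < R0 -> cder P z (f z).
Proof.
  intros Hf. apply primitive_disc.
  - intros z Hz. apply diff_at_ccont, Hf; auto.
  - intros a b p q Hab Hpq Hin. apply goursat; auto.
Qed.

Lemma holo_div (f g : C -> C) (c : C) (R0 : R) : holo f c R0 -> holo g c R0 ->
  (forall z, Cmod (z - c) < R0 -> g z <> 0%C) -> holo (fun z => f z / g z)%C c R0.
Proof. intros Hf Hg Hn z Hz. destruct (Hf z Hz), (Hg z Hz). eexists. apply cder_div; eauto. Qed.

Lemma holo_mult (f g : C -> C) (c : C) (R0 : R) : holo f c R0 -> holo g c R0 -> holo (fun z => f z * g z)%C c R0.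
Proof. intros Hf Hg z Hz. destruct (Hf z Hz), (Hg z Hz). eexists. apply cder_mult; eauto. Qed.

(** [p] is a primitive of q'/q normalized at the centre; q e^(-p) has derivative zero, hence is
    constant. *)
Lemma holo_log (q : C -> C) (c : C) (R0 : R) : 0 < R0 -> holo q c R0 -> (forall z, Cmod (z - c) < R0 -> q z <> 0%C) ->
  exists p, (forall z, Cmod (z - c) < R0 -> cder p z (Cderiv q z / q z)%C) /\
            (forall z, Cmod (z - c) < R0 -> q z = (q c * cexp (p z))%C) /\ p c = 0%C.
Proof.
  intros HR Hq Hn. destruct (holo_primitive (fun z => Cderiv q z / q z)%C c R0) as [P HP].
  { apply holo_div; auto. apply holo_Cderiv; auto. }
  set (p := fun z => (P z - P c)%C). assert (Hp : forall z, Cmod (z - c) < R0 -> cder p z (Cderiv q z / q z)%C).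
  { intros z Hz. eapply cder_eq. apply cder_minus; [apply HP; auto|apply cder_const]. ring. }
  exists p. split; [auto|split].
  - intros z Hz. assert (E : (q z * cexp (- p z))%C = (q c * cexp (- p c))%C).
    { apply (cder_zero_const (fun z => q z * cexp (- p z))%C c R0); auto. intros w Hw. eapply cder_eq.
      - apply (cder_mult q (fun w => cexp (- p w))%C). apply Cderiv_spec, Hq; auto.
        apply (cder_cexp_comp (fun w => - p w)%C), cder_opp, Hp; auto.
      - field. apply Hn; auto. }
    rewrite cexp_opp in E. unfold p at 2 in E. replace (- (P c - P c))%C with (RtoC 0) in E by ring. rewrite cexp_0 in E.
    replace (q z) with (q z * / cexp (p z) * cexp (p z))%C by (field; apply cexp_neq_0). rewrite E. ring.
  - unfold p. ring.
Qed.

(** * Borel-Caratheodory and logarithmic derivatives *)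

Lemma CI_conj (g : R -> C) (a b : R) : rcont_on g a b -> CI (fun t => Cconj (g t)) a b = Cconj (CI g a b).
Proof.
  intros H. destruct (rcont_on_ex g a b H) as [_ E]. unfold CI, Cconj; simpl. f_equal.
  apply (RInt_opp (V := R_CompleteNormedModule) (fun t => snd (g t))); auto.
Qed.

Lemma cavg_conj (g : C -> C) (c : C) (r : R) : rcirc g c r -> cavg (fun w => Cconj (g w)) c r = Cconj (cavg g c r).
Proof.
  intros H. unfold cavg. rewrite (CI_conj (fun x => g (circ c r x))) by (apply rcirc_on; auto).
  rewrite Cmult_conj. f_equal. unfold Cconj, RtoC; simpl. f_equal. ring.
Qed.

Lemma RtoC_neq (x : R) : x <> 0 -> RtoC x <> 0%C.
Proof. intros H E. apply RtoC_inj in E. auto. Qed.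

Lemma Cconj_RtoC (x : R) : Cconj (RtoC x) = RtoC x.
Proof. unfold Cconj, RtoC; simpl. f_equal; ring. Qed.

Lemma Cmult_conj_sqr (u : C) (r : R) : Cmod u = r -> (u * Cconj u)%C = RtoC (r ^ 2).
Proof. intros <-. rewrite <- Cmod2_conj. reflexivity. Qed.

(** On |u| = r the conjugate of u is r^2/u, so the conjugate of the kernel with pole at [v] extends
    holomorphically inside; its pole moves to the reflected point. *)
Lemma circle_conj_kernel (u v : C) (r : R) : 0 < r -> Cmod u = r -> Cmod v < r ->
  (RtoC (r ^ 2) - Cconj v * u)%C <> 0%C /\
  Cconj (u * (/ (u - v)) ^ 2) = (RtoC (r ^ 2) * (u * (/ (RtoC (r ^ 2) - Cconj v * u)) ^ 2))%C.
Proof.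
  intros Hr Hu Hv. assert (Hu0 : u <> 0%C) by (intros E; rewrite E, Cmod_0 in Hu; lra).
  assert (Huv : (u - v)%C <> 0%C) by (intros E; apply Ceq_minus in E; subst; lra).
  assert (Hc : Cconj (u - v) <> 0%C) by (intros E; apply Huv; rewrite <- (Cconj_conj (u - v)), E; unfold Cconj; simpl; unfold RtoC; f_equal; ring).
  assert (E : (RtoC (r ^ 2) - Cconj v * u)%C = (u * Cconj (u - v))%C).
  { rewrite <- (Cmult_conj_sqr u r Hu), Cminus_conj. ring. }
  rewrite E. split; [apply Cmult_neq_0; auto|]. rewrite Cmult_conj, Cpow_conj, Cinv_conj by auto.
  rewrite <- (Cmult_conj_sqr u r Hu). simpl. field. auto.
Qed.

(** Let k be the kernel of p'(z). Both k and conj(p) k have mean zero, so p'(z) is minus the mean of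
    2(A - Re p) k. The factor A - Re p is nonnegative with mean A - Re p(c), so a one-sided bound on
    Re p controls |p'|. *)
Lemma borel_caratheodory (p : C -> C) (c z : C) (r R0 A : R) : holo p c R0 -> 0 < r -> r < R0 -> Cmod (z - c) < r ->
  (forall w, Cmod (w - c) = r -> fst (p w) <= A) ->
  Cmod (Cderiv p z) <= 2 * r / (r - Cmod (z - c)) ^ 2 * (A - fst (p c)).
Proof.
  intros Hp Hr HR Hz HA. assert (H0 := Cmod_ge_0 (z - c)). set (k := fun w => ((w - c) * (/ (w - z)) ^ 2)%C).
  assert (Ik : rcirc k c r) by (apply (rcirc_mult (fun w => w - c)%C); [apply rcirc_sub|apply rcirc_pow, rcirc_inv_sub; auto]).
  assert (Ip := holo_rcirc p c r R0 Hp (Rlt_le _ _ Hr) HR).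
  assert (Ipc : rcirc (fun w => Cconj (p w)) c r) by (intros x; apply (rcont_conj (fun x => p (circ c r x))); auto).
  assert (E1 : Cderiv p z = cavg (fun w => p w * k w)%C c r).
  { rewrite (Cderiv_eq _ _ _ (cauchy_deriv p c z r R0 Hp Hz HR)). apply cavg_ext; [lra|]. intros; unfold k; ring. }
  assert (E2 : cavg k c r = 0%C).
  { assert (Hone : holo (fun _ => 1%C) c R0) by (intros w _; exists (RtoC 0); apply cder_const).
    assert (U := cder_unique _ _ _ _ (cauchy_deriv (fun _ => 1%C) c z r R0 Hone Hz HR) (cder_const 1%C z)).
    rewrite <- U. apply cavg_ext; [lra|]. intros; unfold k; ring. }
  assert (E3 : cavg (fun w => Cconj (p w) * k w)%C c r = 0%C).
  { set (v := (z - c)%C) in *. set (F := fun w => (p w * (RtoC (r ^ 2) * ((w - c) * (/ (RtoC (r ^ 2) - Cconj v * (w - c))) ^ 2)))%C).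
    assert (EF : cavg F c r = 0%C).
    (* The reflected pole is at distance r^2/|v| from the centre; 2r^2/(r + |v|) lies strictly
       between r and that distance. *)
    { set (R1 := Rmin R0 (2 * r ^ 2 / (r + Cmod v))). assert (HR1 : r < R1).
      { apply Rmin_glb_lt; auto. apply Rmult_lt_reg_r with (r + Cmod v); [lra|]. unfold Rdiv. rewrite Rmult_assoc, Rinv_l by lra. simpl. nra. }
      assert (HR1' : R1 * Cmod v < r ^ 2).
      { apply Rle_lt_trans with (2 * r ^ 2 / (r + Cmod v) * Cmod v); [apply Rmult_le_compat_r; auto; apply Rmin_r|].
        apply Rmult_lt_reg_r with (r + Cmod v); [lra|].
        replace (2 * r ^ 2 / (r + Cmod v) * Cmod v * (r + Cmod v)) with (r ^ 2 * (2 * Cmod v)) by (field; lra).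
        apply Rmult_lt_compat_l; [apply pow_lt; auto|lra]. }
      rewrite <- (cauchy_center F c r R1); auto.
      - unfold F. replace (c - c)%C with (RtoC 0) by ring. ring.
      - intros w Hw. destruct (Hp w) as [dp Hdp]; [eapply Rlt_le_trans; [exact Hw|apply Rmin_l]|].
        assert (N : (RtoC (r ^ 2) - Cconj v * (w - c))%C <> 0%C).
        { intros E. apply Ceq_minus in E. assert (E' := f_equal Cmod E).
          rewrite Cmod_mult, Cmod_conj, Cmod_R, Rabs_right in E' by (apply Rle_ge, pow2_ge_0).
          assert (Cmod v * Cmod (w - c) <= Cmod v * R1) by (apply Rmult_le_compat_l; lra). lra. }
        assert (Dl : forall x, cder (fun w => w - c)%C x 1) by (intros x; eapply cder_eq; [apply cder_minus; [apply cder_id|apply cder_const]|ring]).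
        eexists. apply (cder_mult p); [exact Hdp|]. apply cder_scal. apply (cder_mult (fun w => w - c)%C); [apply Dl|].
        apply (cder_mult (fun w => / (RtoC (r ^ 2) - Cconj v * (w - c)))%C (fun w => / (RtoC (r ^ 2) - Cconj v * (w - c)) * 1)%C).
        + apply (cder_inv (fun w => RtoC (r ^ 2) - Cconj v * (w - c))%C); auto. apply cder_minus; [apply cder_const|apply cder_scal, Dl].
        + apply (cder_mult (fun w => / (RtoC (r ^ 2) - Cconj v * (w - c)))%C (fun w => 1)%C); [|apply cder_const].
          apply (cder_inv (fun w => RtoC (r ^ 2) - Cconj v * (w - c))%C); auto. apply cder_minus; [apply cder_const|apply cder_scal, Dl]. }
    rewrite (cavg_ext _ (fun w => Cconj (F w))); [|lra|].
    - rewrite cavg_conj, EF. unfold Cconj, RtoC; simpl; f_equal; ring. apply rcirc_ccont; [lra|]. intros w Hw.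
      destruct (circle_conj_kernel (w - c) v r) as [N _]; auto. destruct (Hp w) as [dp Hdp]; [lra|].
      assert (Dl : forall x, cder (fun w => w - c)%C x 1) by (intros x; eapply cder_eq; [apply cder_minus; [apply cder_id|apply cder_const]|ring]).
      eapply cder_ccont. apply (cder_mult p); [exact Hdp|]. apply cder_scal. apply (cder_mult (fun w => w - c)%C); [apply Dl|].
        apply (cder_mult (fun w => / (RtoC (r ^ 2) - Cconj v * (w - c)))%C (fun w => / (RtoC (r ^ 2) - Cconj v * (w - c)) * 1)%C).
        + apply (cder_inv (fun w => RtoC (r ^ 2) - Cconj v * (w - c))%C); auto. apply cder_minus; [apply cder_const|apply cder_scal, Dl].
        + apply (cder_mult (fun w => / (RtoC (r ^ 2) - Cconj v * (w - c)))%C (fun w => 1)%C); [|apply cder_const].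
          apply (cder_inv (fun w => RtoC (r ^ 2) - Cconj v * (w - c))%C); auto. apply cder_minus; [apply cder_const|apply cder_scal, Dl].
    - intros w Hw. unfold F. destruct (circle_conj_kernel (w - c) v r) as [_ E]; auto.
      rewrite <- E, Cmult_conj, Cconj_conj. unfold k, v. f_equal. f_equal. f_equal. f_equal. ring. }
  assert (Ih : rcirc (fun w => RtoC (2 * (A - fst (p w)))) c r).
  { apply rcirc_ext with (fun w => 2 * RtoC A - (p w + Cconj (p w)))%C.
    { intros w. csolve. }
    apply rcirc_minus; [apply rcirc_const|apply rcirc_plus; auto]. }
  assert (E4 : Cderiv p z = (- cavg (fun w => RtoC (2 * (A - fst (p w))) * k w) c r)%C).
  { rewrite (cavg_ext _ (fun w => (2 * RtoC A) * k w - (p w * k w + Cconj (p w) * k w))%C); [|lra|].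
    - rewrite cavg_minus, cavg_scal, cavg_plus, E2, E3, <- E1; auto; try ring.
      + apply (rcirc_mult p); auto.
      + apply (rcirc_mult (fun w => Cconj (p w))); auto.
      + apply rcirc_scal; auto.
      + apply rcirc_plus; [apply (rcirc_mult p)|apply (rcirc_mult (fun w => Cconj (p w)))]; auto.
    - intros w Hw. replace (RtoC (2 * (A - fst (p w)))) with (2 * RtoC A - (p w + Cconj (p w)))%C; [ring|]. csolve. }
  rewrite E4, Cmod_opp. set (K := r / (r - Cmod (z - c)) ^ 2). eapply Rle_trans.
  - apply (cavg_norm_le _ (fun w => K * (2 * (A - fst (p w))))); [lra| | |].
    + apply (rcirc_mult (fun w => RtoC (2 * (A - fst (p w))))); auto.
    + apply rcirc_ext with (fun w => RtoC K * RtoC (2 * (A - fst (p w))))%C; [intros; rewrite !RtoC_mult; auto|]. apply rcirc_scal; auto.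
    + intros w Hw. rewrite Cmod_mult, Cmod_R, Rabs_right by (specialize (HA w Hw); lra). rewrite Rmult_comm.
      apply Rmult_le_compat_r; [specialize (HA w Hw); lra|]. unfold k. assert (N := circ_neq c z w r Hz Hw).
      rewrite Cmod_mult, Cmod_pow, Cmod_inv, Hw by auto. unfold K, Rdiv. apply Rmult_le_compat_l; [lra|].
      rewrite pow_inv. apply Rinv_le_contravar; [apply pow_lt; lra|]. apply pow_incr. split; [lra|apply circ_dist; auto].
  - rewrite (cavg_ext _ (fun w => RtoC K * (2 * RtoC A - (p w + Cconj (p w))))%C); [|lra|].
    + rewrite cavg_scal, cavg_minus, cavg_const, cavg_plus, cavg_conj, <- (cauchy_center p c r R0); auto.
      * unfold K. simpl. right. field. lra.
      * apply rcirc_const.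
      * apply rcirc_plus; auto.
      * apply rcirc_minus; [apply rcirc_const|apply rcirc_plus; auto].
    + intros w Hw. csolve.
Qed.

Section LogDeriv.
Variables (c : C) (r1 r2 r Rr R' M x0 : R).
Hypotheses (Hr1 : 0 < r1) (Hr2 : r1 < r2) (Hr : r2 < r) (HR : r < Rr) (HR' : Rr < R') (HM : 0 < M).

(** The points [s] lie within radius [r1], the real part of the logarithm is bounded on radius [r2],
    zeros are removed within [r], and |f| <= M on radius [Rr]. [b] is the Borel-Caratheodory
    constant for [r1] and [r2], [D] the loss in Cauchy's bound from [Rr] to [r2], and [a] bounds the
    logarithmic derivative of one Blaschke correction. *)
Let b := 2 * r2 / (r2 - r1) ^ 2.
Let D := Rr / (Rr - r2).
Let a := r / (Rr ^ 2 - r ^ 2).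

Lemma log_deriv_zero_free (f : C -> C) : holo f c R' -> (forall z, Cmod (z - c) = Rr -> Cmod (f z) <= M) ->
  (forall z, Cmod (z - c) < r -> f z <> 0%C) ->
  forall s, Cmod (s - c) <= r1 -> Cmod (Cderiv f s / f s) <= b * ln (D * (M / Cmod (f c))).
Proof.
  intros Hf HfM Hn s Hs. assert (Hcc : Cmod (c - c) = 0) by (replace (c - c)%C with (RtoC 0) by ring; apply Cmod_0).
  assert (Hfc : 0 < Cmod (f c)) by (apply Cmod_gt_0, Hn; lra).
  destruct (holo_log f c r) as (p & P1 & P2 & P3); auto; [lra|apply holo_weaken with R'; auto; lra|].
  rewrite <- (Cderiv_eq p s _ (P1 s ltac:(lra))). assert (HD : 1 <= D).
  { unfold D. apply Rmult_le_reg_r with (Rr - r2); [lra|]. unfold Rdiv. rewrite Rmult_assoc, Rinv_l; lra. }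
  eapply Rle_trans; [apply (borel_caratheodory p c s r2 r (ln (D * (M / Cmod (f c))))); try lra|].
  - intros z Hz. eexists; apply P1; auto.
  - intros w Hw. assert (B : Cmod (f w) <= M * Rr / (Rr - Cmod (w - c))) by (apply (cauchy_disc_bound f c w Rr R'); auto; lra).
    rewrite Hw in B. rewrite P2 in B by lra. rewrite Cmod_mult, Cmod_cexp in B.
    rewrite <- (ln_exp (fst (p w))). apply ln_le; [apply exp_pos|].
    apply Rmult_le_reg_l with (Cmod (f c)); auto. eapply Rle_trans; [exact B|]. unfold D. right. field. lra.
  - rewrite P3. change (fst (RtoC 0)) with 0. rewrite Rminus_0_r. assert (HL : 0 <= ln (D * (M / Cmod (f c)))).
    { rewrite <- ln_1. apply ln_le; [lra|]. assert (Cmod (f c) <= M) by (apply (cauchy_center_bound f c Rr R'); auto; lra).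
      assert (1 <= M / Cmod (f c)) by (apply Rmult_le_reg_r with (Cmod (f c)); auto; unfold Rdiv; rewrite Rmult_assoc, Rinv_l; lra). nra. }
    apply Rmult_le_compat_r; auto. unfold b, Rdiv. apply Rmult_le_compat_l; [lra|].
    apply Rinv_le_contravar; [apply pow_lt; lra|]. apply pow_incr. lra.
Qed.

(* Zeros in the disc are divided out one at a time by Blaschke factors, each of which
   multiplies |f c| by at least Rr/r, while |f| is unchanged on the circle of radius Rr. *)
Lemma log_deriv_bound (n : nat) : forall f : C -> C, holo f c R' -> (forall z, Cmod (z - c) = Rr -> Cmod (f z) <= M) ->
  f c <> 0%C -> M < Cmod (f c) * (Rr / r) ^ n ->
  (forall z, Cmod (z - c) < r -> f z = 0%C -> fst z <= x0) ->
  forall s, Cmod (s - c) <= r1 -> x0 < fst s ->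
    - (INR n * a + b * ln (D * (M / Cmod (f c)))) <= fst (Cderiv f s / f s)%C /\
    Cmod (Cderiv f s / f s) <= INR n * (a + / (fst s - x0)) + b * ln (D * (M / Cmod (f c))).
Proof.
  assert (HD : 1 <= D).
  { unfold D. apply Rmult_le_reg_r with (Rr - r2); [lra|]. unfold Rdiv. rewrite Rmult_assoc, Rinv_l; lra. }
  assert (Ha : 0 < a) by (unfold a; apply Rdiv_lt_0_compat; [lra|nra]). assert (Hb : 0 < b) by (unfold b; positive).
  induction n as [|n IH]; intros f Hf HfM Hfc HMn Hz s Hs Hxs.
  (* [n] limits the number of zeros still to be removed. With n = 0 the hypothesis M < |f c|
     contradicts the mean value bound. *)
  { exfalso. simpl in HMn. assert (Cmod (f c) <= M) by (apply (cauchy_center_bound f c Rr R'); auto; lra). lra. }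
  assert (Hd : 0 < / (fst s - x0)) by positive.
  destruct (excluded_middle_informative (exists z, Cmod (z - c) < r /\ f z = 0%C)) as [[rho [Hrho Hfr]]|Hno].
  2:{ assert (B := log_deriv_zero_free f Hf HfM).
    assert (Hn : forall z, Cmod (z - c) < r -> f z <> 0%C) by (intros z Hz1 Hz2; apply Hno; exists z; auto).
    specialize (B Hn s Hs). assert (T := Cmod_Re (Cderiv f s / f s)). apply Rabs_le_between in T.
    assert (0 <= INR (S n) * a) by (apply Rmult_le_pos; [apply pos_INR|lra]).
    assert (0 <= INR (S n) * (a + / (fst s - x0))) by (apply Rmult_le_pos; [apply pos_INR|lra]). lra. }
  destruct (holo_factor f c rho R' Hf ltac:(lra) Hfr) as (g & Hg & Hfg). set (v := (rho - c)%C) in *.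
  (* The factor z - rho is exchanged for one of the same modulus on the circle of radius [Rr] whose
     zero is the reflection of [rho], outside that circle. *)
  set (B := fun z => ((RtoC (Rr ^ 2) - Cconj v * (z - c)) * RtoC (/ Rr))%C). assert (HB : forall z, cder B z (- Cconj v * RtoC (/ Rr))%C).
  { intros z. unfold B. apply cder_ext with (fun z => RtoC (/ Rr) * (RtoC (Rr ^ 2) - Cconj v * (z - c)))%C; [intros; ring|].
    eapply cder_eq. apply cder_scal, cder_minus; [apply cder_const|apply cder_scal, cder_minus; [apply cder_id|apply cder_const]]. ring. }
  assert (HBn : forall z, Cmod (z - c) < r -> (RtoC (Rr ^ 2) - Cconj v * (z - c))%C <> 0%C /\ Rr ^ 2 - r ^ 2 <= Cmod (RtoC (Rr ^ 2) - Cconj v * (z - c))).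
  { intros z Hz'. assert (T := Cmod_triangle_sub (RtoC (Rr ^ 2)) (Cconj v * (z - c))).
    rewrite Cmod_mult, Cmod_conj, Cmod_R, Rabs_right in T by (apply Rle_ge, pow2_ge_0).
    assert (Cmod v * Cmod (z - c) <= r * r) by (apply Rmult_le_compat; try apply Cmod_ge_0; lra). assert (r * r < Rr ^ 2) by (simpl; nra).
    split; [|simpl in *; lra]. intros E. rewrite E, Cmod_0 in T. lra. }
  set (f1 := fun z => (g z * B z)%C). assert (Hf1 : holo f1 c R') by (apply holo_mult; auto; intros z _; eexists; apply HB).
  assert (HRr : 0 < Rr) by lra. assert (Hf1M : forall z, Cmod (z - c) = Rr -> Cmod (f1 z) <= M).
  { intros z Hzc. specialize (HfM z Hzc). rewrite Hfg in HfM by lra. unfold f1, B.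
    replace (RtoC (Rr ^ 2)) with ((z - c) * Cconj (z - c))%C by (apply Cmult_conj_sqr; auto).
    replace ((z - c) * Cconj (z - c) - Cconj v * (z - c))%C with ((z - c) * Cconj (z - rho))%C.
    - rewrite !Cmod_mult, Cmod_conj, Hzc, Cmod_R, Rabs_right by (left; positive).
      rewrite Cmod_mult in HfM. replace (Cmod (g z) * (Rr * Cmod (z - rho) * / Rr)) with (Cmod (z - rho) * Cmod (g z)) by (field; lra). auto.
    - unfold v. rewrite !Cminus_conj. ring. }
  assert (Hcc : Cmod (c - c) = 0) by (replace (c - c)%C with (RtoC 0) by ring; apply Cmod_0).
  assert (Ef : f c = (- v * g c)%C) by (rewrite Hfg by lra; unfold v; ring).
  assert (Hgc : g c <> 0%C) by (intros E; apply Hfc; rewrite Ef, E; ring).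
  assert (Hv : v <> 0%C) by (intros E; apply Hfc; rewrite Ef, E; ring). assert (Hvp : 0 < Cmod v) by (apply Cmod_gt_0; auto).
  assert (Hgp : 0 < Cmod (g c)) by (apply Cmod_gt_0; auto). assert (Ef1 : Cmod (f1 c) = Cmod (g c) * Rr).
  { unfold f1, B. rewrite Cmod_mult. f_equal. replace ((RtoC (Rr ^ 2) - Cconj v * (c - c)) * RtoC (/ Rr))%C with (RtoC (Rr ^ 2) * RtoC (/ Rr))%C by ring.
    rewrite <- RtoC_mult, Cmod_R. replace (Rr ^ 2 * / Rr) with Rr by (field; lra). apply Rabs_right; lra. }
  assert (Ef' : Cmod (f c) = Cmod v * Cmod (g c)) by (rewrite Ef, Cmod_mult, Cmod_opp; auto).
  assert (Hup : Cmod (f c) * (Rr / r) <= Cmod (f1 c)).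
  { rewrite Ef', Ef1. unfold Rdiv. replace (Cmod v * Cmod (g c) * (Rr * / r)) with (Cmod (g c) * Rr * (Cmod v * / r)) by ring.
    rewrite <- (Rmult_1_r (Cmod (g c) * Rr)) at 2. apply Rmult_le_compat_l; [nra|].
    apply Rmult_le_reg_r with r; [lra|]. rewrite Rmult_assoc, Rinv_l; lra. }
  assert (Hq : 1 < Rr / r) by (apply Rmult_lt_reg_r with r; [lra|]; unfold Rdiv; rewrite Rmult_assoc, Rinv_l; lra).
  assert (Hf1c : 0 < Cmod (f1 c)) by (rewrite Ef1; nra). destruct (IH f1) with (s := s) as [I1 I2]; auto.
  - apply Cmod_gt_0; auto.
  - eapply Rlt_le_trans; [exact HMn|]. simpl. rewrite <- Rmult_assoc. apply Rmult_le_compat_r; [apply pow_le; lra|auto].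
  - intros z Hz1 Hz2. apply Hz; auto. rewrite Hfg by lra. unfold f1, B in Hz2. destruct (HBn z Hz1) as [N _].
    assert (g z = 0%C) as ->; [|ring].
    destruct (Ceq_dec (g z) 0) as [E|E]; auto. exfalso. revert Hz2. apply Cmult_neq_0; auto. apply Cmult_neq_0; auto.
    apply RtoC_neq. apply Rinv_neq_0_compat; lra.
  - assert (Lle : ln (D * (M / Cmod (f1 c))) <= ln (D * (M / Cmod (f c)))).
    { assert (0 < / Cmod (f1 c)) by positive. apply ln_le. apply Rmult_lt_0_compat; [lra|]. positive.
      apply Rmult_le_compat_l; [lra|]. apply Rmult_le_compat_l; [lra|]. apply Rinv_le_contravar; nra. }
    assert (Lle' : b * ln (D * (M / Cmod (f1 c))) <= b * ln (D * (M / Cmod (f c)))) by (apply Rmult_le_compat_l; lra).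
    assert (Hsr : Cmod (s - c) < r) by lra. destruct (HBn s Hsr) as [NB LB]. assert (Hxr : fst rho <= x0) by (apply Hz; auto).
    assert (Nsr : (s - rho)%C <> 0%C) by (intros E; apply Ceq_minus in E; subst; lra). assert (Hgs : g s <> 0%C).
    { intros E. assert (fst s <= x0); [|lra]. apply Hz; auto. rewrite Hfg by lra. rewrite E; ring. }
    destruct (Hg s ltac:(lra)) as [dg Hdg]. assert (Df : cder f s (g s + (s - rho) * dg)%C).
    { apply (cder_ext_loc (fun z => (z - rho) * g z)%C f s _ (R' - Cmod (s - c))); [lra| |].
      - intros w Hw. symmetry. apply Hfg. apply (open_disc_near c s R'); auto; lra.
      - eapply cder_eq. apply (cder_mult (fun z => z - rho)%C g); [apply cder_minus; [apply cder_id|apply cder_const]|exact Hdg]. ring. }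
    assert (Df1 : cder f1 s (dg * B s + g s * (- Cconj v * RtoC (/ Rr)))%C) by (apply (cder_mult g B); auto).
    rewrite (Cderiv_eq _ _ _ Df). rewrite (Cderiv_eq _ _ _ Df1) in I1, I2.
    assert (HRi : RtoC (/ Rr) <> 0%C) by (apply RtoC_neq, Rinv_neq_0_compat; lra).
    set (w1 := (Cconj v / (RtoC (Rr ^ 2) - Cconj v * (s - c)))%C).
    assert (EE : ((g s + (s - rho) * dg) / f s)%C =
       ((dg * B s + g s * (- Cconj v * RtoC (/ Rr))) / f1 s + / (s - rho) + w1)%C).
    { rewrite Hfg by lra. unfold f1, B, w1. field. repeat split; auto. }
    rewrite EE. set (Q := ((dg * B s + g s * (- Cconj v * RtoC (/ Rr))) / f1 s)%C) in *. assert (Bw1 : Cmod w1 <= a).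
    { unfold w1, a. rewrite Cmod_div, Cmod_conj by auto. unfold Rdiv.
      apply Rmult_le_compat; [lra|left; apply Rinv_0_lt_compat; nra|lra|]. apply Rinv_le_contravar; [nra|auto]. }
    (* The decisive sign: [s] lies to the right of the zero, so 1/(s - rho) has nonnegative real
       part. The lower bound therefore avoids 1/(Re s - x0), which the bound on the modulus must
       contain. *)
    assert (Tw := Cmod_Re w1). apply Rabs_le_between in Tw. assert (Re1 : 0 <= fst (/ (s - rho))%C).
    { unfold Cinv; simpl. apply Rmult_le_pos; [simpl; lra|]. left. apply Rinv_0_lt_compat.
      assert (0 <= (snd s + - snd rho) * (snd s + - snd rho)) by apply Rle_0_sqr. nra. }
    assert (Ab1 : Cmod (/ (s - rho)) <= / (fst s - x0)).
    { rewrite Cmod_inv by auto. apply Rinv_le_contravar; [lra|]. eapply Rle_trans; [|apply (Re_le_Cmod (s - rho)%C)]. simpl. lra. }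
    rewrite S_INR. split.
    + change (fst (Q + / (s - rho) + w1)%C) with (fst Q + fst (/ (s - rho))%C + fst w1). lra.
    + eapply Rle_trans; [apply Cmod_triangle|]. eapply Rle_trans; [apply Rplus_le_compat_r, Cmod_triangle|]. lra.
Qed.

End LogDeriv.

(** * Unconditional summation *)

Fixpoint csum {A : Type} (f : A -> C) (l : list A) : C :=
  match l with [] => RtoC 0 | x :: l => (f x + csum f l)%C end.
Fixpoint rsum {A : Type} (f : A -> R) (l : list A) : R :=
  match l with [] => 0 | x :: l => f x + rsum f l end.

Definition eqd {A : Type} (x y : A) : {x = y} + {x <> y} := excluded_middle_informative (x = y).

Definition outside {A : Type} (l l' : list A) : list A :=
  filter (fun x => if in_dec eqd x l then false else true) l'.

Section ListSums.
Context {A : Type}.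
Implicit Types (l : list A).

Lemma csum_app (f : A -> C) l l' : csum f (l ++ l') = (csum f l + csum f l')%C.
Proof. induction l; simpl; [ring|]. rewrite IHl. ring. Qed.
Lemma rsum_app (f : A -> R) l l' : rsum f (l ++ l') = rsum f l + rsum f l'.
Proof. induction l; simpl; [ring|]. rewrite IHl. ring. Qed.
Lemma csum_perm (f : A -> C) l l' : Permutation l l' -> csum f l = csum f l'.
Proof. induction 1; simpl; try congruence; try ring. Qed.
Lemma rsum_perm (f : A -> R) l l' : Permutation l l' -> rsum f l = rsum f l'.
Proof. induction 1; simpl; try congruence; try ring. Qed.
Lemma csum_plus (f g : A -> C) l : csum (fun x => f x + g x)%C l = (csum f l + csum g l)%C.
Proof. induction l; simpl; [ring|]. rewrite IHl. ring. Qed.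
Lemma csum_scal (c : C) (f : A -> C) l : csum (fun x => c * f x)%C l = (c * csum f l)%C.
Proof. induction l; simpl; [ring|]. rewrite IHl. ring. Qed.
Lemma rsum_plus (f g : A -> R) l : rsum (fun x => f x + g x) l = rsum f l + rsum g l.
Proof. induction l; simpl; [ring|]. rewrite IHl. ring. Qed.
Lemma rsum_scal (c : R) (f : A -> R) l : rsum (fun x => c * f x) l = c * rsum f l.
Proof. induction l; simpl; [ring|]. rewrite IHl. ring. Qed.
Lemma csum_ext (f g : A -> C) l : (forall x, In x l -> f x = g x) -> csum f l = csum g l.
Proof. induction l; simpl; intros H; auto. rewrite H, IHl; auto. Qed.
Lemma rsum_ext (f g : A -> R) l : (forall x, In x l -> f x = g x) -> rsum f l = rsum g l.
Proof. induction l; simpl; intros H; auto. rewrite H, IHl; auto. Qed.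
Lemma rsum_le (f g : A -> R) l : (forall x, In x l -> f x <= g x) -> rsum f l <= rsum g l.
Proof. induction l; simpl; intros H; [lra|]. apply Rplus_le_compat; auto. Qed.
Lemma rsum_nonneg (f : A -> R) l : (forall x, In x l -> 0 <= f x) -> 0 <= rsum f l.
Proof. induction l; simpl; intros H; [lra|]. apply Rplus_le_le_0_compat; auto. Qed.
Lemma csum_norm_le (f : A -> C) l : Cmod (csum f l) <= rsum (fun x => Cmod (f x)) l.
Proof. induction l; simpl; [rewrite Cmod_0; lra|]. eapply Rle_trans; [apply Cmod_triangle|]. lra. Qed.
Lemma csum_RtoC (f : A -> R) l : csum (fun x => RtoC (f x)) l = RtoC (rsum f l).
Proof. induction l; simpl; auto. rewrite IHl, RtoC_plus. auto. Qed.
Lemma csum_zero (f : A -> C) l : (forall x, In x l -> f x = 0%C) -> csum f l = 0%C.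
Proof. induction l; simpl; intros H; auto. rewrite H, IHl; auto. ring. Qed.
Lemma rsum_const (c : R) l : rsum (fun _ => c) l = INR (length l) * c.
Proof. induction l; simpl length; [simpl; ring|]. rewrite S_INR. simpl. rewrite IHl. ring. Qed.

Lemma rsum_incl (f : A -> R) l l' : (forall x, In x l' -> 0 <= f x) -> NoDup l -> incl l l' -> rsum f l <= rsum f l'.
Proof.
  revert l'. induction l as [|x l IH]; intros l' Hf Hnd Hi; [apply rsum_nonneg; auto|]. inversion Hnd; subst.
  destruct (in_split x l') as (l1 & l2 & ->); [apply Hi; left; auto|].
  rewrite (rsum_perm f (l1 ++ x :: l2) (x :: l1 ++ l2)) by (symmetry; apply Permutation_middle).
  simpl. apply Rplus_le_compat_l. apply IH; auto.
  - intros y Hy. apply Hf. apply in_app_iff in Hy. apply in_app_iff. simpl. tauto.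
  - intros y Hy. assert (In y (l1 ++ x :: l2)) by (apply Hi; right; auto).
    apply in_app_iff in H. apply in_app_iff. simpl in H. destruct H as [H|[H|H]]; auto. subst; contradiction.
Qed.

Lemma in_outside l l' x : In x (outside l l') <-> In x l' /\ ~ In x l.
Proof. unfold outside. rewrite filter_In. destruct (in_dec eqd x l); split; intros [H1 H2]; split; auto; try congruence; contradiction. Qed.

Lemma NoDup_outside l l' : NoDup l' -> NoDup (outside l l').
Proof. apply NoDup_filter. Qed.

Lemma NoDup_app_disj l l' : NoDup l -> NoDup l' -> (forall x, In x l -> ~ In x l') -> NoDup (l ++ l').
Proof.
  intros H1 H2 H. induction l; simpl; auto. inversion H1; subst. constructor.
  - rewrite in_app_iff. intros [K|K]; auto. apply (H a); simpl; auto.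
  - apply IHl; auto. intros x Hx. apply H; right; auto.
Qed.

Lemma perm_outside l l' : NoDup l -> NoDup l' -> incl l l' -> Permutation l' (l ++ outside l l').
Proof.
  intros H1 H2 H. apply NoDup_Permutation; auto.
  - apply NoDup_app_disj; auto using NoDup_outside. intros x Hx K. apply in_outside in K. tauto.
  - intros x. rewrite in_app_iff, in_outside. assert (In x l -> In x l') by apply H. destruct (in_dec eqd x l); tauto.
Qed.

(** Convergence along all finite sets rather than along an enumeration: no order is involved, so
    sums may be regrouped by associates, by products and by crosses. *)
Definition is_sum (f : A -> C) (S : C) : Prop :=
  forall eps, 0 < eps -> exists l0, NoDup l0 /\
    forall l, NoDup l -> incl l0 l -> Cmod (csum f l - S) <= eps.

Definition sum_bounded (f : A -> R) (B : R) : Prop := forall l, NoDup l -> rsum f l <= B.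

Lemma union_incl l l' : exists l'', NoDup l'' /\ incl l l'' /\ incl l' l''.
Proof.
  exists (nodup eqd (l ++ l')). split; [apply NoDup_nodup|]. split; intros x Hx; apply nodup_In, in_app_iff; auto.
Qed.

Lemma is_sum_unique (f : A -> C) S S' : is_sum f S -> is_sum f S' -> S = S'.
Proof.
  intros H H'. apply Ceq_minus, Cmod_zero_all. intros eps He.
  destruct (H (eps / 2)) as (l & _ & K); [lra|]. destruct (H' (eps / 2)) as (l' & _ & K'); [lra|].
  destruct (union_incl l l') as (l'' & N & I1 & I2). specialize (K l'' N I1). specialize (K' l'' N I2).
  assert (T := Cmod_triangle3 S (csum f l'') S'). rewrite (Cmod_minus_sym S (csum f l'')) in T. lra.
Qed.

Lemma is_sum_ext (f g : A -> C) S : (forall x, f x = g x) -> is_sum f S -> is_sum g S.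
Proof.
  intros E H eps He. destruct (H eps He) as (l & N & K). exists l. split; auto. intros l' N' I. rewrite <- (csum_ext f g); auto.
Qed.

Lemma is_sum_plus (f g : A -> C) S S' : is_sum f S -> is_sum g S' -> is_sum (fun x => f x + g x)%C (S + S')%C.
Proof.
  intros H H' eps He. destruct (H (eps / 2)) as (l & _ & K); [lra|]. destruct (H' (eps / 2)) as (l' & _ & K'); [lra|].
  destruct (union_incl l l') as (l'' & N & I1 & I2). exists l''. split; auto. intros l3 N3 I3.
  rewrite csum_plus. replace (csum f l3 + csum g l3 - (S + S'))%C with ((csum f l3 - S) + (csum g l3 - S'))%C by ring.
  eapply Rle_trans; [apply Cmod_triangle|]. specialize (K l3 N3 (incl_tran I1 I3)). specialize (K' l3 N3 (incl_tran I2 I3)). lra.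
Qed.

Lemma is_sum_scal (c : C) (f : A -> C) S : is_sum f S -> is_sum (fun x => c * f x)%C (c * S)%C.
Proof.
  intros H eps He. assert (P := Cmod_ge_0 c). destruct (H (eps / (Cmod c + 1))) as (l & N & K); [positive|].
  exists l. split; auto. intros l' N' I. rewrite csum_scal.
  replace (c * csum f l' - c * S)%C with (c * (csum f l' - S))%C by ring. rewrite Cmod_mult.
  specialize (K l' N' I). apply Rle_trans with ((Cmod c + 1) * (eps / (Cmod c + 1))); [|right; field; lra].
  apply Rmult_le_compat; try lra. apply Cmod_ge_0.
Qed.

Lemma is_sum_minus (f g : A -> C) S S' : is_sum f S -> is_sum g S' -> is_sum (fun x => f x - g x)%C (S - S')%C.
Proof.
  intros H H'. apply is_sum_ext with (fun x => f x + (-(1)) * g x)%C; [intros; ring|].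
  replace (S - S')%C with (S + (-(1)) * S')%C by ring. apply is_sum_plus; auto. apply is_sum_scal; auto.
Qed.

Lemma is_sum_le (f : A -> C) S B : is_sum f S -> sum_bounded (fun x => Cmod (f x)) B -> Cmod S <= B.
Proof.
  intros H HB. apply le_epsilon. intros eps He. destruct (H eps He) as (l & N & K). specialize (K l N (incl_refl l)). specialize (HB l N).
  assert (T := Cmod_triangle_sub S (csum f l)). rewrite Cmod_minus_sym in T. assert (T' := csum_norm_le f l). lra.
Qed.

Lemma is_sum_nonneg_exists (g : A -> R) B : (forall x, 0 <= g x) -> sum_bounded g B ->
  exists S, S <= B /\ is_sum (fun x => RtoC (g x)) (RtoC S) /\ forall l, NoDup l -> rsum g l <= S.
Proof.
  intros Hg HB. destruct (completeness (fun y => exists l, NoDup l /\ y = rsum g l)) as [S [H1 H2]].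
  - exists B. intros y (l & N & ->). auto.
  - exists 0, []. split; [constructor|auto].
  - assert (U : forall l, NoDup l -> rsum g l <= S) by (intros l N; apply H1; exists l; auto). exists S. repeat split; auto.
    { apply H2. intros y (l & N & ->). auto. }
    intros eps He. assert (E : exists l, NoDup l /\ S - eps < rsum g l).
    { apply not_all_not_ex. intros Hn. assert (S <= S - eps); [|lra]. apply H2. intros y (l & N & ->).
      apply Rnot_lt_le. intros K. apply (Hn l); auto. }
    destruct E as (l & N & K). exists l. split; auto. intros l' N' I.
    rewrite csum_RtoC, <- RtoC_minus, Cmod_R. assert (T := rsum_incl g l l' (fun x _ => Hg x) N I).
    specialize (U l' N'). apply Rabs_le. lra.
Qed.

Lemma sum_bounded_le (f g : A -> R) B : (forall x, f x <= g x) -> sum_bounded g B -> sum_bounded f B.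
Proof. intros H HB l N. eapply Rle_trans; [|apply (HB l N)]. apply rsum_le; auto. Qed.

Lemma sum_bounded_scal (c : R) (f : A -> R) B : 0 <= c -> sum_bounded f B -> sum_bounded (fun x => c * f x) (c * B).
Proof. intros Hc H l N. rewrite rsum_scal. apply Rmult_le_compat_l; auto. Qed.

(** Split into the positive and negative parts of the real and imaginary parts; each has a supremum
    of finite sums. *)
Lemma is_sum_exists (f : A -> C) B : sum_bounded (fun x => Cmod (f x)) B -> exists S, is_sum f S.
Proof.
  intros HB. assert (key : forall g : A -> R, (forall x, 0 <= g x <= Cmod (f x)) -> exists S, is_sum (fun x => RtoC (g x)) S).
  { intros g Hg. destruct (is_sum_nonneg_exists g B) as (S & _ & HS & _).
    - intros; apply Hg. - eapply sum_bounded_le; [|exact HB]. intros; apply Hg. - eauto. }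
  destruct (key (fun x => Rmax (fst (f x)) 0)) as [S1 H1].
  { intros x. split; [apply Rmax_r|]. apply Rmax_lub; [apply Re_le_Cmod|apply Cmod_ge_0]. }
  destruct (key (fun x => Rmax (- fst (f x)) 0)) as [S2 H2].
  { intros x. split; [apply Rmax_r|]. apply Rmax_lub; [|apply Cmod_ge_0]. assert (T := Cmod_Re (f x)). apply Rabs_le_between in T. lra. }
  destruct (key (fun x => Rmax (snd (f x)) 0)) as [S3 H3].
  { intros x. split; [apply Rmax_r|]. apply Rmax_lub; [|apply Cmod_ge_0]. assert (T := Cmod_Im (f x)). apply Rabs_le_between in T. lra. }
  destruct (key (fun x => Rmax (- snd (f x)) 0)) as [S4 H4].
  { intros x. split; [apply Rmax_r|]. apply Rmax_lub; [|apply Cmod_ge_0]. assert (T := Cmod_Im (f x)). apply Rabs_le_between in T. lra. }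
  exists ((S1 - S2) + Ci * (S3 - S4))%C.
  apply is_sum_ext with (fun x => (RtoC (Rmax (fst (f x)) 0) - RtoC (Rmax (- fst (f x)) 0)) + Ci * (RtoC (Rmax (snd (f x)) 0) - RtoC (Rmax (- snd (f x)) 0)))%C.
  - intros x. assert (M : forall y, Rmax y 0 - Rmax (- y) 0 = y) by (intros y; unfold Rmax; destruct (Rle_dec y 0), (Rle_dec (- y) 0); lra).
    rewrite <- !RtoC_minus, !M. csolve.
  - apply is_sum_plus; [apply is_sum_minus; auto|apply is_sum_scal, is_sum_minus; auto].
Qed.

Lemma sum_tail (g : A -> R) B : (forall x, 0 <= g x) -> sum_bounded g B -> forall eps, 0 < eps ->
  exists l0, NoDup l0 /\ forall l, NoDup l -> (forall x, In x l -> ~ In x l0) -> rsum g l <= eps.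
Proof.
  intros Hg HB eps He. destruct (is_sum_nonneg_exists g B Hg HB) as (S & _ & HS & HU).
  destruct (HS eps He) as (l0 & N & K). exists l0. split; auto. intros l Nl Hd.
  specialize (K l0 N (incl_refl _)). rewrite csum_RtoC, <- RtoC_minus, Cmod_R in K. apply Rabs_le_between in K.
  specialize (HU (l0 ++ l)). rewrite rsum_app in HU.
  assert (NoDup (l0 ++ l)) by (apply NoDup_app_disj; auto; intros x H1 H2; apply (Hd x); auto). specialize (HU H). lra.
Qed.

Lemma is_sum_tail (f : A -> C) S l eps : is_sum f S -> NoDup l ->
  (forall l', NoDup l' -> (forall x, In x l' -> ~ In x l) -> rsum (fun x => Cmod (f x)) l' <= eps) ->
  Cmod (csum f l - S) <= eps.
Proof.
  intros H N K. apply le_epsilon. intros e He. destruct (H e He) as (l1 & N1 & K1).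
  destruct (union_incl l l1) as (l2 & N2 & I & I1). specialize (K1 l2 N2 I1).
  rewrite (csum_perm f l2 _ (perm_outside l l2 N N2 I)), csum_app in K1. specialize (K (outside l l2) (NoDup_outside _ _ N2)).
  assert (K' : rsum (fun x => Cmod (f x)) (outside l l2) <= eps).
  { apply K. intros x Hx. apply in_outside in Hx. tauto. }
  assert (T := csum_norm_le f (outside l l2)).
  replace (csum f l - S)%C with ((csum f l + csum f (outside l l2) - S) - csum f (outside l l2))%C by ring.
  eapply Rle_trans; [apply Cmod_triangle_minus|]. lra.
Qed.

Lemma is_sum_finite (f : A -> C) l : NoDup l -> (forall x, ~ In x l -> f x = 0%C) -> is_sum f (csum f l).
Proof.
  intros N H eps He. exists l. split; auto. intros l' N' I.
  rewrite (csum_perm f l' _ (perm_outside l l' N N' I)), csum_app, (csum_zero f (outside l l')).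
  - replace (csum f l + 0 - csum f l)%C with (RtoC 0) by ring. rewrite Cmod_0. lra.
  - intros x Hx. apply in_outside in Hx. apply H. tauto.
Qed.

End ListSums.

Lemma csum_map {A B : Type} (h : B -> A) (f : A -> C) (l : list B) : csum f (map h l) = csum (fun x => f (h x)) l.
Proof. induction l; simpl; auto. rewrite IHl; auto. Qed.
Lemma rsum_map {A B : Type} (h : B -> A) (f : A -> R) (l : list B) : rsum f (map h l) = rsum (fun x => f (h x)) l.
Proof. induction l; simpl; auto. rewrite IHl; auto. Qed.
Lemma csum_flat_map {A B : Type} (h : B -> list A) (f : A -> C) (l : list B) :
  csum f (flat_map h l) = csum (fun x => csum f (h x)) l.
Proof. induction l; simpl; auto. rewrite csum_app, IHl; auto. Qed.
Lemma rsum_flat_map {A B : Type} (h : B -> list A) (f : A -> R) (l : list B) :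
  rsum f (flat_map h l) = rsum (fun x => rsum f (h x)) l.
Proof. induction l; simpl; auto. rewrite rsum_app, IHl; auto. Qed.

Lemma csum_swap {A B : Type} (f : A -> B -> C) (l : list A) (l' : list B) :
  csum (fun x => csum (f x) l') l = csum (fun y => csum (fun x => f x y) l) l'.
Proof.
  induction l; simpl; [rewrite csum_zero; auto|]. rewrite IHl, csum_plus. auto.
Qed.
Lemma rsum_swap {A B : Type} (f : A -> B -> R) (l : list A) (l' : list B) :
  rsum (fun x => rsum (f x) l') l = rsum (fun y => rsum (fun x => f x y) l) l'.
Proof.
  induction l; simpl; [induction l'; simpl; auto; rewrite <- IHl'; ring|]. rewrite IHl, rsum_plus. auto.
Qed.

Lemma NoDup_flat_map {A B : Type} (h : B -> list A) (l : list B) : NoDup l -> (forall b, In b l -> NoDup (h b)) ->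
  (forall b b' a, In b l -> In b' l -> In a (h b) -> In a (h b') -> b = b') -> NoDup (flat_map h l).
Proof.
  induction l as [|b l IH]; simpl; intros N H1 H2; [constructor|]. inversion N; subst. apply NoDup_app_disj; auto.
  - apply IH; auto. intros; eapply H2; eauto.
  - intros x Hx K. apply in_flat_map in K. destruct K as (b' & I & J). assert (b = b') by (eapply H2; eauto). subst. contradiction.
Qed.

(** Unions of finitely many whole fibres are finite sets, and those over a large enough set of
    indices contain any prescribed finite set. *)
Lemma is_sum_fiber {A B : Type} (f : A -> C) (S : C) (pi : A -> B) (fib : B -> list A) : is_sum f S ->
  (forall b, NoDup (fib b)) -> (forall a b, In a (fib b) <-> pi a = b) -> is_sum (fun b => csum f (fib b)) S.
Proof.
  intros H Hn Hin eps He. destruct (H eps He) as (l & N & K). exists (nodup eqd (map pi l)). split; [apply NoDup_nodup|]. intros l' N' I.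
  rewrite <- csum_flat_map. apply K.
  - apply NoDup_flat_map; auto. intros b b' a _ _ I1 I2. apply Hin in I1. apply Hin in I2. congruence.
  - intros a Ha. apply in_flat_map. exists (pi a). split; [|apply Hin; auto]. apply I, nodup_In, in_map; auto.
Qed.

Lemma csum_list_prod {A B : Type} (f : A -> C) (g : B -> C) (l : list A) (l' : list B) :
  csum (fun p => f (fst p) * g (snd p))%C (list_prod l l') = (csum f l * csum g l')%C.
Proof. induction l; simpl; [ring|]. rewrite csum_app, IHl, csum_map. simpl. rewrite csum_scal. ring. Qed.

Lemma rsum_list_prod {A B : Type} (f : A -> R) (g : B -> R) (l : list A) (l' : list B) :
  rsum (fun p => f (fst p) * g (snd p)) (list_prod l l') = rsum f l * rsum g l'.
Proof. induction l; simpl; [ring|]. rewrite rsum_app, IHl, rsum_map. simpl. rewrite rsum_scal. ring. Qed.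

Lemma NoDup_list_prod {A B : Type} (l : list A) (l' : list B) : NoDup l -> NoDup l' -> NoDup (list_prod l l').
Proof.
  intros N N'. induction N as [|x l Hx N IH]; simpl; [constructor|]. apply NoDup_app_disj; auto.
  - apply FinFun.Injective_map_NoDup; auto. intros y y' E; congruence.
  - intros [a b] H K. apply in_map_iff in H. destruct H as (y & E & _). apply in_prod_iff in K. inversion E; subst. tauto.
Qed.

Lemma sum_bounded_prod {A B : Type} (f : A -> R) (g : B -> R) (K K' : R) : (forall x, 0 <= f x) -> (forall x, 0 <= g x) ->
  sum_bounded f K -> sum_bounded g K' -> sum_bounded (fun p => f (fst p) * g (snd p)) (K * K').
Proof.
  intros Hf Hg H H' l N. set (l1 := nodup eqd (map fst l)). set (l2 := nodup eqd (map snd l)).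
  assert (N1 : NoDup l1) by apply NoDup_nodup. assert (N2 : NoDup l2) by apply NoDup_nodup.
  eapply Rle_trans; [apply (rsum_incl _ l (list_prod l1 l2)); auto|].
  - intros; apply Rmult_le_pos; auto.
  - intros [a b] I. apply in_prod; apply nodup_In; [apply (in_map fst _ _ I)|apply (in_map snd _ _ I)].
  - rewrite rsum_list_prod. apply Rmult_le_compat; auto; apply rsum_nonneg; auto.
Qed.

(** The product family is absolutely summable, so its value may be computed along rectangles of
    finite sets, where it factors. *)
Lemma is_sum_prod {A B : Type} (f : A -> C) (g : B -> C) (F G : C) (K K' : R) :
  sum_bounded (fun x => Cmod (f x)) K -> sum_bounded (fun x => Cmod (g x)) K' -> is_sum f F -> is_sum g G ->
  is_sum (fun p => f (fst p) * g (snd p))%C (F * G)%C.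
Proof.
  intros HK HK' HF HG. destruct (is_sum_exists (fun p => f (fst p) * g (snd p))%C (K * K')) as [S HS].
  { eapply sum_bounded_le; [|apply (sum_bounded_prod (fun x => Cmod (f x)) (fun x => Cmod (g x)) K K'); auto; intros; apply Cmod_ge_0].
    intros x; simpl; rewrite Cmod_mult; lra. }
  assert (S = F * G)%C as <-; auto. apply Ceq_minus, Cmod_zero_all. intros eps He. assert (PF := Cmod_ge_0 F). assert (PG := Cmod_ge_0 G).
  set (e := Rmin 1 (eps / 2 / (Cmod F + Cmod G + 2))). assert (He' : 0 < e) by (apply Rmin_pos; [lra|repeat positive]).
  assert (e1 : e <= 1) by apply Rmin_l. assert (e2 : e * (Cmod F + Cmod G + 2) <= eps / 2).
  { apply Rle_trans with (eps / 2 / (Cmod F + Cmod G + 2) * (Cmod F + Cmod G + 2)).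
    apply Rmult_le_compat_r; [lra|apply Rmin_r]. right; field; lra. }
  destruct (HS (eps / 2)) as (l & N & L); [lra|]. destruct (HF e He') as (lf & Nf & Lf). destruct (HG e He') as (lg & Ng & Lg).
  destruct (union_incl lf (map fst l)) as (l1 & N1 & I1 & J1). destruct (union_incl lg (map snd l)) as (l2 & N2 & I2 & J2).
  specialize (L (list_prod l1 l2) (NoDup_list_prod _ _ N1 N2)).
  rewrite csum_list_prod in L. specialize (Lf l1 N1 I1). specialize (Lg l2 N2 I2). assert (I : incl l (list_prod l1 l2)).
  { intros [a b] I. apply in_prod; [apply J1, (in_map fst _ _ I)|apply J2, (in_map snd _ _ I)]. }
  specialize (L I). set (f1 := csum f l1) in *. set (g1 := csum g l2) in *.
  assert (T := Cmod_triangle3 S (f1 * g1) (F * G)). rewrite (Cmod_minus_sym S (f1 * g1)) in T.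
  replace (f1 * g1 - F * G)%C with ((f1 - F) * (g1 - G) + (f1 - F) * G + F * (g1 - G))%C in T by ring.
  assert (T1 := Cmod_triangle ((f1 - F) * (g1 - G) + (f1 - F) * G) (F * (g1 - G))).
  assert (T2 := Cmod_triangle ((f1 - F) * (g1 - G)) ((f1 - F) * G)). rewrite !Cmod_mult in T1, T2.
  assert (P1 : 0 <= Cmod (f1 - F)) by apply Cmod_ge_0. assert (P2 : 0 <= Cmod (g1 - G)) by apply Cmod_ge_0.
  assert (Q1 : Cmod (f1 - F) * Cmod (g1 - G) <= e * 1) by (apply Rmult_le_compat; lra).
  assert (Q2 : Cmod (f1 - F) * Cmod G <= e * Cmod G) by (apply Rmult_le_compat_r; lra).
  assert (Q3 : Cmod F * Cmod (g1 - G) <= Cmod F * e) by (apply Rmult_le_compat_l; lra). rewrite (Cmod_mult (f1 - F) G) in T2. lra.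
Qed.

Lemma cder_csum {A : Type} (T : A -> C -> C) (D : A -> C) (z : C) (l : list A) : (forall a, In a l -> cder (T a) z (D a)) ->
  cder (fun w => csum (fun a => T a w) l) z (csum D l).
Proof.
  induction l; simpl; intros H; [apply cder_const|]. apply (cder_plus (T a)); auto.
Qed.

(* Cauchy's estimates make the second-order Taylor remainders summable. *)
Lemma is_sum_cder {A : Type} (T : A -> C -> C) (F : C -> C) (M : A -> R) (B : R) (c : C) (r R0 : R) :
  0 < r -> r < R0 -> (forall a, holo (T a) c R0) -> (forall a z, Cmod (z - c) <= r -> Cmod (T a z) <= M a) ->
  sum_bounded M B -> (forall z, Cmod (z - c) <= r / 2 -> is_sum (fun a => T a z) (F z)) ->
  exists D, is_sum (fun a => Cderiv (T a) c) D /\ cder F c D.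
Proof.
  intros Hr HR HT HM HB HF. assert (Hcc : Cmod (c - c) = 0) by (replace (c - c)%C with (RtoC 0) by ring; apply Cmod_0).
  assert (HB0 : 0 <= B) by (apply (HB []); constructor). destruct (is_sum_exists (fun a => Cderiv (T a) c) (/ r * B)) as [D HD].
  { eapply sum_bounded_le; [|apply sum_bounded_scal; [left; apply Rinv_0_lt_compat; auto|exact HB]].
    intros a. simpl. rewrite Rmult_comm. apply (cauchy_deriv_bound (T a) c r R0); auto. intros z Hz. apply HM; lra. }
  exists D. split; auto. apply cder_of_quadratic with (B := (2 / r ^ 2) * B) (de := r / 2); [|lra|].
  { apply Rmult_le_pos; auto. left. positive. }
  intros h Hh. assert (S1 : is_sum (fun a => T a (c + h)%C - T a c - h * Cderiv (T a) c)%C (F (c + h)%C - F c - h * D)%C).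
  { apply is_sum_minus; [apply is_sum_minus|apply is_sum_scal; auto]; apply HF; [|lra]. replace (c + h - c)%C with h by ring. lra. }
  rewrite (Cmult_comm D). eapply is_sum_le; [exact S1|]. replace (2 / r ^ 2 * B * Cmod h ^ 2) with ((2 / r ^ 2 * Cmod h ^ 2) * B) by ring.
  eapply sum_bounded_le; [|apply sum_bounded_scal; [|exact HB]].
  - intros a. simpl. rewrite (Cmult_comm h). eapply Rle_trans; [apply (cauchy_taylor1 (T a) c h r R0 (M a)); auto; [|lra]|].
    + intros z Hz. apply HM; lra.
    + simpl. right; ring.
  - apply Rmult_le_pos; [|apply pow_le, Cmod_ge_0]. left. positive.
Qed.

Lemma rcont_csum {A : Type} (T : A -> R -> C) (l : list A) (t : R) : (forall a, rcont (T a) t) -> rcont (fun s => csum (fun a => T a s) l) t.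
Proof. intros H. induction l; simpl; [apply rcont_const|]. apply (rcont_plus (T a)); auto. Qed.

Lemma CI_csum {A : Type} (T : A -> R -> C) (l : list A) (a b : R) : (forall x, rcont_on (T x) a b) ->
  CI (fun t => csum (fun x => T x t) l) a b = csum (fun x => CI (T x) a b) l.
Proof.
  intros H. induction l; simpl; [rewrite CI_const; ring|]. rewrite (CI_plus (T a0)); auto.
  - rewrite IHl; auto.
  - intros t Ht. apply rcont_csum. intros x. apply H; auto.
Qed.

(** A finite set carries all but eps/(b - a + 1) of the majorant; on it sum and integral commute,
    and the rest is small uniformly in t. *)
Lemma is_sum_CI {A : Type} (T : A -> R -> C) (F : R -> C) (M : A -> R) (B a b : R) : a <= b ->
  (forall x, rcont_on (T x) a b) -> rcont_on F a b -> (forall x t, a <= t <= b -> Cmod (T x t) <= M x) ->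
  sum_bounded M B -> (forall t, a <= t <= b -> is_sum (fun x => T x t) (F t)) ->
  is_sum (fun x => CI (T x) a b) (CI F a b).
Proof.
  intros Hab HT HF HM HB HS eps He.
  assert (HM0 : forall x, 0 <= M x) by (intros x; eapply Rle_trans; [apply Cmod_ge_0|apply (HM x a); lra]).
  destruct (sum_tail M B HM0 HB (eps / (b - a + 1))) as (l0 & N0 & K0); [positive|]. exists l0. split; auto. intros l N I.
  rewrite <- CI_csum, <- CI_minus; auto.
  2:{ intros t Ht. apply rcont_csum. intros x. apply HT; auto. }
  apply Rle_trans with (eps / (b - a + 1) * Rabs (b - a)).
  - apply CI_bound.
    + intros t Ht. apply rcont_minus; [|auto]. apply rcont_csum. intros x; apply HT; auto.
    + intros t Ht. rewrite Rmin_left, Rmax_right in Ht by lra.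
      apply is_sum_tail; auto. intros l' N' D. eapply Rle_trans; [|apply (K0 l' N')].
      * apply rsum_le. intros; apply HM; auto.
      * intros x Hx K. apply (D x Hx). apply I; auto.
  - rewrite Rabs_right by lra. apply Rle_trans with (eps / (b - a + 1) * (b - a + 1)); [|right; field; lra].
    apply Rmult_le_compat_l; [left; positive|lra].
Qed.

(** * Arithmetic of Gaussian integers *)

Definition gadd (x y : gauss) : gauss := ((fst x + fst y)%Z, (snd x + snd y)%Z).
Definition gopp (x : gauss) : gauss := ((- fst x)%Z, (- snd x)%Z).
Definition gsub (x y : gauss) : gauss := gadd x (gopp y).
Definition g0 : gauss := (0%Z, 0%Z).
Definition g1 : gauss := (1%Z, 0%Z).
Definition gN (x : gauss) : Z := (fst x * fst x + snd x * snd x)%Z.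
Definition gconj (x : gauss) : gauss := (fst x, (- snd x)%Z).

Lemma gauss_ring : ring_theory g0 g1 gadd gmul gsub gopp eq.
Proof.
  constructor; intros; repeat match goal with x : gauss |- _ => destruct x end;
    unfold gsub, gadd, gmul, gopp, g0, g1; cbn [fst snd]; f_equal; ring.
Qed.
Add Ring gauss_ring : gauss_ring.

Fixpoint gpow (x : gauss) (n : nat) : gauss := match n with O => g1 | S n => gmul x (gpow x n) end.

Lemma gN_mul (x y : gauss) : gN (gmul x y) = (gN x * gN y)%Z.
Proof. destruct x, y; unfold gN, gmul; simpl; ring. Qed.
Lemma gN_nonneg (x : gauss) : (0 <= gN x)%Z.
Proof. unfold gN. nia. Qed.
Lemma gN_eq0 (x : gauss) : gN x = 0%Z -> x = g0.
Proof. destruct x as [a b]; unfold gN, g0; simpl. intros. assert (a = 0 /\ b = 0)%Z as [-> ->] by nia. auto. Qed.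
Lemma gN_pos (x : gauss) : x <> g0 -> (0 < gN x)%Z.
Proof. intros H. assert (P := gN_nonneg x). destruct (Z.eq_dec (gN x) 0) as [E|E]; [apply gN_eq0 in E; contradiction|lia]. Qed.
Lemma gmul_neq0 (x y : gauss) : x <> g0 -> y <> g0 -> gmul x y <> g0.
Proof.
  intros Hx Hy E. apply gN_pos in Hx. apply gN_pos in Hy. assert (gN (gmul x y) = 0%Z) by (rewrite E; auto). rewrite gN_mul in H. nia.
Qed.
Lemma gmul_cancel (x y z : gauss) : x <> g0 -> gmul x y = gmul x z -> y = z.
Proof.
  intros Hx E. assert (E2 : gmul x (gsub y z) = g0) by (replace (gmul x (gsub y z)) with (gsub (gmul x y) (gmul x z)) by ring; rewrite E; ring).
  destruct (excluded_middle_informative (gsub y z = g0)) as [H|H].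
  - replace y with (gadd (gsub y z) z) by ring. rewrite H. ring.
  - exfalso. apply (gmul_neq0 x _ Hx H E2).
Qed.

Lemma gdivision (a b : gauss) : b <> g0 -> exists q r, a = gadd (gmul b q) r /\ (gN r < gN b)%Z.
Proof.
  intros Hb. apply gN_pos in Hb. set (n := gN b) in *. set (w := gmul a (gconj b)).
  (* Floor of y + 1/2, that is, rounding the coordinates of a conj(b)/N(b) to the nearest integer;
     the remainder then has norm at most N(b)/2. *)
  set (q1 := ((2 * fst w + n) / (2 * n))%Z). set (q2 := ((2 * snd w + n) / (2 * n))%Z).
  set (q := (q1, q2) : gauss). set (r := gsub a (gmul b q)). exists q, r. split; [unfold r; ring|].
  assert (E : (gN r * n = (fst w - n * q1) * (fst w - n * q1) + (snd w - n * q2) * (snd w - n * q2))%Z).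
  { replace (gN r * n)%Z with (gN (gmul r (gconj b))).
    2:{ rewrite gN_mul. f_equal. unfold n, gN, gconj; simpl; ring. }
    unfold r, q, w, n. destruct a as [a1 a2], b as [b1 b2]. unfold gsub, gadd, gopp, gmul, gconj, gN; simpl. ring. }
  assert (B1 := Z.div_mod (2 * fst w + n) (2 * n) ltac:(lia)). assert (C1 := Z.mod_pos_bound (2 * fst w + n) (2 * n) ltac:(lia)).
  assert (B2 := Z.div_mod (2 * snd w + n) (2 * n) ltac:(lia)). assert (C2 := Z.mod_pos_bound (2 * snd w + n) (2 * n) ltac:(lia)).
  fold q1 in B1. fold q2 in B2. set (e1 := (fst w - n * q1)%Z) in *. set (e2 := (snd w - n * q2)%Z) in *. nia.
Qed.

Lemma gdvd_refl (x : gauss) : in_ideal x x.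
Proof. exists g1. ring. Qed.
Lemma gdvd_trans (x y z : gauss) : in_ideal x y -> in_ideal y z -> in_ideal x z.
Proof. intros [u ->] [v ->]. exists (gmul u v). ring. Qed.
Lemma gdvd_mul_r (x y z : gauss) : in_ideal x y -> in_ideal x (gmul y z).
Proof. intros [u ->]. exists (gmul u z). ring. Qed.
Lemma gdvd_mul_l (x y z : gauss) : in_ideal x y -> in_ideal x (gmul z y).
Proof. intros [u ->]. exists (gmul u z). ring. Qed.
Lemma gdvd_le (x y : gauss) : y <> g0 -> in_ideal x y -> (gN x <= gN y)%Z.
Proof.
  intros Hy [u ->]. rewrite gN_mul. assert (u <> g0) by (intros ->; apply Hy; ring). apply gN_pos in H. assert (P := gN_nonneg x). nia.
Qed.

Definition gunits : list gauss := [(1, 0)%Z; (-1, 0)%Z; (0, 1)%Z; (0, -1)%Z].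

Lemma gunits_N (u : gauss) : In u gunits <-> gN u = 1%Z.
Proof.
  split.
  - simpl. intros [<-|[<-|[<-|[<-|[]]]]]; reflexivity.
  - destruct u as [a b]. unfold gN; simpl. intros H. assert (a = 0 \/ a = 1 \/ a = -1)%Z by nia. assert (b = 0 \/ b = 1 \/ b = -1)%Z by nia.
    destruct H0 as [->|[->| ->]], H1 as [->|[->| ->]]; simpl in *; auto; lia.
Qed.
Lemma NoDup_gunits : NoDup gunits.
Proof. repeat constructor; simpl; intuition congruence. Qed.
Lemma gunit_inv (u : gauss) : In u gunits -> exists v, In v gunits /\ gmul u v = g1.
Proof.
  intros H. exists (gconj u). rewrite gunits_N in *. destruct u as [a b]. unfold gN, gconj, gmul, g1 in *; simpl in *.
  split; [lia|]. f_equal; lia.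
Qed.
Lemma gunit_iff (u : gauss) : In u gunits <-> in_ideal u g1.
Proof.
  split.
  - intros H. destruct (gunit_inv u H) as (v & _ & E). exists v. auto.
  - intros [v E]. apply gunits_N. assert (H : gN g1 = (gN u * gN v)%Z) by (rewrite E; apply gN_mul).
    change (gN g1) with 1%Z in H. assert (P := gN_nonneg u). destruct (Z.eq_mul_1_nonneg (gN u) (gN v)); auto.
Qed.
Lemma gunit_mul (u v : gauss) : In u gunits -> In v gunits -> In (gmul u v) gunits.
Proof. rewrite !gunits_N, gN_mul. intros -> ->. reflexivity. Qed.
Lemma gdvd_unit_l (u x y : gauss) : In u gunits -> (in_ideal (gmul u x) y <-> in_ideal x y).
Proof.
  intros Hu. destruct (gunit_inv u Hu) as (v & _ & E). split; intros [z ->].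
  - exists (gmul u z). ring.
  - exists (gmul v z). replace (gmul (gmul u x) (gmul v z)) with (gmul (gmul u v) (gmul x z)) by ring. rewrite E. ring.
Qed.

Notation gprime := prime_ideal_gen.

Lemma gprime_neq0 (p : gauss) : gprime p -> p <> g0.
Proof. intros (H & _). exact H. Qed.
Lemma gprime_N (p : gauss) : gprime p -> (2 <= gN p)%Z.
Proof.
  intros (H & H1 & _). apply gN_pos in H. destruct (Z.eq_dec (gN p) 1) as [E|E]; [|lia]. exfalso. apply H1, gunit_iff, gunits_N, E.
Qed.
Lemma gprime_unit (u p : gauss) : In u gunits -> gprime p -> gprime (gmul u p).
Proof.
  intros Hu (H & H1 & H2). assert (U0 : u <> g0) by (intros ->; apply gunits_N in Hu; discriminate).
  split; [apply gmul_neq0; auto|]. split; [rewrite gdvd_unit_l; auto|].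
  intros y z K. rewrite gdvd_unit_l in K by auto. rewrite !gdvd_unit_l by auto. auto.
Qed.

(* The Bezout argument: a nonzero element of least norm in the ideal (p, y) divides both. *)
Lemma girreducible_prime (p : gauss) : p <> g0 -> ~ In p gunits ->
  (forall y z, p = gmul y z -> In y gunits \/ In z gunits) -> gprime p.
Proof.
  intros Hp Hu Hirr. split; [exact Hp|]. split; [rewrite <- gunit_iff; auto|].
  intros y z Hyz. destruct (excluded_middle_informative (in_ideal p y)) as [|Hy]; auto. right.
  set (P := fun n => exists a b, gadd (gmul p a) (gmul y b) <> g0 /\ n = Z.to_nat (gN (gadd (gmul p a) (gmul y b)))).
  assert (HP : exists n, P n).
  { exists (Z.to_nat (gN p)). exists g1, g0. replace (gadd (gmul p g1) (gmul y g0)) with p by ring. auto. }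
  destruct (dec_inh_nat_subset_has_unique_least_element P) as (n & [(a & b & Hg & En) Hmin] & _).
  { intros n; apply classic. } { exact HP. }
  set (g := gadd (gmul p a) (gmul y b)) in *. assert (Hdiv : forall x, (exists a b, x = gadd (gmul p a) (gmul y b)) -> in_ideal g x).
  { intros x (a' & b' & Ex). destruct (gdivision x g Hg) as (q & r & E & Hr).
    destruct (excluded_middle_informative (r = g0)) as [->|Hr0]; [exists q; rewrite E; ring|].
    exfalso. assert (n <= Z.to_nat (gN r))%nat; [|assert (P1 := gN_nonneg r); lia].
    apply Hmin. exists (gsub a' (gmul a q)), (gsub b' (gmul b q)).
    replace (gadd (gmul p (gsub a' (gmul a q))) (gmul y (gsub b' (gmul b q)))) with r; auto.
    replace r with (gsub x (gmul g q)) by (rewrite E; ring). rewrite Ex. unfold g. ring. }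
  destruct (Hdiv p) as [w Ew]. { exists g1, g0. ring. }
  assert (Hgy : in_ideal g y). { apply Hdiv. exists g0, g1. ring. }
  destruct (Hirr g w Ew) as [Ug|Uw].
  - destruct (gunit_inv g Ug) as (v & _ & Ev). replace z with (gmul v (gadd (gmul p (gmul a z)) (gmul b (gmul y z)))).
    + apply gdvd_mul_l. destruct Hyz as [t Et]. rewrite Et. exists (gadd (gmul a z) (gmul b t)). ring.
    + replace (gmul v (gadd (gmul p (gmul a z)) (gmul b (gmul y z)))) with (gmul (gmul g v) z) by (unfold g; ring). rewrite Ev. ring.
  - exfalso. apply Hy. apply gdvd_trans with g; auto. rewrite Ew.
    replace (gmul g w) with (gmul w g) by ring. apply gdvd_unit_l; auto. apply gdvd_refl.
Qed.

(** A nonunit divisor of least norm is irreducible. *)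
Lemma gprime_divisor (x : gauss) : x <> g0 -> ~ In x gunits -> exists p, gprime p /\ in_ideal p x.
Proof.
  intros Hx Hu. set (P := fun n => exists d, in_ideal d x /\ ~ In d gunits /\ n = Z.to_nat (gN d)).
  destruct (dec_inh_nat_subset_has_unique_least_element P) as (n & [(d & Hd & Hdu & En) Hmin] & _).
  { intros n; apply classic. } { exists (Z.to_nat (gN x)), x. repeat split; auto using gdvd_refl. }
  assert (d0 : d <> g0). { intros ->. destruct Hd as [z E]. apply Hx. rewrite E. ring. }
  exists d. split; auto. apply girreducible_prime; auto. intros y z E. destruct (classic (In y gunits)) as [|Hy]; auto. right.
  assert (n <= Z.to_nat (gN y))%nat.
  { apply Hmin. exists y. repeat split; auto. apply gdvd_trans with d; auto. exists z; auto. }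
  apply gunits_N. assert (EN : gN d = (gN y * gN z)%Z) by (rewrite E; apply gN_mul). assert (P1 := gN_pos d d0). nia.
Qed.

Lemma gpow_add (x : gauss) (m n : nat) : gpow x (m + n) = gmul (gpow x m) (gpow x n).
Proof. induction m; simpl; [ring|]. rewrite IHm. ring. Qed.
Lemma gpow_neq0 (x : gauss) (n : nat) : x <> g0 -> gpow x n <> g0.
Proof. intros H. induction n; simpl; [discriminate|]. apply gmul_neq0; auto. Qed.
Lemma gN_gpow (x : gauss) (n : nat) : gN (gpow x n) = (gN x ^ Z.of_nat n)%Z.
Proof. induction n; [reflexivity|]. rewrite Nat2Z.inj_succ, Z.pow_succ_r by lia. simpl gpow. rewrite gN_mul, IHn. auto. Qed.

Lemma gprime_pow (p x : gauss) (m : nat) : gprime p -> in_ideal p (gpow x m) -> in_ideal p x.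
Proof.
  intros Hp. induction m; simpl; intros H.
  - exfalso. destruct Hp as (_ & H1 & _). apply H1, H.
  - destruct Hp as (_ & _ & H2). destruct (H2 _ _ H); auto.
Qed.

Lemma gprime_dvd_prime (p q : gauss) : gprime p -> gprime q -> in_ideal p q -> exists u, In u gunits /\ q = gmul u p.
Proof.
  intros Hp Hq [w E]. destruct Hq as (Hq0 & Hq1 & Hq2). destruct Hp as (Hp0 & Hp1 & _). destruct (Hq2 p w) as [[z Ez]|[z Ez]].
  - rewrite <- E. apply gdvd_refl.
  - exists w. split; [|rewrite E; ring]. apply gunit_iff. exists z. apply (gmul_cancel q); auto. rewrite Ez in E. rewrite E at 1. ring.
  - exfalso. apply Hp1. exists z. apply (gmul_cancel q); auto. rewrite Ez in E. rewrite E at 1. change (1%Z, 0%Z) with g1. ring.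
Qed.

(** * The von Mangoldt function on Gaussian integers *)

Definition is_pp (x p : gauss) (m : nat) : Prop := gprime p /\ (1 <= m)%nat /\ exists u, In u gunits /\ x = gmul u (gpow p m).

Lemma is_pp_unique (x p q : gauss) (m n : nat) : is_pp x p m -> is_pp x q n -> gN p = gN q.
Proof.
  intros (Hp & Hm & u & Hu & E) (Hq & Hn & v & Hv & F). assert (D : in_ideal p (gpow q n)).
  { destruct (gunit_inv v Hv) as (v' & _ & Ev).
    replace (gpow q n) with (gmul v' x) by (rewrite F; replace (gmul v' (gmul v (gpow q n))) with (gmul (gmul v v') (gpow q n)) by ring; rewrite Ev; ring).
    apply gdvd_mul_l. rewrite E. apply gdvd_mul_l. destruct m; [lia|]. simpl. apply gdvd_mul_r, gdvd_refl. }
  apply gprime_pow in D; auto. destruct (gprime_dvd_prime p q Hp Hq D) as (w & Hw & ->).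
  rewrite gN_mul. apply gunits_N in Hw. rewrite Hw. lia.
Qed.

(** The value depends only on the ideal generated by [x]. The prime is picked by choice, harmlessly:
    all candidates have the same norm by [is_pp_unique]. *)
Definition Lam (x : gauss) : R :=
  if excluded_middle_informative (exists p m, is_pp x p m)
  then ln (IZR (gN (epsilon (inhabits g0) (fun p => exists m, is_pp x p m)))) else 0.

Lemma Lam_pp (x p : gauss) (m : nat) : is_pp x p m -> Lam x = ln (IZR (gN p)).
Proof.
  intros H. unfold Lam. destruct (excluded_middle_informative _) as [E|E]; [|exfalso; eauto].
  destruct (epsilon_spec (inhabits g0) (fun p => exists m, is_pp x p m)) as [n Hn]; [eauto|].
  f_equal. f_equal. apply (is_pp_unique x _ _ n m); auto.
Qed.

Lemma Lam_cases (x : gauss) : (exists p m, is_pp x p m) \/ Lam x = 0.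
Proof. unfold Lam. destruct (excluded_middle_informative _); auto. Qed.

Lemma Lam_nonneg (x : gauss) : 0 <= Lam x.
Proof.
  destruct (Lam_cases x) as [(p & m & H)|E]; [|lra]. rewrite (Lam_pp x p m H).
  rewrite <- ln_1. apply ln_le; [lra|]. apply IZR_le. assert (P := gprime_N p (proj1 H)). lia.
Qed.

Lemma is_pp_N (x p : gauss) (m : nat) : is_pp x p m -> gN x = (gN p ^ Z.of_nat m)%Z.
Proof.
  intros (_ & _ & u & Hu & ->). rewrite gN_mul, gN_gpow. apply gunits_N in Hu. rewrite Hu. lia.
Qed.

Lemma is_pp_dvd (x p : gauss) (m : nat) : is_pp x p m -> in_ideal p x.
Proof. intros (_ & Hm & u & Hu & ->). apply gdvd_mul_l. destruct m; [lia|]. simpl. apply gdvd_mul_r, gdvd_refl. Qed.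

Lemma is_pp_neq0 (x p : gauss) (m : nat) : is_pp x p m -> x <> g0.
Proof.
  intros (Hp & _ & u & Hu & ->). apply gmul_neq0; [intros ->; apply gunits_N in Hu; discriminate|]. apply gpow_neq0, gprime_neq0; auto.
Qed.

Lemma Lam_le (x : gauss) : x <> g0 -> Lam x <= ln (IZR (gN x)).
Proof.
  intros Hx. apply gN_pos in Hx as Hx'. destruct (Lam_cases x) as [(p & m & H)|E].
  - rewrite (Lam_pp x p m H). assert (P := gprime_N p (proj1 H)). apply ln_le; [apply IZR_lt; lia|].
    apply IZR_le. apply gdvd_le; auto. eapply is_pp_dvd; eauto.
  - rewrite E. rewrite <- ln_1. apply ln_le; [lra|]. apply IZR_le. lia.
Qed.

Lemma Lam_unit (u : gauss) : In u gunits -> Lam u = 0.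
Proof.
  intros Hu. destruct (Lam_cases u) as [(p & m & H)|E]; auto. exfalso. destruct H as (Hp & Hm & H). apply gunits_N in Hu.
  assert (D := gdvd_le p u). assert (P := gprime_N p Hp).
  assert (gN p <= gN u)%Z; [|lia]. apply D. intros ->; discriminate. eapply is_pp_dvd. split; eauto.
Qed.

Definition zrange (n : nat) : list Z := map (fun k => (Z.of_nat k - Z.of_nat n)%Z) (seq 0 (2 * n + 1)).
Definition box (n : nat) : list gauss := list_prod (zrange n) (zrange n).

Lemma in_zrange (n : nat) (z : Z) : In z (zrange n) <-> (- Z.of_nat n <= z <= Z.of_nat n)%Z.
Proof.
  unfold zrange. rewrite in_map_iff. split.
  - intros (k & <- & H). apply in_seq in H. lia.
  - intros H. exists (Z.to_nat (z + Z.of_nat n)). split; [lia|]. apply in_seq. lia.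
Qed.
Lemma NoDup_zrange (n : nat) : NoDup (zrange n).
Proof. apply FinFun.Injective_map_NoDup; [intros x y H; lia|apply seq_NoDup]. Qed.
Lemma NoDup_box (n : nat) : NoDup (box n).
Proof. apply NoDup_list_prod; apply NoDup_zrange. Qed.
Lemma in_box (n : nat) (x : gauss) : In x (box n) <-> (Z.abs (fst x) <= Z.of_nat n /\ Z.abs (snd x) <= Z.of_nat n)%Z.
Proof. destruct x as [a b]. unfold box. split; intros H; [apply in_prod_iff in H|apply in_prod_iff]; rewrite !in_zrange in *; simpl in *; lia. Qed.
Lemma in_box_N (n : nat) (x : gauss) : (gN x <= Z.of_nat n)%Z -> In x (box n).
Proof. rewrite in_box. unfold gN. destruct x as [a b]; simpl. intros H. split; nia. Qed.

(** Divisors are listed with all their associates, so each ideal divisor occurs four times; this is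
    the 4 in [Lam_divisor_sum]. *)
Definition gdivs (x : gauss) : list gauss :=
  filter (fun d => if excluded_middle_informative (in_ideal d x) then true else false) (box (Z.to_nat (gN x))).

Lemma in_gdivs (x d : gauss) : x <> g0 -> (In d (gdivs x) <-> in_ideal d x).
Proof.
  intros Hx. unfold gdivs. rewrite filter_In. destruct (excluded_middle_informative _) as [H|H]; split; try tauto; try (intros [_ K]; discriminate).
  intros _. split; auto. apply in_box_N. rewrite Z2Nat.id by apply gN_nonneg. apply gdvd_le; auto.
Qed.
Lemma NoDup_gdivs (x : gauss) : NoDup (gdivs x).
Proof. apply NoDup_filter, NoDup_box. Qed.

Lemma coprime_pow_dvd (q p x : gauss) (m : nat) : gprime q -> ~ in_ideal q p -> in_ideal (gpow q m) (gmul p x) -> in_ideal (gpow q m) x.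
Proof.
  intros Hq Hqp. revert x. induction m; intros x H.
  - exists x. simpl. ring.
  - simpl in H. assert (D : in_ideal q (gmul p x)) by (eapply gdvd_trans; [apply gdvd_mul_r, gdvd_refl|exact H]).
    destruct Hq as (Hq0 & Hq1 & Hq2). destruct (Hq2 _ _ D) as [|[y ->]]; [contradiction|]. destruct (IHm y) as [z ->].
    + destruct H as [z Ez]. exists z. apply (gmul_cancel q); auto.
      replace (gmul q (gmul p y)) with (gmul p (gmul q y)) by ring. rewrite Ez. ring.
    + exists z. simpl. ring.
Qed.

Lemma exists_last (P : nat -> Prop) (B : nat) : P 0%nat -> ~ P B -> exists v, P v /\ ~ P (S v).
Proof.
  intros H0. induction B; intros HB; [contradiction|]. destruct (classic (P B)); eauto.
Qed.

Lemma gpow_dvd_mono (p x : gauss) (m n : nat) : (m <= n)%nat -> in_ideal (gpow p n) x -> in_ideal (gpow p m) x.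
Proof.
  intros H. apply gdvd_trans. replace n with (m + (n - m))%nat by lia. rewrite gpow_add. apply gdvd_mul_r, gdvd_refl.
Qed.

Lemma rsum_same_support {A : Type} (f : A -> R) (l l' : list A) : NoDup l -> NoDup l' -> incl l l' ->
  (forall x, In x l' -> ~ In x l -> f x = 0) -> rsum f l' = rsum f l.
Proof.
  intros N N' I H. rewrite (rsum_perm f l' _ (perm_outside l l' N N' I)), rsum_app.
  rewrite (rsum_ext f (fun _ => 0) (outside l l')); [rewrite rsum_const; ring|]. intros x Hx. apply in_outside in Hx. apply H; tauto.
Qed.

(** Induction on the norm through x = p x'. Among the divisors of [x] that do not divide x', the
    only prime powers are the four associates of p^(v+1), where p^v is the exact power of p in x';
    each contributes ln N(p). *)
Lemma Lam_divisor_sum (x : gauss) : x <> g0 -> rsum Lam (gdivs x) = 4 * ln (IZR (gN x)).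
Proof.
  remember (Z.to_nat (gN x)) as n eqn:En. revert x En. induction n as [n IH] using lt_wf_ind. intros x En Hx. apply gN_pos in Hx as Nx.
  destruct (classic (In x gunits)) as [Hu|Hu].
  - rewrite (rsum_ext _ (fun _ => 0)).
    + rewrite rsum_const. apply gunits_N in Hu. rewrite Hu, ln_1. ring.
    + intros d Hd. apply in_gdivs in Hd; auto. apply Lam_unit, gunit_iff. apply gdvd_trans with x; auto. apply gunit_iff; auto.
  - destruct (gprime_divisor x Hx Hu) as (p & Hp & x' & Ex). assert (Hx' : x' <> g0) by (intros ->; apply Hx; rewrite Ex; ring).
    apply gN_pos in Hx' as Nx'. assert (Np := gprime_N p Hp). assert (Hp0 := gprime_neq0 p Hp).
    assert (EN : gN x = (gN p * gN x')%Z) by (rewrite Ex; apply gN_mul). assert (IHx := IH (Z.to_nat (gN x')) ltac:(nia) x' eq_refl Hx').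
    destruct (exists_last (fun v => in_ideal (gpow p v) x') (Z.to_nat (gN x'))) as (v & Hv & Hv').
    { exists x'. simpl. ring. }
    { intros D. apply gdvd_le in D; auto. rewrite gN_gpow, Z2Nat.id in D by lia.
      assert (gN x' < gN p ^ gN x')%Z; [|lia]. apply Z.pow_gt_lin_r; lia. }
    assert (Ppow : gpow p (S v) <> g0) by (apply gpow_neq0; auto). set (E := map (fun u => gmul u (gpow p (S v))) gunits).
    assert (NE : NoDup E).
    { apply FinFun.Injective_map_NoDup; [|apply NoDup_gunits]. intros a b H. apply (gmul_cancel (gpow p (S v))); auto.
      replace (gmul (gpow p (S v)) a) with (gmul a (gpow p (S v))) by ring. rewrite H. ring. }
    assert (Incl : incl (gdivs x') (gdivs x)).
    { intros d Hd. apply in_gdivs; auto. apply in_gdivs in Hd; auto. rewrite Ex. apply gdvd_mul_l; auto. }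
    rewrite (rsum_perm _ _ _ (perm_outside _ _ (NoDup_gdivs x') (NoDup_gdivs x) Incl)), rsum_app, IHx.
    rewrite (rsum_same_support Lam E (outside (gdivs x') (gdivs x))); auto.
    + unfold E. rewrite rsum_map. rewrite (rsum_ext _ (fun _ => ln (IZR (gN p)))).
      * rewrite rsum_const. simpl length. rewrite EN, mult_IZR, ln_mult by (apply IZR_lt; lia). simpl; ring.
      * intros u Hu'. apply (Lam_pp _ p (S v)). split; auto. split; [lia|]. exists u; auto.
    + apply NoDup_outside, NoDup_gdivs.
    + intros d Hd. apply in_map_iff in Hd. destruct Hd as (u & <- & Hu'). apply in_outside. rewrite !in_gdivs by auto.
      rewrite !gdvd_unit_l by auto. split; auto. rewrite Ex. destruct Hv as [y ->]. exists y. simpl. ring.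
    + intros d Hd HdE. apply in_outside in Hd. rewrite !in_gdivs in Hd by auto. destruct Hd as [D1 D2].
      destruct (Lam_cases d) as [(q & m & Hq & Hm & u & Hu' & Ed)|]; auto. exfalso.
      (* A new divisor q^m has q associated to p, since otherwise q^m would already divide x'.
         Dividing [x] bounds m by v + 1, and not dividing x' forces m > v. *)
      rewrite Ed in D1, D2. rewrite gdvd_unit_l in D1, D2 by auto. rewrite Ex in D1. destruct (classic (in_ideal q p)) as [Q|Q].
      * destruct (gprime_dvd_prime q p Hq Hp Q) as (w & Hw & Ew). assert (PW : exists w', In w' gunits /\ gpow q m = gmul w' (gpow p m)).
        { destruct (gunit_inv w Hw) as (w1 & Hw1 & E1).
          assert (Eq : q = gmul w1 p) by (rewrite Ew; replace (gmul w1 (gmul w q)) with (gmul (gmul w w1) q) by ring; rewrite E1; ring).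
          clear - Eq Hw1. induction m as [|m (w' & H & IH)].
          - exists g1. split; [simpl; auto|simpl; ring].
          - exists (gmul w1 w'). split; [apply gunit_mul; auto|]. simpl. rewrite IH, Eq. ring. }
        destruct PW as (w' & Hw' & Epw). rewrite Epw in D1, D2, Ed. rewrite gdvd_unit_l in D1, D2 by auto. destruct m as [|m]; [lia|].
        assert (D3 : in_ideal (gpow p m) x').
        { destruct D1 as [z Ez]. exists z. apply (gmul_cancel p); auto. rewrite Ez. simpl. ring. }
        assert (m <= v)%nat. { destruct (le_lt_dec m v); auto. exfalso. apply Hv'. apply gpow_dvd_mono with m; auto. }
        assert (v < S m)%nat. { destruct (le_lt_dec (S m) v); auto. exfalso. apply D2. apply gpow_dvd_mono with v; auto. }
        assert (m = v) by lia. subst m. apply HdE. unfold E. apply in_map_iff. exists (gmul u w').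
        split; [rewrite Ed; ring|apply gunit_mul; auto].
      * apply D2. apply coprime_pow_dvd with p; auto.
Qed.

(** * Normalized generators *)

Definition gnormal (x : gauss) : Prop := (0 < fst x /\ 0 <= snd x)%Z.

(** Multiplication by the unit that brings [x] to its normalized generator. The origin is fixed, so
    its fibre in [nrm_fib] is a singleton and not four points. *)
Definition nrm (x : gauss) : gauss :=
  if ((0 <? fst x)%Z && (0 <=? snd x)%Z)%bool then x
  else if ((0 <? snd x)%Z && (fst x <=? 0)%Z)%bool then (snd x, - fst x)%Z
  else if ((fst x <? 0)%Z && (snd x <=? 0)%Z)%bool then (- fst x, - snd x)%Z
  else (- snd x, fst x)%Z.

Definition nrm_fib (y : gauss) : list gauss :=
  if ((0 <? fst y)%Z && (0 <=? snd y)%Z)%bool then map (fun u => gmul u y) gunits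
  else if ((fst y =? 0)%Z && (snd y =? 0)%Z)%bool then [y] else [].

Lemma in_nrm_fib (x y : gauss) : In x (nrm_fib y) <-> nrm x = y.
Proof.
  assert (P : forall a b c d : Z, a = c -> b = d -> (a, b) = (c, d)) by (intros; congruence).
  destruct x as [a b], y as [c d]. unfold nrm_fib, gunits, gmul; cbn [fst snd map].
  destruct (Z.ltb_spec 0 c), (Z.leb_spec 0 d), (Z.eqb_spec c 0), (Z.eqb_spec d 0); cbn [andb In]; try lia;
  (split; [intros K; repeat destruct K as [K|K]; try contradiction; apply pair_equal_spec in K; destruct K as [K1 K2]|]); unfold nrm; cbn [fst snd];
  repeat match goal with |- context [(?u <? ?v)%Z] => destruct (Z.ltb_spec u v) | |- context [(?u <=? ?v)%Z] => destruct (Z.leb_spec u v) end;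
    cbn [andb]; try lia; try (apply P; lia); intros K; apply pair_equal_spec in K; destruct K as [K1 K2]; try lia;
  first [left; apply P; lia | right; left; apply P; lia | right; right; left; apply P; lia | right; right; right; left; apply P; lia].
Qed.

Lemma NoDup_nrm_fib (y : gauss) : NoDup (nrm_fib y).
Proof.
  unfold nrm_fib. destruct ((0 <? fst y)%Z && (0 <=? snd y)%Z)%bool eqn:E.
  - apply FinFun.Injective_map_NoDup; [|apply NoDup_gunits]. intros a b H. apply (gmul_cancel y).
    + intros ->. simpl in E. discriminate.
    + replace (gmul y a) with (gmul a y) by ring. rewrite H. ring.
  - destruct ((fst y =? 0)%Z && (snd y =? 0)%Z)%bool; repeat constructor; simpl; auto.
Qed.

Lemma nrm_unit (x : gauss) : x <> g0 -> gnormal (nrm x) /\ exists u, In u gunits /\ nrm x = gmul u x.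
Proof.
  destruct x as [a b]. intros H. assert (H' : (a <> 0 \/ b <> 0)%Z).
  { destruct (Z.eq_dec a 0) as [->|], (Z.eq_dec b 0) as [->|]; auto. }
  unfold nrm, gnormal; simpl fst; simpl snd.
  repeat match goal with |- context [(?u <? ?v)%Z] => destruct (Z.ltb_spec u v) | |- context [(?u <=? ?v)%Z] => destruct (Z.leb_spec u v) end; cbn [andb fst snd]; try lia;
  (split; [lia|]);
  first [ exists (1, 0)%Z; split; [simpl; tauto|unfold gmul; cbn [fst snd]; apply pair_equal_spec; lia]
        | exists (0, -1)%Z; split; [simpl; tauto|unfold gmul; cbn [fst snd]; apply pair_equal_spec; lia]
        | exists (-1, 0)%Z; split; [simpl; tauto|unfold gmul; cbn [fst snd]; apply pair_equal_spec; lia]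
        | exists (0, 1)%Z; split; [simpl; tauto|unfold gmul; cbn [fst snd]; apply pair_equal_spec; lia] ].
Qed.

(** * Hecke characters and L-functions as sums over Gaussian integers *)

Lemma exp_le_mono (x y : R) : x <= y -> exp x <= exp y.
Proof. intros [H| ->]; [left; apply exp_increasing; auto|lra]. Qed.

Definition gC (x : gauss) : C := (IZR (fst x), IZR (snd x)).
(* [uz z = e^{4 i arg z}] is invariant under the units, so the sums below run over all nonzero Gaussian integers
   and count each ideal four times. *)
Definition uz (z : C) : C := ((z / Cconj z) ^ 2)%C.
(** The summand |z|^(-2s) e^(4ik arg z) at an arbitrary nonzero complex number; this lets
    [stencil_bound] expand it around a lattice point. *)
Definition fz (k : nat) (s z : C) : C := (uz z ^ k * cexp (- s * RtoC (ln (Cmod z ^ 2))))%C.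
Definition fk (k : nat) (s : C) (x : gauss) : C := if eqd x g0 then 0%C else fz k s (gC x).
Definition gw (sigma : R) (x : gauss) : R := if eqd x g0 then 0 else exp (- sigma * ln (IZR (gN x))).

Lemma gC_mul (x y : gauss) : gC (gmul x y) = (gC x * gC y)%C.
Proof. unfold gC, gmul, Cmult; simpl. rewrite minus_IZR, plus_IZR, !mult_IZR. reflexivity. Qed.
Lemma gC_add (x y : gauss) : gC (gadd x y) = (gC x + gC y)%C.
Proof. unfold gC, gadd, Cplus; simpl. rewrite !plus_IZR. reflexivity. Qed.
Lemma gC_norm (x : gauss) : Cmod (gC x) ^ 2 = IZR (gN x).
Proof. rewrite Cmod_sqr. unfold gC, gN; simpl. rewrite plus_IZR, !mult_IZR. ring. Qed.
Lemma gC_neq0 (x : gauss) : x <> g0 -> gC x <> 0%C.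
Proof.
  intros H E. apply gN_pos in H. apply IZR_lt in H. rewrite <- gC_norm, E, Cmod_0 in H. simpl in H. lra.
Qed.
Lemma gN_ge1 (x : gauss) : x <> g0 -> 1 <= IZR (gN x).
Proof. intros H. apply gN_pos in H. apply IZR_le. lia. Qed.
Lemma lnN_nonneg (x : gauss) : x <> g0 -> 0 <= ln (IZR (gN x)).
Proof. intros H. rewrite <- ln_1. apply ln_le; [lra|apply gN_ge1; auto]. Qed.

Lemma Cconj_neq0 (z : C) : z <> 0%C -> Cconj z <> 0%C.
Proof. intros H E. apply H. rewrite <- (Cconj_conj z), E. unfold Cconj, RtoC; simpl; f_equal; ring. Qed.

Lemma Cmod_uz (z : C) : z <> 0%C -> Cmod (uz z) = 1.
Proof.
  intros H. unfold uz. rewrite Cmod_pow, Cmod_div, Cmod_conj by (apply Cconj_neq0; auto).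
  assert (0 < Cmod z) by (apply Cmod_gt_0; auto). unfold Rdiv. rewrite Rinv_r by lra. ring.
Qed.

Lemma uz_mult (z w : C) : z <> 0%C -> w <> 0%C -> uz (z * w) = (uz z * uz w)%C.
Proof.
  intros Hz Hw. unfold uz. rewrite <- Cpow_mult_l, Cmult_conj. f_equal. field. split; apply Cconj_neq0; auto.
Qed.

Lemma Cmod_fz (k : nat) (s z : C) : z <> 0%C -> Cmod (fz k s z) = exp (- fst s * ln (Cmod z ^ 2)).
Proof.
  intros H. unfold fz. rewrite Cmod_mult, Cmod_pow, Cmod_uz, pow1, Cmod_cexp by auto. simpl. rewrite Rmult_1_l. f_equal. ring.
Qed.

Lemma Cmod_fk (k : nat) (s : C) (x : gauss) : Cmod (fk k s x) = gw (fst s) x.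
Proof.
  unfold fk, gw. destruct (eqd x g0); [apply Cmod_0|]. rewrite Cmod_fz, gC_norm by (apply gC_neq0; auto). auto.
Qed.

Lemma Cmod_sqr_pos (z : C) : z <> 0%C -> 0 < Cmod z ^ 2.
Proof. intros H. apply pow_lt, Cmod_gt_0; auto. Qed.

Lemma fz_mult (k : nat) (s z w : C) : z <> 0%C -> w <> 0%C -> fz k s (z * w) = (fz k s z * fz k s w)%C.
Proof.
  intros Hz Hw. unfold fz. rewrite uz_mult, Cpow_mult_l by auto. rewrite Cmod_mult, Rpow_mult_distr, ln_mult by (apply Cmod_sqr_pos; auto).
  replace (- s * RtoC (ln (Cmod z ^ 2) + ln (Cmod w ^ 2)))%C with (- s * RtoC (ln (Cmod z ^ 2)) + - s * RtoC (ln (Cmod w ^ 2)))%C by (rewrite RtoC_plus; ring).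
  rewrite cexp_plus. ring.
Qed.

Lemma fk_mult (k : nat) (s : C) (x y : gauss) : fk k s (gmul x y) = (fk k s x * fk k s y)%C.
Proof.
  unfold fk. destruct (eqd x g0) as [->|Hx]; [destruct (eqd (gmul g0 y) g0) as [|N]; [ring|exfalso; apply N; ring]|].
  destruct (eqd y g0) as [->|Hy]; [destruct (eqd (gmul x g0) g0) as [|N]; [ring|exfalso; apply N; ring]|].
  destruct (eqd (gmul x y) g0) as [E|_]; [exfalso; apply (gmul_neq0 x y); auto|]. rewrite gC_mul. apply fz_mult; apply gC_neq0; auto.
Qed.

Lemma gunit_neq0 (u : gauss) : In u gunits -> u <> g0.
Proof. intros H ->. apply gunits_N in H. discriminate. Qed.

Lemma uz_unit (u : gauss) : In u gunits -> uz (gC u) = 1%C.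
Proof.
  assert (E : forall z : C, z <> 0%C -> ((z * z) = (Cconj z * Cconj z))%C -> uz z = 1%C).
  { intros z Hz H. unfold uz. simpl. assert (N := Cconj_neq0 z Hz).
    replace (z / Cconj z * (z / Cconj z * 1))%C with ((z * z) / (Cconj z * Cconj z))%C by (field; auto). rewrite H. field; auto. }
  intros H. apply E; [apply gC_neq0, gunit_neq0; auto|].
  simpl in H. destruct H as [<-|[<-|[<-|[<-|[]]]]]; unfold gC, Cmult, Cconj; simpl; f_equal; ring.
Qed.

Lemma fk_unit (k : nat) (s : C) (u x : gauss) : In u gunits -> fk k s (gmul u x) = fk k s x.
Proof.
  intros H. rewrite fk_mult. replace (fk k s u) with (RtoC 1); [ring|].
  unfold fk. destruct (eqd u g0) as [E|_]; [exfalso; eapply gunit_neq0; eauto|].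
  unfold fz. rewrite uz_unit, Cpow_1_l, gC_norm by auto. apply gunits_N in H. rewrite H, ln_1.
  replace (- s * RtoC 0)%C with (RtoC 0) by ring. rewrite cexp_0. ring.
Qed.

Lemma gw_nonneg (sigma : R) (x : gauss) : 0 <= gw sigma x.
Proof. unfold gw. destruct (eqd x g0); [lra|left; apply exp_pos]. Qed.

Lemma gw_mono (s1 s2 : R) (x : gauss) : s1 <= s2 -> gw s2 x <= gw s1 x.
Proof.
  intros H. unfold gw. destruct (eqd x g0) as [|N]; [lra|]. apply exp_le_mono. assert (P := lnN_nonneg x N). nra.
Qed.

Lemma gw_unit (sigma : R) (u x : gauss) : In u gunits -> gw sigma (gmul u x) = gw sigma x.
Proof. intros H. rewrite <- (Cmod_fk 0 (RtoC sigma)), fk_unit, Cmod_fk; auto. Qed.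

(** ** Comparison with the Dirichlet series of the statement *)

Definition toC (z : Defs.C) : C := (Defs.Re z, Defs.Im z).
Definition ofC (z : C) : Defs.C := Defs.mkC (fst z) (snd z).

Lemma uz_polar (r th : R) : 0 < r -> uz (r * cos th, r * sin th) = cis (4 * th).
Proof.
  intros Hr. assert (E : (r * cos th, r * sin th) = (RtoC r * cis th)%C) by (unfold cis, RtoC, Cmult; simpl; f_equal; ring).
  assert (M : forall a b, (cis a * cis b)%C = cis (a + b)).
  { intros a b. unfold cis, Cmult; simpl. rewrite cos_plus, sin_plus. f_equal; ring. }
  assert (Hc : (cis th * Cconj (cis th))%C = 1%C) by (rewrite Cmult_conj_sqr with (r := 1); [f_equal; ring|apply Cmod_cis]).
  assert (N : cis th <> 0%C) by (intros F; assert (G := Cmod_cis th); rewrite F, Cmod_0 in G; lra).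
  assert (Nr : RtoC r <> 0%C) by (apply RtoC_neq; lra). rewrite E. unfold uz. rewrite Cmult_conj, Cconj_RtoC.
  replace (RtoC r * cis th / (RtoC r * Cconj (cis th)))%C with (cis th * cis th)%C.
  - simpl. rewrite Cmult_1_r, !M. f_equal. ring.
  - rewrite <- (Cmult_1_r (cis th * cis th)), <- Hc at 1.
    assert (N2 := Cconj_neq0 _ N). apply (f_equal (fun w => (w * (cis th / Cconj (cis th)))%C)) in Hc.
    replace (cis th * Cconj (cis th) * (cis th / Cconj (cis th)))%C with (cis th * cis th)%C in Hc by (field; auto).
    rewrite Hc. replace (cis th * Cconj (cis th))%C with (RtoC 1); [field; auto|].
    rewrite Cmult_conj_sqr with (r := 1); [f_equal; ring|apply Cmod_cis].
Qed.

Lemma cis_pow (x : R) (k : nat) : (cis x ^ k)%C = cis (INR k * x).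
Proof.
  rewrite !cis_cexp, <- cexp_nat. f_equal. rewrite RtoC_mult. ring.
Qed.

Lemma gnormal_polar (a b : Z) : (0 < a)%Z ->
  gC (a, b) = (Cmod (gC (a, b)) * cos (theta_gen a b), Cmod (gC (a, b)) * sin (theta_gen a b)).
Proof.
  intros Ha. apply IZR_lt in Ha. unfold theta_gen, gC; simpl fst; simpl snd. set (x := IZR a) in *. set (y := IZR b).
  assert (Hs : Cmod (x, y) = x * sqrt (1 + (y / x) ^ 2)).
  { unfold Cmod; simpl fst; simpl snd. replace (x ^ 2 + y ^ 2) with (x ^ 2 * (1 + (y / x) ^ 2)) by (field; lra).
    rewrite sqrt_mult by (try apply pow2_ge_0; assert (0 <= (y / x) ^ 2) by apply pow2_ge_0; lra). rewrite sqrt_pow2 by lra. auto. }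
  assert (0 < sqrt (1 + (y / x) ^ 2)) by (apply sqrt_lt_R0; assert (0 <= (y / x) ^ 2) by apply pow2_ge_0; lra).
  rewrite Hs, cos_atan, sin_atan. unfold Rsqr. replace (y / x * (y / x)) with ((y / x) ^ 2) by ring. f_equal; field; lra.
Qed.

Lemma uz_Xi (k : nat) (a b : Z) : (0 < a)%Z -> (uz (gC (a, b)) ^ k)%C = toC (Xi (Z.of_nat k) a b).
Proof.
  intros Ha. rewrite gnormal_polar by auto. rewrite uz_polar.
  - rewrite cis_pow. unfold toC, Xi, cis; simpl. rewrite <- INR_IZR_INZ. f_equal; f_equal; ring.
  - apply Cmod_gt_0, gC_neq0. intros E. inversion E. lia.
Qed.

Definition normals (n : nat) : list gauss :=
  map (fun p => (Z.of_nat (fst p), Z.of_nat (snd p)))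
    (filter (fun p => ((1 <=? fst p)%nat && (fst p * fst p + snd p * snd p =? n)%nat)%bool) (list_prod (seq 0 (S n)) (seq 0 (S n)))).

Lemma in_normals (n : nat) (x : gauss) : In x (normals n) <-> gnormal x /\ gN x = Z.of_nat n.
Proof.
  unfold normals, gnormal, gN. rewrite in_map_iff. split.
  - intros ([a b] & <- & H). apply filter_In in H. cbn [fst snd] in *. destruct H as [_ H].
    apply Bool.andb_true_iff in H. destruct H as [H1 H2]. apply Nat.leb_le in H1. apply Nat.eqb_eq in H2. lia.
  - destruct x as [a b]. cbn [fst snd]. intros [[H1 H2] H3].
    exists (Z.to_nat a, Z.to_nat b). cbn [fst snd]. split; [apply pair_equal_spec; lia|]. apply filter_In. cbn [fst snd]. split.
    + apply in_prod; apply in_seq; nia.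
    + apply Bool.andb_true_iff. split; [apply Nat.leb_le; lia|apply Nat.eqb_eq; nia].
Qed.

Lemma NoDup_normals (n : nat) : NoDup (normals n).
Proof.
  apply FinFun.Injective_map_NoDup.
  - intros [a b] [c d] E. cbn [fst snd] in E. apply pair_equal_spec in E. apply pair_equal_spec. lia.
  - apply NoDup_filter, NoDup_list_prod; apply seq_NoDup.
Qed.

Lemma sum_f_R0_rsum (f : nat -> R) (n : nat) : sum_f_R0 f n = rsum f (seq 0 (S n)).
Proof.
  induction n; [simpl; ring|]. rewrite seq_S, rsum_app. simpl rsum. simpl sum_f_R0. rewrite IHn. simpl; ring.
Qed.

Lemma csum_pair {A : Type} (f g : A -> R) (l : list A) : csum (fun x => (f x, g x)) l = (rsum f l, rsum g l).
Proof. induction l; simpl; auto. rewrite IHl. reflexivity. Qed.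

Lemma csum_filter {A : Type} (p : A -> bool) (f : A -> C) (l : list A) : csum f (filter p l) = csum (fun x => if p x then f x else 0%C) l.
Proof. induction l; simpl; auto. destruct (p a); simpl; rewrite IHl; ring. Qed.

Lemma csum_prod_nested {A B : Type} (f : A -> B -> C) (l : list A) (l' : list B) :
  csum (fun p => f (fst p) (snd p)) (list_prod l l') = csum (fun a => csum (f a) l') l.
Proof. induction l; simpl; auto. rewrite csum_app, IHl, csum_map. auto. Qed.

Lemma toC_coef (k n : nat) : toC (coef (Z.of_nat k) n) = csum (fun x => uz (gC x) ^ k)%C (normals n).
Proof.
  unfold normals. rewrite csum_map, csum_filter.
  rewrite (csum_prod_nested (fun a b => if ((1 <=? a)%nat && (a * a + b * b =? n)%nat)%bool then (uz (gC (Z.of_nat a, Z.of_nat b)) ^ k)%C else 0%C)).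
  rewrite (csum_ext _ (fun a => (rsum (fun b => Defs.Re (ideal_weight (Z.of_nat k) n a b)) (seq 0 (S n)), rsum (fun b => Defs.Im (ideal_weight (Z.of_nat k) n a b)) (seq 0 (S n))))).
  - rewrite csum_pair. unfold toC, coef. simpl Defs.Re; simpl Defs.Im. rewrite !sum_f_R0_rsum.
    f_equal; apply rsum_ext; intros; apply sum_f_R0_rsum.
  - intros a _. rewrite <- csum_pair. apply csum_ext. intros b _. unfold ideal_weight.
    destruct ((1 <=? a)%nat && (a * a + b * b =? n)%nat)%bool eqn:E; [|reflexivity].
    apply Bool.andb_true_iff in E. destruct E as [E _]. apply Nat.leb_le in E. rewrite uz_Xi by lia. reflexivity.
Qed.

Definition normals_upto (N : nat) : list gauss := flat_map normals (seq 1 N).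

Lemma in_normals_upto (N : nat) (x : gauss) : In x (normals_upto N) <-> gnormal x /\ (gN x <= Z.of_nat N)%Z.
Proof.
  unfold normals_upto. rewrite in_flat_map. split.
  - intros (n & H1 & H2). apply in_seq in H1. apply in_normals in H2. split; [tauto|lia].
  - intros [H1 H2]. assert (P : (0 < gN x)%Z) by (destruct x as [a b]; unfold gnormal, gN in *; cbn [fst snd] in *; nia).
    exists (Z.to_nat (gN x)). split; [apply in_seq; lia|]. apply in_normals. split; auto. lia.
Qed.

Lemma NoDup_normals_upto (N : nat) : NoDup (normals_upto N).
Proof.
  apply NoDup_flat_map; [apply seq_NoDup|intros; apply NoDup_normals|].
  intros b b' a _ _ H1 H2. apply in_normals in H1. apply in_normals in H2. lia.
Qed.

Lemma toC_npow (n : nat) (s : Defs.C) : toC (npow_neg n s) = cexp (- toC s * RtoC (ln (INR n))).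
Proof.
  unfold toC, npow_neg, cexp, Cmult, Copp, RtoC; simpl.
  replace (- Defs.Re s * ln (INR n) - - Defs.Im s * 0) with (- Defs.Re s * ln (INR n)) by ring.
  replace (- Defs.Re s * 0 + - Defs.Im s * ln (INR n)) with (- (Defs.Im s * ln (INR n))) by ring. rewrite cos_neg, sin_neg. f_equal. ring.
Qed.

Lemma toC_Lpartial (k : nat) (s : Defs.C) (N : nat) : toC (Lpartial (Z.of_nat k) s N) = csum (fk k (toC s)) (normals_upto N).
Proof.
  induction N; [reflexivity|].
  unfold normals_upto. rewrite seq_S, flat_map_app, csum_app. simpl flat_map. rewrite app_nil_r. fold (normals_upto N).
  rewrite <- IHN. simpl Lpartial. assert (E1 : forall z w, toC (Defs.Cadd z w) = (toC z + toC w)%C) by reflexivity.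
  assert (E2 : forall z w, toC (Defs.Cmul z w) = (toC z * toC w)%C) by reflexivity.
  rewrite E1, E2, toC_coef, toC_npow, (Cmult_comm (csum _ _)), <- csum_scal. f_equal. apply csum_ext.
  intros x Hx. apply in_normals in Hx. destruct Hx as [Hx EN].
  unfold fk. destruct (eqd x g0) as [->|_]; [destruct Hx as [Hx _]; simpl in Hx; lia|].
  unfold fz. rewrite gC_norm, EN, <- INR_IZR_INZ. ring.
Qed.

Lemma Cmod_toC (z : Defs.C) : Cmod (toC z) = Cnorm z.
Proof. reflexivity. Qed.

(** The hypothesis gives convergence of ordered partial sums only. For k = 0 the terms are
    nonnegative, so this bounds every finite sum over ideals; each ideal is then spread over its
    four generators. *)
Lemma gw_bounded (F : Defs.C -> Defs.C) : (forall s, 1 < Defs.Re s -> L_series_to 0 s (F s)) ->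
  forall sigma, 1 < sigma -> exists B, sum_bounded (gw sigma) B.
Proof.
  intros H sigma Hs. set (s := Defs.mkC sigma 0). assert (E0 : forall x, fk 0 (toC s) x = RtoC (gw sigma x)).
  { intros x. unfold fk, gw. destruct (eqd x g0); auto. unfold fz. rewrite gC_norm. simpl Cpow.
    replace (- toC s * RtoC (ln (IZR (gN x))))%C with (RtoC (- sigma * ln (IZR (gN x)))).
    - rewrite cexp_RtoC. ring.
    - csolve. }
  assert (E : forall N, toC (Lpartial 0 s N) = RtoC (rsum (gw sigma) (normals_upto N))).
  { intros N. rewrite <- csum_RtoC. rewrite (toC_Lpartial 0). apply csum_ext. intros; apply E0. }
  destruct (H s Hs 1 Rlt_0_1) as [N0 HN]. set (B := Cmod (toC (F s)) + 1). assert (HB : forall N, rsum (gw sigma) (normals_upto N) <= B).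
  { intros N. set (M := Nat.max N N0). specialize (HN M (Nat.le_max_r _ _)). apply Rle_trans with (rsum (gw sigma) (normals_upto M)).
    - apply rsum_incl; [intros; apply gw_nonneg|apply NoDup_normals_upto|].
      intros x Hx. apply in_normals_upto in Hx. apply in_normals_upto. split; [tauto|]. unfold M; lia.
    - rewrite <- Cmod_toC in HN. assert (E3 : forall z w, toC (Csub z w) = (toC z - toC w)%C) by reflexivity.
      rewrite E3, E in HN. assert (T := Cmod_triangle_sub (RtoC (rsum (gw sigma) (normals_upto M))) (toC (F s))).
      rewrite Cmod_R, Rabs_right in T by (apply Rle_ge, rsum_nonneg; intros; apply gw_nonneg). unfold B; lra. }
  exists (4 * B). intros l Nl. assert (HM : exists N, forall x, In x l -> (gN x <= Z.of_nat N)%Z).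
  { clear. induction l as [|a l [N IH]]; [exists 0%nat; simpl; tauto|].
    exists (N + Z.to_nat (gN a))%nat. intros x [<-|Hx]; [lia|]. specialize (IH x Hx). lia. }
  destruct HM as [N HM]. eapply Rle_trans; [apply (rsum_incl (gw sigma) l (flat_map nrm_fib (g0 :: normals_upto N))); auto|].
  - intros; apply gw_nonneg.
  - intros x Hx. apply in_flat_map. exists (nrm x). split; [|apply in_nrm_fib; auto].
    destruct (classic (x = g0)) as [->|Hn]; [left; reflexivity|]. right.
    destruct (nrm_unit x Hn) as (H1 & u & Hu & Eu). apply in_normals_upto. split; auto.
    rewrite Eu, gN_mul. apply gunits_N in Hu. rewrite Hu. specialize (HM x Hx). lia.
  - rewrite rsum_flat_map. cbn [rsum]. replace (rsum (gw sigma) (nrm_fib g0)) with 0.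
    2:{ change (nrm_fib g0) with [g0]. simpl. unfold gw. destruct (eqd g0 g0); [ring|congruence]. }
    rewrite (rsum_ext _ (fun y => 4 * gw sigma y)).
    + rewrite rsum_scal, Rplus_0_l. apply Rmult_le_compat_l; [lra|auto].
    + intros y Hy. apply in_normals_upto in Hy. destruct Hy as [[Y1 Y2] _].
      unfold nrm_fib. apply Z.ltb_lt in Y1. apply Z.leb_le in Y2. rewrite Y1, Y2. cbn [andb].
      rewrite rsum_map, (rsum_ext _ (fun _ => gw sigma y)); [rewrite rsum_const; simpl; ring|]. intros u Hu. apply gw_unit; auto.
Qed.

(** Absolute summability provides some unconditional value; grouping the four generators of each
    ideal identifies it with four times the limit of the ordered partial sums. *)
Lemma L_is_sum (k : nat) (s : C) (v : Defs.C) (B : R) : sum_bounded (gw (fst s)) B ->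
  L_series_to (Z.of_nat k) (ofC s) v -> is_sum (fk k s) (4 * toC v)%C.
Proof.
  intros HB HL. destruct (is_sum_exists (fk k s) B) as [S HS].
  { eapply sum_bounded_le; [|exact HB]. intros x; simpl. rewrite Cmod_fk; lra. }
  assert (S = 4 * toC v)%C as <-; auto. assert (HF := is_sum_fiber (fk k s) S nrm nrm_fib HS NoDup_nrm_fib in_nrm_fib).
  set (h := fun y => csum (fk k s) (nrm_fib y)) in HF. assert (h4 : forall y, gnormal y -> h y = (4 * fk k s y)%C).
  { intros y [Y1 Y2]. unfold h, nrm_fib. apply Z.ltb_lt in Y1. apply Z.leb_le in Y2. rewrite Y1, Y2. cbn [andb].
    rewrite csum_map, (csum_ext _ (fun _ => fk k s y)); [|intros u Hu; apply fk_unit; auto]. simpl. csolve. }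
  assert (h0 : forall y, ~ gnormal y -> h y = 0%C).
  { intros y Hy. unfold h, nrm_fib, gnormal in *. destruct (Z.ltb_spec 0 (fst y)), (Z.leb_spec 0 (snd y)); cbn [andb]; try tauto;
    destruct (Z.eqb_spec (fst y) 0), (Z.eqb_spec (snd y) 0); cbn [andb csum]; auto;
    (replace y with g0 by (destruct y; simpl in *; subst; auto)); unfold fk; destruct (eqd g0 g0); try congruence; ring. }
  apply Ceq_minus, Cmod_zero_all. intros eps He. destruct (HF (eps / 2)) as (l1 & N3 & K); [lra|].
  assert (HM' : exists N, forall x, In x l1 -> (gN x <= Z.of_nat N)%Z).
  { clear. induction l1 as [|a l [N IH]]; [exists 0%nat; simpl; tauto|].
    exists (N + Z.to_nat (gN a))%nat. intros x [<-|Hx]; [lia|]. specialize (IH x Hx). lia. }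
  destruct HM' as [N4 HM']. destruct (HL (eps / 8)) as [N5 HN]; [lra|]. set (N6 := Nat.max N4 N5). specialize (HN N6 (Nat.le_max_r _ _)).
  (* This list contains [l1], as unconditional convergence requires, and differs from the ideals of
     norm at most N6 only by elements that are not normalized, where [h] vanishes. *)
  specialize (K (normals_upto N6 ++ outside (normals_upto N6) l1)). assert (P1 : NoDup (normals_upto N6 ++ outside (normals_upto N6) l1)).
  { apply NoDup_app_disj; [apply NoDup_normals_upto|apply NoDup_outside; auto|]. intros x H1 H2. apply in_outside in H2. tauto. }
  assert (P2 : incl l1 (normals_upto N6 ++ outside (normals_upto N6) l1)).
  { intros x Hx. apply in_app_iff. destruct (in_dec eqd x (normals_upto N6)); auto. right. apply in_outside; auto. }
  specialize (K P1 P2). rewrite csum_app, (csum_zero h (outside _ _)) in K.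
  - rewrite (csum_ext h (fun y => 4 * fk k s y)%C (normals_upto N6)) in K.
    2:{ intros y Hy. apply in_normals_upto in Hy. apply h4; tauto. }
    rewrite csum_scal in K. rewrite <- Cmod_toC in HN. assert (E3 : forall z w, toC (Csub z w) = (toC z - toC w)%C) by reflexivity.
    rewrite E3, toC_Lpartial in HN. replace (toC (ofC s)) with s in HN by (destruct s; reflexivity).
    set (A := csum (fk k s) (normals_upto N6)) in *. replace (S - 4 * toC v)%C with (4 * (A - toC v) - (4 * A + 0 - S))%C by ring.
    eapply Rle_trans; [apply Cmod_triangle_minus|]. rewrite Cmod_mult, Cmod_R, Rabs_right by lra. lra.
  - intros y Hy. apply in_outside in Hy. apply h0. intros Hn. apply (proj2 Hy). apply in_normals_upto. split; auto.
    assert (T := HM' y (proj1 Hy)). unfold N6. lia.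
Qed.

Lemma GRH_data (k : nat) : GRH_Xi (Z.of_nat k) -> (forall sigma, 1 < sigma -> exists B, sum_bounded (gw sigma) B) ->
  exists F : C -> C, (forall z : C, z <> RtoC 1 -> diff_at F z) /\
    (forall s, 1 < fst s -> is_sum (fk k s) (4 * F s)%C) /\
    (forall s, 0 < fst s < 1 -> F s = 0%C -> fst s = 1 / 2).
Proof.
  intros (F & H1 & H2 & H3) HB. exists (fun z => toC (F (ofC z))). split; [|split].
  - intros z Hz. destruct (H1 (ofC z)) as [d Hd].
    { intros E. apply Hz. apply (f_equal toC) in E. apply Ceq_pair; [exact (f_equal fst E)|exact (f_equal snd E)]. }
    exists (toC d). intros eps He. destruct (Hd eps He) as [de [Hde K]]. exists de. split; auto.
    intros w Hw. destruct (Ceq_dec w z) as [->|N].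
    + replace (toC (F (ofC z)) - toC (F (ofC z)) - toC d * (z - z))%C with (RtoC 0) by ring. rewrite Cmod_0.
      assert (P := Cmod_ge_0 (z - z)). nra.
    + assert (N' : (w - z)%C <> 0%C) by (intros E; apply Ceq_minus in E; auto). specialize (K (ofC (w - z)%C)).
      assert (K' : Cnorm (Csub (Defs.Cdiv (Csub (F (Cadd (ofC z) (ofC (w - z)))) (F (ofC z))) (ofC (w - z)%C)) d) < eps).
      { apply K; [|exact Hw]. intros E. apply N'. apply (f_equal toC) in E. apply Ceq_pair; [exact (f_equal fst E)|exact (f_equal snd E)]. }
      rewrite <- Cmod_toC in K'. assert (E4 : forall z w, toC (Defs.Cdiv z w) = (toC z / toC w)%C) by reflexivity.
      assert (E3 : forall z w, toC (Csub z w) = (toC z - toC w)%C) by reflexivity.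
      rewrite E3, E4, E3 in K'. replace (toC (ofC (w - z)%C)) with (w - z)%C in K' by (destruct z, w; reflexivity).
      replace (Cadd (ofC z) (ofC (w - z)%C)) with (ofC w) in K' by (destruct z, w; unfold ofC, Cadd; simpl; f_equal; ring).
      replace (toC (F (ofC w)) - toC (F (ofC z)) - toC d * (w - z))%C with
        (((toC (F (ofC w)) - toC (F (ofC z))) / (w - z) - toC d) * (w - z))%C by (field; auto).
      rewrite Cmod_mult. apply Rmult_le_compat_r; [apply Cmod_ge_0|lra].
  - intros s Hs. destruct (HB (fst s) Hs) as [B HB']. apply (L_is_sum k s _ B); auto.
  - intros s Hs E. apply (H3 (ofC s) Hs). destruct (F (ofC s)) as [a b]. unfold C0. f_equal; [exact (f_equal fst E)|exact (f_equal snd E)].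
Qed.

(** * Analytic continuation by a five-point stencil *)

Definition q5 : gauss := (2, 1)%Z.
Definition cross : list gauss := g0 :: gunits.
(** The discrete Laplacian of the summand at [m]. *)
Definition stencil (k : nat) (s : C) (m : gauss) : C :=
  (csum (fun u => fk k s (gadd m u)) gunits - 4 * fk k s m)%C.
Definition Dk (k : nat) (s : C) : C := (1 - 5 * fk k s q5)%C.

(** Modulo 2 + i one has i = -2, so 2a + b is twice the class of a + bi in the field of five
    elements, and the five points of the cross take its five values. [cross_quo] divides by 2 + i by
    means of the conjugate. *)
Definition cross_rep (x : gauss) : gauss :=
  let r := ((2 * fst x + snd x) mod 5)%Z in
  if (r =? 0)%Z then (0, 0)%Z else if (r =? 1)%Z then (0, 1)%Z else if (r =? 2)%Z then (1, 0)%Z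
  else if (r =? 3)%Z then (-1, 0)%Z else (0, -1)%Z.
Definition cross_quo (x : gauss) : gauss :=
  let y := gsub x (cross_rep x) in (((2 * fst y + snd y) / 5)%Z, ((2 * snd y - fst y) / 5)%Z).
Definition cross_fib (m : gauss) : list gauss := map (fun e => gadd (gmul q5 m) e) cross.

(* The translates of the cross {0, 1, -1, i, -i} by multiples of 2 + i tile Z[i]. *)
Lemma in_cross_fib (x m : gauss) : In x (cross_fib m) <-> cross_quo x = m.
Proof.
  assert (P : forall a b c d : Z, (a, b) = (c, d) <-> a = c /\ b = d) by (intros; apply pair_equal_spec).
  destruct x as [a b], m as [c d]. unfold cross_fib, cross, gunits, cross_quo, cross_rep, gsub, gadd, gopp, gmul, q5, g0.
  cbn [map In fst snd]. rewrite !P.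
  assert (B := Z.mod_pos_bound (2 * a + b) 5 ltac:(lia)). assert (E := Z.div_mod (2 * a + b) 5 ltac:(lia)).
  set (r := ((2 * a + b) mod 5)%Z) in *. set (t := ((2 * a + b) / 5)%Z) in *.
  destruct (Z.eqb_spec r 0); [|destruct (Z.eqb_spec r 1); [|destruct (Z.eqb_spec r 2); [|destruct (Z.eqb_spec r 3)]]]; cbn [fst snd];
  Z.to_euclidean_division_equations; lia.
Qed.

Lemma NoDup_cross_fib (m : gauss) : NoDup (cross_fib m).
Proof.
  apply FinFun.Injective_map_NoDup.
  - intros a b H. replace a with (gsub (gadd (gmul q5 m) a) (gmul q5 m)) by ring. rewrite H. ring.
  - unfold cross, gunits, g0. repeat constructor; simpl; intuition congruence.
Qed.

(** The values over all crosses add up to S. Taking differences from the centres removes each centre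
    value five times; by multiplicativity the value at (2 + i)m is [fk] of 2 + i times the value at
    m, so the total removed is 5 fk(2 + i) S. *)
Lemma stencil_identity (k : nat) (s S : C) : is_sum (fk k s) S -> is_sum (fun m => stencil k s (gmul q5 m)) (Dk k s * S)%C.
Proof.
  intros H. assert (HF := is_sum_fiber (fk k s) S cross_quo cross_fib H NoDup_cross_fib in_cross_fib).
  replace (Dk k s * S)%C with (S - 5 * fk k s q5 * S)%C by (unfold Dk; ring).
  eapply is_sum_ext; [|apply is_sum_minus; [exact HF|apply is_sum_scal; exact H]].
  intros m. unfold cross_fib, cross, stencil. rewrite csum_map. cbn [csum].
  replace (gadd (gmul q5 m) g0) with (gmul q5 m) by ring. rewrite (fk_mult k s q5 m). ring.
Qed.

Lemma gw_fst_exp (sigma : R) (x : gauss) : x <> g0 -> gw sigma x = exp (- sigma * ln (IZR (gN x))).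
Proof. intros H. unfold gw. destruct (eqd x g0); [contradiction|auto]. Qed.

Lemma fk_eq (k : nat) (s : C) (x : gauss) : x <> g0 -> fk k s x = fz k s (gC x).
Proof. intros H. unfold fk. destruct (eqd x g0); [contradiction|auto]. Qed.

Lemma cder_fk (k : nat) (s : C) (x : gauss) : cder (fun s => fk k s x) s (- RtoC (ln (IZR (gN x))) * fk k s x)%C.
Proof.
  destruct (eqd x g0) as [->|N].
  - unfold fk. destruct (eqd g0 g0); [|congruence]. eapply cder_eq; [apply cder_const|ring].
  - apply cder_ext with (fun s => uz (gC x) ^ k * cexp (- s * RtoC (ln (Cmod (gC x) ^ 2))))%C; [intros; rewrite fk_eq; auto|].
    rewrite fk_eq by auto. unfold fz. rewrite gC_norm. set (L := RtoC (ln (IZR (gN x)))).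
    eapply cder_eq. apply cder_scal. apply (cder_cexp_comp (fun s => - s * L)%C).
    apply cder_ext with (fun s => (- L) * s)%C; [intros; ring|]. apply cder_scal, cder_id. ring.
Qed.

Lemma diff_stencil (k : nat) (s : C) (m : gauss) : diff_at (fun s => stencil k s m) s.
Proof.
  eexists. unfold stencil. apply cder_minus; [|apply cder_scal, cder_fk].
  apply (cder_csum (fun u s => fk k s (gadd m u))). intros; apply cder_fk.
Qed.

Lemma diff_Dk (k : nat) (s : C) : cder (Dk k) s (5 * (RtoC (ln 5) * fk k s q5))%C.
Proof.
  unfold Dk. eapply cder_eq. apply cder_minus; [apply cder_const|apply cder_scal, cder_fk]. change (gN q5) with 5%Z. ring.
Qed.

(** ** The principal branch of [log (1 + w)] *)

Lemma holo_segment_bound (f : C -> C) (a b : C) (M de : R) : 0 < de ->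
  (forall t, 0 <= t <= 1 -> holo f (a + RtoC t * (b - a)) de) ->
  (forall t, 0 <= t <= 1 -> Cmod (Cderiv f (a + RtoC t * (b - a))) <= M) -> Cmod (f b - f a) <= M * Cmod (b - a).
Proof.
  intros Hde Hh HM. assert (E := CI_FTC (fun t => f (a + RtoC t * (b - a))%C) (fun t => Cderiv f (a + RtoC t * (b - a)) * (b - a))%C 0 1).
  cbv beta in E. replace (a + 1 * (b - a))%C with b in E by ring. replace (a + 0 * (b - a))%C with a in E by ring.
  assert (Self : forall z : C, Cmod (z - z) < de) by (intros z; replace (z - z)%C with (RtoC 0) by ring; rewrite Cmod_0; auto).
  assert (Hc : rcont_on (fun t => Cderiv f (a + RtoC t * (b - a)) * (b - a))%C 0 1).
  { intros t Ht. rewrite Rmin_left, Rmax_right in Ht by lra. apply rcont_mult; [|apply rcont_const].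
    apply (rcont_comp (Cderiv f) (fun t => a + RtoC t * (b - a))%C); [|eapply rder_rcont, rder_affine].
    apply diff_at_ccont. apply (holo_Cderiv f _ de (Hh t Ht)). apply Self. }
  rewrite <- E; auto.
  - replace (M * Cmod (b - a)) with (M * Cmod (b - a) * Rabs (1 - 0)) by (rewrite Rminus_0_r, Rabs_R1; ring).
    apply CI_bound; auto. intros t Ht. rewrite Rmin_left, Rmax_right in Ht by lra.
    rewrite Cmod_mult. apply Rmult_le_compat_r; [apply Cmod_ge_0|auto].
  - intros t Ht. rewrite Rmin_left, Rmax_right in Ht by lra.
    apply (rder_comp f (fun t => a + RtoC t * (b - a))%C); [|apply rder_affine]. apply Cderiv_spec, (Hh t Ht), Self.
Qed.

(** The branch comes from [holo_log] on the unit disc. The quadratic error integrates the derivative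
    -z/(1 + z) of p(z) - z. *)
Lemma log1p_exists : exists p : C -> C, forall w, Cmod w <= 1 / 2 ->
  (1 + w)%C = cexp (p w) /\ Cmod (p w - w) <= 2 * Cmod w ^ 2.
Proof.
  assert (D1 : forall z, cder (fun w => 1 + w)%C z 1) by (intros z; eapply cder_eq; [apply cder_plus; [apply cder_const|apply cder_id]|ring]).
  assert (N1 : forall z : C, Cmod z < 1 -> (1 + z)%C <> 0%C).
  { intros z Hz E. assert (z = - (1))%C by (replace z with ((1 + z) - 1)%C by ring; rewrite E; ring). subst. rewrite Cmod_opp, Cmod_1 in Hz. lra. }
  destruct (holo_log (fun w => 1 + w)%C 0 1) as (p & P1 & P2 & P3); [lra| | |].
  - intros z _. eexists; apply D1.
  - intros z Hz. apply N1. replace (z - 0)%C with z in Hz by ring. auto.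
  - exists p. intros w Hw. split.
    + rewrite P2; [ring|]. replace (w - 0)%C with w by ring. lra.
    + assert (S := holo_segment_bound (fun z => p z - z)%C 0 w (2 * Cmod w) (1 / 4)).
      assert (Hp : forall z, Cmod z < 1 -> cder (fun z => p z - z)%C z (- z / (1 + z))%C).
      { intros z Hz. eapply cder_eq. apply cder_minus; [apply P1|apply cder_id]. replace (z - 0)%C with z by ring; auto.
        rewrite (Cderiv_eq _ _ _ (D1 z)). field. apply N1; auto. }
      assert (Ht : forall t, 0 <= t <= 1 -> Cmod (0 + RtoC t * (w - 0)) <= Cmod w).
      { intros t Ht. replace (0 + RtoC t * (w - 0))%C with (RtoC t * w)%C by ring. rewrite Cmod_mult, Cmod_R, Rabs_right by lra.
        assert (Q := Cmod_ge_0 w). nra. }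
      replace (p w - w)%C with (p w - w - (p 0 - 0))%C by (rewrite P3; ring).
      replace (2 * Cmod w ^ 2) with (2 * Cmod w * Cmod (w - 0)) by (replace (w - 0)%C with w by ring; ring). apply S; [lra| |].
      * intros t Ht' z Hz. eexists. apply Hp. specialize (Ht t Ht'). assert (T := Cmod_triangle3 z (0 + RtoC t * (w - 0)) 0).
        replace (z - 0)%C with z in T by ring. replace (0 + RtoC t * (w - 0) - 0)%C with (0 + RtoC t * (w - 0))%C in T by ring. lra.
      * intros t Ht'. specialize (Ht t Ht'). set (z := (0 + RtoC t * (w - 0))%C) in *. rewrite (Cderiv_eq _ _ _ (Hp z ltac:(lra))).
        rewrite Cmod_div, Cmod_opp by (apply N1; lra). assert (L : 1 / 2 <= Cmod (1 + z)).
        { assert (T := Cmod_triangle_sub 1 (- z)). rewrite Cmod_1, Cmod_opp in T. replace (1 - - z)%C with (1 + z)%C in T by ring. lra. }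
        apply Rmult_le_reg_r with (Cmod (1 + z)); [lra|]. unfold Rdiv at 1. rewrite Rmult_assoc, Rinv_l by lra.
        assert (Q := Cmod_ge_0 w). nra.
Qed.

(** Formally the summand is z^(2k - s) conj(z)^(-2k - s), so a factor e^p on z multiplies it by the
    exponential shown. Any logarithm [p] will do, since the summand is single-valued. *)
Lemma fz_ratio (k : nat) (s z e p : C) : z <> 0%C -> (1 + e / z)%C = cexp p ->
  fz k s (z + e) = (fz k s z * cexp ((2 * RtoC (INR k) - s) * p - (2 * RtoC (INR k) + s) * Cconj p))%C.
Proof.
  intros Hz E. replace (z + e)%C with (z * (1 + e / z))%C by (field; auto). rewrite E, fz_mult; auto using cexp_neq_0.
  f_equal. unfold fz, uz. rewrite Cmod_cexp, <- cexp_conj.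
  replace (cexp p / cexp (Cconj p))%C with (cexp (p - Cconj p)) by (unfold Cminus, Cdiv; rewrite cexp_plus, cexp_opp; auto).
  rewrite <- (cexp_nat 2), <- cexp_nat, <- cexp_plus. f_equal.
  replace (exp (fst p) ^ 2) with (exp (2 * fst p)) by (simpl; rewrite Rmult_1_r, <- exp_plus; f_equal; ring).
  rewrite ln_exp. replace (RtoC (2 * fst p)) with (p + Cconj p)%C by (csolve).
  simpl INR. replace (RtoC (1 + 1)) with (RtoC 2) by (f_equal; ring). ring.
Qed.

(** Large enough for both regimes of [stencil_bound]: the Taylor regime, and the trivial one with
    its constant 4^10. *)
Definition stK : R := 4 * 4 ^ 10 * 64 + 10000.

(** Relative to the centre, the neighbour x + u contributes e^Q with Q linear in u/z and its
    conjugate up to second order. The units sum to zero, so the linear parts cancel and the stencil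
    gains a factor 1/N(x): its series converges for Re s > 0. The price is quadratic in k and s. *)
Lemma stencil_bound (k : nat) (s : C) (x : gauss) : (5 <= gN x)%Z -> 0 <= fst s <= 10 ->
  Cmod (stencil k s x) <= stK * (1 + INR k + Cmod s) ^ 2 * gw (fst s + 1) x.
Proof.
  intros Hx Hs.
  assert (x0 : x <> g0) by (intros ->; discriminate (Z.le_trans _ _ _ Hx (Z.le_refl _)) || (unfold gN in Hx; simpl in Hx; lia)).
  assert (z0 := gC_neq0 x x0). set (z := gC x) in *. assert (Hz2 : 5 <= Cmod z ^ 2) by (unfold z; rewrite gC_norm; apply IZR_le; auto).
  assert (Hz : 2 <= Cmod z) by (assert (P := Cmod_ge_0 z); simpl in Hz2; nra). assert (Hu1 : forall u, In u gunits -> Cmod (gC u) = 1).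
  { intros u Hu. apply gunits_N in Hu. assert (P := gC_norm u). rewrite Hu in P. assert (Q := Cmod_ge_0 (gC u)). simpl in P. nra. }
  set (w := / Cmod z). assert (Hw : 0 < w <= 1 / 2).
  { unfold w. split; [positive|]. replace (1 / 2) with (/ 2) by field. apply Rinv_le_contravar; lra. }
  set (v := fun u => (gC u / z)%C). assert (Hwu : forall u, In u gunits -> Cmod (v u) = w).
  { intros u Hu. unfold v. rewrite Cmod_div, Hu1 by auto. unfold w. field. lra. }
  assert (Hgw : gw (fst s + 1) x = Cmod (fz k s z) * w ^ 2).
  { rewrite gw_fst_exp, Cmod_fz by auto. unfold w. rewrite pow_inv. unfold z. rewrite gC_norm.
    replace (- (fst s + 1) * ln (IZR (gN x))) with (- fst s * ln (IZR (gN x)) + - ln (IZR (gN x))) by ring.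
    rewrite exp_plus, exp_Ropp, exp_ln; auto. assert (P := gN_ge1 x x0). lra. }
  rewrite Hgw. set (F := Cmod (fz k s z)) in *. assert (HF : 0 <= F) by apply Cmod_ge_0. destruct log1p_exists as [p Hp].
  set (a := (2 * RtoC (INR k) - s)%C). set (b := (2 * RtoC (INR k) + s)%C). set (Q := fun u => (a * p (v u) - b * Cconj (p (v u)))%C).
  set (L := fun u => (a * v u - b * Cconj (v u))%C).
  assert (Hfk : forall u, In u gunits -> fk k s (gadd x u) = (fz k s z * cexp (Q u))%C /\ Cmod (1 + v u) = exp (fst (p (v u)))).
  { intros u Hu. destruct (Hp (v u)) as [E _]; [rewrite Hwu; auto; lra|]. assert (Ng : gadd x u <> g0).
    { intros E'. assert (E2 : (gC x + gC u = 0)%C) by (rewrite <- gC_add, E'; reflexivity). fold z in E2.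
      assert (z = - gC u)%C by (replace z with ((z + gC u) - gC u)%C by ring; rewrite E2; ring).
      rewrite H, Cmod_opp, Hu1 in Hz by auto. lra. }
    split; [|rewrite E; apply Cmod_cexp]. rewrite fk_eq, gC_add by auto. apply fz_ratio; auto. }
  assert (SL : csum L gunits = 0%C).
  { unfold gunits. cbn [csum]. unfold L, v, gC. cbn [fst snd].
    assert (Cc : Cconj z <> 0%C) by (apply Cconj_neq0; auto). rewrite !Cdiv_conj by auto.
    replace ((IZR 1, IZR 0) : C) with (RtoC 1) by reflexivity. replace ((IZR (-1), IZR 0) : C) with (- RtoC 1)%C by (csolve).
    replace ((IZR 0, IZR (-1)) : C) with (- ((IZR 0, IZR 1) : C))%C by (csolve).
    rewrite !Copp_conj. set (i := (IZR 0, IZR 1) : C). field. auto. }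
  assert (HS : stencil k s x = (fz k s z * csum (fun u => cexp (Q u) - 1)%C gunits)%C).
  { unfold stencil. rewrite (csum_ext _ (fun u => fz k s z * cexp (Q u))%C) by (intros u Hu; apply Hfk; auto).
    rewrite (fk_eq k s x) by auto. fold z. simpl. ring. }
  rewrite HS, Cmod_mult. fold F. set (T := 4 * INR k + 2 * Cmod s).
  assert (Hk : 0 <= INR k) by apply pos_INR. assert (Hsm : 0 <= Cmod s) by apply Cmod_ge_0. assert (Hab : Cmod a + Cmod b <= T).
  { assert (Cmod a <= 2 * INR k + Cmod s).
    { unfold a. eapply Rle_trans; [apply Cmod_triangle_minus|]. rewrite Cmod_mult, !Cmod_R, !Rabs_right; lra. }
    assert (Cmod b <= 2 * INR k + Cmod s).
    { unfold b. eapply Rle_trans; [apply Cmod_triangle|]. rewrite Cmod_mult, !Cmod_R, !Rabs_right; lra. }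
    unfold T; lra. }
  assert (HT0 : 0 <= T) by (unfold T; lra). set (V := (1 + INR k + Cmod s) ^ 2).
  assert (HTV : T ^ 2 <= 16 * V) by (unfold T, V; simpl; nra). assert (HTV1 : T <= 16 * V) by (unfold T, V; simpl; nra).
  (* |e^Q| = |1 + u/z|^(-2 Re s), which is at most 2^20 because |1 + u/z| >= 1/2 and Re s <= 10. *)
  assert (HQb : forall u, In u gunits -> Cmod (cexp (Q u)) <= 4 ^ 10).
  { intros u Hu. destruct (Hp (v u)) as [E1 E2]; [rewrite Hwu; auto; lra|]. destruct (Hfk u Hu) as [_ E3]. unfold Q. rewrite Cmod_cexp.
    assert (R : fst (a * p (v u) - b * Cconj (p (v u)))%C = - fst s * (2 * fst (p (v u)))).
    { unfold a, b. destruct (p (v u)), s; simpl. ring. }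
    rewrite R. assert (L1 : 1 / 2 <= Cmod (1 + v u)).
    { assert (T1 := Cmod_triangle_sub 1 (- (v u))). rewrite Cmod_1, Cmod_opp, Hwu in T1 by auto. replace (1 - - (v u))%C with (1 + v u)%C in T1 by ring. lra. }
    rewrite E3 in L1. assert (L2 : - ln 2 <= fst (p (v u))).
    { rewrite <- (ln_exp (fst (p (v u)))), <- ln_Rinv by lra. apply ln_le; lra. }
    assert (ln2 : 0 < ln 2) by (rewrite <- ln_1; apply ln_increasing; lra). replace (4 ^ 10) with (exp (20 * ln 2)).
    * apply exp_le_mono. nra.
    * replace (20 * ln 2) with (INR 20 * ln 2) by (simpl; ring). rewrite <- ln_pow by lra. rewrite exp_ln; [ring|apply pow_lt; lra]. }
  (* Either |Q| <= 1 and Taylor's formula applies, or 4 T^2 w^2 >= 1 and the trivial bound already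
     has the required size. *)
  assert (Key : forall u, In u gunits -> Cmod (cexp (Q u) - 1 - L u) <= stK / 4 * V * w ^ 2 \/ 1 <= 4 * T ^ 2 * w ^ 2).
  { intros u Hu. destruct (Hp (v u)) as [E1 E2]; [rewrite Hwu; auto; lra|]. rewrite Hwu in E2 by auto.
    assert (Hpw : Cmod (p (v u)) <= 2 * w).
    { replace (p (v u)) with ((p (v u) - v u) + v u)%C by ring.
      eapply Rle_trans; [apply Cmod_triangle|]. rewrite Hwu by auto. simpl in E2. nra. }
    destruct (Rle_dec (T * (2 * w)) 1) as [Hle|Hgt].
    - left. assert (HQ : Cmod (Q u) <= T * (2 * w)).
      { unfold Q. eapply Rle_trans; [apply Cmod_triangle_minus|]. rewrite !Cmod_mult, Cmod_conj.
        assert (Pa := Cmod_ge_0 a). assert (Pb := Cmod_ge_0 b).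
        apply Rle_trans with ((Cmod a + Cmod b) * Cmod (p (v u))); [right; ring|]. apply Rmult_le_compat; try lra. apply Cmod_ge_0. }
      assert (HQL : Cmod (Q u - L u) <= T * (2 * w ^ 2)).
      { unfold Q, L. replace (a * p (v u) - b * Cconj (p (v u)) - (a * v u - b * Cconj (v u)))%C with
          (a * (p (v u) - v u) - b * Cconj (p (v u) - v u))%C by (rewrite Cminus_conj; ring).
        eapply Rle_trans; [apply Cmod_triangle_minus|]. rewrite !Cmod_mult, Cmod_conj.
        assert (Pa := Cmod_ge_0 a). assert (Pb := Cmod_ge_0 b).
        apply Rle_trans with ((Cmod a + Cmod b) * Cmod (p (v u) - v u)%C); [right; ring|]. apply Rmult_le_compat; try lra. apply Cmod_ge_0. }
      replace (cexp (Q u) - 1 - L u)%C with ((cexp (Q u) - 1 - Q u) + (Q u - L u))%C by ring. eapply Rle_trans; [apply Cmod_triangle|].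
      assert (HE : Cmod (cexp (Q u) - 1 - Q u) <= 10 * (T * (2 * w)) ^ 2).
      { eapply Rle_trans; [apply cexp_taylor1; lra|]. apply Rmult_le_compat_l; [lra|]. apply pow_incr. split; [apply Cmod_ge_0|auto]. }
      assert (Hw2 : 0 <= w ^ 2) by (apply pow_le; lra). replace (10 * (T * (2 * w)) ^ 2) with (40 * T ^ 2 * w ^ 2) in HE by ring.
      apply Rle_trans with ((40 * (16 * V) + 2 * (16 * V)) * w ^ 2).
      + assert (40 * T ^ 2 * w ^ 2 <= 40 * (16 * V) * w ^ 2) by (apply Rmult_le_compat_r; auto; lra).
        assert (T * (2 * w ^ 2) <= 16 * V * (2 * w ^ 2)) by (apply Rmult_le_compat_r; lra). lra.
      + apply Rmult_le_compat_r; auto. unfold stK. nra.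
    - right. assert (1 < (T * (2 * w)) ^ 2) by (assert (1 < T * (2 * w)) by lra; simpl; nra).
        replace (4 * T ^ 2 * w ^ 2) with ((T * (2 * w)) ^ 2) by ring. lra. }
  assert (Hw2 : 0 <= w ^ 2) by (apply pow_le; lra). assert (HSum : Cmod (csum (fun u => cexp (Q u) - 1)%C gunits) <= stK * V * w ^ 2).
  { destruct (classic (4 * T ^ 2 * w ^ 2 < 1)) as [Hs1|Hs1].
    - rewrite (csum_ext _ (fun u => cexp (Q u) - 1 - L u + L u)%C), csum_plus, SL, Cplus_0_r by (intros; ring).
      eapply Rle_trans; [apply csum_norm_le|]. eapply Rle_trans; [apply (rsum_le _ (fun _ => stK / 4 * V * w ^ 2))|].
      + intros u Hu. destruct (Key u Hu) as [K|K]; [auto|lra].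
      + rewrite rsum_const. simpl length. right. simpl INR. field.
    -
      eapply Rle_trans; [apply csum_norm_le|]. eapply Rle_trans; [apply (rsum_le _ (fun _ => 4 ^ 10 + 1))|].
      + intros u Hu. eapply Rle_trans; [apply Cmod_triangle_minus|]. rewrite Cmod_1. specialize (HQb u Hu). lra.
      + rewrite rsum_const. simpl length. apply Rle_trans with ((4 * (4 ^ 10 + 1)) * (4 * T ^ 2 * w ^ 2)); [simpl INR; nra|].
        apply Rle_trans with ((4 * (4 ^ 10 + 1)) * (4 * (16 * V) * w ^ 2)).
        * apply Rmult_le_compat_l; [lra|]. apply Rmult_le_compat_r; lra.
        * unfold stK. replace (4 * (4 ^ 10 + 1) * (4 * (16 * V) * w ^ 2)) with ((4 * 4 ^ 10 * 64 + 256) * (V * w ^ 2)) by ring.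
          replace ((4 * 4 ^ 10 * 64 + 10000) * V * w ^ 2) with ((4 * 4 ^ 10 * 64 + 10000) * (V * w ^ 2)) by ring.
          apply Rmult_le_compat_r; [apply Rmult_le_pos; lra|lra]. }
  replace (stK * V * (F * w ^ 2)) with (F * (stK * V * w ^ 2)) by ring. apply Rmult_le_compat_l; auto.
Qed.

Lemma sum_bounded_plus {A : Type} (f g : A -> R) (K K' : R) : sum_bounded f K -> sum_bounded g K' -> sum_bounded (fun x => f x + g x) (K + K').
Proof. intros H H' l N. rewrite rsum_plus. specialize (H l N). specialize (H' l N). lra. Qed.

Lemma sum_bounded_single {A : Type} (a : A) (c : R) : 0 <= c -> sum_bounded (fun x => if eqd x a then c else 0) c.
Proof.
  intros Hc l N. induction N as [|x l Hx N IH]; simpl; [auto|]. destruct (eqd x a) as [->|]; [|lra].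
  rewrite (rsum_ext _ (fun _ => 0)), rsum_const; [lra|]. intros y Hy. destruct (eqd y a) as [->|]; [contradiction|auto].
Qed.

Lemma gw_unit1 (sigma : R) (u : gauss) : In u gunits -> gw sigma u = 1.
Proof.
  intros H. rewrite gw_fst_exp by (apply gunit_neq0; auto). apply gunits_N in H. rewrite H, ln_1, Rmult_0_r. apply exp_0.
Qed.

Lemma stencil_g0 (k : nat) (s : C) : Cmod (stencil k s (gmul q5 g0)) <= 4.
Proof.
  unfold stencil. replace (gmul q5 g0) with g0 by ring. replace (fk k s g0) with (RtoC 0) by (unfold fk; destruct (eqd g0 g0); congruence).
  replace (csum (fun u => fk k s (gadd g0 u)) gunits - 4 * 0)%C with (csum (fun u => fk k s (gadd g0 u)) gunits) by ring.
  eapply Rle_trans; [apply csum_norm_le|]. rewrite (rsum_ext _ (fun _ => 1)); [rewrite rsum_const; simpl; lra|].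
  intros u Hu. replace (gadd g0 u) with u by ring. rewrite Cmod_fk. apply gw_unit1; auto.
Qed.

Lemma gw_q5 (sigma : R) (x : gauss) : 0 <= sigma -> gw sigma (gmul q5 x) <= gw sigma x.
Proof.
  intros Hs. destruct (eqd x g0) as [->|N]. { replace (gmul q5 g0) with g0 by ring. lra. }
  rewrite !gw_fst_exp; auto. 2:{ apply gmul_neq0; auto. discriminate. }
  apply exp_le_mono. rewrite gN_mul, mult_IZR. change (gN q5) with 5%Z.
  assert (P := gN_ge1 x N). rewrite ln_mult by lra. assert (0 < ln 5) by (rewrite <- ln_1; apply ln_increasing; lra). nra.
Qed.

Lemma near_coords (z w : C) (r : R) : Cmod (w - z) < r -> Rabs (fst w - fst z) < r /\ Rabs (snd w - snd z) < r.
Proof.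
  intros H. split; (eapply Rle_lt_trans; [|exact H]); [apply (Cmod_Re (w - z)%C)|apply (Cmod_Im (w - z)%C)].
Qed.
Lemma fst_seg (a b : C) (t : R) : fst (a + RtoC t * (b - a))%C = fst a + t * (fst b - fst a).
Proof. destruct a, b; simpl; ring. Qed.
Lemma snd_seg (a b : C) (t : R) : snd (a + RtoC t * (b - a))%C = snd a + t * (snd b - snd a).
Proof. destruct a, b; simpl; ring. Qed.

(** Re s > 1/20 puts the exponent of the stencil majorant at 21/20, inside the region of
    convergence, and leaves room to the left of 1/2 for the discs around zeros. *)
Definition strip (s : C) : Prop := 1 / 20 < fst s < 10.

(** * The stencil series and the continued functions on the strip *)

Section Continuation.
Variable BB : R.
Hypothesis HBB : sum_bounded (gw (21 / 20)) BB.

Definition stM (k : nat) (S : R) (a : gauss) : R := (if eqd a g0 then 4 else 0) + stK * (1 + INR k + S) ^ 2 * gw (21 / 20) a.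

Lemma stK_pos : 0 < stK.
Proof. unfold stK. lra. Qed.

Lemma stM_bound (k : nat) (S : R) (s : C) (a : gauss) : strip s -> Cmod s <= S -> Cmod (stencil k s (gmul q5 a)) <= stM k S a.
Proof.
  intros Hs HS. unfold stM. unfold strip in Hs. assert (P := stK_pos). assert (Hk := pos_INR k). assert (H0 := Cmod_ge_0 s).
  destruct (eqd a g0) as [->|N].
  - assert (Q := stencil_g0 k s). assert (0 <= stK * (1 + INR k + S) ^ 2 * gw (21 / 20) g0); [|lra].
    apply Rmult_le_pos; [apply Rmult_le_pos; [lra|apply pow2_ge_0]|apply gw_nonneg].
  - rewrite Rplus_0_l. eapply Rle_trans; [apply stencil_bound|].
    + rewrite gN_mul. change (gN q5) with 5%Z. assert (Q := gN_pos a N). lia.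
    + lra.
    + apply Rmult_le_compat.
      * apply Rmult_le_pos; [lra|apply pow2_ge_0].
      * apply gw_nonneg.
      * apply Rmult_le_compat_l; [lra|]. apply pow_incr. lra.
      * eapply Rle_trans; [apply gw_q5; lra|]. apply gw_mono. lra.
Qed.

Lemma BB_nonneg : 0 <= BB.
Proof. apply (HBB []). constructor. Qed.

Lemma stM_sum (k : nat) (S : R) : sum_bounded (stM k S) (4 + stK * (1 + INR k + S) ^ 2 * BB).
Proof.
  apply sum_bounded_plus; [apply sum_bounded_single; lra|].
  apply sum_bounded_scal; auto. apply Rmult_le_pos; [left; apply stK_pos|apply pow2_ge_0].
Qed.

Definition CR : R := 4 + stK * BB.

Lemma CR_pos : 0 < CR.
Proof. unfold CR. assert (P := stK_pos). assert (Q := BB_nonneg). nra. Qed.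

Definition Rsum (k : nat) (s : C) : C := epsilon (inhabits (RtoC 0)) (fun S => is_sum (fun m => stencil k s (gmul q5 m)) S).

Lemma Rsum_spec (k : nat) (s : C) : strip s -> is_sum (fun m => stencil k s (gmul q5 m)) (Rsum k s).
Proof.
  intros Hs. apply (epsilon_spec (inhabits (RtoC 0)) (fun S => is_sum (fun m => stencil k s (gmul q5 m)) S)).
  eapply is_sum_exists. eapply sum_bounded_le; [|apply (stM_sum k (Cmod s))]. intros a. apply stM_bound; auto; lra.
Qed.

Lemma Rsum_bound (k : nat) (s : C) : strip s -> Cmod (Rsum k s) <= CR * (1 + INR k + Cmod s) ^ 2.
Proof.
  intros Hs. assert (Hk := pos_INR k). assert (H0 := Cmod_ge_0 s). eapply Rle_trans; [eapply is_sum_le; [apply (Rsum_spec k s Hs)|]|].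
  - eapply sum_bounded_le; [|apply (stM_sum k (Cmod s))]. intros a. apply stM_bound; auto; lra.
  - unfold CR. assert (1 <= (1 + INR k + Cmod s) ^ 2) by (apply pow_R1_Rle; lra). lra.
Qed.

Lemma strip_open (s : C) : strip s -> exists r, 0 < r /\ forall w, Cmod (w - s) < r -> strip w.
Proof.
  intros [H1 H2]. exists (Rmin (fst s - 1 / 20) (10 - fst s)). split; [apply Rmin_pos; lra|].
  intros w Hw. assert (T := Cmod_Re (w - s)). simpl in T. apply Rabs_le_between in T.
  assert (L1 := Rlt_le_trans _ _ _ Hw (Rmin_l _ _)). assert (L2 := Rlt_le_trans _ _ _ Hw (Rmin_r _ _)). unfold strip; lra.
Qed.

Lemma Rsum_diff (k : nat) (s : C) : strip s -> diff_at (Rsum k) s.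
Proof.
  intros Hs. destruct (strip_open s Hs) as (r & Hr & HW).
  destruct (is_sum_cder (fun m s => stencil k s (gmul q5 m)) (Rsum k) (stM k (Cmod s + r)) (4 + stK * (1 + INR k + (Cmod s + r)) ^ 2 * BB) s (r / 2) r) as (D & _ & HD); try lra.
  - intros a z _. apply diff_stencil.
  - intros a z Hz. apply stM_bound; [apply HW; lra|]. replace z with (s + (z - s))%C by ring. eapply Rle_trans; [apply Cmod_triangle|]. lra.
  - apply stM_sum.
  - intros z Hz. apply Rsum_spec, HW. lra.
  - exists D. auto.
Qed.

(** Both sides agree for Re s > 1. Off the real axis the identity travels along horizontal segments
    from Re s = 2, which avoid the point 1; real points other than 1 follow by continuity from
    above. *)
Lemma Dk_F (k : nat) (F : C -> C) : (forall z : C, z <> RtoC 1 -> diff_at F z) ->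
  (forall s, 1 < fst s -> is_sum (fk k s) (4 * F s)%C) ->
  forall s, strip s -> s <> RtoC 1 -> (Dk k s * (4 * F s))%C = Rsum k s.
Proof.
  intros HF Hsum. set (h := fun s => (Dk k s * (4 * F s) - Rsum k s)%C). assert (Hd : forall s, strip s -> s <> RtoC 1 -> diff_at h s).
  { intros s Hs N. destruct (HF s N) as [d1 H1]. destruct (Rsum_diff k s Hs) as [d2 H2].
    eexists. apply cder_minus; [|exact H2]. apply cder_mult; [apply diff_Dk|]. apply cder_scal. exact H1. }
  assert (H0 : forall s, 1 < fst s < 10 -> h s = 0%C).
  { intros s Hs. unfold h. assert (Hst : strip s) by (unfold strip; lra).
    rewrite (is_sum_unique _ _ _ (Rsum_spec k s Hst) (stencil_identity k s _ (Hsum s ltac:(lra)))). ring. }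
  assert (Hy : forall s, strip s -> snd s <> 0 -> h s = 0%C).
  (* [del] keeps the discs along the segment inside the strip and off the real axis. *)
  { intros s [S1 S2] Hs. set (del := Rmin (Rabs (snd s)) (Rmin (fst s - 1 / 20) (Rmin 1 (10 - fst s)))).
    assert (D1 : del <= Rabs (snd s)) by apply Rmin_l. assert (D' : del <= Rmin (fst s - 1 / 20) (Rmin 1 (10 - fst s))) by apply Rmin_r.
    assert (D2 := Rle_trans _ _ _ D' (Rmin_l _ _)). assert (D'' := Rle_trans _ _ _ D' (Rmin_r _ _)).
    assert (D3 := Rle_trans _ _ _ D'' (Rmin_l _ _)). assert (D4 := Rle_trans _ _ _ D'' (Rmin_r _ _)).
    assert (Dp : 0 < del) by (repeat apply Rmin_pos; try lra; apply Rabs_pos_lt; auto).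
    apply (identity_segment h (2, snd s) s del (1 / 2)); auto; try lra.
    - intros t Ht w Hw. destruct (near_coords _ _ _ Hw) as [T1 T2]. rewrite fst_seg in T1. rewrite snd_seg in T2. cbn [fst snd] in T1, T2.
      apply Rabs_lt_between in T1. apply Hd.
      + unfold strip. destruct (Rle_dec (fst s) 2).
        * assert (0 <= t * (2 - fst s) <= 2 - fst s) by nra. lra.
        * assert (0 <= t * (fst s - 2) <= fst s - 2) by nra. lra.
      + intros E. rewrite E in T2. cbn [snd RtoC] in T2. unfold RtoC in T2. cbn [snd] in T2.
        replace (0 - (snd s + t * (snd s - snd s))) with (- snd s) in T2 by ring. rewrite Rabs_Ropp in T2. lra.
    - intros z Hz. apply H0. destruct (near_coords _ _ _ Hz) as [T1 _]. cbn [fst] in T1. apply Rabs_lt_between in T1. lra.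
    - replace (s - s)%C with (RtoC 0) by ring. rewrite Cmod_0; auto. }
  intros s Hs N. apply Ceq_minus. change (h s = 0%C). destruct (Req_dec (snd s) 0) as [E|E]; [|auto].
  assert (Hc := diff_at_ccont h s (Hd s Hs N)). destruct (strip_open s Hs) as (r & Hr & HW).
  apply Cmod_zero_all. intros eps He. destruct (Hc eps He) as (d & Hdd & K).
  set (eta := Rmin d r / 2). assert (Hm : 0 < Rmin d r) by (apply Rmin_pos; auto).
  assert (Rmin d r <= d) by apply Rmin_l. assert (Rmin d r <= r) by apply Rmin_r. set (w := (s + Ci * RtoC eta)%C).
  assert (Ew : Cmod (w - s) = eta).
  { unfold w. replace (s + Ci * RtoC eta - s)%C with (Ci * RtoC eta)%C by ring. rewrite Cmod_mult, Cmod_Ci, Cmod_R, Rabs_right; unfold eta; lra. }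
  specialize (K w ltac:(rewrite Ew; unfold eta; lra)). rewrite Hy in K.
  - rewrite Cmod_minus_sym in K. replace (h s - 0)%C with (h s) in K by ring. lra.
  - apply HW. rewrite Ew. unfold eta; lra.
  - unfold w. destruct s as [x y]. simpl in *. rewrite E. unfold eta. lra.
Qed.

Definition mu (k : nat) (s : C) : C := match k with O => (s - 1)%C | _ => RtoC 1 end.

Lemma mu_diff (k : nat) (s : C) : diff_at (mu k) s.
Proof.
  destruct k; eexists.
  - apply cder_minus; [apply cder_id|apply cder_const].
  - apply (cder_const (RtoC 1)).
Qed.

Lemma mu_bound (k : nat) (s : C) : Cmod (mu k s) <= 1 + INR k + Cmod s.
Proof.
  assert (P := Cmod_ge_0 s). destruct k as [|k]; unfold mu.
  - eapply Rle_trans; [apply Cmod_triangle_minus|]. rewrite Cmod_1. simpl. lra.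
  - rewrite Cmod_1. assert (Q := pos_INR (S k)). lra.
Qed.

(** Modulo 5 the powers of 2 + i alternate between 2 + i and 3 + 4i, so none of them is real. *)
Lemma q5_pow_im (n : nat) : (snd (gpow q5 (S n)) mod 5 <> 0)%Z.
Proof.
  assert (H : ((fst (gpow q5 (S n)) mod 5 = 2 /\ snd (gpow q5 (S n)) mod 5 = 1) \/ (fst (gpow q5 (S n)) mod 5 = 3 /\ snd (gpow q5 (S n)) mod 5 = 4))%Z).
  { induction n as [|n IH]; [left; split; reflexivity|].
    change (gpow q5 (S (S n))) with (gmul q5 (gpow q5 (S n))). destruct (gpow q5 (S n)) as [a b]. unfold gmul, q5. cbn [fst snd] in *.
    Z.to_euclidean_division_equations. lia. }
  lia.
Qed.

Lemma gC_pow (x : gauss) (n : nat) : gC (gpow x n) = (gC x ^ n)%C.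
Proof. induction n; [reflexivity|]. simpl gpow. rewrite gC_mul, IHn. reflexivity. Qed.

Lemma ln5_gt1 : 1 < ln 5.
Proof. rewrite <- (ln_exp 1) at 1. apply ln_increasing; [apply exp_pos|]. assert (E := exp_le_3). lra. Qed.

Lemma Dk_cexp : exists om, forall k s, Dk k s = (1 - cexp (RtoC (ln 5) * (1 - s) + Ci * RtoC (INR k * om)))%C.
Proof.
  exists (4 * theta_gen 2 1). intros k s. unfold Dk. f_equal. f_equal.
  rewrite fk_eq by discriminate. unfold fz. rewrite gC_norm. change (gN q5) with 5%Z.
  change q5 with (2%Z, 1%Z). rewrite gnormal_polar, uz_polar by (try lia; apply Cmod_gt_0, gC_neq0; discriminate).
  rewrite cis_pow, cis_cexp, cexp_plus.
  replace (RtoC (ln 5) * (1 - s))%C with (RtoC (ln 5) + - s * RtoC (ln 5))%C by ring. rewrite cexp_plus, cexp_RtoC, exp_ln by lra. ring.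
Qed.

Lemma cexp_neg_ln5 : cexp (- RtoC 1 * RtoC (ln 5)) = RtoC (/ 5).
Proof.
  replace (- RtoC 1 * RtoC (ln 5))%C with (RtoC (- ln 5)) by (rewrite RtoC_opp; ring). rewrite cexp_RtoC, exp_Ropp, exp_ln by lra. auto.
Qed.

(** At s = 1 the factor is 1 - uz(2 + i)^k; were it zero, a positive power of 2 + i would equal its
    conjugate. Hence the functions with nontrivial character have no pole at 1. *)
Lemma Dk_1 (k : nat) : Dk (S k) (RtoC 1) <> 0%C.
Proof.
  unfold Dk. rewrite fk_eq by discriminate. unfold fz. rewrite gC_norm. change (gN q5) with 5%Z. rewrite cexp_neg_ln5. intros E.
  assert (N5 : gC q5 <> 0%C) by (apply gC_neq0; discriminate). assert (Nc := Cconj_neq0 _ N5). assert (U : (uz (gC q5) ^ S k = 1)%C).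
  { replace (uz (gC q5) ^ S k)%C with (1 - (1 - 5 * (uz (gC q5) ^ S k * RtoC (/ 5))))%C; [rewrite E; ring|].
    replace (RtoC (/ 5)) with (/ RtoC 5)%C by (rewrite RtoC_inv; [auto|lra]). field; try (apply RtoC_neq; lra). }
  unfold uz in U. rewrite <- Cpow_mult_r in U. unfold Cdiv in U. rewrite Cpow_mult_l, Cpow_inv in U by auto. set (n := (2 * S k)%nat) in *.
  assert (V : (gC q5 ^ n = Cconj (gC q5 ^ n))%C).
  { rewrite Cpow_conj. replace (gC q5 ^ n)%C with (gC q5 ^ n * / Cconj (gC q5) ^ n * Cconj (gC q5) ^ n)%C by (field; apply Cpow_nz; auto).
    rewrite U. ring. }
  rewrite <- gC_pow in V. apply (f_equal snd) in V. change (IZR (snd (gpow q5 n)) = - IZR (snd (gpow q5 n))) in V.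
  assert (Z0 : IZR (snd (gpow q5 n)) = 0) by lra. apply eq_IZR in Z0.
  assert (P := q5_pow_im (pred n)). replace (S (pred n)) with n in P by (unfold n; lia). rewrite Z0 in P. apply P. reflexivity.
Qed.

(** For k = 0 the zero at 1 is simple, because the derivative of [Dk] there is ln 5. *)
Lemma Dk_factor (k : nat) : exists E, (forall z, Cmod (z - RtoC 1) < 1 / 2 -> diff_at E z) /\ E (RtoC 1) <> 0%C /\
  forall z, Cmod (z - RtoC 1) < 1 / 2 -> Dk k z = (mu k z * E z)%C.
Proof.
  destruct k as [|k].
  - destruct (holo_factor (Dk 0) (RtoC 1) (RtoC 1) (1 / 2)) as (E & H1 & H2).
    + intros z _. eexists. apply diff_Dk.
    + replace (RtoC 1 - RtoC 1)%C with (RtoC 0) by ring. rewrite Cmod_0; lra.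
    + unfold Dk. rewrite fk_eq by discriminate. unfold fz. rewrite gC_norm. change (gN q5) with 5%Z. rewrite cexp_neg_ln5. simpl.
      replace (RtoC (/ 5)) with (/ RtoC 5)%C by (rewrite RtoC_inv; [auto|lra]). field; try (apply RtoC_neq; lra).
    + exists E. split; [exact H1|]. split; [|exact H2].
      assert (Hc : Cmod (RtoC 1 - RtoC 1) < 1 / 2) by (replace (RtoC 1 - RtoC 1)%C with (RtoC 0) by ring; rewrite Cmod_0; lra).
      destruct (H1 _ Hc) as [dE HdE]. assert (D : cder (Dk 0) (RtoC 1) (E (RtoC 1))).
      { apply (cder_ext_loc (fun z => (z - RtoC 1) * E z)%C (Dk 0) (RtoC 1) _ (1 / 2)); [lra|intros; symmetry; auto|].
        eapply cder_eq. apply (cder_mult (fun z => z - RtoC 1)%C E); [apply cder_minus; [apply cder_id|apply cder_const]|exact HdE]. ring. }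
      rewrite (cder_unique _ _ _ _ D (diff_Dk 0 (RtoC 1))).
      rewrite fk_eq by discriminate. unfold fz. rewrite gC_norm. change (gN q5) with 5%Z. rewrite cexp_neg_ln5. simpl.
      assert (L := ln5_gt1). repeat apply Cmult_neq_0; try (apply RtoC_neq; lra).
  - exists (Dk (S k)). split; [intros; eexists; apply diff_Dk|]. split; [apply Dk_1|]. intros; unfold mu; ring.
Qed.

(** No condition on the singularity of [F] at 1 is given. Near 1 the stencil identity writes F as
    [Rsum] over 4 [Dk], and [Dk] has only the zero of [mu] there, so mu F extends
    holomorphically. *)
Lemma entire_part (k : nat) (F : C -> C) : (forall z : C, z <> RtoC 1 -> diff_at F z) ->
  (forall s, 1 < fst s -> is_sum (fk k s) (4 * F s)%C) ->
  exists f, (forall s, strip s -> diff_at f s) /\ (forall s : C, s <> RtoC 1 -> f s = (mu k s * F s)%C) /\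
    (forall s, strip s -> (Dk k s * (4 * f s))%C = (mu k s * Rsum k s)%C).
Proof.
  intros HF Hsum. destruct (Dk_factor k) as (E & E1 & E2 & E3). assert (DF := Dk_F k F HF Hsum).
  set (f := fun s => if Ceq_dec s (RtoC 1) then (Rsum k s / (4 * E s))%C else (mu k s * F s)%C).
  assert (S1 : strip (RtoC 1)) by (unfold strip; simpl; lra).
  assert (Hc1 : Cmod (RtoC 1 - RtoC 1) < 1 / 2) by (replace (RtoC 1 - RtoC 1)%C with (RtoC 0) by ring; rewrite Cmod_0; lra).
  assert (N4 : RtoC 4 <> 0%C) by (apply RtoC_neq; lra). exists f. split; [|split].
  - intros s Hs. destruct (Ceq_dec s (RtoC 1)) as [->|N].
    + assert (EC : ccont E (RtoC 1)) by (apply diff_at_ccont, E1; auto).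
      destruct (EC (Cmod (E (RtoC 1)))) as (d & Hd & K); [apply Cmod_gt_0; auto|].
      destruct (E1 _ Hc1) as [dE HdE]. destruct (Rsum_diff k _ S1) as [dR HdR].
      eexists. apply (cder_ext_loc (fun s => Rsum k s / (4 * E s))%C f (RtoC 1) _ (Rmin d (1 / 2))).
      * apply Rmin_pos; lra.
      * intros w Hw. assert (L1 := Rlt_le_trans _ _ _ Hw (Rmin_l _ _)). assert (L2 := Rlt_le_trans _ _ _ Hw (Rmin_r _ _)).
        unfold f. destruct (Ceq_dec w (RtoC 1)) as [->|N]; auto. assert (NE : E w <> 0%C).
        { intros Z. specialize (K w L1). rewrite Z in K. replace (0 - E (RtoC 1))%C with (- E (RtoC 1))%C in K by ring. rewrite Cmod_opp in K. lra. }
        assert (Sw : strip w) by (unfold strip; assert (T := Cmod_Re (w - RtoC 1)); simpl in T; apply Rabs_le_between in T; lra).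
        rewrite <- (DF w Sw N), (E3 w L2). field. auto.
      * apply (cder_div (Rsum k) (fun s => 4 * E s)%C); [|exact HdR|apply cder_scal; exact HdE]. apply Cmult_neq_0; auto.
    + destruct (HF s N) as [dF HdF]. destruct (mu_diff k s) as [dm Hdm]. eexists.
      apply (cder_ext_loc (fun s => mu k s * F s)%C f s _ (Cmod (s - RtoC 1))).
      * apply Cmod_gt_0. intros Z; apply Ceq_minus in Z; auto.
      * intros w Hw. unfold f. destruct (Ceq_dec w (RtoC 1)) as [->|]; auto. rewrite Cmod_minus_sym in Hw. lra.
      * apply cder_mult; eauto.
  - intros s N. unfold f. destruct (Ceq_dec s (RtoC 1)); congruence.
  - intros s Hs. unfold f. destruct (Ceq_dec s (RtoC 1)) as [->|N].
    + rewrite E3 by auto. field. auto.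
    + rewrite <- (DF s Hs N). ring.
Qed.
End Continuation.

(** ** Polynomial bounds *)

Lemma sin_lower (x : R) : 0 <= x <= PI / 2 -> x / 8 <= sin x.
Proof.
  intros Hx. assert (PI4 := PI_4). destruct (Rle_dec x (1 / 2)) as [H|H].
  - assert (T := sin_taylor1 x). rewrite Rabs_right in T by lra. specialize (T ltac:(lra)). apply Rabs_le_between in T. simpl in T. nra.
  - assert (T := sin_taylor1 (1 / 2)). rewrite (Rabs_right (1 / 2)) in T by lra. specialize (T ltac:(lra)). apply Rabs_le_between in T.
    assert (sin (1 / 2) <= sin x); [|simpl in T; lra]. apply sin_incr_1; lra.
Qed.

Lemma sin_sqr_lower (x : R) : Rabs x <= PI / 2 -> x ^ 2 / 64 <= sin x ^ 2.
Proof.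
  intros H. assert (L := sin_lower (Rabs x) (conj (Rabs_pos x) H)). assert (E : sin x ^ 2 = sin (Rabs x) ^ 2).
  { unfold Rabs. destruct (Rcase_abs x); [rewrite sin_neg|]; ring. }
  rewrite E, <- (pow2_abs x). assert (P := Rabs_pos x). nra.
Qed.

Lemma reduce_2pi (b : R) : exists n : Z, Rabs (b - 2 * PI * IZR n) <= PI.
Proof.
  assert (P := PI_RGT_0). exists (Int_part (b / (2 * PI) + 1 / 2)).
  destruct (base_Int_part (b / (2 * PI) + 1 / 2)) as [H1 H2]. set (n := IZR (Int_part (b / (2 * PI) + 1 / 2))) in *.
  assert (E : b = 2 * PI * (b / (2 * PI))) by (field; lra). set (t := b / (2 * PI)) in *. apply Rabs_le. rewrite E. nra.
Qed.

Lemma cexp_2pi (n : Z) : cexp (Ci * RtoC (2 * PI * IZR n)) = 1%C.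
Proof.
  rewrite <- cis_cexp. unfold cis. replace (2 * PI * IZR n) with (0 + 2 * IZR n * PI) by ring.
  assert (H : forall m : nat, cos (0 + 2 * INR m * PI) = 1 /\ sin (0 + 2 * INR m * PI) = 0).
  { intros m. rewrite cos_period, sin_period, cos_0, sin_0; auto. }
  destruct (Z.le_gt_cases 0 n).
  - rewrite <- (Z2Nat.id n) by auto. rewrite <- INR_IZR_INZ. destruct (H (Z.to_nat n)) as [-> ->]. reflexivity.
  - replace (0 + 2 * IZR n * PI) with (- (0 + 2 * INR (Z.to_nat (- n)) * PI)).
    + rewrite cos_neg, sin_neg. destruct (H (Z.to_nat (- n))) as [-> ->]. unfold RtoC; f_equal; ring.
    + rewrite INR_IZR_INZ, Z2Nat.id, opp_IZR by lia. ring.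
Qed.

Lemma one_minus_cexp_far (v : C) : 1 <= Rabs (fst v) -> 1 / 2 <= Cmod (1 - cexp v).
Proof.
  intros H. unfold Rabs in H. destruct (Rcase_abs (fst v)).
  - assert (T := Cmod_triangle_sub 1 (cexp v)). rewrite Cmod_1, Cmod_cexp in T. assert (exp (fst v) <= 1 / 2); [|lra].
    replace (fst v) with (- (- fst v)) by ring. rewrite exp_Ropp. assert (E := exp_ineq1_le (- fst v)).
    replace (1 / 2) with (/ 2) by field. apply Rinv_le_contravar; lra.
  - assert (T := Cmod_triangle_sub (cexp v) 1). rewrite Cmod_1, Cmod_cexp, Cmod_minus_sym in T. assert (E := exp_ineq1_le (fst v)). lra.
Qed.

(** A lower bound for |1 - e^v| by the distance from v to a multiple of 2 pi i. It rests on |1 -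
    e^(a+ib)|^2 = (e^a - 1)^2 + 4 e^a sin^2(b/2). *)
Lemma one_minus_cexp_near (v : C) : Rabs (fst v) <= 1 ->
  exists n : Z, Cmod (v - Ci * RtoC (2 * PI * IZR n)) <= 5 /\ Cmod (v - Ci * RtoC (2 * PI * IZR n)) <= 32 * Cmod (1 - cexp v).
Proof.
  intros Ha. destruct (reduce_2pi (snd v)) as [n Hn]. exists n. set (v' := (v - Ci * RtoC (2 * PI * IZR n))%C).
  assert (Ev : cexp v = cexp v').
  { replace v with (v' + Ci * RtoC (2 * PI * IZR n))%C by (unfold v'; ring). rewrite cexp_plus, cexp_2pi. ring. }
  set (a := fst v). set (b := snd v - 2 * PI * IZR n). assert (Evab : v' = (a, b)) by (unfold v', a, b; csolve).
  assert (PI4 := PI_4). assert (a1 := Ha). fold a in a1. apply Rabs_le_between in a1. split.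
  - eapply Rle_trans; [apply Cmod_le_sum|]. rewrite Evab. simpl. fold a in Ha. fold b in Hn. lra.
  - rewrite Ev, Evab.
    assert (S := sin_sqr_lower (b / 2)). rewrite Rabs_div, (Rabs_right 2) in S by lra. fold b in Hn. specialize (S ltac:(lra)).
    assert (E : (Cmod (1 - cexp (a, b))) ^ 2 = (exp a - 1) ^ 2 + 4 * exp a * sin (b / 2) ^ 2).
    { rewrite Cmod_sqr. unfold cexp, Cminus, Cplus, Copp, RtoC; cbn [fst snd].
      replace (cos b) with (1 - 2 * sin (b / 2) ^ 2) by (replace b with (2 * (b / 2)) at 2 by field; rewrite cos_2a_sin; ring).
      assert (T : sin b ^ 2 = 4 * sin (b / 2) ^ 2 * (1 - sin (b / 2) ^ 2)).
      { replace b with (2 * (b / 2)) at 1 by field. rewrite sin_2a. assert (Q := sin2_cos2 (b / 2)). unfold Rsqr in Q.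
        replace (1 - sin (b / 2) ^ 2) with (cos (b / 2) * cos (b / 2)) by (simpl; lra). ring. }
      replace ((0 + - (exp a * sin b)) ^ 2) with (exp a ^ 2 * sin b ^ 2) by ring. rewrite T. ring. }
    assert (X1 : a ^ 2 / 4 <= (exp a - 1) ^ 2).
    { destruct (Rle_dec 0 a) as [L|L].
      - assert (T := exp_ineq1_le a). nra.
      - assert (T := exp_ineq1_le (- a)).
        assert (Q : exp (- a) * exp a = 1) by (rewrite <- exp_plus; replace (- a + a) with 0 by ring; apply exp_0).
        assert (- a / 2 <= 1 - exp a) by nra. nra. }
    assert (X2 : 1 / 4 <= exp a).
    { assert (E3 := exp_le_3).
      apply Rle_trans with (exp (- (1))); [|apply exp_le_mono; lra]. rewrite exp_Ropp. replace (1 / 4) with (/ 4) by field.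
      apply Rinv_le_contravar; [apply exp_pos|lra]. }
    assert (X3 : (Cmod (a, b)) ^ 2 = a ^ 2 + b ^ 2) by (rewrite Cmod_sqr; reflexivity). assert (Y2 := Cmod_ge_0 (1 - cexp (a, b))).
    apply Rsqr_incr_0_var; [|lra]. rewrite !Rsqr_pow2. rewrite Rpow_mult_distr, E, X3. nra.
Qed.

(** [f] is P/(4 Dk) with P = mu Rsum of polynomial size, but [Dk] has zeros all along Re s = 1. [P]
    vanishes at each of them as well, so near a zero z1 it is at most sup|P'| times |w - z1|, and |w
    - z1| is at most 32 |Dk|. *)
Lemma poly_bound (BB : R) (HBB : sum_bounded (gw (21 / 20)) BB) : exists CB, 0 < CB /\ forall k f,
  (forall s, strip s -> diff_at f s) -> (forall s, strip s -> (Dk k s * (4 * f s))%C = (mu k s * Rsum k s)%C) ->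
  forall s, 1 / 10 <= fst s <= 8 -> Cmod (f s) <= CB * (1 + INR k + Cmod s) ^ 3.
Proof.
  assert (CRp := CR_pos BB HBB). set (CP := CR BB) in *. exists (16 * 32 * 25 * 343 * CP + CP). split; [lra|]. intros k f Hf HD.
  assert (Hk := pos_INR k). set (P := fun s => (mu k s * Rsum k s)%C). assert (HPd : forall s, strip s -> diff_at P s).
  { intros s Hs. destruct (mu_diff k s). destruct (Rsum_diff BB HBB k s Hs). eexists. apply cder_mult; eauto. }
  assert (HPb : forall s, strip s -> Cmod (P s) <= CP * (1 + INR k + Cmod s) ^ 3).
  { intros s Hs. unfold P. rewrite Cmod_mult. assert (A1 := mu_bound k s). assert (A2 := Rsum_bound BB HBB k s Hs). fold CP in A2.
    replace (CP * (1 + INR k + Cmod s) ^ 3) with ((1 + INR k + Cmod s) * (CP * (1 + INR k + Cmod s) ^ 2)) by ring.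
    apply Rmult_le_compat; try apply Cmod_ge_0; auto. }
  destruct Dk_cexp as [om Hom]. assert (L5 := ln5_gt1).
  assert (Main : forall w, 1 / 10 <= fst w <= 8 -> Dk k w <> 0%C -> Cmod (f w) <= (16 * 32 * 25 * 343 * CP + CP) * (1 + INR k + Cmod w) ^ 3).
  { intros w Hw HDw. assert (Sw : strip w) by (unfold strip; lra). assert (Hw0 := Cmod_ge_0 w).
    assert (EP : Cmod (Dk k w) * (4 * Cmod (f w)) = Cmod (P w)).
    { unfold P. rewrite <- HD by auto. rewrite (Cmod_mult (Dk k w)), (Cmod_mult 4), Cmod_R, Rabs_right; lra. }
    assert (Hf0 := Cmod_ge_0 (f w)). assert (HD0 : 0 < Cmod (Dk k w)) by (apply Cmod_gt_0; auto).
    set (V := 1 + INR k + Cmod w) in *. assert (HV : 1 <= V) by (unfold V; lra).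
    set (v := (RtoC (ln 5) * (1 - w) + Ci * RtoC (INR k * om))%C). assert (EDv : Dk k w = (1 - cexp v)%C) by apply Hom.
    assert (Fv : fst v = ln 5 * (1 - fst w)) by (unfold v; destruct w; simpl; ring). destruct (Rle_dec 1 (Rabs (fst v))) as [Hfar|Hnear].
    - apply one_minus_cexp_far in Hfar. rewrite <- EDv in Hfar. assert (B := HPb w Sw). fold V in B. nra.
    - destruct (one_minus_cexp_near v) as (n & N1 & N2); [lra|]. rewrite <- EDv in N2. set (v' := (v - Ci * RtoC (2 * PI * IZR n))%C) in *.
      (* Moving [w] by v'/ln 5 carries the exponent to a multiple of 2 pi i: this is a zero of [Dk],
         and it lies on Re s = 1. *)
      set (z1 := (w + v' * RtoC (/ ln 5))%C). assert (Nl : RtoC (ln 5) <> 0%C) by (apply RtoC_neq; lra). assert (Hz1 : Dk k z1 = 0%C).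
      { rewrite Hom. replace (RtoC (ln 5) * (1 - z1) + Ci * RtoC (INR k * om))%C with (Ci * RtoC (2 * PI * IZR n))%C.
        - rewrite cexp_2pi. ring.
        - unfold z1, v', v. rewrite RtoC_inv by lra. field. auto. }
      assert (Fz1 : fst z1 = 1).
      { unfold z1. replace (fst (w + v' * RtoC (/ ln 5))%C) with (fst w + fst v' * / ln 5) by (destruct w, v'; simpl; ring).
        replace (fst v') with (fst v) by (unfold v'; destruct v; simpl; ring). rewrite Fv. field. lra. }
      assert (Dz : Cmod (w - z1) = Cmod v' * / ln 5).
      { unfold z1. replace (w - (w + v' * RtoC (/ ln 5)))%C with (- (v' * RtoC (/ ln 5)))%C by ring.
        rewrite Cmod_opp, Cmod_mult, Cmod_R, Rabs_right; auto. left. positive. }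
      assert (IL : / ln 5 <= 1) by (rewrite <- Rinv_1; apply Rinv_le_contravar; lra). assert (Hv'0 := Cmod_ge_0 v').
      assert (Hdist : Cmod (w - z1) <= Cmod v') by (rewrite Dz; rewrite <- (Rmult_1_r (Cmod v')) at 2; apply Rmult_le_compat_l; auto).
      assert (Sz1 : strip z1) by (unfold strip; lra). assert (Pz1 : P z1 = 0%C) by (unfold P; rewrite <- HD, Hz1 by auto; ring).
      assert (Seg : forall t, 0 <= t <= 1 -> let y := (z1 + RtoC t * (w - z1))%C in 1 / 10 <= fst y <= 8 /\ Cmod y <= Cmod w + 5).
      { intros t Ht y. split.
        - unfold y. replace (fst (z1 + RtoC t * (w - z1))%C) with (fst z1 + t * (fst w - fst z1)) by (destruct z1, w; simpl; ring). rewrite Fz1. nra.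
        - replace y with (w + RtoC (t - 1) * (w - z1))%C by (unfold y; rewrite RtoC_minus; ring).
          eapply Rle_trans; [apply Cmod_triangle|]. rewrite Cmod_mult, Cmod_R, Rabs_left1 by lra. nra. }
      assert (Bseg := holo_segment_bound P z1 w (25 * CP * (7 * V) ^ 3) (1 / 20)).
      rewrite Pz1 in Bseg. replace (P w - 0)%C with (P w) in Bseg by ring. rewrite <- EP in Bseg.
      assert (Bfin : Cmod (Dk k w) * (4 * Cmod (f w)) <= 25 * CP * (7 * V) ^ 3 * Cmod (w - z1)).
      { apply Bseg; [lra| |].
        - intros t Ht z Hz. apply HPd. destruct (Seg t Ht) as [G1 _]. set (y := (z1 + RtoC t * (w - z1))%C) in *.
          destruct (near_coords _ _ _ Hz) as [T _]. apply Rabs_lt_between in T. unfold strip. lra.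
        - intros t Ht. destruct (Seg t Ht) as [G1 G2]. set (y := (z1 + RtoC t * (w - z1))%C) in *.
          eapply Rle_trans; [apply (cauchy_deriv_bound P y (1 / 25) (1 / 20) (CP * (7 * V) ^ 3)); try lra|].
          + intros z Hz. apply HPd. destruct (near_coords _ _ _ Hz) as [T _]. apply Rabs_lt_between in T. unfold strip. lra.
          + intros z Hz. assert (Hz' : Cmod (z - y) < 1 / 20) by lra. destruct (near_coords _ _ _ Hz') as [T _]. apply Rabs_lt_between in T.
            eapply Rle_trans; [apply HPb; unfold strip; lra|]. apply Rmult_le_compat_l; [lra|]. apply pow_incr.
            assert (Hz0 := Cmod_ge_0 z). split; [lra|]. replace z with (y + (z - y))%C by ring.
            assert (T2 := Cmod_triangle y (z - y)). unfold V. lra.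
          + right. field. }
      assert (Q : Cmod (Dk k w) * (4 * Cmod (f w)) <= Cmod (Dk k w) * (32 * (25 * CP * (7 * V) ^ 3))).
      { eapply Rle_trans; [exact Bfin|]. replace (Cmod (Dk k w) * (32 * (25 * CP * (7 * V) ^ 3))) with ((25 * CP * (7 * V) ^ 3) * (32 * Cmod (Dk k w))) by ring.
        apply Rmult_le_compat_l; [|lra]. apply Rmult_le_pos; [lra|apply pow_le; lra]. }
      apply Rmult_le_reg_l in Q; auto. replace ((7 * V) ^ 3) with (343 * V ^ 3) in Q by ring. nra. }
  intros s Hs. destruct (classic (Dk k s = 0%C)) as [E|N]; [|apply Main; auto]. assert (F1 : fst s = 1).
  { rewrite Hom in E. set (v := (RtoC (ln 5) * (1 - s) + Ci * RtoC (INR k * om))%C) in *.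
    assert (C1 : Cmod (cexp v) = 1) by (replace (cexp v) with (1 - (1 - cexp v))%C by ring; rewrite E; replace (1 - 0)%C with (RtoC 1) by ring; apply Cmod_1).
    rewrite Cmod_cexp in C1. assert (fst v = 0) by (rewrite <- ln_1, <- C1, ln_exp; auto).
    assert (Fv : fst v = ln 5 * (1 - fst s)) by (unfold v; destruct s; simpl; ring). nra. }
  (* At a zero of [Dk] the estimate is the limit of those at s + e, which are not zeros since they
     lie off Re s = 1. *)
  apply le_epsilon. intros eps He. assert (Ss : strip s) by (unfold strip; lra).
  set (Y := fun e : R => (16 * 32 * 25 * 343 * CP + CP) * (1 + INR k + (Cmod s + e)) ^ 3). assert (YC : continuity_pt Y 0).
  { apply derivable_continuous_pt. unfold Y. reg. }
  destruct (YC (eps / 2)) as (d1 & Hd1 & K1); [lra|]. destruct (diff_at_ccont f s (Hf s Ss) (eps / 2)) as (d2 & Hd2 & K2); [lra|].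
  set (e := Rmin 1 (Rmin d1 d2) / 2). assert (Hm : 0 < Rmin 1 (Rmin d1 d2)) by (repeat apply Rmin_pos; lra).
  assert (M1 := Rmin_l 1 (Rmin d1 d2)). assert (M2 := Rmin_r 1 (Rmin d1 d2)). assert (M3 := Rmin_l d1 d2). assert (M4 := Rmin_r d1 d2).
  assert (Hee : 0 < e) by (unfold e; lra). set (w := (s + RtoC e)%C).
  assert (Ews : Cmod (w - s) = e) by (unfold w; replace (s + RtoC e - s)%C with (RtoC e) by ring; rewrite Cmod_R, Rabs_right; lra).
  assert (Fw : fst w = 1 + e) by (unfold w; destruct s; simpl in *; lra). assert (Dw : Dk k w <> 0%C).
  { intros E2. rewrite Hom in E2. set (v := (RtoC (ln 5) * (1 - w) + Ci * RtoC (INR k * om))%C) in *.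
    assert (C1 : Cmod (cexp v) = 1) by (replace (cexp v) with (1 - (1 - cexp v))%C by ring; rewrite E2; replace (1 - 0)%C with (RtoC 1) by ring; apply Cmod_1).
    rewrite Cmod_cexp in C1. assert (fst v = 0) by (rewrite <- ln_1, <- C1, ln_exp; auto).
    assert (Fv : fst v = ln 5 * (1 - fst w)) by (unfold v; destruct w; simpl; ring). nra. }
  assert (B := Main w ltac:(unfold e in *; lra) Dw). specialize (K2 w ltac:(rewrite Ews; unfold e; lra)).
  assert (T := Cmod_triangle_sub (f s) (f w)). rewrite Cmod_minus_sym in T.
  assert (Tw : Cmod w <= Cmod s + e) by (replace w with (s + (w - s))%C by ring; rewrite <- Ews; apply Cmod_triangle).
  assert (KY : Rabs (Y e - Y 0) < eps / 2).
  { apply K1. split; [split; [exact I|lra]|]. unfold R_dist. simpl. unfold R_dist. rewrite Rminus_0_r, Rabs_right; unfold e; lra. }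
  apply Rabs_lt_between in KY. unfold Y in KY. rewrite Rplus_0_r in KY.
  assert ((1 + INR k + Cmod w) ^ 3 <= (1 + INR k + (Cmod s + e)) ^ 3) by (apply pow_incr; assert (Q := Cmod_ge_0 w); lra).
  assert ((16 * 32 * 25 * 343 * CP + CP) * (1 + INR k + Cmod w) ^ 3 <= (16 * 32 * 25 * 343 * CP + CP) * (1 + INR k + (Cmod s + e)) ^ 3) by (apply Rmult_le_compat_l; lra).
  lra.
Qed.

(** * The logarithmic derivative as a von Mangoldt series *)

(** Multiplication of pairs has an infinite fibre over 0, so the listed fibres are required to cover
    only the support of the family. *)
Lemma is_sum_fiber_support {A B : Type} (f : A -> C) (S : C) (pi : A -> B) (fib : B -> list A) : is_sum f S ->
  (forall b, NoDup (fib b)) -> (forall a b, In a (fib b) -> pi a = b) -> (forall a, f a <> 0%C -> In a (fib (pi a))) ->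
  is_sum (fun b => csum f (fib b)) S.
Proof.
  intros H Hn Hin Hsup eps He. destruct (H eps He) as (l & N & K).
  exists (nodup eqd (map pi l)). split; [apply NoDup_nodup|]. intros l' N' I. rewrite <- csum_flat_map. set (m := flat_map fib l').
  assert (Nm : NoDup m).
  { apply NoDup_flat_map; auto. intros b b' a _ _ I1 I2. apply Hin in I1. apply Hin in I2. congruence. }
  assert (E : csum f m = csum f (m ++ outside m l)).
  { rewrite csum_app, (csum_zero f (outside m l)); [ring|]. intros a Ha. apply in_outside in Ha. destruct Ha as [Ha1 Ha2].
    destruct (Ceq_dec (f a) 0) as [|N0]; auto. exfalso. apply Ha2. apply in_flat_map. exists (pi a).
    split; [apply I, nodup_In, in_map; auto|apply Hsup; auto]. }
  rewrite E. apply K.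
  - apply NoDup_app_disj; auto using NoDup_outside. intros x H1 H2. apply in_outside in H2. tauto.
  - intros x Hx. apply in_app_iff. destruct (in_dec eqd x m); auto. right. apply in_outside; auto.
Qed.

Definition gquot (x d : gauss) : gauss := epsilon (inhabits g0) (fun z => x = gmul d z).
Lemma gquot_spec (x d : gauss) : in_ideal d x -> x = gmul d (gquot x d).
Proof. intros H. exact (epsilon_spec (inhabits g0) (fun z => x = gmul d z) H). Qed.

Definition div_pairs (x : gauss) : list (gauss * gauss) :=
  if eqd x g0 then [] else map (fun d => (d, gquot x d)) (gdivs x).

Lemma fk_g0 (k : nat) (s : C) : fk k s g0 = 0%C.
Proof. unfold fk. destruct (eqd g0 g0); congruence. Qed.

Lemma Lam_g0 : Lam g0 = 0.
Proof. destruct (Lam_cases g0) as [(p & m & H)|E]; auto. exfalso. apply (is_pp_neq0 _ _ _ H). auto. Qed.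

(** Dirichlet convolution: the pairs with product x contribute fk(x) times the divisor sum of
    [Lam]. *)
Lemma mangoldt_convolution (k : nat) (s h S : C) (K K' : R) :
  sum_bounded (fun x => Lam x * gw (fst s) x) K -> sum_bounded (gw (fst s)) K' ->
  is_sum (fun x => RtoC (Lam x) * fk k s x)%C h -> is_sum (fk k s) S ->
  is_sum (fun x => 4 * (RtoC (ln (IZR (gN x))) * fk k s x))%C (h * S)%C.
Proof.
  intros HK HK' Hh HS. assert (P := is_sum_prod (fun x => RtoC (Lam x) * fk k s x)%C (fk k s) h S K K').
  assert (HP : is_sum (fun p => RtoC (Lam (fst p)) * fk k s (fst p) * fk k s (snd p))%C (h * S)%C).
  { apply P; auto.
    - eapply sum_bounded_le; [|exact HK]. intros x; simpl. rewrite Cmod_mult, Cmod_fk, Cmod_R, Rabs_right by (apply Rle_ge, Lam_nonneg). lra.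
    - eapply sum_bounded_le; [|exact HK']. intros x; simpl. rewrite Cmod_fk. lra. }
  clear P. apply (is_sum_fiber_support _ _ (fun p => gmul (fst p) (snd p)) div_pairs) in HP.
  - eapply is_sum_ext; [|exact HP]. intros x. simpl. unfold div_pairs. destruct (eqd x g0) as [->|N].
    + simpl. rewrite fk_g0. ring.
    + rewrite csum_map. cbn [fst snd]. rewrite (csum_ext _ (fun d => fk k s x * RtoC (Lam d))%C).
      * rewrite csum_scal, csum_RtoC, Lam_divisor_sum by auto. rewrite RtoC_mult. ring.
      * intros d Hd. apply in_gdivs in Hd; auto. rewrite (gquot_spec x d Hd) at 2. rewrite fk_mult. ring.
  - intros x. unfold div_pairs. destruct (eqd x g0); [constructor|].
    apply FinFun.Injective_map_NoDup; [|apply NoDup_gdivs]. intros a b E. congruence.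
  - intros [a b] x H. unfold div_pairs in H. destruct (eqd x g0) as [|N]; [contradiction|].
    apply in_map_iff in H. destruct H as (d & E & Hd). apply in_gdivs in Hd; auto. inversion E; subst. cbn [fst snd]. symmetry. apply gquot_spec; auto.
  - intros [a b] H. cbn [fst snd] in *. assert (Na : a <> g0) by (intros ->; apply H; rewrite Lam_g0; ring).
    assert (Nb : b <> g0) by (intros ->; apply H; rewrite fk_g0; ring).
    assert (Nab := gmul_neq0 a b Na Nb). unfold div_pairs. destruct (eqd (gmul a b) g0); [contradiction|].
    apply in_map_iff. exists a. assert (D : in_ideal a (gmul a b)) by (exists b; auto).
    split; [|apply in_gdivs; auto]. f_equal. apply (gmul_cancel a); auto. symmetry. apply gquot_spec; auto.
Qed.

Lemma ln_le_gw (sigma e : R) (x : gauss) : 0 < e -> ln (IZR (gN x)) * gw sigma x <= / e * gw (sigma - e) x.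
Proof.
  intros He. destruct (eqd x g0) as [->|N].
  - unfold gw. destruct (eqd g0 g0); [lra|congruence].
  - rewrite !gw_fst_exp by auto. set (L := ln (IZR (gN x))).
    replace (- (sigma - e) * L) with (e * L + - sigma * L) by ring. rewrite exp_plus.
    assert (T := exp_ineq1_le (e * L)). assert (P := exp_pos (- sigma * L)). assert (L <= / e * exp (e * L)).
    { apply Rmult_le_reg_l with e; auto. rewrite <- Rmult_assoc, Rinv_r by lra. lra. }
    rewrite <- Rmult_assoc. apply Rmult_le_compat_r; lra.
Qed.

Lemma Lam_gw_le (sigma e : R) (x : gauss) : 0 < e -> Lam x * gw sigma x <= / e * gw (sigma - e) x.
Proof.
  intros He. eapply Rle_trans; [|apply ln_le_gw; exact He]. destruct (eqd x g0) as [->|N].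
  - unfold gw. destruct (eqd g0 g0); [lra|congruence].
  - apply Rmult_le_compat_r; [apply gw_nonneg|apply Lam_le; auto].
Qed.

Lemma Lam_gw_bounded : (forall sigma, 1 < sigma -> exists B, sum_bounded (gw sigma) B) ->
  forall sigma, 1 < sigma -> exists B, sum_bounded (fun x => Lam x * gw sigma x) B.
Proof.
  intros W sigma Hs. set (e := (sigma - 1) / 2). destruct (W (sigma - e)) as [B HB]; [unfold e; lra|].
  exists (/ e * B). eapply sum_bounded_le; [intros x; apply (Lam_gw_le sigma e); unfold e; lra|].
  apply sum_bounded_scal; auto. left. apply Rinv_0_lt_compat. unfold e; lra.
Qed.

Lemma is_sum_Re_nonneg {A : Type} (g : A -> C) (S : C) : (forall x, 0 <= fst (g x)) -> is_sum g S -> 0 <= fst S.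
Proof.
  intros Hg H. apply le_epsilon. intros eps He. destruct (H eps He) as (l & N & K).
  specialize (K l N (incl_refl l)). assert (P : 0 <= fst (csum g l)).
  { clear - Hg. induction l; simpl; [lra|]. specialize (Hg a). lra. }
  assert (T := Re_le_Cmod (csum g l - S)). change (fst (csum g l - S)%C) with (fst (csum g l) - fst S) in T. lra.
Qed.

(** The squared modulus along a horizontal line obeys a real differential equation; no logarithm of
    F is needed before F is known not to vanish. *)
Lemma normsq_derive (F : C -> C) (t x : R) (H : C) : cder F (x, t) (- H * F (x, t))%C ->
  is_derive (fun y => Cmod (F (y, t)) ^ 2) x (- 2 * fst H * Cmod (F (x, t)) ^ 2).
Proof.
  intros HF.
  assert (Hr : rder (fun y => F (y, t)) x (- H * F (x, t) * 1)%C) by (apply (rder_comp F (fun y => (y, t))); [exact HF|apply rder_hor]).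
  assert (D1 := rder_fst _ _ _ Hr). assert (D2 := rder_snd _ _ _ Hr).
  apply is_derive_ext with (fun y => fst (F (y, t)) * fst (F (y, t)) + snd (F (y, t)) * snd (F (y, t))).
  - intros y. rewrite Cmod_sqr. simpl. ring.
  - eapply is_derive_ext_loc; [apply filter_forall; intros; reflexivity|].
    replace (- 2 * fst H * Cmod (F (x, t)) ^ 2) with
      ((fst (- H * F (x, t) * 1)%C * fst (F (x, t)) + fst (F (x, t)) * fst (- H * F (x, t) * 1)%C) +
       (snd (- H * F (x, t) * 1)%C * snd (F (x, t)) + snd (F (x, t)) * snd (- H * F (x, t) * 1)%C)).
    + apply (is_derive_plus (V := R_NormedModule) (fun y => fst (F (y, t)) * fst (F (y, t))) (fun y => snd (F (y, t)) * snd (F (y, t)))).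
      * apply (is_derive_mult (fun y => fst (F (y, t))) (fun y => fst (F (y, t)))); auto. intros; apply Rmult_comm.
      * apply (is_derive_mult (fun y => snd (F (y, t))) (fun y => snd (F (y, t)))); auto. intros; apply Rmult_comm.
    + rewrite Cmod_sqr. destruct H, (F (x, t)); simpl. ring.
Qed.

Lemma nonincreasing (g dg : R -> R) (a b : R) : a <= b -> (forall x, a <= x <= b -> is_derive g x (dg x)) ->
  (forall x, a <= x <= b -> dg x <= 0) -> g b <= g a.
Proof.
  intros Hab Hd Hn. destruct (MVT_gen g a b dg) as (c & Hc & E).
  - intros x Hx. rewrite Rmin_left, Rmax_right in Hx by lra. apply Hd; lra.
  - intros x Hx. rewrite Rmin_left, Rmax_right in Hx by lra. apply derivable_continuous_pt. exists (dg x). apply is_derive_Reals, Hd; lra.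
  - rewrite Rmin_left, Rmax_right in Hc by lra. assert (Q := Hn c ltac:(lra)). assert (dg c * (b - a) <= 0) by nra. lra.
Qed.

(* [F k] is [L(s, Xi_k)]; [f k] is [F k], multiplied by [s - 1] when [k = 0], with the removable singularity at 1 filled in. *)
Record Ldata (BB : R) (F f : nat -> C -> C) : Prop := {
  Ld_W : forall sigma, 1 < sigma -> exists B, sum_bounded (gw sigma) B;
  Ld_diff : forall k (z : C), z <> RtoC 1 -> diff_at (F k) z;
  Ld_sum : forall k s, 1 < fst s -> is_sum (fk k s) (4 * F k s)%C;
  Ld_grh : forall k s, 0 < fst s < 1 -> F k s = 0%C -> fst s = 1 / 2;
  Ld_fdiff : forall k s, strip s -> diff_at (f k) s;
  Ld_feq : forall k (s : C), s <> RtoC 1 -> f k s = (mu k s * F k s)%C;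
  Ld_bound : forall k s, 1 / 10 <= fst s <= 8 -> Cmod (f k s) <= BB * (1 + INR k + Cmod s) ^ 3 }.

Section LFunctions.
Variables (BB : R) (F f : nat -> C -> C).
Hypothesis HL : Ldata BB F f.

(** A sum over Gaussian integers, hence four times -L'/L. *)
Definition Lamsum (k : nat) (s : C) : C := epsilon (inhabits (RtoC 0)) (fun h => is_sum (fun x => RtoC (Lam x) * fk k s x)%C h).

Lemma Lamsum_spec (k : nat) (s : C) : 1 < fst s -> is_sum (fun x => RtoC (Lam x) * fk k s x)%C (Lamsum k s).
Proof.
  intros Hs. apply (epsilon_spec (inhabits (RtoC 0)) (fun h => is_sum (fun x => RtoC (Lam x) * fk k s x)%C h)).
  destruct (Lam_gw_bounded (Ld_W _ _ _ HL) (fst s) Hs) as [B HB]. apply is_sum_exists with B.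
  eapply sum_bounded_le; [|exact HB]. intros x; simpl. rewrite Cmod_mult, Cmod_fk, Cmod_R, Rabs_right by (apply Rle_ge, Lam_nonneg). lra.
Qed.

Lemma Lamsum_bound (k : nat) (s : C) (sigma B : R) : 1 < sigma <= fst s -> sum_bounded (fun x => Lam x * gw sigma x) B -> Cmod (Lamsum k s) <= B.
Proof.
  intros Hs HB. apply (is_sum_le _ _ _ (Lamsum_spec k s ltac:(lra))).
  eapply sum_bounded_le; [|exact HB]. intros x; simpl. rewrite Cmod_mult, Cmod_fk, Cmod_R, Rabs_right by (apply Rle_ge, Lam_nonneg).
  apply Rmult_le_compat_l; [apply Lam_nonneg|apply gw_mono; lra].
Qed.

Lemma neq1_of_Re (s : C) : 1 < fst s -> s <> RtoC 1.
Proof. intros H E. rewrite E in H. simpl in H. lra. Qed.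

(** Termwise differentiation gives (4F)' = - sum of ln N fk, while the convolution identity gives
    Lamsum 4F = 4 times that sum. *)
Lemma log_deriv_series (k : nat) (s : C) : 1 < fst s -> cder (F k) s (- (Lamsum k s / 4) * F k s)%C.
Proof.
  intros Hs. set (r := (fst s - 1) / 2). set (sg := 1 + r). destruct (Ld_W _ _ _ HL sg) as [B HB]; [unfold sg, r; lra|].
  assert (Hn : forall z : C, Cmod (z - s) <= r -> sg <= fst z).
  { intros z Hz. assert (T := Cmod_Re (z - s)). change (fst (z - s)%C) with (fst z - fst s) in T. apply Rabs_le_between in T. unfold sg, r in *. lra. }
  destruct (is_sum_cder (fun x s => fk k s x) (fun s => 4 * F k s)%C (gw sg) B s r (r + 1)) as (D & HD1 & HD2); auto; try (unfold r; lra).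
  - intros x z _. eexists. apply cder_fk.
  - intros x z Hz. rewrite Cmod_fk. apply gw_mono. apply Hn; auto.
  - intros z Hz. apply (Ld_sum _ _ _ HL). specialize (Hn z ltac:(unfold r in *; lra)). unfold sg, r in *. lra.
  - destruct (Lam_gw_bounded (Ld_W _ _ _ HL) (fst s) Hs) as [B1 HB1]. destruct (Ld_W _ _ _ HL (fst s) Hs) as [B2 HB2].
    assert (Cv := mangoldt_convolution k s (Lamsum k s) (4 * F k s)%C B1 B2 HB1 HB2 (Lamsum_spec k s Hs) (Ld_sum _ _ _ HL k s Hs)).
    assert (E : (Lamsum k s * (4 * F k s) = -(4) * D)%C).
    { apply (is_sum_unique _ _ _ Cv). eapply is_sum_ext; [|apply (is_sum_scal (-(4))%C _ _ HD1)].
      intros x. simpl. rewrite (Cderiv_eq _ _ _ (cder_fk k s x)). ring. }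
    destruct (Ld_diff _ _ _ HL k s (neq1_of_Re s Hs)) as [d Hd]. assert (E2 := cder_unique _ _ _ _ HD2 (cder_scal 4 (F k) s d Hd)).
    eapply cder_eq; [exact Hd|]. rewrite E2 in E.
    replace d with (- (-(4) * (4 * d)) / (4 * 4))%C by (field; auto). rewrite <- E. field; auto.
Qed.

Lemma normsq_F (k : nat) (t x : R) : 1 < x ->
  is_derive (fun y => Cmod (F k (y, t)) ^ 2) x (- / 2 * fst (Lamsum k (x, t)) * Cmod (F k (x, t)) ^ 2).
Proof.
  intros Hx. replace (- / 2 * fst (Lamsum k (x, t))) with (- 2 * fst (Lamsum k (x, t) / 4)%C).
  - apply normsq_derive. apply log_deriv_series. auto.
  - unfold Cdiv. rewrite <- RtoC_inv by lra. destruct (Lamsum k (x, t)); simpl. field.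
Qed.

(* Gronwall along a horizontal ray: |F|^2 e^{-b x} is nonincreasing when b bounds |h|. *)
Lemma F_gronwall (k : nat) (t x0 x1 b : R) : 1 < x0 <= x1 -> sum_bounded (fun x => Lam x * gw x0 x) b ->
  Cmod (F k (x1, t)) ^ 2 * exp (- b * x1) <= Cmod (F k (x0, t)) ^ 2 * exp (- b * x0).
Proof.
  intros Hx Hb.
  apply (nonincreasing (fun x => Cmod (F k (x, t)) ^ 2 * exp (- b * x))
    (fun x => (- / 2 * fst (Lamsum k (x, t)) * Cmod (F k (x, t)) ^ 2) * exp (- b * x) + Cmod (F k (x, t)) ^ 2 * (- b * exp (- b * x)))); [lra| |].
  - intros x Hx'. apply (is_derive_mult (fun y => Cmod (F k (y, t)) ^ 2) (fun y => exp (- b * y))); [apply normsq_F; lra| |intros; apply Rmult_comm].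
    auto_derive; auto. ring.
  - intros x Hx'. assert (B := Lamsum_bound k (x, t) x0 b ltac:(simpl; lra) Hb).
    assert (T := Cmod_Re (Lamsum k (x, t))). apply Rabs_le_between in T.
    assert (E := exp_pos (- b * x)). assert (N : 0 <= Cmod (F k (x, t)) ^ 2) by apply pow2_ge_0.
    replace (- / 2 * fst (Lamsum k (x, t)) * Cmod (F k (x, t)) ^ 2 * exp (- b * x) + Cmod (F k (x, t)) ^ 2 * (- b * exp (- b * x)))
      with ((- / 2 * fst (Lamsum k (x, t)) - b) * (Cmod (F k (x, t)) ^ 2 * exp (- b * x))) by ring.
    assert (0 <= Cmod (F k (x, t)) ^ 2 * exp (- b * x)) by (apply Rmult_le_pos; lra). nra.
Qed.

Lemma F_far : exists x1, 4 <= x1 /\ forall k t, 1 / 2 <= Cmod (F k (x1, t)).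
Proof.
  destruct (Ld_W _ _ _ HL 2 ltac:(lra)) as [B HB]. assert (B0 : 0 <= B) by (apply (HB []); constructor).
  (* [y] makes 2^(-y) B at most 1, so in 4F the nonunits contribute at most 1 against the 4 of the
     units. *)
  set (y := Rmax 2 (ln (B + 1) / ln 2)). set (x1 := 2 + y). assert (ln2 : 0 < ln 2) by (rewrite <- ln_1; apply ln_increasing; lra).
  assert (Hy : 2 <= y) by apply Rmax_l. assert (Hexp : exp (- y * ln 2) * B <= 1).
  { assert (ln (B + 1) <= y * ln 2).
    { apply Rle_trans with (ln (B + 1) / ln 2 * ln 2); [right; field; lra|]. apply Rmult_le_compat_r; [lra|apply Rmax_r]. }
    assert (exp (- y * ln 2) <= / (B + 1)).
    { rewrite <- (exp_ln (/ (B + 1))) by positive. apply exp_le_mono. rewrite ln_Rinv by lra. lra. }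
    apply Rle_trans with (/ (B + 1) * (B + 1)); [|rewrite Rinv_l; lra]. assert (0 < / (B + 1)) by positive. nra. }
  exists x1. split; [unfold x1; lra|]. intros k t. assert (Hs := Ld_sum _ _ _ HL k (x1, t) ltac:(simpl; unfold x1; lra)).
  set (g := fun x => if in_dec eqd x gunits then 1%C else 0%C). assert (Hg : is_sum g (csum g gunits)).
  { apply is_sum_finite; [apply NoDup_gunits|]. intros x Hx. unfold g. destruct (in_dec eqd x gunits); [contradiction|auto]. }
  assert (Hg4 : csum g gunits = 4%C).
  { rewrite (csum_ext _ (fun _ => 1%C)). simpl. csolve. intros u Hu. unfold g. destruct (in_dec eqd u gunits); [auto|contradiction]. }
  rewrite Hg4 in Hg. assert (Hd := is_sum_minus _ _ _ _ Hs Hg). apply is_sum_le with (B := exp (- y * ln 2) * B) in Hd.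
  - assert (T := Cmod_triangle_sub 4 (4 - 4 * F k (x1, t))). replace (4 - (4 - 4 * F k (x1, t)))%C with (4 * F k (x1, t))%C in T by ring.
    rewrite Cmod_mult, Cmod_R, Rabs_right in T by lra. rewrite (Cmod_minus_sym 4) in T. lra.
  - eapply sum_bounded_le; [|apply sum_bounded_scal; [left; apply exp_pos|exact HB]].
    intros x. simpl. unfold g. destruct (in_dec eqd x gunits) as [Hu|Hu].
    + replace (fk k (x1, t) x) with (RtoC 1).
      * replace (1 - 1)%C with (RtoC 0) by ring. rewrite Cmod_0. apply Rmult_le_pos; [left; apply exp_pos|apply gw_nonneg].
      * replace x with (gmul x g1) by ring. rewrite fk_unit by auto. rewrite fk_eq by discriminate.
        unfold fz. rewrite uz_unit by (simpl; auto). rewrite Cpow_1_l, gC_norm. change (gN g1) with 1%Z. rewrite ln_1.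
        replace (- (x1, t) * RtoC 0)%C with (RtoC 0) by ring. rewrite cexp_0. ring.
    + replace (fk k (x1, t) x - 0)%C with (fk k (x1, t) x) by ring. rewrite Cmod_fk. cbn [fst].
      destruct (eqd x g0) as [->|N]. { unfold gw. destruct (eqd g0 g0); [lra|congruence]. }
      rewrite !gw_fst_exp by auto. rewrite <- exp_plus. apply exp_le_mono. assert (ln 2 <= ln (IZR (gN x))).
      { apply ln_le; [lra|]. apply IZR_le. assert (P := gN_pos x N). destruct (Z.eq_dec (gN x) 1) as [E|E]; [|lia]. exfalso. apply Hu, gunits_N, E. }
      unfold x1. nra.
Qed.

(** Gronwall's inequality, run in either direction along the horizontal line, would carry a zero to
    the abscissa of [F_far]. *)
Lemma F_neq0 (k : nat) (s : C) : 1 < fst s -> F k s <> 0%C.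
Proof.
  intros Hs E. destruct F_far as (x1 & Hx1 & Hf). destruct s as [x t]. simpl in Hs.
  destruct (Lam_gw_bounded (Ld_W _ _ _ HL) (Rmin x 4)) as [b Hb]; [apply Rmin_glb_lt; lra|].
  assert (Hb' : sum_bounded (fun y => Lam y * gw x y) b).
  { eapply sum_bounded_le; [|exact Hb]. intros y. apply Rmult_le_compat_l; [apply Lam_nonneg|apply gw_mono, Rmin_l]. }
  destruct (Rle_dec x x1) as [L|L].
  - assert (G := F_gronwall k t x x1 b ltac:(lra) Hb'). rewrite E, Cmod_0 in G. specialize (Hf k t).
    assert (P := exp_pos (- b * x1)). assert (0 < Cmod (F k (x1, t)) ^ 2) by (apply pow_lt; lra). simpl in *. nra.
  - (* to the right of x1, run Gronwall leftwards: |F|^2 e^{+b x} is nondecreasing *)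
    assert (Hb4 : sum_bounded (fun y => Lam y * gw x1 y) b).
    { eapply sum_bounded_le; [|exact Hb]. intros y. apply Rmult_le_compat_l; [apply Lam_nonneg|apply gw_mono]. eapply Rle_trans; [apply Rmin_r|lra]. }
    assert (G : - (Cmod (F k (x, t)) ^ 2 * exp (b * x)) <= - (Cmod (F k (x1, t)) ^ 2 * exp (b * x1))).
    { apply (nonincreasing (fun x => - (Cmod (F k (x, t)) ^ 2 * exp (b * x)))
       (fun x => - ((- / 2 * fst (Lamsum k (x, t)) * Cmod (F k (x, t)) ^ 2) * exp (b * x) + Cmod (F k (x, t)) ^ 2 * (b * exp (b * x))))); [lra| |].
      - intros y Hy. apply (is_derive_opp (V := R_NormedModule) (fun x => Cmod (F k (x, t)) ^ 2 * exp (b * x))).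
        apply (is_derive_mult (fun y => Cmod (F k (y, t)) ^ 2) (fun y => exp (b * y))); [apply normsq_F; lra| |intros; apply Rmult_comm].
        auto_derive; auto. ring.
      - intros y Hy. assert (B := Lamsum_bound k (y, t) x1 b ltac:(simpl; lra) Hb4).
        assert (T := Cmod_Re (Lamsum k (y, t))). apply Rabs_le_between in T.
        replace (- (- / 2 * fst (Lamsum k (y, t)) * Cmod (F k (y, t)) ^ 2 * exp (b * y) + Cmod (F k (y, t)) ^ 2 * (b * exp (b * y))))
          with (- ((- / 2 * fst (Lamsum k (y, t)) + b) * (Cmod (F k (y, t)) ^ 2 * exp (b * y)))) by ring.
        assert (0 <= Cmod (F k (y, t)) ^ 2 * exp (b * y)) by (apply Rmult_le_pos; [apply pow2_ge_0|left; apply exp_pos]). nra. }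
    rewrite E, Cmod_0 in G. specialize (Hf k t).
    assert (P := exp_pos (b * x1)). assert (0 < Cmod (F k (x1, t)) ^ 2) by (apply pow_lt; lra). simpl in *. nra.
Qed.

(** The Gronwall constant comes from the majorant at exponent 4, which does not depend on k or t.
    The points 4 + it will be the centres of the discs in [log_deriv_estimate]. *)
Lemma F_lower4 : exists c0, 0 < c0 /\ forall k t, c0 <= Cmod (F k (4, t)).
Proof.
  destruct F_far as (x1 & Hx1 & Hf). destruct (Lam_gw_bounded (Ld_W _ _ _ HL) 4 ltac:(lra)) as [b Hb].
  set (q := exp (- b * x1 + b * 4)). assert (Hq : 0 < q) by apply exp_pos.
  exists (Rmin (1 / 2) (q / 4)). split; [apply Rmin_pos; lra|]. intros k t.
  assert (G := F_gronwall k t 4 x1 b ltac:(lra) Hb). specialize (Hf k t). assert (E : Cmod (F k (x1, t)) ^ 2 * q <= Cmod (F k (4, t)) ^ 2).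
  { unfold q. rewrite exp_plus. apply Rmult_le_reg_r with (exp (- b * 4)); [apply exp_pos|].
    replace (Cmod (F k (x1, t)) ^ 2 * (exp (- b * x1) * exp (b * 4)) * exp (- b * 4)) with
      (Cmod (F k (x1, t)) ^ 2 * exp (- b * x1) * (exp (b * 4) * exp (- b * 4))) by ring.
    rewrite <- (exp_plus (b * 4)). replace (b * 4 + - b * 4) with 0 by ring. rewrite exp_0. lra. }
  assert (N := Cmod_ge_0 (F k (4, t))). set (X := Cmod (F k (4, t))) in *.
  assert (q / 4 <= X ^ 2) by (assert (1 / 4 <= Cmod (F k (x1, t)) ^ 2) by nra; nra).
  destruct (Rle_dec (1 / 2) X); [eapply Rle_trans; [apply Rmin_l|auto]|]. eapply Rle_trans; [apply Rmin_r|]. nra.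
Qed.

(** ** No zeros on the line [Re s = 1] *)

(** For a unimodular w one has 3 + 4 Re w + Re w^2 = 2 (1 + Re w)^2. Here w is the phase of a term
    for (k, t), and w^2 the phase for (2k, 2t). *)
Lemma three_four_one (k : nat) (x t : R) : 1 < x ->
  0 <= 3 * fst (Lamsum 0 (x, 0)) + 4 * fst (Lamsum k (x, t)) + fst (Lamsum (2 * k) (x, 2 * t)).
Proof.
  intros Hx.
  assert (H := is_sum_plus _ _ _ _ (is_sum_plus _ _ _ _ (is_sum_scal 3 _ _ (Lamsum_spec 0 (x, 0) Hx)) (is_sum_scal 4 _ _ (Lamsum_spec k (x, t) Hx))) (Lamsum_spec (2 * k) (x, 2 * t) Hx)).
  apply is_sum_Re_nonneg in H.
  - match goal with |- ?A <= ?B => replace B with (fst (3 * Lamsum 0 (x, 0%R) + 4 * Lamsum k (x, t) + Lamsum (2 * k) (x, (2 * t)%R))%C); auto end.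
    destruct (Lamsum 0 (x, 0)), (Lamsum k (x, t)), (Lamsum (2 * k) (x, 2 * t)). simpl. ring.
  - intros y. destruct (eqd y g0) as [->|N]. { rewrite !fk_g0. simpl. lra. }
    rewrite !fk_eq by auto. unfold fz. set (L := ln (Cmod (gC y) ^ 2)). set (w := (uz (gC y) ^ k * cexp (- (Ci * RtoC t) * RtoC L))%C).
    assert (Mw : Cmod w = 1).
    { unfold w. rewrite Cmod_mult, Cmod_pow, Cmod_uz, pow1, Cmod_cexp by (apply gC_neq0; auto). simpl. rewrite Rmult_1_l.
      rewrite <- exp_0. f_equal. ring. }
    assert (E0 : (uz (gC y) ^ 0 * cexp (- (x, 0%R) * RtoC L))%C = RtoC (exp (- x * L))).
    { replace (- (x, 0%R) * RtoC L)%C with (RtoC (- x * L)) by (csolve). rewrite cexp_RtoC. simpl. ring. }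
    assert (E1 : (uz (gC y) ^ k * cexp (- (x, t) * RtoC L))%C = (RtoC (exp (- x * L)) * w)%C).
    { unfold w. replace (- (x, t) * RtoC L)%C with (RtoC (- x * L) + - (Ci * RtoC t) * RtoC L)%C by (csolve).
      rewrite cexp_plus, cexp_RtoC. ring. }
    assert (E2 : (uz (gC y) ^ (2 * k) * cexp (- (x, 2 * t)%R * RtoC L))%C = (RtoC (exp (- x * L)) * (w * w))%C).
    { unfold w. replace (- (x, (2 * t)%R) * RtoC L)%C with (RtoC (- x * L) + - (Ci * RtoC t) * RtoC L + - (Ci * RtoC t) * RtoC L)%C by (csolve).
      replace (2 * k)%nat with (k + k)%nat by lia. rewrite !cexp_plus, cexp_RtoC, Cpow_add_r. ring. }
    rewrite E0, E1, E2. clear E0 E1 E2. clearbody w. assert (Q := Cmod_sqr w). rewrite Mw in Q.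
    assert (P := exp_pos (- x * L)). assert (P2 := Lam_nonneg y). destruct w as [a b]. simpl in *.
    match goal with |- _ <= ?Z => replace Z with (Lam y * exp (- x * L) * (3 + 4 * a + (a * a - b * b))) by ring end.
    apply Rmult_le_pos; [apply Rmult_le_pos; lra|]. nra.
Qed.

(** The logarithmic derivative of the product is minus half the 3-4-1 combination, so the product
    decreases in x and on (1, 2] is at least its value at 2. *)
Lemma product_341 (k : nat) (t x : R) : 1 < x <= 2 ->
  (Cmod (F 0 (2, 0)) ^ 2) ^ 3 * (Cmod (F k (2, t)) ^ 2) ^ 4 * Cmod (F (2 * k) (2, 2 * t)) ^ 2 <=
  (Cmod (F 0 (x, 0)) ^ 2) ^ 3 * (Cmod (F k (x, t)) ^ 2) ^ 4 * Cmod (F (2 * k) (x, 2 * t)) ^ 2.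
Proof.
  intros Hx.
  set (n0 := fun y => Cmod (F 0 (y, 0)) ^ 2). set (n1 := fun y => Cmod (F k (y, t)) ^ 2). set (n2 := fun y => Cmod (F (2 * k) (y, 2 * t)) ^ 2).
  change (n0 2 ^ 3 * n1 2 ^ 4 * n2 2 <= n0 x ^ 3 * n1 x ^ 4 * n2 x).
  set (a0 := fun y => - / 2 * fst (Lamsum 0 (y, 0))). set (a1 := fun y => - / 2 * fst (Lamsum k (y, t))). set (a2 := fun y => - / 2 * fst (Lamsum (2 * k) (y, 2 * t))).
  assert (D0 : forall y, 1 < y -> is_derive n0 y (a0 y * n0 y)) by (intros y Hy; apply (normsq_F 0 0 y Hy)).
  assert (D1 : forall y, 1 < y -> is_derive n1 y (a1 y * n1 y)) by (intros y Hy; apply (normsq_F k t y Hy)).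
  assert (D2 : forall y, 1 < y -> is_derive n2 y (a2 y * n2 y)) by (intros y Hy; apply (normsq_F (2 * k) (2 * t) y Hy)).
  apply (nonincreasing (fun y => n0 y ^ 3 * n1 y ^ 4 * n2 y)
    (fun y => (3 * a0 y + 4 * a1 y + a2 y) * (n0 y ^ 3 * n1 y ^ 4 * n2 y))); [lra| |].
  - intros y Hy. specialize (D0 y ltac:(lra)). specialize (D1 y ltac:(lra)). specialize (D2 y ltac:(lra)).
    assert (E0 := is_derive_pow n0 3 y _ D0). assert (E1 := is_derive_pow n1 4 y _ D1).
    assert (M1 := is_derive_mult (fun y => n0 y ^ 3) (fun y => n1 y ^ 4) y _ _ E0 E1 Rmult_comm).
    assert (M2 := is_derive_mult (fun y => n0 y ^ 3 * n1 y ^ 4) n2 y _ _ M1 D2 Rmult_comm). eapply is_derive_ext; [intros; reflexivity|].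
    match type of M2 with is_derive _ _ ?d => replace ((3 * a0 y + 4 * a1 y + a2 y) * (n0 y ^ 3 * n1 y ^ 4 * n2 y)) with d; [exact M2|] end.
    unfold plus, mult; simpl. ring.
  - intros y Hy. assert (T := three_four_one k y t ltac:(lra)). assert (0 <= n0 y ^ 3 * n1 y ^ 4 * n2 y).
    { apply Rmult_le_pos; [apply Rmult_le_pos; apply pow_le|]; apply pow2_ge_0. }
    assert (3 * a0 y + 4 * a1 y + a2 y <= 0) by (unfold a0, a1, a2; lra). nra.
Qed.
End LFunctions.

Lemma is_sum_rsum_le {A : Type} (g : A -> R) (S : C) (l : list A) : (forall x, 0 <= g x) -> is_sum (fun x => RtoC (g x)) S ->
  NoDup l -> rsum g l <= fst S.
Proof.
  intros Hg HS N. apply le_epsilon. intros eps He. destruct (HS eps He) as (l0 & N0 & K).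
  destruct (union_incl l l0) as (l1 & N1 & I & I0). specialize (K l1 N1 I0). rewrite csum_RtoC in K.
  assert (T := Cmod_Re (RtoC (rsum g l1) - S)). change (fst (RtoC (rsum g l1) - S)%C) with (rsum g l1 - fst S) in T.
  apply Rabs_le_between in T. assert (Q := rsum_incl g l l1 (fun x _ => Hg x) N I). lra.
Qed.

(** A dyadic square of 4^j points, all of norm below 5 4^j, so each shell contributes at least 1/5
    to the sum of 1/N. *)
Definition shell (j : nat) : list gauss :=
  list_prod (map Z.of_nat (seq (2 ^ j) (2 ^ j))) (map Z.of_nat (seq 0 (2 ^ j))).

Lemma in_shell (j : nat) (x : gauss) : In x (shell j) -> (2 ^ Z.of_nat j <= fst x < 2 * 2 ^ Z.of_nat j)%Z /\ (0 <= snd x < 2 ^ Z.of_nat j)%Z.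
Proof.
  destruct x as [a b]. unfold shell. intros H. apply in_prod_iff in H. destruct H as [H1 H2].
  apply in_map_iff in H1. destruct H1 as (m & <- & H1). apply in_map_iff in H2. destruct H2 as (n & <- & H2).
  apply in_seq in H1. apply in_seq in H2. assert (E : (2 ^ Z.of_nat j)%Z = Z.of_nat (2 ^ j)) by (rewrite Nat2Z.inj_pow; reflexivity).
  cbn [fst snd]. lia.
Qed.

Lemma NoDup_shell (j : nat) : NoDup (shell j).
Proof. apply NoDup_list_prod; apply FinFun.Injective_map_NoDup; try apply seq_NoDup; intros x y; lia. Qed.

Lemma shell_sum (j : nat) : 1 / 5 <= rsum (gw 1) (shell j).
Proof.
  assert (P4 : 0 < 4 ^ j) by (apply pow_lt; lra). apply Rle_trans with (rsum (fun _ => / (5 * 4 ^ j)) (shell j)).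
  - rewrite rsum_const. assert (Len : length (shell j) = (2 ^ j * 2 ^ j)%nat).
    { unfold shell, gauss. rewrite length_prod, !length_map, !length_seq. reflexivity. }
    rewrite Len, mult_INR, pow_INR.
    replace (INR 2) with 2 by (simpl; ring). rewrite <- Rpow_mult_distr. replace (2 * 2) with 4 by ring. right. field. lra.
  - apply rsum_le. intros x Hx. apply in_shell in Hx.
    assert (N : x <> g0) by (intros ->; cbn [fst snd g0] in Hx; unfold g0 in Hx; cbn [fst] in Hx; lia).
    rewrite gw_fst_exp by auto. replace (- (1) * ln (IZR (gN x))) with (- ln (IZR (gN x))) by ring.
    assert (G := gN_ge1 x N). rewrite exp_Ropp, exp_ln by lra. apply Rinv_le_contravar; [lra|].
    replace (5 * 4 ^ j) with (IZR (5 * (2 ^ Z.of_nat j * 2 ^ Z.of_nat j))).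
    + apply IZR_le. unfold gN. set (p := (2 ^ Z.of_nat j)%Z) in *. nia.
    + rewrite !mult_IZR, <- pow_IZR, <- Rpow_mult_distr. f_equal.
Qed.

Lemma gw1_diverges (B : R) : ~ sum_bounded (gw 1) B.
Proof.
  intros H. destruct (nfloor_ex (Rmax 0 (5 * B))) as [n [_ Hn]]; [apply Rmax_l|]. assert (Q := Rmax_r 0 (5 * B)).
  assert (ND : NoDup (flat_map shell (seq 0 (S n)))).
  { apply NoDup_flat_map; [apply seq_NoDup|intros; apply NoDup_shell|]. intros i j x _ _ Hi Hj. apply in_shell in Hi. apply in_shell in Hj.
    destruct (Nat.lt_trichotomy i j) as [L|[L|L]]; auto; exfalso.
    - assert (2 * 2 ^ Z.of_nat i <= 2 ^ Z.of_nat j)%Z; [|lia]. rewrite <- Z.pow_succ_r by lia. apply Z.pow_le_mono_r; lia.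
    - assert (2 * 2 ^ Z.of_nat j <= 2 ^ Z.of_nat i)%Z; [|lia]. rewrite <- Z.pow_succ_r by lia. apply Z.pow_le_mono_r; lia. }
  specialize (H _ ND). rewrite rsum_flat_map in H.
  assert (L : rsum (fun _ : nat => 1 / 5) (seq 0 (S n)) <= rsum (fun j => rsum (gw 1) (shell j)) (seq 0 (S n))) by (apply rsum_le; intros; apply shell_sum).
  rewrite rsum_const, length_seq, S_INR in L. lra.
Qed.

Section LFunctions2.
Variables (BB : R) (F f : nat -> C -> C).
Hypothesis HL : Ldata BB F f.

Lemma F_bound_near (k : nat) (t : R) : (k <> 0%nat \/ t <> 0) -> exists c de, 0 < c /\ 0 < de /\
  forall x, 1 < x < 1 + de -> Cmod (F k (x, t)) <= c * Cmod (f k (x, t)).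
Proof.
  intros H. destruct k as [|k].
  - destruct H as [H|H]; [congruence|]. exists (/ Rabs t), 1. assert (P := Rabs_pos_lt t H).
    split; [apply Rinv_0_lt_compat; auto|]. split; [lra|]. intros x Hx.
    rewrite (Ld_feq _ _ _ HL) by (intros E; apply (f_equal fst) in E; simpl in E; lra).
    rewrite Cmod_mult. unfold mu. assert (T := Cmod_Im ((x, t) - 1)). simpl in T. replace (t + - 0) with t in T by ring.
    assert (N := Cmod_ge_0 (F 0 (x, t))). apply Rmult_le_reg_l with (Rabs t); auto.
    rewrite <- Rmult_assoc, Rinv_r by lra. rewrite Rmult_1_l. apply Rmult_le_compat_r; auto.
  - exists 1, 1. split; [lra|]. split; [lra|]. intros x Hx.
    rewrite (Ld_feq _ _ _ HL) by (intros E; apply (f_equal fst) in E; simpl in E; lra).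
    unfold mu. replace (RtoC 1 * F (S k) (x, t))%C with (F (S k) (x, t)) by ring. lra.
Qed.

Lemma Cmod_hor (x t : R) : 1 <= x -> Cmod ((x, t) - (1, t)) = x - 1.
Proof.
  intros H. replace ((x, t) - (1, t))%C with (RtoC (x - 1)) by (csolve). rewrite Cmod_R, Rabs_right; lra.
Qed.

Lemma f_locally_bounded (k : nat) (t : R) : exists c de, 0 < c /\ 0 < de /\ forall x, 1 < x < 1 + de -> Cmod (f k (x, t)) <= c.
Proof.
  assert (S1 : strip (1, t)) by (unfold strip; simpl; lra).
  destruct (diff_at_ccont _ _ (Ld_fdiff _ _ _ HL k _ S1) 1 Rlt_0_1) as (de & Hde & K).
  exists (Cmod (f k (1, t)) + 1), de. split; [assert (P := Cmod_ge_0 (f k (1, t))); lra|]. split; auto.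
  intros x Hx. specialize (K (x, t)). rewrite Cmod_hor in K by lra. specialize (K ltac:(lra)).
  assert (T := Cmod_triangle_sub (f k (x, t)) (f k (1, t))). lra.
Qed.

Lemma f_zero_linear (k : nat) (t : R) : f k (1, t) = 0%C -> exists c de, 0 < c /\ 0 < de /\
  forall x, 1 < x < 1 + de -> Cmod (f k (x, t)) <= c * (x - 1).
Proof.
  intros E. assert (S1 : strip (1, t)) by (unfold strip; simpl; lra).
  destruct (Ld_fdiff _ _ _ HL k _ S1) as [d Hd]. destruct (Hd 1 Rlt_0_1) as (de & Hde & K).
  exists (1 + Cmod d), de. split; [assert (P := Cmod_ge_0 d); lra|]. split; auto.
  intros x Hx. specialize (K (x, t)). rewrite Cmod_hor in K by lra. specialize (K ltac:(lra)). rewrite E in K.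
  replace (f k (x, t)) with ((f k (x, t) - 0 - d * ((x, t) - (1, t))) + d * ((x, t) - (1, t)))%C by ring.
  eapply Rle_trans; [apply Cmod_triangle|]. rewrite Cmod_mult, Cmod_hor by lra. lra.
Qed.

Lemma fk0_real (x : R) (y : gauss) : fk 0 (x, 0) y = RtoC (gw x y).
Proof.
  unfold fk, gw. destruct (eqd y g0); auto. unfold fz. rewrite gC_norm. simpl Cpow.
  replace (- (x, 0%R) * RtoC (ln (IZR (gN y))))%C with (RtoC (- x * ln (IZR (gN y)))) by (csolve). rewrite cexp_RtoC. ring.
Qed.

(** If f(1) were 0, F would stay bounded as x decreases to 1, and with it every finite sum of 1/N,
    against [gw1_diverges]. So the zeta function really has its pole. *)
Lemma f0_at_1 : f 0 (RtoC 1) <> 0%C.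
Proof.
  intros E. destruct (f_zero_linear 0 0 E) as (c & de & Hc & Hde & K). apply (gw1_diverges (3 * (4 * c))). intros l Nl.
  assert (HM : exists m, 1 <= m /\ forall x, In x l -> x <> g0 -> ln (IZR (gN x)) <= m).
  { clear Nl. induction l as [|a l (m & Hm & IH)]; [exists 1; simpl; split; [lra|tauto]|].
    exists (Rmax m (ln (IZR (gN a)))). split; [eapply Rle_trans; [exact Hm|apply Rmax_l]|].
    intros x [<-|Hx] N; [apply Rmax_r|]. eapply Rle_trans; [apply IH; auto|apply Rmax_l]. }
  (* [m] bounds ln N on the finite list and e <= 1/m, so passing from exponent 1 + e to exponent 1
     costs at most the factor exp(1) <= 3. *)
  destruct HM as (m & Hm & HM). set (e := Rmin (de / 2) (/ m)). assert (Im : 0 < / m) by positive.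
  assert (He : 0 < e) by (apply Rmin_pos; lra). assert (e1 : e <= de / 2) by apply Rmin_l. assert (e2 : e <= / m) by apply Rmin_r.
  assert (em : e * m <= 1) by (apply Rle_trans with (/ m * m); [apply Rmult_le_compat_r; lra|rewrite Rinv_l; lra]).
  set (x := 1 + e). specialize (K x ltac:(unfold x; lra)). assert (B : Cmod (F 0 (x, 0)) <= c).
  { rewrite (Ld_feq _ _ _ HL) in K by (intros E'; apply (f_equal fst) in E'; simpl in E'; unfold x in E'; lra).
    unfold mu in K. replace ((x, 0%R) - 1)%C with (RtoC e) in K by (apply Ceq_pair; unfold x; simpl; ring).
    rewrite Cmod_mult, Cmod_R, Rabs_right in K by lra. apply Rmult_le_reg_l with e; auto. unfold x in *; lra. }
  assert (S : is_sum (fun y => RtoC (gw x y)) (4 * F 0 (x, 0%R))%C).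
  { eapply is_sum_ext; [|apply (Ld_sum _ _ _ HL 0 (x, 0)); simpl; unfold x; lra]. intros; apply fk0_real. }
  assert (Q := is_sum_rsum_le _ _ l (gw_nonneg x) S Nl).
  assert (T := Re_le_Cmod (4 * F 0 (x, 0%R))). rewrite Cmod_mult, Cmod_R, Rabs_right in T by lra.
  apply Rle_trans with (rsum (fun y => 3 * gw x y) l).
  - apply rsum_le. intros y Hy. destruct (eqd y g0) as [->|N]. { unfold gw. destruct (eqd g0 g0); [lra|congruence]. }
    rewrite !gw_fst_exp by auto. set (Ly := ln (IZR (gN y))). assert (Ly <= m) by (apply HM; auto).
    assert (Ly0 := lnN_nonneg y N). fold Ly in Ly0. replace (- (1) * Ly) with (e * Ly + - x * Ly) by (unfold x; ring). rewrite exp_plus.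
    apply Rmult_le_compat_r; [left; apply exp_pos|]. apply Rle_trans with (exp 1); [apply exp_le_mono; nra|apply exp_le_3].
  - rewrite rsum_scal. lra.
Qed.

(** At distance e from the line the pole gives e^-3, the supposed zero e^4, and the factor at (2k,
    2t) stays bounded because it avoids the pole. The squared moduli multiply to O(e^2), against the
    positive lower bound of [product_341]. *)
Lemma f_line1 (k : nat) (t : R) : (k <> 0%nat \/ t <> 0) -> f k (1, t) <> 0%C.
Proof.
  intros H E. destruct (f_zero_linear k t E) as (c1 & d1 & C1 & D1 & K1). destruct (F_bound_near k t H) as (c2 & d2 & C2 & D2 & K2).
  destruct (f_locally_bounded 0 0) as (c3 & d3 & C3 & D3 & K3). destruct (f_locally_bounded (2 * k) (2 * t)) as (c4 & d4 & C4 & D4 & K4).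
  destruct (F_bound_near (2 * k) (2 * t)) as (c5 & d5 & C5 & D5 & K5); [destruct H; [left; lia|right; lra]|].
  set (P2 := (Cmod (F 0 (2, 0)) ^ 2) ^ 3 * (Cmod (F k (2, t)) ^ 2) ^ 4 * Cmod (F (2 * k) (2, 2 * t)) ^ 2). assert (HP2 : 0 < P2).
  { unfold P2. repeat apply Rmult_lt_0_compat; try lra; repeat apply pow_lt; apply Cmod_gt_0, (F_neq0 BB F f HL); simpl; lra. }
  set (Q := (c3 ^ 2) ^ 3 * ((c2 * c1) ^ 2) ^ 4 * (c5 * c4) ^ 2).
  assert (HQ : 0 < Q) by (unfold Q; repeat apply Rmult_lt_0_compat; repeat apply pow_lt; try apply Rmult_lt_0_compat; auto; lra).
  set (m := Rmin 1 (Rmin (P2 / (2 * Q)) (Rmin (Rmin d1 d2) (Rmin d3 (Rmin d4 d5))))).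
  assert (M1 : m <= 1) by apply Rmin_l. assert (M0 : m <= Rmin (P2 / (2 * Q)) (Rmin (Rmin d1 d2) (Rmin d3 (Rmin d4 d5)))) by apply Rmin_r.
  assert (M2 := Rle_trans _ _ _ M0 (Rmin_l _ _)). assert (M3 := Rle_trans _ _ _ M0 (Rmin_r _ _)).
  assert (M4 := Rle_trans _ _ _ M3 (Rmin_l _ _)). assert (M5 := Rle_trans _ _ _ M3 (Rmin_r _ _)).
  assert (M6 := Rle_trans _ _ _ M4 (Rmin_l _ _)). assert (M7 := Rle_trans _ _ _ M4 (Rmin_r _ _)).
  assert (M8 := Rle_trans _ _ _ M5 (Rmin_l _ _)). assert (M9 := Rle_trans _ _ _ M5 (Rmin_r _ _)).
  assert (M10 := Rle_trans _ _ _ M9 (Rmin_l _ _)). assert (M11 := Rle_trans _ _ _ M9 (Rmin_r _ _)). assert (Hm : 0 < m).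
  { repeat apply Rmin_pos; auto; try lra. positive. }
  set (e := m / 2). set (x := 1 + e). assert (He : 0 < e) by (unfold e; lra). assert (Hx : 1 < x <= 2) by (unfold x, e; lra).
  assert (G := product_341 BB F f HL k t x Hx). fold P2 in G.
  specialize (K1 x ltac:(unfold x, e; lra)). specialize (K2 x ltac:(unfold x, e; lra)). specialize (K3 x ltac:(unfold x, e; lra)).
  specialize (K4 x ltac:(unfold x, e; lra)). specialize (K5 x ltac:(unfold x, e; lra)). replace (x - 1) with e in K1 by (unfold x; ring).
  assert (B0 : e * Cmod (F 0 (x, 0)) <= c3).
  { rewrite (Ld_feq _ _ _ HL) in K3 by (intros E'; apply (f_equal fst) in E'; simpl in E'; lra).
    unfold mu in K3. replace ((x, 0%R) - 1)%C with (RtoC e) in K3 by (apply Ceq_pair; unfold x; simpl; ring).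
    rewrite Cmod_mult, Cmod_R, Rabs_right in K3 by lra. exact K3. }
  set (y0 := Cmod (F 0 (x, 0))) in *. set (y1 := Cmod (F k (x, t))) in *. set (y2 := Cmod (F (2 * k) (x, 2 * t))) in *.
  assert (Y0 : 0 <= y0) by apply Cmod_ge_0. assert (Y1 : 0 <= y1) by apply Cmod_ge_0. assert (Y2 : 0 <= y2) by apply Cmod_ge_0.
  assert (B1 : y1 <= c2 * c1 * e) by (eapply Rle_trans; [exact K2|]; rewrite Rmult_assoc; apply Rmult_le_compat_l; lra).
  assert (B2 : y2 <= c5 * c4) by (eapply Rle_trans; [exact K5|]; apply Rmult_le_compat_l; lra).
  assert (G2 : (y0 ^ 2) ^ 3 * (y1 ^ 2) ^ 4 * y2 ^ 2 <= Q * e ^ 2).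
  { apply Rle_trans with ((y0 ^ 2) ^ 3 * ((c2 * c1 * e) ^ 2) ^ 4 * (c5 * c4) ^ 2).
    - apply Rmult_le_compat; [apply Rmult_le_pos; repeat apply pow_le; auto|apply pow_le; auto| |apply pow_incr; lra].
      apply Rmult_le_compat_l; [repeat apply pow_le; auto|]. apply pow_incr. split; [apply pow_le; auto|apply pow_incr; lra].
    - replace ((y0 ^ 2) ^ 3 * ((c2 * c1 * e) ^ 2) ^ 4 * (c5 * c4) ^ 2) with (((e * y0) ^ 2) ^ 3 * (((c2 * c1) ^ 2) ^ 4 * (c5 * c4) ^ 2 * e ^ 2)) by ring.
      unfold Q. replace ((c3 ^ 2) ^ 3 * ((c2 * c1) ^ 2) ^ 4 * (c5 * c4) ^ 2 * e ^ 2) with ((c3 ^ 2) ^ 3 * (((c2 * c1) ^ 2) ^ 4 * (c5 * c4) ^ 2 * e ^ 2)) by ring.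
      apply Rmult_le_compat_r.
      + apply Rmult_le_pos; [apply Rmult_le_pos|]; repeat apply pow_le; try apply Rmult_le_pos; lra.
      + assert (0 <= e * y0) by (apply Rmult_le_pos; lra). apply pow_incr. split; [apply pow_le; auto|apply pow_incr; lra]. }
  assert (e ^ 2 <= e) by (simpl; unfold e in *; nra). assert (Q * e ^ 2 <= Q * e) by (apply Rmult_le_compat_l; lra).
  assert (Q * e <= P2 / 4).
  { unfold e. assert (Q * m <= Q * (P2 / (2 * Q))) by (apply Rmult_le_compat_l; lra).
    replace (Q * (P2 / (2 * Q))) with (P2 / 2) in H2 by (field; lra). lra. }
  lra.
Qed.

Lemma f_neq0 (k : nat) (s : C) : 1 <= fst s < 10 -> f k s <> 0%C.
Proof.
  intros Hs. destruct (Req_dec (fst s) 1) as [E|E].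
  - destruct s as [x t]. simpl in E. subst x. destruct (classic (k <> 0%nat \/ t <> 0)) as [H|H]; [apply f_line1; auto|].
    assert (k = 0%nat) by tauto. assert (t = 0) by tauto. subst. apply f0_at_1.
  - assert (N : s <> RtoC 1) by (intros E'; apply E; rewrite E'; reflexivity).
    rewrite (Ld_feq _ _ _ HL) by auto. apply Cmult_neq_0; [|apply (F_neq0 BB F f HL); lra].
    destruct k; unfold mu; [intros E'; apply N, Ceq_minus; exact E'|apply RtoC_neq; lra].
Qed.

Lemma f_zeros (k : nat) (s : C) : strip s -> f k s = 0%C -> fst s <= 1 / 2.
Proof.
  intros [S1 S2] E. destruct (Rle_dec 1 (fst s)); [exfalso; apply (f_neq0 k s); auto; lra|].
  assert (N : s <> RtoC 1) by (intros E'; rewrite E' in n; simpl in n; lra).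
  rewrite (Ld_feq _ _ _ HL) in E by auto. right. apply (Ld_grh _ _ _ HL k s); [lra|].
  destruct (Ceq_dec (F k s) 0) as [|N0]; auto. exfalso. revert E. apply Cmult_neq_0; auto.
  destruct k; unfold mu; [intros E'; apply N, Ceq_minus; exact E'|apply RtoC_neq; lra].
Qed.

(** [log_deriv_bound] on a disc around 4 + it. By polynomial growth and [F_lower4], ln(M/|f c|) is
    O(ln(k + |t| + 3)), and this bounds the number of zeros removed as well. *)
Lemma log_deriv_estimate : exists C1, 0 < C1 /\ forall k t x, 1 / 2 < x <= 7 ->
  - (C1 * ln (INR k + Rabs t + 3)) <= fst (Cderiv (f k) (x, t) / f k (x, t))%C /\
  Cmod (Cderiv (f k) (x, t) / f k (x, t)) <= C1 * ln (INR k + Rabs t + 3) * (1 + / (x - 1 / 2)).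
Proof.
  destruct (F_lower4 BB F f HL) as (c0 & Hc0 & HF4).
  set (B' := Rmax BB 1). assert (HB' : BB <= B') by apply Rmax_l. assert (HB1 : 1 <= B') by apply Rmax_r.
  (* Radius 3.5 around 4 + it reaches from Re s = 1/2 beyond 7. Radius 3.9 stays in 1/10 <= Re s <=
     8, where [Ld_bound] applies, and 3.92 stays inside the strip. *)
  set (r1 := 35 / 10). set (r2 := 36 / 10). set (r := 37 / 10). set (Rr := 39 / 10). set (R' := 392 / 100).
  set (b := 2 * r2 / (r2 - r1) ^ 2). set (D := Rr / (Rr - r2)). set (a := r / (Rr ^ 2 - r ^ 2)).
  assert (Hb : 0 < b) by (unfold b, r2, r1; lra). assert (HD : 0 < D) by (unfold D, Rr, r2; lra). assert (Ha : 0 < a) by (unfold a, Rr, r; lra).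
  set (lq := ln (Rr / r)). assert (Hq : 1 < Rr / r) by (unfold Rr, r; lra). assert (Hlq : 0 < lq) by (unfold lq; rewrite <- ln_1; apply ln_increasing; lra).
  set (Y := Rabs (ln (B' * 27 / c0)) + 3). assert (HY : 3 <= Y) by (unfold Y; assert (P := Rabs_pos (ln (B' * 27 / c0))); lra).
  set (n1 := Y / lq + 2). set (LD := Rabs (ln D)). assert (Hn1 : 0 < n1) by (unfold n1; assert (0 < Y / lq) by positive; lra).
  exists (n1 * (a + 1) + b * (LD + Y)). assert (HLD : 0 <= LD) by apply Rabs_pos. split; [nra|]. intros k t x Hx.
  set (T := INR k + Rabs t + 3). set (L := ln T).
  assert (Hk := pos_INR k). assert (Ht := Rabs_pos t). assert (HT : 3 <= T) by (unfold T; lra). assert (HLl : 1 <= L).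
  { unfold L. rewrite <- (ln_exp 1). apply ln_le; [apply exp_pos|]. assert (E := exp_le_3). lra. }
  set (c := (4, t) : C). set (M := B' * (3 * T) ^ 3). assert (HcC : Cmod c <= 4 + Rabs t).
  { eapply Rle_trans; [apply Cmod_le_sum|]. unfold c; simpl. rewrite (Rabs_right 4) by lra. lra. }
  assert (Near : forall z, Cmod (z - c) <= 392 / 100 -> 4 - 392 / 100 <= fst z <= 4 + 392 / 100).
  { intros z Hz. assert (T1 := Cmod_Re (z - c)). change (fst (z - c)%C) with (fst z - 4) in T1. apply Rabs_le_between in T1. lra. }
  assert (Hholo : holo (f k) c R').
  { intros z Hz. apply (Ld_fdiff _ _ _ HL). specialize (Near z ltac:(unfold R' in Hz; lra)). unfold strip; lra. }
  assert (HfM : forall z, Cmod (z - c) = Rr -> Cmod (f k z) <= M).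
  { intros z Hz. assert (T1 := Cmod_Re (z - c)). change (fst (z - c)%C) with (fst z - 4) in T1. apply Rabs_le_between in T1.
    eapply Rle_trans; [apply (Ld_bound _ _ _ HL); unfold Rr in Hz; lra|].
    assert (P : 0 <= (1 + INR k + Cmod z) ^ 3) by (apply pow_le; assert (Q := Cmod_ge_0 z); lra).
    apply Rle_trans with (B' * (1 + INR k + Cmod z) ^ 3); [apply Rmult_le_compat_r; auto|].
    unfold M. apply Rmult_le_compat_l; [lra|]. apply pow_incr. split; [assert (Q := Cmod_ge_0 z); lra|].
    assert (Cmod z <= Cmod (z - c) + Cmod c) by (replace z with ((z - c) + c)%C at 1 by ring; apply Cmod_triangle).
    unfold T. unfold Rr in Hz. lra. }
  assert (Hfc : c0 <= Cmod (f k c)).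
  { rewrite (Ld_feq _ _ _ HL) by (intros E; apply (f_equal fst) in E; simpl in E; lra).
    rewrite Cmod_mult. apply Rle_trans with (1 * Cmod (F k c)); [rewrite Rmult_1_l; apply HF4|].
    apply Rmult_le_compat_r; [apply Cmod_ge_0|]. destruct k; unfold mu; [|rewrite Cmod_1; lra].
    assert (T1 := Re_le_Cmod (c - 1)). simpl in T1. lra. }
  assert (Hfc0 : f k c <> 0%C) by (intros E; rewrite E, Cmod_0 in Hfc; lra). set (q := M / Cmod (f k c)).
  assert (HMf : Cmod (f k c) <= M) by (apply (cauchy_center_bound (f k) c Rr R'); auto; unfold Rr, R'; lra).
  assert (Hq1 : 1 <= q) by (unfold q; apply Rmult_le_reg_r with (Cmod (f k c)); [lra|]; unfold Rdiv; rewrite Rmult_assoc, Rinv_l; lra).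
  assert (Hlnq : 0 <= ln q) by (rewrite <- ln_1; apply ln_le; lra). assert (HlnY : ln q <= Y * L).
  { apply Rle_trans with (ln (B' * 27 / c0 * T ^ 3)).
    - apply ln_le; [lra|]. unfold q, M. replace (B' * 27 / c0 * T ^ 3) with (B' * (3 * T) ^ 3 / c0) by (field; lra).
      unfold Rdiv. apply Rmult_le_compat_l; [fold M; lra|]. apply Rinv_le_contravar; lra.
    - rewrite ln_mult by (try apply pow_lt; try (positive); lra). rewrite ln_pow by lra.
      change (ln T) with L. replace (INR 3) with 3 by (simpl; ring). unfold Y. assert (P := Rle_abs (ln (B' * 27 / c0))). assert (P' := Rabs_pos (ln (B' * 27 / c0))). nra. }
  (* One more than this floor makes the power of Rr/r exceed M/|f c|, as the zero count in
     [log_deriv_bound] requires. *)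
  destruct (nfloor_ex (ln q / lq)) as [n [Hn1' Hn2]]; [apply Rmult_le_pos; [auto|left; apply Rinv_0_lt_compat; auto]|].
  assert (HMn : M < Cmod (f k c) * (Rr / r) ^ S n).
  { replace M with (Cmod (f k c) * q) by (unfold q; field; lra). apply Rmult_lt_compat_l; [lra|].
    apply ln_lt_inv; [lra|apply pow_lt; lra|]. rewrite ln_pow by lra. fold lq. rewrite S_INR.
    apply Rmult_lt_compat_r with (r := lq) in Hn2; auto. unfold Rdiv in Hn2. rewrite Rmult_assoc, Rinv_l in Hn2; lra. }
  assert (HnL : INR (S n) <= n1 * L).
  { rewrite S_INR. assert (ln q / lq <= Y * L / lq) by (unfold Rdiv; apply Rmult_le_compat_r; [left; apply Rinv_0_lt_compat; auto|auto]).
    replace (Y * L / lq) with (Y / lq * L) in H by (field; lra). unfold n1. nra. }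
  assert (HsC : Cmod ((x, t) - c) <= r1).
  { unfold c. replace ((x, t) - (4, t))%C with (RtoC (x - 4)) by (csolve). rewrite Cmod_R. unfold r1. apply Rabs_le. lra. }
  destruct (log_deriv_bound c r1 r2 r Rr R' M (1 / 2)) with (n := S n) (f := f k) (s := (x, t)) as [A1 A2]; auto; try (unfold r1, r2, r, Rr, R'; lra); try (simpl; lra).
  { intros z Hz. apply f_zeros. specialize (Near z ltac:(unfold r in Hz; lra)). unfold strip; lra. }
  fold b D a q in A1, A2. simpl fst in A2.
  assert (HlnD : ln (D * q) <= LD + Y * L) by (rewrite ln_mult by lra; unfold LD; assert (P := Rle_abs (ln D)); lra).
  assert (HlnD' : b * ln (D * q) <= b * (LD + Y) * L).
  { rewrite Rmult_assoc. apply Rmult_le_compat_l; [lra|]. nra. }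
  assert (Hi : 0 < / (x - 1 / 2)) by positive. assert (HSn : 0 <= INR (S n)) by apply pos_INR. split.
  - apply Rle_trans with (- (INR (S n) * a + b * ln (D * q))); [|exact A1]. apply Ropp_le_contravar. nra.
  - eapply Rle_trans; [exact A2|]. assert (0 <= b * (LD + Y) * L) by (apply Rmult_le_pos; [apply Rmult_le_pos|]; lra).
    assert (n1 * L * (a + / (x - 1 / 2)) <= n1 * L * ((a + 1) * (1 + / (x - 1 / 2)))) by (apply Rmult_le_compat_l; [lra|]; nra).
    replace ((n1 * (a + 1) + b * (LD + Y)) * L * (1 + / (x - 1 / 2))) with (n1 * L * ((a + 1) * (1 + / (x - 1 / 2))) + b * (LD + Y) * L * (1 + / (x - 1 / 2))) by ring.
    nra.
Qed.
End LFunctions2.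

(** * Gaussian kernels on vertical lines *)

(** e^(z^2) decays like e^(-t^2) on vertical lines; integrated against N^(-z) it produces the
    Gaussian weight in ln N. *)
Definition kern (L : R) (z : C) : C := cexp (RtoC L * z + z * z).

Lemma diff_kern (L : R) (z : C) : diff_at (kern L) z.
Proof.
  eexists. apply cder_cexp_comp. apply cder_plus; [apply cder_scal, cder_id|apply cder_mult; apply cder_id].
Qed.

Lemma Cmod_kern (L x t : R) : Cmod (kern L (x, t)) = exp (L * x + x ^ 2 - t ^ 2).
Proof. unfold kern. rewrite Cmod_cexp. f_equal. simpl. ring. Qed.

Lemma kern_conj (L t : R) : Cconj (kern (- L) (0, t)) = kern L (0, t).
Proof. unfold kern. rewrite <- cexp_conj. f_equal. csolve. Qed.

Lemma kern_real (L p : R) : kern L (RtoC p) = RtoC (exp (L * p + p ^ 2)).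
Proof. unfold kern. rewrite <- cexp_RtoC. f_equal. csolve. Qed.

(** Gaussian integrals on vertical lines are estimated through this majorant, whose primitive is an
    arctangent. *)
Lemma exp_square_weight (t : R) : exp (- t ^ 2) * (1 + Rabs t) <= 4 / (1 + t ^ 2).
Proof.
  set (x := t ^ 2). assert (Hx : 0 <= x) by apply pow2_ge_0.
  assert (E : exp x * exp (- x) = 1) by (rewrite <- exp_plus, Rplus_opp_r, exp_0; auto). assert (E2 : (1 + x / 2) ^ 2 <= exp x).
  { replace x with (x / 2 + x / 2) at 2 by field. rewrite exp_plus. assert (T := exp_ineq1_le (x / 2)). simpl. nra. }
  assert (P := exp_pos (- x)). assert (X : x = Rabs t ^ 2) by (unfold x; rewrite pow2_abs; auto).
  apply Rmult_le_reg_r with (1 + x); [lra|]. unfold Rdiv. rewrite (Rmult_assoc 4), Rinv_l by lra.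
  assert ((1 + Rabs t) * (1 + x) <= 4 * exp x).
  { eapply Rle_trans; [|apply Rmult_le_compat_l; [lra|exact E2]]. rewrite X. set (y := Rabs t) in *. nra. }
  apply Rle_trans with (exp (- x) * (4 * exp x)); [|nra]. rewrite Rmult_assoc. apply Rmult_le_compat_l; lra.
Qed.

Lemma exp_square_le (t : R) : exp (- t ^ 2) <= 4 / (1 + t ^ 2).
Proof. eapply Rle_trans; [|apply exp_square_weight]. assert (A := Rabs_pos t). assert (P := exp_pos (- t ^ 2)). nra. Qed.

Lemma RInt_cauchy_weight (M T : R) : 0 <= M -> ex_RInt (fun t => M / (1 + t ^ 2)) (- T) T /\ RInt (fun t => M / (1 + t ^ 2)) (- T) T <= M * PI.
Proof.
  intros HM. assert (H : is_RInt (fun t => M / (1 + t ^ 2)) (- T) T (minus (M * atan T) (M * atan (- T)))).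
  { apply (is_RInt_derive (V := R_CompleteNormedModule) (fun t => M * atan t) (fun t => M / (1 + t ^ 2))).
    - intros x _. assert (0 <= x ^ 2) by apply pow2_ge_0. auto_derive; auto. simpl. field. simpl in H; lra.
    - intros x _. apply (ex_derive_continuous (fun t => M / (1 + t ^ 2))). assert (0 <= x ^ 2) by apply pow2_ge_0. auto_derive. simpl in H; lra. }
  split; [eexists; exact H|]. rewrite (is_RInt_unique _ _ _ _ H).
  change (minus (M * atan T) (M * atan (- T))) with (M * atan T - M * atan (- T)). rewrite atan_opp. assert (B := atan_bound T). nra.
Qed.

Lemma CI_cauchy_weight (f : R -> C) (M T : R) : 0 <= M -> 0 <= T -> rcont_on f (- T) T ->
  (forall t, Cmod (f t) <= M / (1 + t ^ 2)) -> Cmod (CI f (- T) T) <= M * PI.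
Proof.
  intros HM HT Hc Hf. destruct (RInt_cauchy_weight M T HM) as [H1 H2]. eapply Rle_trans; [|exact H2]. apply CI_norm_le; auto; lra.
Qed.

Lemma edge_decay (M eps : R) : 0 <= M -> 0 < eps -> exists T0, 1 <= T0 /\ forall T, T0 <= T -> M * (T + 3) * exp (- T ^ 2) <= eps.
Proof.
  intros HM He. exists (Rmax 1 (16 * M / eps)). split; [apply Rmax_l|]. intros T HT.
  assert (H1 : 1 <= T) by (eapply Rle_trans; [apply Rmax_l|exact HT]).
  assert (H2 : 16 * M / eps <= T) by (eapply Rle_trans; [apply Rmax_r|exact HT]).
  assert (H3 : 16 * M <= T * eps) by (apply Rmult_le_compat_r with (r := eps) in H2; [|lra]; unfold Rdiv in H2; rewrite Rmult_assoc, Rinv_l in H2; lra).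
  assert (E := exp_square_le T).
  assert (E2 : exp (- T ^ 2) * (1 + T ^ 2) <= 4) by (apply Rmult_le_compat_r with (r := 1 + T ^ 2) in E; [|nra]; unfold Rdiv in E; rewrite Rmult_assoc, Rinv_l in E; nra).
  apply Rmult_le_reg_r with (1 + T ^ 2); [nra|]. apply Rle_trans with (M * (T + 3) * 4).
  - rewrite Rmult_assoc. apply Rmult_le_compat_l; [nra|exact E2].
  - nra.
Qed.

(** One point [p] of mere continuity is allowed, for the pole term; for a holomorphic integrand any
    [p] will do. *)
Lemma edge_shift (g : C -> C) (p : C) (a b T eta : R) : 0 <= T ->
  (forall z, Rmin a b <= fst z <= Rmax a b -> ccont g z) ->
  (forall z, Rmin a b <= fst z <= Rmax a b -> z <> p -> diff_at g z) ->
  (forall x, Rmin a b <= x <= Rmax a b -> Cmod (g (x, T)) <= eta /\ Cmod (g (x, - T)) <= eta) ->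
  Cmod (CI (fun t => g (b, t)) (- T) T - CI (fun t => g (a, t)) (- T) T) <= 2 * eta * Rabs (b - a).
Proof.
  intros HT.
  assert (core : forall a b, a <= b -> (forall z, Rmin a b <= fst z <= Rmax a b -> ccont g z) ->
    (forall z, Rmin a b <= fst z <= Rmax a b -> z <> p -> diff_at g z) ->
    (forall x, Rmin a b <= x <= Rmax a b -> Cmod (g (x, T)) <= eta /\ Cmod (g (x, - T)) <= eta) ->
    Cmod (CI (fun t => g (b, t)) (- T) T - CI (fun t => g (a, t)) (- T) T) <= 2 * eta * Rabs (b - a)).
  { clear a b. intros a b Hab Hc Hd Hb.
    assert (Em : Rmin a b = a) by (apply Rmin_left; auto). assert (EM : Rmax a b = b) by (apply Rmax_right; auto). rewrite Em, EM in *.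
    assert (R0 : rect g a b (- T) T = 0%C).
    { apply goursat_except with p; [auto|lra| |]; intros z [Hz _]; [apply Hc|apply Hd]; auto. }
    unfold rect in R0. set (Vb := CI (fun t => g (b, t)) (- T) T) in *. set (Va := CI (fun t => g (a, t)) (- T) T) in *.
    set (H1 := CI (fun x => g (x, - T)) a b) in *. set (H2 := CI (fun x => g (x, T)) a b) in *.
    assert (E : (Ci * (Vb - Va))%C = (H2 - H1)%C).
    { replace (Ci * (Vb - Va))%C with ((H1 + Ci * Vb - H2 - Ci * Va) + (H2 - H1))%C by ring. rewrite R0. ring. }
    assert (N : Cmod (Vb - Va) = Cmod (H2 - H1)).
    { rewrite <- E, Cmod_mult. assert (Cmod Ci = 1) as ->; [|ring]. unfold Cmod, Ci; simpl. replace (0 * (0 * 1) + 1 * (1 * 1)) with 1 by ring. apply sqrt_1. }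
    rewrite N. eapply Rle_trans; [apply Cmod_triangle_minus|]. assert (B1 : Cmod H1 <= eta * Rabs (b - a)).
    { apply CI_bound; intros x Hx; rewrite Em, EM in Hx; [apply rcont_hor, Hc; auto|apply Hb; auto]. }
    assert (B2 : Cmod H2 <= eta * Rabs (b - a)).
    { apply CI_bound; intros x Hx; rewrite Em, EM in Hx; [apply rcont_hor, Hc; auto|apply Hb; auto]. }
    lra. }
  intros Hc Hd Hb. destruct (Rle_dec a b) as [L|L]; [apply core; auto|].
  rewrite Cmod_minus_sym, Rabs_minus_sym. apply core; [lra| | |]; rewrite (Rmin_comm b), (Rmax_comm b); auto.
Qed.

Definition tends (v : R -> C) (l : C) : Prop := forall eps, 0 < eps -> exists T0, 1 <= T0 /\ forall T, T0 <= T -> Cmod (v T - l) <= eps.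

Definition vline (h : C -> C) (L x T : R) : C := CI (fun t => h (x, t) * kern L (x, t))%C (- T) T.

Section Strip.
Variables (h : C -> C) (a A B : R).
Hypothesis Ha : 0 < a <= 5 / 2.
Hypothesis HA : 0 <= A.
Hypothesis HB : 0 <= B.
Hypothesis Hd : forall z, 0 <= fst z <= a -> diff_at h z.
Hypothesis Hb : forall x t, 0 <= x <= a -> Cmod (h (x, t)) <= B * (Rabs t + 3).
Hypothesis Hre : forall t, fst (h (0, t)) <= A * (1 + Rabs t).
Hypothesis Har : forall t, Cmod (h (a, t)) <= 2 * A * (1 + Rabs t).

Lemma rcont_on_vline (L x T : R) : 0 <= x <= a -> rcont_on (fun t => h (x, t) * kern L (x, t))%C (- T) T.
Proof.
  intros Hx t _. apply (rcont_ver (fun z => h z * kern L z)%C). apply diff_at_ccont.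
  destruct (Hd (x, t)) as [d1 D1]; [auto|]. destruct (diff_kern L (x, t)) as [d2 D2]. eexists. apply cder_mult; eauto.
Qed.

(** The crude bound [B] enters only here, through the horizontal edges, where e^(-T^2) beats it; it
    is absent from the limit in [vline_bound]. *)
Lemma vline_shift (L eps : R) : 0 < eps -> exists T0, 1 <= T0 /\ forall T, T0 <= T -> Cmod (vline h L a T - vline h L 0 T) <= eps.
Proof.
  intros He. set (E := exp (Rabs L * a + a ^ 2)). assert (PE : 0 < E) by apply exp_pos.
  destruct (edge_decay (2 * B * E * a) eps) as (T0 & H0 & HT); [repeat apply Rmult_le_pos; lra|auto|].
  exists T0. split; auto. intros T HT'. unfold vline.
  assert (M0 : Rmin 0 a = 0) by (apply Rmin_left; lra). assert (M1 : Rmax 0 a = a) by (apply Rmax_right; lra).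
  assert (Dg : forall z, 0 <= fst z <= a -> diff_at (fun z => h z * kern L z)%C z).
  { intros z Hz. destruct (Hd z Hz) as [d1 D1]. destruct (diff_kern L z) as [d2 D2]. eexists. apply cder_mult; eauto. }
  eapply Rle_trans.
  - apply (edge_shift (fun z => h z * kern L z)%C 0%C 0 a T (B * (T + 3) * (E * exp (- T ^ 2)))); [lra| | |]; rewrite ?M0, ?M1.
    + intros z Hz. apply diff_at_ccont; auto.
    + intros z Hz _. auto.
    + assert (K : forall x s, 0 <= x <= a -> Rabs s = T -> Cmod (h (x, s) * kern L (x, s)) <= B * (T + 3) * (E * exp (- T ^ 2))).
      { intros x s Hx Hs. rewrite Cmod_mult, Cmod_kern. apply Rmult_le_compat; [apply Cmod_ge_0|left; apply exp_pos|rewrite <- Hs; auto|].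
        unfold E. rewrite <- exp_plus. apply exp_le_mono. rewrite <- Hs, pow2_abs.
        assert (L * x <= Rabs L * a) by (apply Rle_trans with (Rabs L * x); [apply Rmult_le_compat_r; [lra|apply Rle_abs]|apply Rmult_le_compat_l; [apply Rabs_pos|lra]]).
        nra. }
      intros x Hx. split; apply K; auto; [|rewrite Rabs_Ropp]; apply Rabs_right; lra.
  - rewrite Rminus_0_r, Rabs_right by lra. eapply Rle_trans; [|apply (HT T HT')]. right. ring.
Qed.

(** For L <= 0 the factor e^(La) is at most 1; 25/4 is the square of the largest admissible [a]. *)
Lemma vline_right (L T : R) : L <= 0 -> 0 <= T -> Cmod (vline h L a T) <= 8 * A * exp (25 / 4) * PI.
Proof.
  intros HL HT. assert (P := exp_pos (25 / 4)). apply CI_cauchy_weight; [repeat apply Rmult_le_pos; lra|auto|apply rcont_on_vline; lra|].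
  intros t. rewrite Cmod_mult, Cmod_kern. assert (W := exp_square_weight t). 
  assert (E : exp (L * a + a ^ 2 - t ^ 2) <= exp (25 / 4) * exp (- t ^ 2)) by (rewrite <- exp_plus; apply exp_le_mono; nra).
  apply Rle_trans with (2 * A * (1 + Rabs t) * (exp (25 / 4) * exp (- t ^ 2))).
  - apply Rmult_le_compat; [apply Cmod_ge_0|left; apply exp_pos|auto|auto].
  - replace (2 * A * (1 + Rabs t) * (exp (25 / 4) * exp (- t ^ 2))) with (2 * A * exp (25 / 4) * (exp (- t ^ 2) * (1 + Rabs t))) by ring.
    replace (8 * A * exp (25 / 4) / (1 + t ^ 2)) with (2 * A * exp (25 / 4) * (4 / (1 + t ^ 2))) by (field; nra).
    apply Rmult_le_compat_l; [repeat apply Rmult_le_pos; lra|auto].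
Qed.

(* [h e^{iLt} = 2 Re(h) e^{iLt} - conj(h e^{-iLt})]: a one-sided bound on [Re h] and the kernels for [0] and [-L] control the kernel for [L]. *)
Lemma vline_left (L T : R) : 0 <= T -> Cmod (vline h L 0 T) <= 16 * A * PI + 2 * Cmod (vline h 0 0 T) + Cmod (vline h (- L) 0 T).
Proof.
  intros HT. assert (H0a : 0 <= 0 <= a) by lra.
  assert (C1 := rcont_on_vline L 0 T H0a). assert (C2 := rcont_on_vline (- L) 0 T H0a). assert (C3 := rcont_on_vline 0 0 T H0a).
  assert (CC : rcont_on (fun t => Cconj (h (0, t) * kern (- L) (0, t))) (- T) T).
  { intros t Ht. destruct (rcont_on_ex _ _ _ C2) as [_ _]. specialize (C2 t Ht). intros eps He. destruct (C2 eps He) as (d & Hd' & K). exists d. split; auto.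
    intros s Hs. specialize (K s Hs). rewrite <- Cmod_conj in K. rewrite Cminus_conj in K. exact K. }
  assert (E : vline h L 0 T = (CI (fun t => h (0, t)%R * kern L (0, t)%R + Cconj (h (0, t)%R * kern (- L) (0, t)%R)) (- T) T - Cconj (vline h (- L) 0 T))%C).
  { unfold vline. rewrite <- CI_conj, CI_plus by auto. ring. }
  rewrite E. eapply Rle_trans; [apply Cmod_triangle_minus|]. rewrite Cmod_conj. apply Rplus_le_compat_r.
  destruct (RInt_cauchy_weight (16 * A) T) as [W1 W2]; [lra|]. destruct (rcont_on_ex _ _ _ C3) as [X1 _].
  apply Rle_trans with (RInt (fun t => plus (16 * A / (1 + t ^ 2)) (scal (- 2) (fst (h (0, t) * kern 0 (0, t))%C))) (- T) T).
  - apply CI_norm_le; [lra|apply rcont_on_plus; auto|apply (ex_RInt_plus (V := R_NormedModule)); auto; apply (ex_RInt_scal (V := R_NormedModule)); auto|].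
    intros t _. rewrite Cmult_conj, kern_conj.
    replace (h (0, t) * kern L (0, t) + Cconj (h (0, t)) * kern L (0, t))%C with (RtoC (2 * fst (h (0, t))) * kern L (0, t))%C
      by (destruct (h (0, t)); unfold RtoC, Cconj; csolve).
    rewrite Cmod_mult, Cmod_R, Cmod_kern.
    assert (K0 : kern 0 (0, t) = RtoC (exp (- t ^ 2))) by (unfold kern; rewrite <- cexp_RtoC; f_equal; csolve).
    rewrite K0. replace (L * 0 + 0 ^ 2 - t ^ 2) with (- t ^ 2) by ring.
    change (plus (16 * A / (1 + t ^ 2)) (scal (- 2) (fst (h (0, t) * RtoC (exp (- t ^ 2)))%C)))
      with (16 * A / (1 + t ^ 2) + - 2 * fst (h (0, t) * RtoC (exp (- t ^ 2)))%C).
    replace (fst (h (0, t) * RtoC (exp (- t ^ 2)))%C) with (fst (h (0, t)) * exp (- t ^ 2)) by (simpl; ring).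
    assert (W := exp_square_weight t). assert (Pt := exp_pos (- t ^ 2)). specialize (Hre t). assert (R0 := Rabs_pos t).
    (* A one-sided bound controls the absolute value: r <= A(1 + |t|) implies |2r| <= 4A(1 + |t|) -
       2r. The integral of r e^(-t^2) is the real part of the line integral with L = 0. *)
    set (r := fst (h (0, t))) in *. set (e := exp (- t ^ 2)) in *. assert (Rabs (2 * r) <= 4 * (A * (1 + Rabs t)) - 2 * r).
    { assert (0 <= A * (1 + Rabs t)) by (apply Rmult_le_pos; lra). unfold Rabs at 1. destruct Rcase_abs; lra. }
    apply Rle_trans with ((4 * (A * (1 + Rabs t)) - 2 * r) * e); [apply Rmult_le_compat_r; lra|].
    replace (16 * A / (1 + t ^ 2)) with (4 * A * (4 / (1 + t ^ 2))) by (field; nra).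
    assert (4 * A * (e * (1 + Rabs t)) <= 4 * A * (4 / (1 + t ^ 2))) by (apply Rmult_le_compat_l; lra). lra.
  - rewrite (RInt_plus (V := R_CompleteNormedModule)), (RInt_scal (V := R_CompleteNormedModule)); auto.
    2: apply (ex_RInt_scal (V := R_NormedModule)); auto.
    change (RInt (fun t => 16 * A / (1 + t ^ 2)) (- T) T + - 2 * fst (vline h 0 0 T) <= 16 * A * PI + 2 * Cmod (vline h 0 0 T)).
    assert (T1 := Cmod_Re (vline h 0 0 T)). apply Rabs_le_between in T1. lra.
Qed.

(** The line with the large kernel is moved to abscissa 0, traded there for the kernels with 0 and
    -L, and these are moved back to [a], where [vline_right] applies. *)
Lemma vline_bound (L eps : R) : 0 <= L -> 0 < eps ->
  exists T0, 1 <= T0 /\ forall T, T0 <= T -> Cmod (vline h L a T) <= A * (16 * PI + 24 * exp (25 / 4) * PI) + eps.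
Proof.
  intros HL He.
  destruct (vline_shift L (eps / 4)) as (T1 & H1 & K1); [lra|]. destruct (vline_shift (- L) (eps / 4)) as (T2 & H2 & K2); [lra|].
  destruct (vline_shift 0 (eps / 4)) as (T3 & H3 & K3); [lra|].
  exists (Rmax T1 (Rmax T2 T3)). split; [eapply Rle_trans; [exact H1|apply Rmax_l]|]. intros T HT.
  assert (Q1 := Rle_trans _ _ _ (Rmax_l _ _) HT). assert (Q := Rle_trans _ _ _ (Rmax_r _ _) HT).
  assert (Q2 := Rle_trans _ _ _ (Rmax_l _ _) Q). assert (Q3 := Rle_trans _ _ _ (Rmax_r _ _) Q).
  specialize (K1 T Q1). specialize (K2 T Q2). specialize (K3 T Q3). rewrite Cmod_minus_sym in K2, K3.
  assert (B1 := vline_left L T ltac:(lra)). assert (B2 := vline_right (- L) T ltac:(lra) ltac:(lra)). assert (B3 := vline_right 0 T ltac:(lra) ltac:(lra)).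
  assert (N1 := Cmod_triangle_sub (vline h L a T) (vline h L 0 T)).
  assert (N2 := Cmod_triangle_sub (vline h (- L) 0 T) (vline h (- L) a T)).
  assert (N3 := Cmod_triangle_sub (vline h 0 0 T) (vline h 0 a T)). lra.
Qed.
End Strip.

Lemma Cminus_0_r (z : C) : (z - 0)%C = z.
Proof. ring. Qed.

(** * The contribution of the pole *)

Lemma RInt_inv_line (q T : R) : q <> 0 -> fst (CI (fun t => / (q, t))%C (- T) T) = 2 * atan (T / q).
Proof.
  intros Hq. simpl. apply is_RInt_unique.
  replace (2 * atan (T / q)) with (minus (atan (T / q)) (atan (- T / q)))
    by (replace (- T / q) with (- (T / q)) by (field; auto); rewrite atan_opp; unfold minus, plus, opp; simpl; ring).
  apply (is_RInt_derive (V := R_CompleteNormedModule) (fun t => atan (t / q)) (fun t => q / (q * (q * 1) + t * (t * 1)))).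
  - intros x _. auto_derive; auto. field. repeat split; auto; nra.
  - intros x _. apply (ex_derive_continuous (fun t => q / (q * (q * 1) + t * (t * 1)))). auto_derive. nra.
Qed.

Lemma rcont_on_diff (g : C -> C) (x a b : R) : (forall t, diff_at g (x, t)) -> rcont_on (fun t => g (x, t)) a b.
Proof. intros H t _. apply rcont_ver, diff_at_ccont, H. Qed.

Lemma diff_inv_sub (p z : C) : z <> p -> diff_at (fun w => / (w - p))%C z.
Proof.
  intros H. eexists. apply cder_inv; [intros E; apply H, Ceq_minus; exact E|]. apply cder_minus; [apply cder_id|apply cder_const].
Qed.

Lemma diff_kern_div (L : R) (p z : C) : z <> p -> diff_at (fun w => kern L w * / (w - p))%C z.
Proof.
  intros H. destruct (diff_kern L z) as [d1 D1]. destruct (diff_inv_sub p z H) as [d2 D2]. eexists. apply cder_mult; eauto.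
Qed.

(** Subtracting the value of the kernel at [p] makes the quotient continuous, so the line can be
    moved across [p] to Re z = 0 without a residue theorem. What remains are integrals of 1/(z - p),
    whose real parts are arctangents; 2 atan(T/2) >= pi/2 supplies the lower bound. *)
Lemma pole_term (L p : R) : 0 <= L -> 1 / 4 <= p <= 1 / 2 -> forall eps, 0 < eps -> exists T0, 1 <= T0 /\ forall T, T0 <= T ->
  exp (L * p + p ^ 2) * (PI / 2) - 16 * PI - eps <= fst (CI (fun t => kern L ((2 + p)%R, t) * / (((2 + p)%R, t) - RtoC p))%C (- T) T)
   <= exp (L * p + p ^ 2) * (2 * PI) + 16 * PI + eps.
Proof.
  intros HL Hp eps He. set (E := exp (L * p + p ^ 2)). assert (PE : 0 < E) by apply exp_pos. set (a := 2 + p). set (pc := RtoC p).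
  destruct (diff_kern L pc) as [d Hd]. set (g := fun z : C => if eqd z pc then d else ((kern L z - RtoC E) * / (z - pc))%C).
  assert (Kp : kern L pc = RtoC E) by apply kern_real.
  assert (Nz : forall z, z <> pc -> (z - pc)%C <> 0%C) by (intros z H E'; apply H, Ceq_minus; auto).
  assert (Gd : forall z, z <> pc -> diff_at g z).
  { intros z Hz. destruct (diff_kern L z) as [d1 D1]. destruct (diff_inv_sub pc z Hz) as [d2 D2].
    eexists. eapply (cder_ext_loc (fun w => (kern L w - RtoC E) * / (w - pc))%C g z _ (Cmod (z - pc))).
    - apply Cmod_gt_0; auto.
    - intros w Hw. unfold g. destruct (eqd w pc) as [->|]; auto. rewrite Cmod_minus_sym in Hw. lra.
    - apply cder_mult; [apply cder_minus; [exact D1|apply cder_const]|exact D2]. }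
  assert (Gc : forall z, ccont g z).
  { intros z. destruct (eqd z pc) as [->|N]; [|apply diff_at_ccont; auto].
    intros e He'. destruct (Hd (e / 2)) as (de & Hde & K); [lra|]. exists de. split; auto. intros w Hw. unfold g.
    destruct (eqd pc pc); [|congruence]. destruct (eqd w pc) as [->|N]; [replace (d - d)%C with (RtoC 0) by ring; rewrite Cmod_0; auto|].
    specialize (K w Hw). rewrite Kp in K. specialize (Nz w N).
    replace ((kern L w - RtoC E) * / (w - pc) - d)%C with ((kern L w - RtoC E - d * (w - pc)) * / (w - pc))%C by (field; auto).
    assert (P : 0 < Cmod (w - pc)) by (apply Cmod_gt_0; auto).
    rewrite Cmod_mult, Cmod_inv by auto. apply Rle_lt_trans with (e / 2 * Cmod (w - pc) * / Cmod (w - pc)).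
    - apply Rmult_le_compat_r; [left; apply Rinv_0_lt_compat; auto|auto].
    - rewrite Rmult_assoc, Rinv_r by lra. lra. }
  set (M := exp (L * a + a ^ 2) + E). exists (Rmax 2 (2 * M * a / eps)). split; [eapply Rle_trans; [|apply Rmax_l]; lra|]. intros T HT.
  assert (T2 : 2 <= T) by (eapply Rle_trans; [apply Rmax_l|exact HT]).
  assert (T3 : 2 * M * a / eps <= T) by (eapply Rle_trans; [apply Rmax_r|exact HT]).
  assert (Sh : Cmod (CI (fun t => g (a, t)) (- T) T - CI (fun t => g (0, t)) (- T) T) <= eps).
  { eapply Rle_trans; [apply (edge_shift g pc 0 a T (M / T)); [lra|auto|auto|]|].
    - rewrite Rmin_left, Rmax_right by (unfold a; lra). assert (K : forall x s, 0 <= x <= a -> Rabs s = T -> Cmod (g (x, s)) <= M / T).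
      { intros x s Hx Hs. assert (N : (x, s) <> pc) by (intros E'; apply (f_equal snd) in E'; simpl in E'; subst s; rewrite Rabs_R0 in Hs; lra).
        unfold g. destruct (@eqd C (x, s) pc); [contradiction|]. rewrite Cmod_mult, Cmod_inv by auto.
        assert (Q := Cmod_Im ((x, s) - pc)). replace (snd ((x, s) - pc)%C) with s in Q by (simpl; ring). rewrite Hs in Q.
        apply Rmult_le_compat; [apply Cmod_ge_0|left; positive| |apply Rinv_le_contravar; lra].
        eapply Rle_trans; [apply Cmod_triangle_minus|]. rewrite Cmod_kern, Cmod_R, (Rabs_right E) by lra. unfold M. apply Rplus_le_compat_r.
        apply exp_le_mono. nra. }
      intros x Hx. split; apply K; auto; [|rewrite Rabs_Ropp]; apply Rabs_right; lra.
    - rewrite Rminus_0_r, Rabs_right by (unfold a; lra).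
      apply Rmult_le_compat_r with (r := eps) in T3; [|lra]. unfold Rdiv in T3. rewrite Rmult_assoc, Rinv_l in T3 by lra.
      apply Rmult_le_reg_r with T; [lra|]. replace (2 * (M / T) * a * T) with (2 * M * a) by (field; lra). lra. }
  assert (Line : forall x, x <> p -> CI (fun t => g (x, t)) (- T) T =
    (CI (fun t => kern L (x, t)%R * / ((x, t)%R - pc)) (- T) T - RtoC E * CI (fun t => / ((x - p)%R, t)%R) (- T) T)%C).
  { intros x Hx. assert (N : forall t, (x, t) <> pc) by (intros t Et; apply Hx; apply (f_equal fst) in Et; exact Et).
    assert (C2 : rcont_on (fun t => / ((x, t) - pc))%C (- T) T) by (apply (rcont_on_diff (fun z => / (z - pc))%C); intros; apply diff_inv_sub; auto).
    assert (Q : forall t, ((x - p, t) : C) = ((x, t) - pc)%C) by (intros; csolve).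
    rewrite (CI_ext (fun t => / ((x - p)%R, t))%C (fun t => / ((x, t) - pc))%C) by (intros; rewrite Q; auto).
    rewrite <- CI_scal, <- CI_minus; auto; [|apply (rcont_on_diff (fun z => kern L z * / (z - pc))%C); intros; apply diff_kern_div; auto|apply rcont_on_scal; auto].
    apply CI_ext. intros t _. unfold g. destruct (@eqd C (x, t) pc); [exfalso; apply (N t); auto|]. ring. }
  rewrite (Line a), (Line 0) in Sh by (unfold a; lra).
  assert (I1 := RInt_inv_line (a - p) T ltac:(unfold a; lra)). assert (I2 := RInt_inv_line (0 - p) T ltac:(lra)).
  assert (Lf : Cmod (CI (fun t => kern L (0, t)%R * / ((0, t)%R - pc))%C (- T) T) <= 16 * PI).
  { assert (N : forall t, (0, t) <> pc) by (intros t E'; apply (f_equal fst) in E'; simpl in E'; lra).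
    apply CI_cauchy_weight; [lra|lra|apply (rcont_on_diff (fun z => kern L z * / (z - pc))%C); intros; apply diff_kern_div; auto|].
    intros t. rewrite Cmod_mult, Cmod_inv, Cmod_kern by auto. replace (L * 0 + 0 ^ 2 - t ^ 2) with (- t ^ 2) by ring.
    assert (Q := Cmod_Re ((0, t) - pc)). replace (fst ((0, t) - pc)%C) with (- p) in Q by (simpl; ring). rewrite Rabs_Ropp, Rabs_right in Q by lra.
    assert (W := exp_square_le t). assert (Pt := exp_pos (- t ^ 2)). apply Rle_trans with (4 / (1 + t ^ 2) * 4); [|right; field; nra].
    apply Rmult_le_compat; [lra|left; positive|auto|]. replace 4 with (/ (1 / 4)) by field. apply Rinv_le_contravar; lra. }
  set (Rt := CI (fun t => kern L (a, t)%R * / ((a, t)%R - pc))%C (- T) T) in *.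
  set (Lt := CI (fun t => kern L (0, t)%R * / ((0, t)%R - pc))%C (- T) T) in *.
  set (i1 := CI (fun t => / ((a - p)%R, t)%R)%C (- T) T) in *. set (i2 := CI (fun t => / ((0 - p)%R, t)%R)%C (- T) T) in *.
  assert (Fs := Cmod_Re (Rt - RtoC E * i1 - (Lt - RtoC E * i2))).
  replace (fst (Rt - RtoC E * i1 - (Lt - RtoC E * i2))%C) with (fst Rt - E * fst i1 - (fst Lt - E * fst i2)) in Fs by (simpl; ring).
  assert (Fl := Cmod_Re Lt). rewrite I1, I2 in Fs. apply Rabs_le_between in Fs. apply Rabs_le_between in Fl.
  replace (a - p) with 2 in Fs by (unfold a; ring). assert (A1 : PI / 4 <= atan (T / 2) <= PI / 2).
  { split; [|left; apply atan_bound]. rewrite <- atan_1. destruct (Req_dec (T / 2) 1) as [->|]; [lra|]. left. apply atan_increasing. lra. }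
  assert (A2 : - (PI / 2) <= atan (T / (0 - p)) <= 0).
  { split; [left; assert (Q := atan_bound (T / (0 - p))); lra|]. assert (N : T / (0 - p) < 0).
    { replace (T / (0 - p)) with (- (T / p)) by (field; lra). assert (0 < T / p) by positive. lra. }
    apply atan_increasing in N. rewrite atan_0 in N. lra. }
  assert (E * (PI / 4) <= E * atan (T / 2) <= E * (PI / 2)) by (split; apply Rmult_le_compat_l; lra).
  assert (E * - (PI / 2) <= E * atan (T / (0 - p)) <= E * 0) by (split; apply Rmult_le_compat_l; lra). split; lra.
Qed.

(** * Gaussian transforms and termwise limits *)

Definition gint (T : R) : R := RInt (fun t => exp (- t ^ 2)) (- T) T.

Lemma continuous_gauss (t : R) : continuous (fun t => exp (- t ^ 2)) t.
Proof. apply (ex_derive_continuous (fun t => exp (- t ^ 2))). auto_derive. auto. Qed.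

Lemma ex_RInt_gauss (a b : R) : ex_RInt (fun t => exp (- t ^ 2)) a b.
Proof. apply (ex_RInt_continuous (V := R_CompleteNormedModule)). intros; apply continuous_gauss. Qed.

(** The truncated Gaussian integral is carried along as a factor. Only its order of magnitude
    matters, so its limit is never evaluated. *)
Lemma gint_bounds (T : R) : 1 <= T -> 1 / 2 <= gint T <= 4 * PI.
Proof.
  intros HT. unfold gint. split.
  - assert (P : forall a b, a <= b -> 0 <= RInt (fun t => exp (- t ^ 2)) a b).
    { intros a b H. apply RInt_ge_0; auto; [apply ex_RInt_gauss|]. intros; left; apply exp_pos. }
    rewrite <- (RInt_Chasles (V := R_CompleteNormedModule) _ (- T) (- 1) T), <- (RInt_Chasles (V := R_CompleteNormedModule) _ (- 1) 1 T) by apply ex_RInt_gauss.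
    assert (M : RInt (fun _ => 1 / 3) (- 1) 1 <= RInt (fun t => exp (- t ^ 2)) (- 1) 1).
    { apply RInt_le; [lra|apply ex_RInt_const|apply ex_RInt_gauss|]. intros t Ht.
      apply Rle_trans with (exp (- (1))); [|apply exp_le_mono; nra].
      rewrite exp_Ropp. unfold Rdiv. rewrite Rmult_1_l. apply Rinv_le_contravar; [apply exp_pos|apply exp_le_3]. }
    rewrite (RInt_const (V := R_CompleteNormedModule)) in M. change (scal (1 - - 1) (1 / 3)) with ((1 - - 1) * (1 / 3)) in M.
    assert (P1 := P (- T) (- 1) ltac:(lra)). assert (P2 := P 1 T HT).
    change (1 / 2 <= RInt (fun t => exp (- t ^ 2)) (- T) (- 1) + (RInt (fun t => exp (- t ^ 2)) (- 1) 1 + RInt (fun t => exp (- t ^ 2)) 1 T)). lra.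
  - destruct (RInt_cauchy_weight 4 T) as [H1 H2]; [lra|]. eapply Rle_trans; [|exact H2].
    apply RInt_le; [lra|apply ex_RInt_gauss|auto|]. intros t _. apply exp_square_le.
Qed.

(** Completing the square: on Re z = -u/2 the kernel is exactly e^(-u^2/4) e^(-t^2), and the line is
    moved there. *)
Lemma gauss_transform (u a : R) : tends (fun T => CI (fun t => kern u (a, t)) (- T) T - RtoC (exp (- (u ^ 2 / 4)) * gint T))%C 0%C.
Proof.
  intros eps He. set (b := - u / 2). set (m := Rabs a + Rabs u). set (E := exp (Rabs u * m + m ^ 2)). assert (PE : 0 < E) by apply exp_pos.
  assert (Pa := Rabs_pos a). assert (Pu := Rabs_pos u). assert (Pb := Rabs_pos (a - b)).
  destruct (edge_decay (2 * E * Rabs (a - b)) eps) as (T0 & H0 & HT); [nra|auto|]. exists T0. split; auto. intros T HT'.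
  assert (Eb : CI (fun t => kern u (b, t)) (- T) T = RtoC (exp (- (u ^ 2 / 4)) * gint T)).
  { rewrite (CI_ext _ (fun t => RtoC (exp (- (u ^ 2 / 4))) * RtoC (exp (- t ^ 2)))%C).
    - rewrite CI_scal by (intros t _; apply rcont_RtoC, continuous_gauss). rewrite RtoC_mult. f_equal. unfold CI, RtoC, gint; simpl fst; simpl snd. f_equal.
      rewrite (RInt_const (V := R_CompleteNormedModule)). unfold scal; simpl; unfold mult; simpl; ring.
    - intros t _. rewrite <- RtoC_mult, <- exp_plus, <- cexp_RtoC. unfold kern. f_equal. unfold b. apply Ceq_pair; simpl; field. }
  rewrite <- Eb, Cminus_0_r. eapply Rle_trans; [apply (edge_shift (kern u) 0%C b a T (E * exp (- T ^ 2))); [lra| | |]|].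
  - intros z _. apply diff_at_ccont, diff_kern.
  - intros z _ _. apply diff_kern.
  - assert (K : forall x s, Rmin b a <= x <= Rmax b a -> Rabs s = T -> Cmod (kern u (x, s)) <= E * exp (- T ^ 2)).
    { intros x s Hx Hs. rewrite Cmod_kern. unfold E. rewrite <- exp_plus. apply exp_le_mono. rewrite <- Hs, pow2_abs. assert (Rabs x <= m).
      { replace x with (x - 0) by ring. apply (between_abs b a); auto; rewrite Rminus_0_r.
        - unfold b, m. replace (- u / 2) with (- (u / 2)) by field. rewrite Rabs_Ropp. unfold Rdiv. rewrite Rabs_mult, (Rabs_right (/ 2)) by lra. lra.
        - unfold m. lra. }
      assert (u * x <= Rabs u * m) by (apply Rle_trans with (Rabs (u * x)); [apply Rle_abs|rewrite Rabs_mult; apply Rmult_le_compat_l; lra]).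
      assert (x ^ 2 <= m ^ 2) by (rewrite <- (pow2_abs x); apply pow_incr; split; [apply Rabs_pos|auto]). lra. }
    intros x Hx. split; apply K; auto; [|rewrite Rabs_Ropp]; apply Rabs_right; lra.
  - eapply Rle_trans; [|apply (HT T HT')]. assert (Q := exp_pos (- T ^ 2)).
    replace (2 * (E * exp (- T ^ 2)) * Rabs (a - b)) with (2 * E * Rabs (a - b) * 1 * exp (- T ^ 2)) by ring.
    apply Rmult_le_compat_r; [lra|]. apply Rmult_le_compat_l; [nra|lra].
Qed.

Lemma tends_scal (c : C) (v : R -> C) : tends v 0%C -> tends (fun T => c * v T)%C 0%C.
Proof.
  intros H eps He. assert (P := Cmod_ge_0 c). destruct (H (eps / (Cmod c + 1))) as (T0 & H0 & K); [positive|].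
  exists T0. split; auto. intros T HT. specialize (K T HT). rewrite Cminus_0_r in *. rewrite Cmod_mult.
  apply Rle_trans with ((Cmod c + 1) * (eps / (Cmod c + 1))); [|right; field; lra]. apply Rmult_le_compat; try apply Cmod_ge_0; auto; lra.
Qed.

Lemma tends_csum {A : Type} (d : R -> A -> C) (l : list A) : (forall x, tends (fun T => d T x) 0%C) -> tends (fun T => csum (d T) l) 0%C.
Proof.
  intros H. induction l as [|x l IH].
  - intros eps He. exists 1. split; [lra|]. intros T _. simpl. rewrite Cminus_0_r, Cmod_0. lra.
  - intros eps He. destruct (H x (eps / 2)) as (T1 & H1 & K1); [lra|]. destruct (IH (eps / 2)) as (T2 & H2 & K2); [lra|].
    exists (Rmax T1 T2). split; [eapply Rle_trans; [exact H1|apply Rmax_l]|]. intros T HT.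
    specialize (K1 T (Rle_trans _ _ _ (Rmax_l _ _) HT)). specialize (K2 T (Rle_trans _ _ _ (Rmax_r _ _) HT)).
    rewrite Cminus_0_r in *. simpl. eapply Rle_trans; [apply Cmod_triangle|lra].
Qed.

(** Dominated convergence in T: the tail of the majorant is small uniformly, and finitely many terms
    tend to zero. *)
Lemma is_sum_dominated {A : Type} (d : R -> A -> C) (D : R -> C) (M : A -> R) (B : R) : sum_bounded M B -> (forall x, 0 <= M x) ->
  (forall T x, 1 <= T -> Cmod (d T x) <= M x) -> (forall T, 1 <= T -> is_sum (d T) (D T)) -> (forall x, tends (fun T => d T x) 0%C) -> tends D 0%C.
Proof.
  intros HB HM Hd HD Ht eps He. destruct (sum_tail M B HM HB (eps / 2)) as (l0 & N0 & K); [lra|].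
  destruct (tends_csum d l0 Ht (eps / 2)) as (T0 & H0 & K0); [lra|]. exists T0. split; auto. intros T HT.
  specialize (K0 T HT). rewrite Cminus_0_r in *. assert (Q : Cmod (csum (d T) l0 - D T) <= eps / 2).
  { apply is_sum_tail; auto; [apply HD; lra|]. intros l' N' I. eapply Rle_trans; [apply rsum_le; intros; apply Hd; lra|]. apply K; auto. }
  rewrite Cmod_minus_sym in Q. assert (R := Cmod_triangle_sub (D T) (csum (d T) l0)). lra.
Qed.

(** The coefficient of the character in S_k, with L = log Y. *)
Definition wt (sigma L : R) (x : gauss) : R := Lam x * gw sigma x * exp (- ((L - ln (IZR (gN x))) ^ 2 / 4)).

Lemma wt_nonneg (sigma L : R) (x : gauss) : 0 <= wt sigma L x.
Proof.
  apply Rmult_le_pos; [apply Rmult_le_pos; [apply Lam_nonneg|apply gw_nonneg]|left; apply exp_pos].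
Qed.

Lemma gw_split (s e : R) (x : gauss) : gw s x * exp (e * ln (IZR (gN x))) = gw (s - e) x.
Proof.
  destruct (eqd x g0) as [->|N]; [unfold gw; destruct (eqd g0 g0); [ring|congruence]|].
  rewrite !gw_fst_exp by auto. rewrite <- exp_plus. f_equal. ring.
Qed.

(** Rankin's trick with a free shift: ((L - l)/2 + a)^2 >= 0 trades the Gaussian for a power of the
    norm. With sigma + a = 3 it gives absolute convergence, with a = 1/4 the bound for proper prime
    powers. *)
Lemma wt_le (sigma L a : R) (x : gauss) : wt sigma L x <= Lam x * gw (sigma + a) x * exp (a * L + a ^ 2).
Proof.
  unfold wt. rewrite !Rmult_assoc. apply Rmult_le_compat_l; [apply Lam_nonneg|].
  replace sigma with (sigma + a - a) by ring. rewrite <- gw_split. replace (sigma + a - a + a) with (sigma + a) by ring.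
  rewrite !Rmult_assoc. apply Rmult_le_compat_l; [apply gw_nonneg|]. rewrite <- exp_plus. apply exp_le_mono.
  set (l := ln (IZR (gN x))). assert (0 <= ((L - l) / 2 + a) ^ 2) by apply pow2_ge_0. nra.
Qed.

(** Separates k from t, so that ln(k + 3) factors out of the integrals over t. *)
Lemma ln_shift_le (k : nat) (t : R) : 1 <= ln (INR k + 3) /\ ln (INR k + Rabs t + 3) <= ln (INR k + 3) * (1 + Rabs t).
Proof.
  assert (Hk := pos_INR k). assert (Ht := Rabs_pos t). assert (H1 : 1 <= ln (INR k + 3)).
  { rewrite <- (ln_exp 1). apply ln_le; [apply exp_pos|]. assert (E := exp_le_3). lra. }
  split; auto. apply Rle_trans with (ln ((INR k + 3) * exp (Rabs t))).
  - apply ln_le; [lra|]. assert (E := exp_ineq1_le (Rabs t)). nra.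
  - rewrite ln_mult, ln_exp by (try apply exp_pos; lra). nra.
Qed.

Section Smoothed.
Variables (BB : R) (F f : nat -> C -> C).
Hypothesis HL : Ldata BB F f.

Lemma f_neq0_right (k : nat) (s : C) : 1 / 2 < fst s < 10 -> f k s <> 0%C.
Proof. intros Hs E. assert (Q := f_zeros BB F f HL k s). unfold strip in Q. specialize (Q ltac:(lra) E). lra. Qed.

Lemma logder_diff (k : nat) (s : C) : 1 / 2 < fst s < 9 -> diff_at (fun z => - (Cderiv (f k) z / f k z))%C s.
Proof.
  intros Hs. assert (Hf : holo (f k) s (2 / 5)).
  { intros z Hz. apply (Ld_fdiff _ _ _ HL). assert (T := Cmod_Re (z - s)). change (fst (z - s)%C) with (fst z - fst s) in T. apply Rabs_le_between in T. unfold strip. lra. }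
  assert (H0 : Cmod (s - s) < 2 / 5) by (replace (s - s)%C with (RtoC 0) by ring; rewrite Cmod_0; lra).
  destruct (Hf s H0) as [d Hd]. destruct (holo_Cderiv _ _ _ Hf s H0) as [d' Hd'].
  eexists. apply cder_opp, cder_div; eauto. apply f_neq0_right; lra.
Qed.

Lemma logder_Lamsum (k : nat) (s : C) : 1 < fst s < 10 ->
  (- (Cderiv (f k) s / f k s) = Lamsum k s / 4 - (if Nat.eqb k 0 then / (s - 1) else 0))%C.
Proof.
  intros Hs. assert (N : s <> RtoC 1) by (apply neq1_of_Re; lra). assert (Ns : (s - 1)%C <> 0%C) by (intros E; apply N, Ceq_minus; exact E).
  assert (HF := log_deriv_series BB F f HL k s ltac:(lra)). assert (F0 := F_neq0 BB F f HL k s ltac:(lra)).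
  assert (Hloc : forall w : C, Cmod (w - s) < Cmod (s - 1) -> (mu k w * F k w)%C = f k w).
  { intros w Hw. rewrite (Ld_feq _ _ _ HL); auto. intros ->. rewrite Cmod_minus_sym in Hw. lra. }
  assert (Hp : 0 < Cmod (s - 1)) by (apply Cmod_gt_0; auto). rewrite (Ld_feq _ _ _ HL k s N).
  destruct k as [|k]; unfold mu in *; simpl Nat.eqb; cbv iota.
  - assert (D : cder (f 0%nat) s (1 * F 0%nat s + (s - 1) * (- (Lamsum 0 s / 4) * F 0%nat s))%C).
    { eapply (cder_ext_loc _ _ _ _ _ Hp Hloc). apply (cder_mult (fun w => w - 1)%C); auto.
      eapply cder_eq; [apply cder_minus; [apply cder_id|apply cder_const]|ring]. }
    rewrite (Cderiv_eq _ _ _ D). field. repeat split; auto; apply RtoC_neq; lra.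
  - assert (D : cder (f (S k)) s (- (Lamsum (S k) s / 4) * F (S k) s)%C).
    { eapply (cder_ext_loc _ _ _ _ _ Hp Hloc). eapply cder_eq; [apply (cder_scal 1); exact HF|ring]. }
    rewrite (Cderiv_eq _ _ _ D). field. repeat split; auto; apply RtoC_neq; lra.
Qed.

Definition hfun (k : nat) (sigma : R) (z : C) : C := (- (Cderiv (f k) (z + RtoC sigma) / f k (z + RtoC sigma)))%C.

Lemma hfun_diff (k : nat) (sigma : R) (z : C) : 1 / 2 < sigma <= 3 / 4 -> 0 <= fst z <= 5 / 2 -> diff_at (hfun k sigma) z.
Proof.
  intros Hs Hz. destruct (logder_diff k (z + RtoC sigma)%C) as [d Hd]; [simpl; lra|].
  eexists. apply (cder_comp (fun w => - (Cderiv (f k) w / f k w))%C (fun z => z + RtoC sigma)%C); [exact Hd|].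
  apply cder_plus; [apply cder_id|apply cder_const].
Qed.

(** On Re s = 3 the series converges absolutely and may be integrated term by term;
    [gauss_transform] turns each term into its weight [wt]. *)
Lemma Lam_series_transform (k : nat) (sigma L : R) : 1 / 2 < sigma <= 3 / 4 ->
  exists S, is_sum (fun x => RtoC (wt sigma L x) * uz (gC x) ^ k)%C S /\
    tends (fun T => CI (fun t => Lamsum k (3, t)%R * kern L ((3 - sigma)%R, t)) (- T) T - RtoC (gint T) * S)%C 0%C.
Proof.
  intros Hs. set (a := 3 - sigma). destruct (Lam_gw_bounded (Ld_W _ _ _ HL) 3) as [B HB]; [lra|].
  set (E := exp (a * L + a ^ 2)). assert (PE : 0 < E) by apply exp_pos. assert (HW : sum_bounded (fun x => wt sigma L x) (E * B)).
  { eapply sum_bounded_le; [|apply sum_bounded_scal; [|exact HB]; left; exact PE]. intros x; cbv beta.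
    eapply Rle_trans; [apply (wt_le sigma L a)|]. replace (sigma + a) with 3 by (unfold a; ring). fold E. lra. }
  assert (HU : forall x, Cmod (RtoC (wt sigma L x) * uz (gC x) ^ k) = wt sigma L x).
  { intros x. destruct (eqd x g0) as [->|N]; [unfold wt; rewrite Lam_g0, !Rmult_0_l, Cmult_0_l, Cmod_0; auto|].
    rewrite Cmod_mult, Cmod_pow, Cmod_uz, pow1, Cmod_R, Rabs_right by (try apply gC_neq0; auto; apply Rle_ge, wt_nonneg). ring. }
  destruct (is_sum_exists (fun x => RtoC (wt sigma L x) * uz (gC x) ^ k)%C (E * B)) as [S HS].
  { eapply sum_bounded_le; [|exact HW]. intros x; cbv beta. rewrite HU. lra. }
  exists S. split; auto. set (D := fun (x : gauss) (t : R) => (RtoC (Lam x) * fk k (3, t)%R x * kern L (a, t))%C).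
  set (q := fun x : gauss => (RtoC (Lam x * gw sigma x) * uz (gC x) ^ k)%C).
  assert (DE : forall x t, D x t = (q x * kern (L - ln (IZR (gN x))) (a, t))%C).
  { intros x t. unfold D, q. destruct (eqd x g0) as [->|N]; [rewrite Lam_g0, fk_g0; rewrite Rmult_0_l; ring|].
    rewrite fk_eq, gw_fst_exp by auto. unfold fz. rewrite gC_norm. set (l := ln (IZR (gN x))). rewrite RtoC_mult, <- cexp_RtoC. unfold kern.
    replace (cexp (RtoC (L - l) * (a, t) + (a, t) * (a, t))) with (cexp (RtoC (sigma * l)) * cexp (- (3, t) * RtoC l) * cexp (RtoC L * (a, t) + (a, t) * (a, t)))%C.
    - replace (RtoC (Lam x) * cexp (RtoC (- sigma * l)) * uz (gC x) ^ k * (cexp (RtoC (sigma * l)) * cexp (- (3, t)%R * RtoC l) * cexp (RtoC L * (a, t) + (a, t) * (a, t))))%C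
        with (RtoC (Lam x) * uz (gC x) ^ k * (cexp (RtoC (- sigma * l)) * cexp (RtoC (sigma * l))) * cexp (- (3, t)%R * RtoC l) * cexp (RtoC L * (a, t) + (a, t) * (a, t)))%C by ring.
      rewrite <- (cexp_plus (RtoC (- sigma * l))). replace (RtoC (- sigma * l) + RtoC (sigma * l))%C with (RtoC 0) by (rewrite <- RtoC_plus; f_equal; ring).
      rewrite cexp_0. ring.
    - rewrite <- !cexp_plus. f_equal. unfold a. csolve. }
  assert (Dc : forall x u v, rcont_on (D x) u v).
  { intros x u v t Ht. apply rcont_ext with (fun t => q x * kern (L - ln (IZR (gN x))) (a, t))%C; [intros; symmetry; apply DE|].
    apply rcont_scal. apply rcont_ver, diff_at_ccont, diff_kern. }
  assert (Db : forall x t, Cmod (D x t) <= E * (Lam x * gw 3 x) * exp (- t ^ 2)).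
  { intros x t. unfold D. rewrite !Cmod_mult, Cmod_fk, Cmod_kern, Cmod_R, Rabs_right by (apply Rle_ge, Lam_nonneg). simpl fst.
    replace (L * a + a ^ 2 - t ^ 2) with (a * L + a ^ 2 + - t ^ 2) by ring. rewrite exp_plus. fold E. right. ring. }
  assert (M0 : forall x, 0 <= Lam x * gw 3 x) by (intros; apply Rmult_le_pos; [apply Lam_nonneg|apply gw_nonneg]).
  assert (Lc : forall u v, rcont_on (fun t => Lamsum k (3, t)%R * kern L (a, t))%C u v).
  { intros u v t _. apply rcont_mult; [|apply rcont_ver, diff_at_ccont, diff_kern].
    set (G := fun s : C => (4 * (- (Cderiv (f k) s / f k s) + (if Nat.eqb k 0 then / (s - 1) else 0)))%C).
    apply rcont_ext with (fun t => G (3, t)).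
    - intros s. unfold G. rewrite (logder_Lamsum k (3, s)) by (simpl; lra).
      replace (4 * (Lamsum k (3, s) / 4 - (if (k =? 0)%nat then / ((3, s)%R - 1) else 0) + (if (k =? 0)%nat then / ((3, s)%R - 1) else 0)))%C with (4 * (Lamsum k (3, s) / 4))%C by ring.
      field.
    - apply (rcont_ver G). unfold G. apply diff_at_ccont. destruct (logder_diff k (3, t)) as [d Hd]; [simpl; lra|].
      assert (Q : exists d', cder (fun s : C => if Nat.eqb k 0 then / (s - 1) else 0)%C (3, t) d').
      { destruct (Nat.eqb k 0); [|eexists; apply cder_const]. apply diff_inv_sub. intros E'. apply (f_equal fst) in E'. simpl in E'. lra. }
      destruct Q as [d' Hd']. eexists. apply cder_scal, cder_plus; [exact Hd|exact Hd']. }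
  assert (G1 : forall T, 1 <= T -> is_sum (fun x => CI (D x) (- T) T) (CI (fun t => Lamsum k (3, t)%R * kern L (a, t))%C (- T) T)).
  { intros T HT. apply is_sum_CI with (M := fun x => E * (Lam x * gw 3 x)) (B := E * B); [lra|intros; apply Dc|apply Lc| |apply sum_bounded_scal; auto; lra|].
    - intros x t _. eapply Rle_trans; [apply Db|]. rewrite <- (Rmult_1_r (E * (Lam x * gw 3 x))) at 2.
      apply Rmult_le_compat_l; [apply Rmult_le_pos; auto; lra|]. rewrite <- exp_0. apply exp_le_mono. assert (0 <= t ^ 2) by apply pow2_ge_0. lra.
    - intros t _. unfold D. apply is_sum_ext with (fun x => kern L (a, t) * (RtoC (Lam x) * fk k (3, t) x))%C; [intros; ring|].
      rewrite Cmult_comm. apply is_sum_scal. apply (Lamsum_spec BB F f HL). simpl. lra. }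
  apply (is_sum_dominated (fun T x => CI (D x) (- T) T - RtoC (gint T) * (RtoC (wt sigma L x) * uz (gC x) ^ k))%C _ (fun x => 8 * PI * (E * (Lam x * gw 3 x))) (8 * PI * (E * B))).
  - assert (P := PI_RGT_0). apply sum_bounded_scal; [lra|]. apply sum_bounded_scal; auto; lra.
  - intros x. assert (P := PI_RGT_0). apply Rmult_le_pos; [lra|apply Rmult_le_pos; auto; lra].
  - intros T x HT. eapply Rle_trans; [apply Cmod_triangle_minus|]. rewrite Cmod_mult, HU, Cmod_R.
    assert (Gb := gint_bounds T HT). rewrite Rabs_right by lra.
    assert (W := wt_le sigma L a x). replace (sigma + a) with 3 in W by (unfold a; ring). fold E in W.
    assert (Q : Cmod (CI (D x) (- T) T) <= 4 * (E * (Lam x * gw 3 x)) * PI).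
    { apply CI_cauchy_weight; [apply Rmult_le_pos; [lra|apply Rmult_le_pos; auto; lra]|lra|apply Dc|].
      intros t. eapply Rle_trans; [apply Db|]. assert (Z := exp_square_le t).
      replace (4 * (E * (Lam x * gw 3 x)) / (1 + t ^ 2)) with (E * (Lam x * gw 3 x) * (4 / (1 + t ^ 2))) by (field; nra).
      apply Rmult_le_compat_l; auto. apply Rmult_le_pos; auto; lra. }
    assert (gint T * wt sigma L x <= 4 * PI * (Lam x * gw 3 x * E)) by (apply Rmult_le_compat; auto; [lra|apply wt_nonneg|lra]). lra.
  - intros T HT. apply is_sum_minus; auto. apply is_sum_scal; auto.
  - intros x. set (u := L - ln (IZR (gN x))).
    assert (Q := tends_scal (q x) _ (gauss_transform u a)). intros eps He. destruct (Q eps He) as (T0 & H0 & K). exists T0. split; auto.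
    intros T HT. specialize (K T HT). rewrite Cminus_0_r in *.
    rewrite (CI_ext (D x) (fun t => q x * kern u (a, t))%C) by (intros; apply DE). rewrite CI_scal by (intros t _; apply rcont_ver, diff_at_ccont, diff_kern).
    eapply Rle_trans; [|exact K]. right. f_equal. unfold wt. fold u. unfold q. rewrite !RtoC_mult. ring.
Qed.

(** Up to a small error, gint(T) S is four times the line integral of -f'/f, plus four times the
    pole term if k = 0. The former is O(ln(k + 3)) by [vline_bound]; the latter has order e^(L(1 -
    sigma)) by [pole_term] with p = 1 - sigma. *)
Lemma smoothed_sums : exists C2 c0, 0 < C2 /\ 0 < c0 /\ forall k sigma L, 1 / 2 < sigma <= 3 / 4 -> 0 <= L ->
  exists S, is_sum (fun x => RtoC (wt sigma L x) * uz (gC x) ^ k)%C S /\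
    (k <> 0%nat -> Cmod S <= C2 * ln (INR k + 3)) /\
    (k = 0%nat -> c0 * exp (L * (1 - sigma)) - C2 <= fst S <= C2 * exp (L * (1 - sigma)) + C2).
Proof.
  destruct (log_deriv_estimate BB F f HL) as (C1 & HC1 & Hest).
  set (C0 := 16 * PI + 24 * exp (25 / 4) * PI). assert (PP := PI_RGT_0). assert (PQ := exp_pos (25 / 4)).
  assert (P0 : 0 < C0) by (unfold C0; assert (0 < exp (25 / 4) * PI) by positive; lra). assert (PC : 0 < C1 * C0) by positive.
  set (C2 := 8 * (C1 * C0 * ln 3) + 8 * (C1 * C0) + 400 * PI + 20). assert (L3 : 0 < ln 3) by (rewrite <- ln_1; apply ln_increasing; lra).
  assert (PC3 : 0 < C1 * C0 * ln 3) by positive. exists C2, (/ 4). split; [unfold C2; lra|]. split; [lra|]. intros k sigma L Hs HL0.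
  destruct (Lam_series_transform k sigma L Hs) as (S & HS & HT). exists S. split; auto.
  set (A := C1 * ln (INR k + 3)). destruct (ln_shift_le k 0) as [Lk _]. assert (HA : 0 < A) by (unfold A; positive).
  set (a := 3 - sigma). assert (Ha : 0 < a <= 5 / 2) by (unfold a; lra). set (iv := / (sigma - 1 / 2)). assert (Hiv : 0 < iv) by positive.
  assert (Hh : forall x t, hfun k sigma (x, t) = (- (Cderiv (f k) ((x + sigma)%R, t) / f k ((x + sigma)%R, t)))%C).
  { intros x t. unfold hfun. replace ((x, t) + RtoC sigma)%C with ((x + sigma, t) : C) by (csolve). auto. }
  assert (HV : exists T0, 1 <= T0 /\ forall T, T0 <= T -> Cmod (vline (hfun k sigma) L a T) <= A * C0 + 1).
  (* The two-sided bound A(1 + iv) blows up as sigma approaches 1/2, but the conclusion involves [A]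
     alone. *)
  { unfold C0. apply (vline_bound (hfun k sigma) a A (A * (1 + iv))); auto; try lra.
    - apply Rmult_le_pos; lra.
    - intros z Hz. apply hfun_diff; lra.
    - intros x t Hx. rewrite Hh, Cmod_opp. destruct (Hest k t (x + sigma)) as [_ Q]; [unfold a in Hx; lra|]. eapply Rle_trans; [exact Q|].
      destruct (ln_shift_le k t) as [_ Q2]. assert (Rt := Rabs_pos t).
      assert (Q3 : C1 * ln (INR k + Rabs t + 3) <= A * (1 + Rabs t)) by (unfold A; rewrite Rmult_assoc; apply Rmult_le_compat_l; lra).
      assert (Q4 : / (x + sigma - 1 / 2) <= iv) by (apply Rinv_le_contravar; lra). assert (0 < / (x + sigma - 1 / 2)) by positive.
      apply Rle_trans with (A * (1 + Rabs t) * (1 + iv)).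
      + apply Rmult_le_compat; auto; try lra. apply Rmult_le_pos; [lra|]. rewrite <- ln_1. apply ln_le; [lra|]. assert (Z := pos_INR k). lra.
      + replace (A * (1 + Rabs t) * (1 + iv)) with (A * (1 + iv) * (1 + Rabs t)) by ring. apply Rmult_le_compat_l; [apply Rmult_le_pos; lra|lra].
    - intros t. rewrite Hh. destruct (Hest k t (0 + sigma)) as [Q _]; [lra|]. destruct (ln_shift_le k t) as [_ Q2].
      assert (Q3 : C1 * ln (INR k + Rabs t + 3) <= A * (1 + Rabs t)) by (unfold A; rewrite Rmult_assoc; apply Rmult_le_compat_l; lra).
      change (fst (- (Cderiv (f k) ((0 + sigma)%R, t) / f k ((0 + sigma)%R, t)))%C) with (- fst (Cderiv (f k) ((0 + sigma)%R, t) / f k ((0 + sigma)%R, t))%C). lra.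
    - intros t. rewrite Hh, Cmod_opp. replace (a + sigma) with 3 by (unfold a; ring). destruct (Hest k t 3) as [_ Q]; [lra|]. eapply Rle_trans; [exact Q|].
      destruct (ln_shift_le k t) as [_ Q2]. assert (Rt := Rabs_pos t).
      assert (Q3 : C1 * ln (INR k + Rabs t + 3) <= A * (1 + Rabs t)) by (unfold A; rewrite Rmult_assoc; apply Rmult_le_compat_l; lra).
      assert (0 <= A * (1 + Rabs t)) by (apply Rmult_le_pos; lra).
      apply Rle_trans with (A * (1 + Rabs t) * (1 + / (3 - 1 / 2))); [apply Rmult_le_compat_r; [|auto]|]; lra. }
  destruct HV as (T1 & HT1 & KV). destruct (HT 1 Rlt_0_1) as (T2 & HT2 & KT).
  assert (Kl : forall T, Lamsum k (3, T) = (4 * (hfun k sigma (a, T) + (if Nat.eqb k 0 then / ((a, T) - RtoC (1 - sigma)) else 0)))%C).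
  { intros T. rewrite Hh. replace (a + sigma) with 3 by (unfold a; ring). rewrite (logder_Lamsum k (3, T)) by (simpl; lra).
    replace ((a, T) - RtoC (1 - sigma))%C with ((3, T) - 1)%C by (apply Ceq_pair; unfold a; simpl; ring).
    replace (4 * (Lamsum k (3, T) / 4 - (if (k =? 0)%nat then / ((3, T)%R - 1) else 0) + (if (k =? 0)%nat then / ((3, T)%R - 1) else 0)))%C with (4 * (Lamsum k (3, T) / 4))%C by ring.
    field. }
  assert (Vc : forall T, rcont_on (fun t => hfun k sigma (a, t) * kern L (a, t))%C (- T) T).
  { intros T. apply (rcont_on_vline _ a); [|lra]. intros z Hz. apply hfun_diff; lra. }
  split; intros Hk.
  - set (T := Rmax T1 T2). assert (Q1 : T1 <= T) by apply Rmax_l. assert (Q2 : T2 <= T) by apply Rmax_r.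
    specialize (KV T Q1). specialize (KT T Q2). rewrite Cminus_0_r in KT.
    rewrite (CI_ext _ (fun t => 4 * (hfun k sigma (a, t) * kern L (a, t)))%C) in KT.
    2:{ intros t _. rewrite Kl. destruct k; [congruence|]. simpl Nat.eqb. cbv iota. fold a. ring. }
    rewrite CI_scal in KT by auto. change (CI (fun t => hfun k sigma (a, t) * kern L (a, t))%C (- T) T) with (vline (hfun k sigma) L a T) in KT.
    assert (Gb := gint_bounds T ltac:(lra)). rewrite Cmod_minus_sym in KT.
    assert (N := Cmod_triangle_sub (RtoC (gint T) * S) (4 * vline (hfun k sigma) L a T)).
    rewrite !Cmod_mult, !Cmod_R, (Rabs_right 4), (Rabs_right (gint T)) in N by lra.
    assert (Cs := Cmod_ge_0 S). assert (1 / 2 * Cmod S <= gint T * Cmod S) by (apply Rmult_le_compat_r; lra).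
    assert (A * C0 = C1 * C0 * ln (INR k + 3)) by (unfold A; ring).
    assert (C2 * ln (INR k + 3) >= (8 * (C1 * C0) + 20) * ln (INR k + 3)) by (apply Rmult_ge_compat_r; [lra|unfold C2; lra]). lra.
  - subst k. set (p := 1 - sigma). assert (Hp : 1 / 4 <= p <= 1 / 2) by (unfold p; lra).
    destruct (pole_term L p HL0 Hp 1 Rlt_0_1) as (T3 & HT3 & KP). replace (2 + p) with a in KP by (unfold p, a; ring).
    set (T := Rmax T1 (Rmax T2 T3)). assert (Q1 : T1 <= T) by apply Rmax_l. assert (Q : Rmax T2 T3 <= T) by apply Rmax_r.
    assert (Q2 := Rle_trans _ _ _ (Rmax_l _ _) Q). assert (Q3 := Rle_trans _ _ _ (Rmax_r _ _) Q).
    specialize (KV T Q1). specialize (KT T Q2). specialize (KP T Q3). rewrite Cminus_0_r in KT.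
    assert (Np : forall t, (a, t) <> RtoC p) by (intros t E'; apply (f_equal fst) in E'; unfold a, p in E'; simpl in E'; lra).
    assert (Pc : rcont_on (fun t => kern L (a, t) * / ((a, t) - RtoC p))%C (- T) T) by (apply (rcont_on_diff (fun z => kern L z * / (z - RtoC p))%C); intros; apply diff_kern_div; auto).
    rewrite (CI_ext _ (fun t => 4 * (hfun 0 sigma (a, t) * kern L (a, t) + kern L (a, t) * / ((a, t) - RtoC p)))%C) in KT.
    2:{ intros t _. rewrite Kl. simpl Nat.eqb. cbv iota. fold a p. ring. }
    rewrite CI_scal, CI_plus in KT by (try apply rcont_on_plus; auto).
    change (CI (fun t => hfun 0 sigma (a, t) * kern L (a, t))%C (- T) T) with (vline (hfun 0 sigma) L a T) in KT.
    set (Pt := CI (fun t => kern L (a, t) * / ((a, t) - RtoC p))%C (- T) T) in *. set (V := vline (hfun 0 sigma) L a T) in *.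
    assert (Gb := gint_bounds T ltac:(lra)).
    assert (N := Cmod_Re (4 * (V + Pt) - RtoC (gint T) * S)). replace (fst (4 * (V + Pt) - RtoC (gint T) * S)%C) with (4 * (fst V + fst Pt) - gint T * fst S) in N by (simpl; ring).
    assert (NV := Cmod_Re V). apply Rabs_le_between in N. apply Rabs_le_between in NV.
    set (X := exp (L * p)) in *. assert (PX : 0 < X) by apply exp_pos. assert (EX : X <= exp (L * p + p ^ 2) <= 3 * X).
    { rewrite exp_plus. fold X. assert (1 <= exp (p ^ 2)) by (rewrite <- exp_0; apply exp_le_mono; apply pow2_ge_0).
      assert (exp (p ^ 2) <= 3) by (eapply Rle_trans; [|apply exp_le_3]; apply exp_le_mono; nra). nra. }
    set (Y := exp (L * p + p ^ 2)) in *. assert (PL := PI2_3_2).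
    assert (EA : A * C0 = C1 * C0 * ln 3) by (unfold A; simpl INR; rewrite Rplus_0_l; ring).
    assert (YP1 : Y * (PI / 2) >= X * (PI / 2)) by (apply Rmult_ge_compat_r; lra). assert (YP2 : Y * (2 * PI) <= 3 * X * (2 * PI)) by (apply Rmult_le_compat_r; lra).
    split.
    + apply Rnot_lt_le. intros Hlt. destruct (Rle_dec 0 (fst S)) as [Pos|Neg].
      * assert (gint T * fst S <= 4 * PI * (/ 4 * X - C2)) by (apply Rle_trans with (4 * PI * fst S); [apply Rmult_le_compat_r|apply Rmult_le_compat_l]; lra).
        assert (C2 * PI >= C2 * 3) by (apply Rmult_ge_compat_l; [unfold C2|]; lra). unfold C2 in *. lra.
      * assert (gint T * fst S <= 1 / 2 * fst S) by nra. assert (X * PI >= X * 3) by (apply Rmult_ge_compat_l; lra). unfold C2 in *. lra.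
    + apply Rnot_lt_le. intros Hlt. assert (C20 : 0 < C2) by (unfold C2; lra). assert (0 < C2 * X) by positive.
      assert (1 / 2 * fst S <= gint T * fst S) by (apply Rmult_le_compat_r; lra).
      assert (C2 * X >= (400 * PI) * X) by (apply Rmult_ge_compat_r; [lra|unfold C2; lra]). unfold C2 in *. lra.
Qed.
End Smoothed.

(** * Variance over a finite grid of rotations *)

Lemma Cmod_plus_sqr (z w : C) : Cmod (z + w) ^ 2 = Cmod z ^ 2 + Cmod w ^ 2 + 2 * fst (Cconj z * w)%C.
Proof. rewrite !Cmod_sqr. destruct z, w; simpl. ring. Qed.

Lemma csum_conj {A : Type} (f : A -> C) (l : list A) : Cconj (csum f l) = csum (fun x => Cconj (f x)) l.
Proof. induction l; simpl; [csolve|]. rewrite Cplus_conj, IHl. auto. Qed.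

Lemma fst_csum {A : Type} (f : A -> C) (l : list A) : fst (csum f l) = rsum (fun x => fst (f x)) l.
Proof. induction l; simpl; auto. rewrite IHl. auto. Qed.

Lemma csum_seq_S (f : nat -> C) (n : nat) : csum f (seq 0 (S n)) = (csum f (seq 0 n) + f n)%C.
Proof. rewrite seq_S, csum_app. simpl. ring. Qed.

Lemma rsum_seq_S (f : nat -> R) (n : nat) : rsum f (seq 0 (S n)) = rsum f (seq 0 n) + f n.
Proof. rewrite seq_S, rsum_app. simpl. ring. Qed.

Lemma Cpow_conj_cancel (y : C) (m n : nat) : Cmod y = 1 -> (m <= n)%nat -> (Cconj (y ^ m) * y ^ n)%C = (y ^ (n - m))%C.
Proof.
  intros Hy H. replace n with (m + (n - m))%nat at 1 by lia. rewrite Cpow_add_r. assert (E : (Cconj (y ^ m) * y ^ m)%C = RtoC 1).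
  { rewrite Cmult_comm. assert (Q : (y ^ m * Cconj (y ^ m))%C = RtoC (Cmod (y ^ m) ^ 2)).
    { rewrite Cmod_sqr. csolve. }
    rewrite Q, Cmod_pow, Hy, !pow1. auto. }
  rewrite Cmult_assoc, E. ring.
Qed.

Section RootsOfUnity.
Variable N : nat.
Hypothesis HN : (0 < N)%nat.

(** omega^j subtracts the j-th grid angle pi j/(2N) from theta in e^(4 i theta). *)
Definition omega : C := cis (- (2 * PI / INR N)).

Lemma Cmod_omega_pow (j : nat) : Cmod (omega ^ j) = 1.
Proof. unfold omega. rewrite cis_pow. apply Cmod_cis. Qed.

Lemma omega_pow_neq1 (m : nat) : (0 < m < N)%nat -> (omega ^ m)%C <> RtoC 1.
Proof.
  intros Hm E. unfold omega in E. rewrite cis_pow in E. unfold cis in E. apply (f_equal fst) in E. cbn [fst RtoC] in E.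
  replace (INR m * - (2 * PI / INR N)) with (- (2 * (INR m * PI / INR N))) in E by (field; apply not_0_INR; lia).
  rewrite cos_neg, cos_2a_sin in E. assert (P := PI_RGT_0).
  assert (HN' : 0 < INR N) by (apply lt_0_INR; lia). assert (Hm1 : 0 < INR m) by (apply lt_0_INR; lia). assert (Hm2 : INR m < INR N) by (apply lt_INR; lia).
  assert (0 < sin (INR m * PI / INR N)); [|nra]. apply sin_gt_0; [positive|].
  apply Rmult_lt_reg_r with (INR N); auto. unfold Rdiv. rewrite Rmult_assoc, Rinv_l by lra. nra.
Qed.

Lemma omega_N : (omega ^ N)%C = RtoC 1.
Proof.
  unfold omega. rewrite cis_pow. replace (INR N * - (2 * PI / INR N)) with (- (2 * PI)) by (field; apply not_0_INR; lia).
  unfold cis. rewrite cos_neg, sin_neg, cos_2PI, sin_2PI. csolve.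
Qed.

Lemma geometric_csum (z : C) (n : nat) : ((z - 1) * csum (fun j => z ^ j) (seq 0 n))%C = (z ^ n - 1)%C.
Proof.
  induction n; [simpl; ring|]. rewrite csum_seq_S, Cmult_plus_distr_l, IHn. simpl. ring.
Qed.

Lemma omega_orthogonal (m : nat) : (0 < m < N)%nat -> csum (fun j => (omega ^ j) ^ m)%C (seq 0 N) = 0%C.
Proof.
  intros Hm. assert (G := geometric_csum (omega ^ m)%C N). rewrite <- Cpow_mult_r, (Nat.mul_comm m N), Cpow_mult_r, omega_N in G.
  assert (Z : (RtoC 1 ^ m - 1)%C = 0%C) by (rewrite Cpow_1_l; ring). rewrite Z in G.
  rewrite (csum_ext _ (fun j => (omega ^ m) ^ j)%C) by (intros; rewrite <- !Cpow_mult_r; f_equal; lia).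
  destruct (Ceq_dec (csum (fun j => ((omega ^ m) ^ j)%C) (seq 0 N)) 0) as [|Nz]; auto. exfalso.
  revert G. apply Cmult_neq_0; auto. intros E. apply (omega_pow_neq1 m Hm), Ceq_minus; auto.
Qed.

(** Induction on the number of coefficients: a new frequency differs from each earlier one by a
    positive number less than N, so it is orthogonal to them on the grid. *)
Lemma parseval (a : nat -> C) (D : nat) : (D <= N)%nat ->
  rsum (fun j => Cmod (csum (fun d => a d * (omega ^ j) ^ d)%C (seq 0 D)) ^ 2) (seq 0 N) = INR N * rsum (fun d => Cmod (a d) ^ 2) (seq 0 D).
Proof.
  induction D as [|D IH]; intros HD.
  - simpl. rewrite (rsum_ext _ (fun _ => 0)) by (intros; rewrite Cmod_0; ring). rewrite rsum_const. ring.
  - rewrite rsum_seq_S, Rmult_plus_distr_l, <- IH by lia.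
    rewrite (rsum_ext _ (fun j => (Cmod (csum (fun d => a d * (omega ^ j) ^ d)%C (seq 0 D)) ^ 2 + Cmod (a D) ^ 2) +
      2 * fst (Cconj (csum (fun d => a d * (omega ^ j) ^ d)%C (seq 0 D)) * (a D * (omega ^ j) ^ D))%C)).
    + rewrite !rsum_plus, rsum_const, rsum_scal, length_seq. rewrite <- fst_csum.
      rewrite (csum_ext _ (fun j => csum (fun d => Cconj (a d) * a D * (omega ^ j) ^ (D - d))%C (seq 0 D))).
      * rewrite csum_swap, csum_zero; [simpl; ring|]. intros d Hd. apply in_seq in Hd. rewrite csum_scal, omega_orthogonal by lia. ring.
      * intros j _. rewrite csum_conj, Cmult_comm, <- csum_scal. apply csum_ext. intros d Hd. apply in_seq in Hd.
        rewrite Cmult_conj, <- (Cpow_conj_cancel (omega ^ j) d D) by (try apply Cmod_omega_pow; lia). ring.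
    + intros j _. rewrite csum_seq_S, Cmod_plus_sqr, Cmod_mult, Cmod_pow, Cmod_omega_pow, pow1, Rmult_1_r. auto.
Qed.
End RootsOfUnity.

(** * Autocorrelations and the tent polynomial *)

Definition rho (c : nat -> R) (D d : nat) : R := rsum (fun m => c m * c (m + S d)%nat) (seq 0 (D - S d)).

(** [rho c D d] is the autocorrelation at lag d + 1, not d. Each product is at most half the sum of
    its two squares. *)
Lemma rho_bound (c : nat -> R) (D d : nat) : Rabs (rho c D d) <= rsum (fun m => c m ^ 2) (seq 0 D).
Proof.
  unfold rho. set (n := (D - S d)%nat). assert (A1 : rsum (fun m => c m ^ 2) (seq 0 n) <= rsum (fun m => c m ^ 2) (seq 0 D)).
  { apply rsum_incl; [intros; apply pow2_ge_0|apply seq_NoDup|]. intros m Hm. apply in_seq in Hm. apply in_seq. lia. }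
  assert (A2 : rsum (fun m => c (m + S d)%nat ^ 2) (seq 0 n) <= rsum (fun m => c m ^ 2) (seq 0 D)).
  { rewrite <- (rsum_map (fun m => (m + S d)%nat) (fun m => c m ^ 2)). apply rsum_incl; [intros; apply pow2_ge_0| |].
    - apply FinFun.Injective_map_NoDup; [intros x y; lia|apply seq_NoDup].
    - intros m Hm. apply in_map_iff in Hm. destruct Hm as (k & <- & Hk). apply in_seq in Hk. apply in_seq. lia. }
  assert (B : forall l, Rabs (rsum (fun m => c m * c (m + S d)%nat) l) <= (rsum (fun m => c m ^ 2) l + rsum (fun m => c (m + S d)%nat ^ 2) l) / 2).
  { induction l as [|m l IH]; cbn [rsum]; [rewrite Rabs_R0; lra|]. eapply Rle_trans; [apply Rabs_triang|].
    assert (Rabs (c m * c (m + S d)%nat) <= (c m ^ 2 + c (m + S d)%nat ^ 2) / 2).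
    { assert (P1 := pow2_ge_0 (c m - c (m + S d)%nat)). assert (P2 := pow2_ge_0 (c m + c (m + S d)%nat)). apply Rabs_le. simpl in *. lra. }
    lra. }
  specialize (B (seq 0 n)). lra.
Qed.

Lemma csum_rev_seq (f : nat -> C) (n : nat) : csum (fun d => f (n - 1 - d)%nat) (seq 0 n) = csum f (seq 0 n).
Proof.
  rewrite <- (csum_map (fun d => (n - 1 - d)%nat) f). apply csum_perm, NoDup_Permutation.
  - apply NoDup_map_NoDup_ForallPairs; [|apply seq_NoDup]. intros x y Hx Hy. apply in_seq in Hx. apply in_seq in Hy. lia.
  - apply seq_NoDup.
  - intros x. rewrite in_map_iff, in_seq. split.
    + intros (d & <- & Hd). apply in_seq in Hd. lia.
    + intros Hx. exists (n - 1 - x)%nat. rewrite in_seq. lia.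
Qed.

(** A new top coefficient adds one product to each autocorrelation; read in reverse order these are
    the cross terms of the square. *)
Lemma square_expansion (c : nat -> R) (D : nat) (y : C) : Cmod y = 1 ->
  Cmod (csum (fun m => RtoC (c m) * y ^ m)%C (seq 0 D)) ^ 2 =
  rsum (fun m => c m ^ 2) (seq 0 D) + 2 * fst (csum (fun d => RtoC (rho c D d) * y ^ S d)%C (seq 0 D)).
Proof.
  intros Hy. induction D as [|D IH]; [simpl; rewrite Cmod_0; ring|].
  rewrite csum_seq_S, Cmod_plus_sqr, IH, rsum_seq_S, Cmod_mult, Cmod_pow, Hy, pow1, Cmod_R, Rmult_1_r, pow2_abs.
  rewrite (csum_seq_S (fun d => RtoC (rho c (S D) d) * y ^ S d)%C). replace (rho c (S D) D) with 0 by (unfold rho; rewrite Nat.sub_diag; reflexivity).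
  assert (E : csum (fun d => RtoC (rho c (S D) d) * y ^ S d)%C (seq 0 D) =
    (csum (fun d => RtoC (rho c D d) * y ^ S d) (seq 0 D) + Cconj (csum (fun m => RtoC (c m) * y ^ m) (seq 0 D)) * (RtoC (c D) * y ^ D))%C).
  { rewrite csum_conj, (Cmult_comm (csum (fun x => Cconj (RtoC (c x) * y ^ x)) (seq 0 D))), <- csum_scal.
    rewrite <- (csum_rev_seq (fun m => RtoC (c D) * y ^ D * Cconj (RtoC (c m) * y ^ m))%C), <- csum_plus. apply csum_ext. intros d Hd. apply in_seq in Hd.
    rewrite Cmult_conj. replace (Cconj (RtoC (c (D - 1 - d)%nat))) with (RtoC (c (D - 1 - d)%nat)) by (csolve).
    replace (RtoC (c D) * y ^ D * (RtoC (c (D - 1 - d)%nat) * Cconj (y ^ (D - 1 - d))))%C with (RtoC (c (D - 1 - d)%nat * c D) * (Cconj (y ^ (D - 1 - d)) * y ^ D))%C by (rewrite RtoC_mult; ring).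
    rewrite Cpow_conj_cancel by (auto; lia). replace (D - (D - 1 - d))%nat with (S d) by lia.
    replace (rho c (S D) d) with (rho c D d + c (D - 1 - d)%nat * c D); [rewrite RtoC_plus; ring|].
    unfold rho. replace (S D - S d)%nat with (S (D - S d)) by lia. rewrite rsum_seq_S. replace (D - S d)%nat with (D - 1 - d)%nat by lia.
    do 3 f_equal. lia. }
  rewrite E. simpl fst. ring.
Qed.

(* On the unit circle [|P|^2] has mean of order [M^3] for the polynomial [P] with these coefficients, but [|y - 1|^2 |P|^2]
   has mean [2M]: [P] concentrates on an arc of length [1/M]. *)
Definition tent (M m : nat) : R := INR (Nat.min m (2 * M - m)).

(** The ascending half alone suffices: 1 + 4 + ... + M^2 >= M^3/3. *)
Lemma tent_energy (M : nat) : INR M ^ 3 / 3 <= rsum (fun m => tent M m ^ 2) (seq 0 (S (2 * M))).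
Proof.
  apply Rle_trans with (rsum (fun m => tent M m ^ 2) (seq 0 (S M))).
  - rewrite (rsum_ext _ (fun m => INR m ^ 2)).
    + clear. induction M as [|M IH]; [simpl; lra|]. rewrite rsum_seq_S. rewrite S_INR. assert (P := pos_INR M). simpl in *. nra.
    + intros m Hm. apply in_seq in Hm. unfold tent. rewrite Nat.min_l by lia. auto.
  - apply rsum_incl; [intros; apply pow2_ge_0|apply seq_NoDup|]. intros m Hm. apply in_seq in Hm. apply in_seq. lia.
Qed.

Lemma tent_step (M m : nat) : (m < 2 * M)%nat -> (tent M (S m) - tent M m) ^ 2 = 1.
Proof.
  intros H. unfold tent. destruct (le_lt_dec (S m) M).
  - rewrite !Nat.min_l by lia. rewrite S_INR. ring.
  - rewrite !Nat.min_r by lia. replace (2 * M - m)%nat with (S (2 * M - S m)) by lia. rewrite S_INR. ring.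
Qed.

(** Summation by parts. The new coefficients are the slopes of the tent, all 1 or -1, so the second
    moment of P is far smaller than its energy. *)
Lemma tent_difference (M : nat) (y : C) :
  ((y - 1) * csum (fun m => RtoC (tent M m) * y ^ m) (seq 0 (S (2 * M))))%C = (- (y * csum (fun m => RtoC (tent M (S m) - tent M m) * y ^ m) (seq 0 (2 * M))))%C.
Proof.
  assert (H : forall n, ((y - 1) * csum (fun m => RtoC (tent M m) * y ^ m) (seq 0 (S n)) =
    RtoC (tent M n) * y ^ S n - RtoC (tent M 0) - y * csum (fun m => RtoC (tent M (S m) - tent M m) * y ^ m) (seq 0 n))%C).
  { induction n as [|n IH]; [simpl; ring|]. rewrite csum_seq_S, Cmult_plus_distr_l, IH, (csum_seq_S _ n), RtoC_minus. simpl. ring. }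
  rewrite H. unfold tent at 1 2. rewrite Nat.sub_diag, Nat.min_0_r, Nat.min_0_l. simpl INR. ring.
Qed.

(** * Bad rotations for an abstract weighted family of phases *)

Section Variance.
Variables (A : Type) (l : list A) (w : A -> R) (u : A -> C) (good : A -> bool) (N M : nat) (J : list nat) (eta B : R).
Hypothesis Hw : forall x, In x l -> 0 <= w x.
Hypothesis Hu : forall x, In x l -> Cmod (u x) = 1.
Hypothesis HM : (0 < M)%nat.
Hypothesis HNM : (2 * M < N)%nat.
Hypothesis HJ : NoDup J.
Hypothesis HJN : incl J (seq 0 N).
Hypothesis Heta : 0 < eta.
Hypothesis Hgood : forall x j, In x l -> good x = true -> In j J -> eta <= Cmod (u x * omega N ^ j - 1).
Hypothesis HB : forall d, (d < 2 * M)%nat -> Cmod (csum (fun x => RtoC (w x) * u x ^ S d)%C l) <= B.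

Let D := S (2 * M).
Let Q := rsum (fun m => tent M m ^ 2) (seq 0 D).
Let P (y : C) : C := csum (fun m => RtoC (tent M m) * y ^ m)%C (seq 0 D).
Let Sw := rsum w l.

Lemma HN0 : (0 < N)%nat.
Proof. lia. Qed.

Lemma P_mean (v : C) : Cmod v = 1 -> rsum (fun j => Cmod (P (v * omega N ^ j)) ^ 2) (seq 0 N) = INR N * Q.
Proof.
  intros Hv. rewrite (rsum_ext _ (fun j => Cmod (csum (fun m => (RtoC (tent M m) * v ^ m) * (omega N ^ j) ^ m)%C (seq 0 D)) ^ 2)).
  - rewrite (parseval N HN0) by (unfold D; lia). f_equal. apply rsum_ext. intros m _. rewrite Cmod_mult, Cmod_pow, Hv, pow1, Cmod_R, Rmult_1_r, pow2_abs. auto.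
  - intros j _. unfold P. f_equal. f_equal. apply csum_ext. intros m _. rewrite Cpow_mult_l. ring.
Qed.

Lemma P_moment (v : C) : Cmod v = 1 -> rsum (fun j => Cmod (v * omega N ^ j - 1) ^ 2 * Cmod (P (v * omega N ^ j)) ^ 2) (seq 0 N) = INR N * INR (2 * M).
Proof.
  intros Hv. rewrite (rsum_ext _ (fun j => Cmod (csum (fun m => (RtoC (tent M (S m) - tent M m) * v ^ m) * (omega N ^ j) ^ m)%C (seq 0 (2 * M))) ^ 2)).
  - rewrite (parseval N HN0) by lia. f_equal. rewrite (rsum_ext _ (fun _ => 1)); [rewrite rsum_const, length_seq; ring|].
    intros m Hm. apply in_seq in Hm. rewrite Cmod_mult, Cmod_pow, Hv, pow1, Cmod_R, Rmult_1_r, pow2_abs. apply tent_step. lia.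
  - intros j _. rewrite <- Rpow_mult_distr, <- Cmod_mult. unfold P, D. rewrite tent_difference, Cmod_opp, Cmod_mult.
    rewrite Cmod_mult, Hv, Cmod_omega_pow, !Rmult_1_l. f_equal. f_equal. apply csum_ext. intros m _. rewrite Cpow_mult_l. ring.
Qed.

(** For a bad j each good x has |u omega^j - 1| >= eta, so |P|^2 may be multiplied by |u omega^j -
    1|^2/eta^2 without decreasing; over the whole grid this has mean 2M/eta^2. The other x are
    charged their full mean Q. *)
Lemma bad_upper : rsum (fun j => rsum (fun x => w x * Cmod (P (u x * omega N ^ j)) ^ 2) l) J <=
  INR N * INR (2 * M) / eta ^ 2 * Sw + INR N * Q * rsum (fun x => if good x then 0 else w x) l.
Proof.
  assert (E2 : 0 < eta ^ 2) by (apply pow_lt; auto).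
  rewrite rsum_swap. unfold Sw. rewrite <- !rsum_scal, <- rsum_plus. apply rsum_le. intros x Hx.
  rewrite rsum_scal. specialize (Hw x Hx). assert (N0 := pos_INR N). assert (M0 := pos_INR (2 * M)). destruct (good x) eqn:Gx.
  - rewrite Rmult_0_r, Rplus_0_r, Rmult_comm. apply Rmult_le_compat_r; auto.
    apply Rle_trans with (rsum (fun j => / eta ^ 2 * (Cmod (u x * omega N ^ j - 1) ^ 2 * Cmod (P (u x * omega N ^ j)) ^ 2)) J).
    + apply rsum_le. intros j Hj. assert (G := Hgood x j Hx Gx Hj). assert (G2 : eta ^ 2 <= Cmod (u x * omega N ^ j - 1) ^ 2) by (apply pow_incr; lra).
      assert (Z := pow2_ge_0 (Cmod (P (u x * omega N ^ j)))).
      apply Rmult_le_reg_l with (eta ^ 2); auto. rewrite <- Rmult_assoc, Rinv_r by lra. rewrite Rmult_1_l. apply Rmult_le_compat_r; auto.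
    + rewrite rsum_scal. unfold Rdiv. rewrite Rmult_comm. apply Rmult_le_compat_r; [left; apply Rinv_0_lt_compat; auto|].
      rewrite <- (P_moment (u x)) by auto. apply rsum_incl; auto. intros; apply Rmult_le_pos; apply pow2_ge_0.
  - apply Rle_trans with (INR N * Q * w x).
    + rewrite Rmult_comm. apply Rmult_le_compat_r; auto. rewrite <- (P_mean (u x)) by auto. apply rsum_incl; auto. intros; apply pow2_ge_0.
    + assert (0 <= INR N * INR (2 * M) / eta ^ 2 * w x); [|lra]. apply Rmult_le_pos; auto. unfold Rdiv. apply Rmult_le_pos; [apply Rmult_le_pos; auto|left; apply Rinv_0_lt_compat; auto].
Qed.

Let Ej (j : nat) : C := csum (fun d => RtoC (rho (tent M) D d) * csum (fun x => RtoC (w x) * u x ^ S d) l * (omega N ^ j) ^ S d)%C (seq 0 D).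

(** The zeroth Fourier coefficient of |P|^2 gives the same main term for every rotation; the
    nontrivial moments form the fluctuation [Ej]. *)
Lemma bad_expansion (j : nat) : rsum (fun x => w x * Cmod (P (u x * omega N ^ j)) ^ 2) l = Q * Sw + 2 * fst (Ej j).
Proof.
  rewrite (rsum_ext _ (fun x => Q * w x + 2 * fst (RtoC (w x) * csum (fun d => RtoC (rho (tent M) D d) * (u x * omega N ^ j) ^ S d) (seq 0 D))%C)).
  - rewrite rsum_plus, !rsum_scal. f_equal. f_equal. rewrite <- fst_csum. f_equal. unfold Ej.
    rewrite (csum_ext _ (fun x => csum (fun d => RtoC (rho (tent M) D d) * (RtoC (w x) * u x ^ S d) * (omega N ^ j) ^ S d)%C (seq 0 D))).
    + rewrite csum_swap. apply csum_ext. intros d _.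
      rewrite (csum_ext _ (fun x => (RtoC (rho (tent M) D d) * (omega N ^ j) ^ S d) * (RtoC (w x) * u x ^ S d))%C) by (intros; ring). rewrite csum_scal. ring.
    + intros x _. rewrite <- csum_scal. apply csum_ext. intros d _. rewrite Cpow_mult_l. ring.
  - intros x Hx. unfold P. rewrite square_expansion by (rewrite Cmod_mult, Cmod_omega_pow, Hu by auto; ring). fold Q.
    set (z := csum (fun d => RtoC (rho (tent M) D d) * (u x * omega N ^ j) ^ S d)%C (seq 0 D)). simpl. ring.
Qed.

(** Parseval in j: each coefficient is an autocorrelation, at most Q, times a moment, at most B. The
    last index d = 2M carries the autocorrelation zero, so only moments up to 2M matter. *)
Lemma Ej_energy : rsum (fun j => Cmod (Ej j) ^ 2) (seq 0 N) <= INR N * (INR D * (Q * B) ^ 2).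
Proof.
  rewrite (rsum_ext _ (fun j => Cmod (csum (fun d => (RtoC (rho (tent M) D d) * csum (fun x => RtoC (w x) * u x ^ S d) l) * (omega N ^ j) ^ d)%C (seq 0 D)) ^ 2)).
  - rewrite (parseval N HN0) by (unfold D; lia). apply Rmult_le_compat_l; [apply pos_INR|].
    apply Rle_trans with (rsum (fun _ => (Q * B) ^ 2) (seq 0 D)); [|rewrite rsum_const, length_seq; lra].
    apply rsum_le. intros d Hd. apply in_seq in Hd. apply pow_incr. split; [apply Cmod_ge_0|]. rewrite Cmod_mult, Cmod_R.
    destruct (le_lt_dec (2 * M) d) as [Ld|Ld].
    + replace (rho (tent M) D d) with 0 by (unfold rho; replace (D - S d)%nat with 0%nat by lia; reflexivity). rewrite Rabs_R0, Rmult_0_l.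
      assert (B0 : 0 <= B) by (eapply Rle_trans; [apply Cmod_ge_0|apply (HB 0%nat); lia]).
      apply Rmult_le_pos; auto. apply rsum_nonneg; intros; apply pow2_ge_0.
    + apply Rmult_le_compat; auto using Cmod_ge_0; [apply Rabs_pos|apply rho_bound].
  - intros j _. unfold Ej. f_equal.
    rewrite (csum_ext _ (fun d => (omega N ^ j) * ((RtoC (rho (tent M) D d) * csum (fun x => RtoC (w x) * u x ^ S d) l) * (omega N ^ j) ^ d))%C) by (intros; simpl; ring).
    rewrite csum_scal, Cmod_mult, Cmod_omega_pow. ring.
Qed.

(** [bad_upper] is compared with the main term. The inequality 2e <= QS/4 + 4e^2/(QS) keeps three
    quarters of the main term for each bad j and charges the rest to the fluctuation energy; Q >=
    M^3/3 turns 2M/(eta^2 Q) into 6/(M eta)^2. *)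
Lemma grid_variance : 0 < Sw -> 3 / 4 * INR (length J) <=
  INR N * (6 / (INR M * eta) ^ 2 + rsum (fun x => if good x then 0 else w x) l / Sw + 4 * INR (S (2 * M)) * B ^ 2 / Sw ^ 2).
Proof.
  intros HS. set (Wb := rsum (fun x => if good x then 0 else w x) l).
  assert (HMr : 0 < INR M) by (apply lt_0_INR; lia). assert (M3 : 0 < INR M ^ 3) by (apply pow_lt; auto).
  assert (HQ := tent_energy M). fold D Q in HQ. assert (Q0 : 0 < Q) by lra. assert (U := bad_upper). fold Wb in U.
  rewrite (rsum_ext _ (fun j => Q * Sw + 2 * fst (Ej j))) in U by (intros; apply bad_expansion). assert (QS : 0 < Q * Sw) by positive.
  assert (Lo : rsum (fun j => 3 / 4 * (Q * Sw) + - (4 / (Q * Sw)) * Cmod (Ej j) ^ 2) J <= rsum (fun j => Q * Sw + 2 * fst (Ej j)) J).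
  { apply rsum_le. intros j _. assert (T := Cmod_Re (Ej j)). apply Rabs_le_between in T. set (e := Cmod (Ej j)) in *.
    assert (H : 2 * e <= Q * Sw / 4 + 4 / (Q * Sw) * e ^ 2).
    { assert (Z := pow2_ge_0 (Q * Sw / 2 - 2 * e)). apply Rmult_le_reg_l with (Q * Sw); auto.
      replace (Q * Sw * (Q * Sw / 4 + 4 / (Q * Sw) * e ^ 2)) with ((Q * Sw) ^ 2 / 4 + 4 * e ^ 2) by (field; lra). simpl in *. nra. }
    lra. }
  rewrite rsum_plus, rsum_const, rsum_scal in Lo. assert (En : rsum (fun j => Cmod (Ej j) ^ 2) J <= INR N * (INR D * (Q * B) ^ 2)).
  { eapply Rle_trans; [|exact Ej_energy]. apply rsum_incl; auto. intros; apply pow2_ge_0. }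
  assert (IQ : 0 < 4 / (Q * Sw)) by positive.
  assert (En2 : 4 / (Q * Sw) * rsum (fun j => Cmod (Ej j) ^ 2) J <= 4 / (Q * Sw) * (INR N * (INR D * (Q * B) ^ 2))) by (apply Rmult_le_compat_l; lra).
  assert (Fin : INR (length J) * (3 / 4 * (Q * Sw)) <= INR N * INR (2 * M) / eta ^ 2 * Sw + INR N * Q * Wb + 4 / (Q * Sw) * (INR N * (INR D * (Q * B) ^ 2))) by lra.
  apply Rmult_le_reg_r with (Q * Sw); auto. eapply Rle_trans; [right|eapply Rle_trans; [exact Fin|]]; [ring|].
  replace (INR N * (6 / (INR M * eta) ^ 2 + Wb / Sw + 4 * INR (S (2 * M)) * B ^ 2 / Sw ^ 2) * (Q * Sw))
    with (INR N * (6 / (INR M * eta) ^ 2 * Q) * Sw + INR N * Q * Wb + 4 / (Q * Sw) * (INR N * (INR D * (Q * B) ^ 2))) by (unfold D; field; repeat split; lra).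
  apply Rplus_le_compat_r, Rplus_le_compat_r. apply Rmult_le_compat_r; [lra|]. unfold Rdiv at 1. rewrite Rmult_assoc. apply Rmult_le_compat_l; [apply pos_INR|].
  apply Rle_trans with (6 / (INR M * eta) ^ 2 * (INR M ^ 3 / 3)).
  - rewrite mult_INR. simpl (INR 2). right. field. lra.
  - apply Rmult_le_compat_l; [left; apply Rdiv_lt_0_compat; [lra|apply pow_lt, Rmult_lt_0_compat; auto]|auto].
Qed.
End Variance.

(** * Contribution of the prime powers that are not primes of small norm *)

Definition test (Q : Prop) : bool := if excluded_middle_informative Q then true else false.

Lemma test_true (Q : Prop) : test Q = true <-> Q.
Proof. unfold test. destruct (excluded_middle_informative Q); split; auto; discriminate. Qed.

Lemma test_false (Q : Prop) : test Q = false <-> ~ Q.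
Proof. unfold test. destruct (excluded_middle_informative Q); split; auto; try discriminate; tauto. Qed.

Lemma sum_bounded_inj {A B : Type} (f : A -> R) (g : B -> R) (phi : A -> B) (K : R) : sum_bounded g K ->
  (forall x, f x <> 0 -> f x <= g (phi x)) -> (forall x y, f x <> 0 -> f y <> 0 -> phi x = phi y -> x = y) -> sum_bounded f K.
Proof.
  intros HK Hle Hinj l Nl. set (l' := filter (fun x => test (f x <> 0)) l). assert (Nl' : NoDup l') by (apply NoDup_filter; auto).
  assert (Hl' : forall x, In x l' -> f x <> 0) by (intros x Hx; apply filter_In in Hx; apply test_true, Hx).
  rewrite (rsum_same_support f l' l); auto.
  - eapply Rle_trans; [apply (rsum_le f (fun x => g (phi x))); auto|]. rewrite <- rsum_map. apply HK.
    apply NoDup_map_NoDup_ForallPairs; auto. intros x y Hx Hy. apply Hinj; auto.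
  - intros x Hx. apply filter_In in Hx. tauto.
  - intros x Hx Hn. destruct (Req_dec (f x) 0) as [|N]; auto. exfalso. apply Hn, filter_In. split; auto. apply test_true; auto.
Qed.

Lemma geometric_bounded (q : R) : 0 <= q < 1 -> sum_bounded (fun m : nat => q ^ m) (/ (1 - q)).
Proof.
  intros Hq l Nl. apply Rle_trans with (rsum (fun m => q ^ m) (seq 0 (S (list_max l)))).
  - apply rsum_incl; auto; [intros; apply pow_le; lra|]. intros m Hm. apply in_seq.
    assert (H := proj1 (list_max_le l (list_max l)) (Nat.le_refl _)). rewrite Forall_forall in H. specialize (H m Hm). lia.
  - generalize (S (list_max l)). intros n. apply Rmult_le_reg_l with (1 - q); [lra|]. rewrite Rinv_r by lra.
    assert (E : (1 - q) * rsum (fun m => q ^ m) (seq 0 n) = 1 - q ^ n) by (induction n; [simpl; ring|rewrite rsum_seq_S, Rmult_plus_distr_l, IHn; simpl; ring]).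
    rewrite E. assert (P := pow_le q n (proj1 Hq)). lra.
Qed.

Lemma exp_nat_pow (x : R) (n : nat) : exp x ^ n = exp (INR n * x).
Proof. induction n; [simpl; rewrite Rmult_0_l, exp_0; auto|]. rewrite S_INR, Rmult_plus_distr_r, exp_plus, Rmult_1_l. simpl. rewrite IHn. ring. Qed.

(** A prime power that is not prime is u p^(m+2). At exponent 3/4 its weight is at most ln N(p)
    N(p)^(-3/2) q^m with q = 2^(-3/4), which is summable over the prime, the unit and m. The map
    [phi] recovers these data and is injective because they determine x. *)
Lemma nonprime_mass : (forall sigma, 1 < sigma -> exists B, sum_bounded (gw sigma) B) ->
  exists C3, 0 < C3 /\ sum_bounded (fun x => if test (gprime x) then 0 else Lam x * gw (3 / 4) x) C3.
Proof.
  intros W. destruct (W (5 / 4)) as [B HB]; [lra|]. set (q := exp (- (3 / 4) * ln 2)). assert (L2 := ln_lt_2).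
  assert (Hq : 0 <= q < 1) by (split; [left; apply exp_pos|]; unfold q; rewrite <- exp_0; apply exp_increasing; lra).
  assert (HA : sum_bounded (fun p => ln (IZR (gN p)) * gw (3 / 2) p) (/ (1 / 4) * B)).
  { eapply sum_bounded_le; [|apply (sum_bounded_scal (/ (1 / 4)) (gw (5 / 4)) B); [lra|exact HB]]. intros p; cbv beta.
    eapply Rle_trans; [apply (ln_le_gw (3 / 2) (1 / 4)); lra|]. replace (3 / 2 - 1 / 4) with (5 / 4) by field. lra. }
  assert (HU : sum_bounded (fun u : gauss => if test (In u gunits) then 1 else 0) 4).
  { intros l Nl. rewrite (rsum_same_support _ (filter (fun u => test (In u gunits)) l) l); auto using NoDup_filter.
    - apply Rle_trans with (rsum (fun _ => 1) (filter (fun u => test (In u gunits)) l)); [apply rsum_le; intros x _; destruct (test _); lra|].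
      apply Rle_trans with (rsum (fun _ : gauss => 1) gunits); [apply rsum_incl; [intros; lra|apply NoDup_filter; auto|]|simpl; lra].
      intros x Hx. apply filter_In in Hx. apply test_true, Hx.
    - intros x Hx. apply filter_In in Hx. tauto.
    - intros x Hx Hn. destruct (test (In x gunits)) eqn:E; auto. exfalso. apply Hn, filter_In. auto. }
  assert (HG := sum_bounded_prod _ _ _ _ (fun u : gauss => ltac:(destruct (test (In u gunits)); lra) : 0 <= (if test (In u gunits) then 1 else 0)) (fun m => pow_le q m (proj1 Hq)) HU (geometric_bounded q Hq)).
  assert (A0 : forall p, 0 <= ln (IZR (gN p)) * gw (3 / 2) p).
  { intros p. destruct (eqd p g0) as [->|N]; [unfold gw; destruct (eqd g0 g0); [lra|congruence]|]. apply Rmult_le_pos; [apply lnN_nonneg; auto|apply gw_nonneg]. }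
  assert (G0 : forall d : gauss * nat, 0 <= (if test (In (fst d) gunits) then 1 else 0) * q ^ snd d).
  { intros d. apply Rmult_le_pos; [destruct (test _); lra|apply pow_le; lra]. }
  assert (HP := sum_bounded_prod _ _ _ _ A0 G0 HA HG). set (C3 := / (1 / 4) * B * (4 * / (1 - q))) in HP.
  set (f := fun x => if test (gprime x) then 0 else Lam x * gw (3 / 4) x).
  assert (Key : forall x, f x <> 0 -> exists d : gauss * (gauss * nat), gprime (fst d) /\ In (fst (snd d)) gunits /\
    x = gmul (fst (snd d)) (gpow (fst d) (S (S (snd (snd d)))))).
  { intros x Hx. unfold f in Hx. destruct (test (gprime x)) eqn:T; [lra|]. apply (proj1 (test_false _)) in T.
    destruct (Lam_cases x) as [(p & m & Hp & Hm & u & Hu & E)|E]; [|rewrite E in Hx; lra].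
    destruct m as [|[|m]]; [lia| |exists (p, (u, m)); auto].
    exfalso. apply T. rewrite E. apply gprime_unit; auto. replace (gpow p 1) with p by (simpl; ring). auto. }
  set (phi := fun x => epsilon (inhabits (g0, (g0, 0%nat))) (fun d : gauss * (gauss * nat) => gprime (fst d) /\ In (fst (snd d)) gunits /\
    x = gmul (fst (snd d)) (gpow (fst d) (S (S (snd (snd d))))))).
  assert (Phi : forall x, f x <> 0 -> gprime (fst (phi x)) /\ In (fst (snd (phi x))) gunits /\
    x = gmul (fst (snd (phi x))) (gpow (fst (phi x)) (S (S (snd (snd (phi x))))))) by (intros x Hx; apply epsilon_spec; auto).
  exists (Rmax C3 1). split; [eapply Rlt_le_trans; [|apply Rmax_r]; lra|]. intros l Nl. eapply Rle_trans; [|apply Rmax_l]. revert l Nl.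
  apply (sum_bounded_inj f _ phi C3 HP).
  - intros x Hx. destruct (Phi x Hx) as (Hp & Hu & E). set (d := phi x) in *. destruct d as [p [u m]]. cbn [fst snd] in *.
    assert (PP : is_pp x p (S (S m))) by (split; auto; split; [lia|]; exists u; auto).
    assert (N0 := is_pp_neq0 _ _ _ PP). assert (Np := gprime_neq0 p Hp).
    assert (Ef : f x = Lam x * gw (3 / 4) x) by (unfold f in *; destruct (test (gprime x)); [lra|auto]).
    rewrite Ef, (Lam_pp x p _ PP), gw_fst_exp, (is_pp_N x p _ PP), <- pow_IZR by auto.
    assert (N1 := gN_ge1 p Np). rewrite ln_pow by lra. set (L := ln (IZR (gN p))). rewrite (gw_fst_exp (3 / 2)) by auto. fold L.
    rewrite (proj2 (test_true (In u gunits)) Hu), Rmult_1_l, Rmult_assoc. assert (L0 : 0 <= L) by (apply lnN_nonneg; auto).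
    apply Rmult_le_compat_l; auto. unfold q. rewrite exp_nat_pow, <- exp_plus. apply exp_le_mono. rewrite !S_INR.
    assert (ln 2 <= L) by (apply ln_le; [lra|apply IZR_le, gprime_N; auto]). assert (Hm := pos_INR m). nra.
  - intros x y Hx Hy E. destruct (Phi x Hx) as (_ & _ & Ex). destruct (Phi y Hy) as (_ & _ & Ey). rewrite Ex, Ey, E. auto.
Qed.

(** For l >= L + b one has (L - l)^2 >= b^2 + (L + b - l)^2, so large norms are paid for by the
    weight centred at L + b. *)
Lemma wt_tail (sigma L b : R) (x : gauss) : 0 <= b -> x <> g0 -> exp (L + b) <= IZR (gN x) -> wt sigma L x <= exp (- (b ^ 2 / 4)) * wt sigma (L + b) x.
Proof.
  intros Hb N H. unfold wt. set (l := ln (IZR (gN x))).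
  assert (Hl : L + b <= l) by (rewrite <- (ln_exp (L + b)); apply ln_le; [apply exp_pos|auto]).
  assert (P : 0 <= Lam x * gw sigma x) by (apply Rmult_le_pos; [apply Lam_nonneg|apply gw_nonneg]).
  replace (exp (- (b ^ 2 / 4)) * (Lam x * gw sigma x * exp (- ((L + b - l) ^ 2 / 4)))) with (Lam x * gw sigma x * (exp (- (b ^ 2 / 4)) * exp (- ((L + b - l) ^ 2 / 4)))) by ring.
  apply Rmult_le_compat_l; auto. rewrite <- exp_plus. apply exp_le_mono. nra.
Qed.

(** * Counting the grid cells that contain a bad angle *)

Definition cell (N j : nat) (theta : R) : Prop := PI / 2 * INR j / INR N <= theta < PI / 2 * INR (S j) / INR N.

Definition bad_cells (K X : R) (N : nat) : list nat := filter (fun j => test (exists theta, bad_set K X theta /\ cell N j theta)) (seq 0 N).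

Lemma chord_lower (x : R) : exists n : Z, Rabs (x - 2 * PI * IZR n) <= PI /\ Rabs (x - 2 * PI * IZR n) / 8 <= Cmod (cis x - 1).
Proof.
  destruct (reduce_2pi x) as [n Hn]. exists n. split; auto. set (r := x - 2 * PI * IZR n) in *. assert (E : cis x = cis r).
  { rewrite !cis_cexp. replace x with (r + 2 * PI * IZR n) by (unfold r; ring).
    replace (Ci * RtoC (r + 2 * PI * IZR n))%C with (Ci * RtoC r + Ci * RtoC (2 * PI * IZR n))%C by (rewrite RtoC_plus; ring).
    rewrite cexp_plus, cexp_2pi. ring. }
  rewrite E. assert (S := sin_sqr_lower (r / 2)). unfold Rdiv in S at 1. rewrite Rabs_mult, (Rabs_right (/ 2)) in S by lra. specialize (S ltac:(lra)).
  assert (Q : Cmod (cis r - 1) ^ 2 = 4 * sin (r / 2) ^ 2).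
  { rewrite Cmod_sqr. unfold cis, Cminus, Cplus, Copp, RtoC; cbn [fst snd]. assert (T := sin2_cos2 (r / 2)). unfold Rsqr in T.
    replace (cos r) with (1 - 2 * sin (r / 2) * sin (r / 2)) by (rewrite <- cos_2a_sin; f_equal; field).
    replace (sin r) with (2 * sin (r / 2) * cos (r / 2)) by (rewrite <- sin_2a; f_equal; field).
    replace ((2 * sin (r / 2) * cos (r / 2) + - 0) ^ 2) with (4 * sin (r / 2) ^ 2 * (cos (r / 2) * cos (r / 2))) by ring.
    replace (cos (r / 2) * cos (r / 2)) with (1 - sin (r / 2) * sin (r / 2)) by lra. ring. }
  assert (C0 := Cmod_ge_0 (cis r - 1)). assert (A : Rabs r ^ 2 = r ^ 2) by apply pow2_abs.
  apply Rsqr_incr_0_var; auto. unfold Rsqr. simpl in *. nra.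
Qed.

(** A cell is at most pi/(8K) wide, half the half-length of the arc, so a prime angle stays more
    than pi/(8K) from the grid angle. Multiplied by 4 and divided by 8 in the chord bound this
    leaves pi/(16K), which exceeds 1/(6K). *)
Lemma far_from_bad_cell (K X : R) (N j : nat) (x : gauss) (theta : R) : 1 <= K -> 4 * K <= INR N -> bad_set K X theta -> cell N j theta ->
  gprime x -> IZR (gN x) <= X -> / (6 * K) <= Cmod (uz (gC x) * omega N ^ j - 1).
Proof.
  intros HK HN [Ht Hbad] [Hc1 Hc2] Hx HX. assert (P3 := PI2_3_2).
  assert (N0 := gprime_neq0 x Hx). destruct (nrm_unit x N0) as ([Ha Hb] & u & Hu & E).
  set (y := nrm x) in *. assert (Hy : gprime y) by (rewrite E; apply gprime_unit; auto).
  assert (Ny : gN y = gN x) by (rewrite E, gN_mul; apply gunits_N in Hu; rewrite Hu; ring).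
  assert (Uy : uz (gC y) = uz (gC x)) by (rewrite E, gC_mul, uz_mult, uz_unit by (try apply gC_neq0; auto; apply gunit_neq0; auto); ring).
  rewrite <- Uy. destruct y as [a b]. cbn [fst snd] in *. assert (Hya : gC (a, b) <> 0%C) by (apply gC_neq0, gprime_neq0; auto).
  rewrite gnormal_polar, uz_polar by (auto; apply Cmod_gt_0; auto). set (tha := theta_gen a b) in *. 
  set (thj := PI / 2 * INR j / INR N) in *. assert (Eo : (cis (4 * tha) * omega N ^ j)%C = cis (4 * (tha - thj))).
  { unfold omega. rewrite cis_pow. rewrite !cis_cexp, <- cexp_plus. f_equal. rewrite <- Cmult_plus_distr_l, <- RtoC_plus. f_equal. f_equal. unfold thj. field. lra. }
  rewrite Eo. destruct (chord_lower (4 * (tha - thj))) as (n & Hn1 & Hn2). set (r := 4 * (tha - thj) - 2 * PI * IZR n) in *.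
  assert (Na : ~ in_arc K theta tha).
  { intros Harc. apply Hbad. exists a, b. split; [auto|]. split; [auto|]. split; [exact Hy|]. split; [|exact Harc]. unfold gnorm. assert (Eg : IZR a ^ 2 + IZR b ^ 2 = IZR (gN (a, b))) by (unfold gN; cbn [fst snd]; rewrite plus_IZR, !mult_IZR; ring).
    rewrite Eg, Ny. auto. }
  assert (Far : PI / (4 * K) < Rabs (r / 4 + (thj - theta))).
  { apply Rnot_le_lt. intros Hle. apply Na. exists (- n)%Z. rewrite opp_IZR. replace (tha + - IZR n * (PI / 2) - theta) with (r / 4 + (thj - theta)) by (unfold r; field). auto. }
  assert (Hw : Rabs (thj - theta) <= PI / (8 * K)).
  { assert (PI / 2 * INR (S j) / INR N = thj + PI / 2 / INR N) by (unfold thj; rewrite S_INR; field; lra).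
    assert (PI / 2 / INR N <= PI / (8 * K)).
    { replace (PI / 2 / INR N) with (PI / 2 * / INR N) by reflexivity. replace (PI / (8 * K)) with (PI / 2 * / (4 * K)) by (field; lra).
      apply Rmult_le_compat_l; [lra|]. apply Rinv_le_contravar; lra. }
    apply Rabs_le. lra. }
  assert (T := Rabs_triang (r / 4) (thj - theta)). unfold Rdiv in T at 2. rewrite Rabs_mult, (Rabs_right (/ 4)) in T by lra.
  eapply Rle_trans; [|exact Hn2]. apply Rle_trans with (PI / (16 * K)).
  - replace (/ (6 * K)) with (/ 6 * / K) by (field; lra). replace (PI / (16 * K)) with (PI / 16 * / K) by (field; lra).
    apply Rmult_le_compat_r; [left; positive|lra].
  - assert (PI / (4 * K) = PI / (8 * K) + PI / (8 * K)) by (field; lra). assert (PI / (8 * K) = 2 * (PI / (16 * K))) by (field; lra). lra.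
Qed.

Section Count.
Variables (C3 sigma L : R) (S : nat -> C).
Hypothesis HC3 : sum_bounded (fun x => if test (gprime x) then 0 else Lam x * gw (3 / 4) x) C3.
Hypothesis Hsig : 1 / 2 < sigma.
Hypothesis HS : forall k, is_sum (fun x => RtoC (wt sigma L x) * uz (gC x) ^ k)%C (S k).

(** [grid_variance] works on finite lists; one list approximates all the required moments within 1.
    The loss reappears as the +1 and the s0 - 1 of [bad_cells_count]. *)
Lemma common_list (n : nat) : exists l, NoDup l /\ forall k, (k < n)%nat -> Cmod (csum (fun x => RtoC (wt sigma L x) * uz (gC x) ^ k)%C l - S k) <= 1.
Proof.
  assert (H : exists l, NoDup l /\ forall l', NoDup l' -> incl l l' -> forall k, (k < n)%nat -> Cmod (csum (fun x => RtoC (wt sigma L x) * uz (gC x) ^ k)%C l' - S k) <= 1).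
  { induction n as [|n (l & Nl & H)]; [exists []; split; [constructor|intros; lia]|].
    destruct (HS n 1 Rlt_0_1) as (l1 & N1 & H1). destruct (union_incl l l1) as (l2 & N2 & I & I1). exists l2. split; auto.
    intros l' Nl' I' k Hk. destruct (Nat.eq_dec k n) as [->|]; [apply H1; auto; eapply incl_tran; eauto|]. apply H; auto; [eapply incl_tran; eauto|lia]. }
  destruct H as (l & Nl & H). exists l. split; auto. intros k Hk. apply H; auto. apply incl_refl.
Qed.

(** The elements that are not good are primes of norm above e^(L+b), paid for by [wt_tail], and
    nonprimes, paid for by the mass [C3] at exponent 3/4 <= sigma + 1/4. *)
Lemma bad_cells_count (b K s0 s0' B : R) (N M : nat) : 0 <= b -> 1 <= K -> 4 * K <= INR N -> (0 < M)%nat -> (2 * M < N)%nat ->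
  1 < s0 <= fst (S 0%nat) -> (forall k, (1 <= k <= 2 * M)%nat -> Cmod (S k) + 1 <= B) ->
  (exists T, is_sum (fun x => RtoC (wt sigma (L + b) x)) T /\ fst T <= s0') ->
  3 / 4 * INR (length (bad_cells K (exp (L + b)) N)) <= INR N * (6 / (INR M * / (6 * K)) ^ 2 +
    (exp (- (b ^ 2 / 4)) * s0' + exp (L / 4 + 1 / 16) * C3) / (s0 - 1) + 4 * INR (Datatypes.S (2 * M)) * B ^ 2 / (s0 - 1) ^ 2).
Proof.
  intros Hb HK HN HM HNM Hs0 HB (T & HT & Hs0'). destruct (common_list (Datatypes.S (2 * M))) as (l & Nl & Hl).
  (* The phase at 0 is set to 1 to keep [u] unimodular; the weight vanishes there. *)
  set (w := wt sigma L). set (u := fun x => if eqd x g0 then RtoC 1 else uz (gC x)).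
  set (good := fun x => test (gprime x /\ IZR (gN x) <= exp (L + b))). set (J := bad_cells K (exp (L + b)) N).
  assert (Hwu : forall x k, (RtoC (w x) * u x ^ k)%C = (RtoC (wt sigma L x) * uz (gC x) ^ k)%C).
  { intros x k. unfold u. destruct (eqd x g0) as [->|]; auto. unfold w, wt. rewrite Lam_g0, !Rmult_0_l. ring. }
  assert (Sw : s0 - 1 <= rsum w l).
  { specialize (Hl 0%nat ltac:(lia)). rewrite (csum_ext _ (fun x => RtoC (w x))) in Hl by (intros x _; simpl; unfold w; ring). rewrite csum_RtoC in Hl.
    assert (Q := Cmod_Re (RtoC (rsum w l) - S 0%nat)). change (fst (RtoC (rsum w l) - S 0%nat)%C) with (rsum w l - fst (S 0%nat)) in Q. apply Rabs_le_between in Q. lra. }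
  assert (G := grid_variance gauss l w u good N M J (/ (6 * K)) B).
  assert (Wb : rsum (fun x => if good x then 0 else w x) l <= exp (- (b ^ 2 / 4)) * s0' + exp (L / 4 + 1 / 16) * C3).
  { apply Rle_trans with (rsum (fun x => exp (- (b ^ 2 / 4)) * wt sigma (L + b) x + exp (L / 4 + 1 / 16) * (if test (gprime x) then 0 else Lam x * gw (3 / 4) x)) l).
    - apply rsum_le. intros x _. assert (P1 := wt_nonneg sigma (L + b) x). assert (E1 := exp_pos (- (b ^ 2 / 4))). assert (E2 := exp_pos (L / 4 + 1 / 16)).
      assert (P3 : 0 <= Lam x * gw (3 / 4) x) by (apply Rmult_le_pos; [apply Lam_nonneg|apply gw_nonneg]).
      assert (0 <= exp (- (b ^ 2 / 4)) * wt sigma (L + b) x) by (apply Rmult_le_pos; lra). destruct (good x) eqn:Gx.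
      + destruct (test (gprime x)); [lra|]. assert (0 <= exp (L / 4 + 1 / 16) * (Lam x * gw (3 / 4) x)) by (apply Rmult_le_pos; lra). lra.
      + apply (proj1 (test_false _)) in Gx. destruct (test (gprime x)) eqn:Px.
        * apply (proj1 (test_true _)) in Px. rewrite Rmult_0_r, Rplus_0_r. apply wt_tail; auto; [apply gprime_neq0; auto|].
          apply Rnot_lt_le. intros Hlt. apply Gx. split; auto. lra.
        * assert (Q := wt_le sigma L (1 / 4) x). fold w in Q. assert (M1 : gw (sigma + 1 / 4) x <= gw (3 / 4) x) by (apply gw_mono; lra).
          assert (Lam x * gw (sigma + 1 / 4) x * exp (1 / 4 * L + (1 / 4) ^ 2) <= Lam x * gw (3 / 4) x * exp (L / 4 + 1 / 16)); [|lra].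
          replace (1 / 4 * L + (1 / 4) ^ 2) with (L / 4 + 1 / 16) by field. apply Rmult_le_compat_r; [lra|]. apply Rmult_le_compat_l; [apply Lam_nonneg|auto].
    - rewrite rsum_plus, !rsum_scal. assert (E1 := exp_pos (- (b ^ 2 / 4))). assert (E2 := exp_pos (L / 4 + 1 / 16)).
      apply Rplus_le_compat; apply Rmult_le_compat_l; try lra; [|apply HC3; auto].
      eapply Rle_trans; [apply (is_sum_rsum_le _ T l (wt_nonneg sigma (L + b)) HT Nl)|auto]. }
  set (wb := rsum (fun x => if good x then 0 else w x) l) in *. assert (Sp : 0 < rsum w l) by lra. eapply Rle_trans; [apply G; clear G|].
  - intros x _. apply wt_nonneg.
  - intros x _. unfold u. destruct (eqd x g0) as [|n]; [apply Cmod_1|apply Cmod_uz, gC_neq0; auto].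
  - auto.
  - auto.
  - apply NoDup_filter, seq_NoDup.
  - intros j Hj. apply filter_In in Hj. tauto.
  - apply Rinv_0_lt_compat. lra.
  - intros x j _ Gx Hj. apply (proj1 (test_true _)) in Gx. apply filter_In in Hj. destruct Hj as [_ Hj]. apply (proj1 (test_true _)) in Hj. destruct Hj as (theta & H1 & H2).
    unfold u. destruct (eqd x g0) as [E|n]; [exfalso; apply (gprime_neq0 x); [tauto|auto]|].
    apply (far_from_bad_cell K (exp (L + b)) N j x theta); tauto.
  - intros d Hd. rewrite (csum_ext _ (fun x => RtoC (wt sigma L x) * uz (gC x) ^ Datatypes.S d)%C) by (intros; apply Hwu).
    specialize (Hl (Datatypes.S d) ltac:(lia)). assert (Q := Cmod_triangle_sub (csum (fun x => RtoC (wt sigma L x) * uz (gC x) ^ Datatypes.S d)%C l) (S (Datatypes.S d))).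
    specialize (HB (Datatypes.S d) ltac:(lia)). lra.
  - auto.
  - fold wb. apply Rmult_le_compat_l; [apply pos_INR|].
    assert (W0 : 0 <= wb) by (apply rsum_nonneg; intros x _; destruct (good x); [lra|apply wt_nonneg]).
    apply Rplus_le_compat; [apply Rplus_le_compat_l|]; unfold Rdiv; apply Rmult_le_compat; auto; try lra.
    + left; positive.
    + apply Rinv_le_contravar; lra.
    + apply Rmult_le_pos; [apply Rmult_le_pos; [lra|apply pos_INR]|apply pow2_ge_0].
    + left; apply Rinv_0_lt_compat, pow_lt; lra.
    + apply Rinv_le_contravar; [apply pow_lt; lra|apply pow_incr; lra].
Qed.
End Count.

(** * Choice of parameters and conclusion *)

Lemma GRH_Ldata : (forall k : Z, GRH_Xi k) -> exists BB F f, Ldata BB F f.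
Proof.
  intros H. assert (W : forall sigma, 1 < sigma -> exists B, sum_bounded (gw sigma) B) by (destruct (H 0%Z) as (F & _ & HF & _); exact (gw_bounded F HF)).
  set (P := fun k (F : C -> C) => (forall z : C, z <> RtoC 1 -> diff_at F z) /\ (forall s, 1 < fst s -> is_sum (fk k s) (4 * F s)%C) /\
    (forall s, 0 < fst s < 1 -> F s = 0%C -> fst s = 1 / 2)).
  set (F := fun k => epsilon (inhabits (fun _ : C => RtoC 0)) (P k)).
  assert (HF : forall k, P k (F k)) by (intros k; apply epsilon_spec, GRH_data; auto).
  set (P2 := fun k (f : C -> C) => (forall s, strip s -> diff_at f s) /\ (forall s : C, s <> RtoC 1 -> f s = (mu k s * F k s)%C) /\
    (forall s, strip s -> (Dk k s * (4 * f s))%C = (mu k s * Rsum k s)%C)).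
  destruct (W (21 / 20)) as [BB HBB]; [lra|]. set (f := fun k => epsilon (inhabits (fun _ : C => RtoC 0)) (P2 k)).
  assert (Hf : forall k, P2 k (f k)).
  { intros k. apply epsilon_spec. destruct (HF k) as (H1 & H2 & _). apply (entire_part BB HBB); auto. }
  destruct (poly_bound BB HBB) as (CB & _ & HCB). exists CB, F, f. constructor; auto.
  - intros k. apply HF.
  - intros k. apply HF.
  - intros k. apply HF.
  - intros k. apply Hf.
  - intros k. apply Hf.
  - intros k. apply HCB; apply Hf.
Qed.

Lemma div_le_of_le (x y z : R) : 0 < y -> x <= z * y -> x / y <= z.
Proof. intros Hy H. apply Rmult_le_reg_r with y; auto. unfold Rdiv. rewrite Rmult_assoc, Rinv_l; lra. Qed.

Lemma nat_above (x : R) : 0 <= x -> exists n : nat, x <= INR n <= x + 1.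
Proof. intros H. destruct (nfloor_ex x H) as [n [H1 H2]]. exists (S n). rewrite S_INR. lra. Qed.

(** e^(b/2) bounds the growth of the total mass when L is raised to L + b; the Gaussian gain
    outweighs it. *)
Lemma gaussian_tail_small (q : R) : 0 < q -> exists b, 0 <= b /\ exp (- (b ^ 2 / 4)) * exp (b / 2) <= q.
Proof.
  intros Hq. set (b := Rmax 4 (2 / q)). assert (B4 : 4 <= b) by apply Rmax_l. assert (Bq : 2 / q <= b) by apply Rmax_r.
  exists b. split; [lra|]. rewrite <- exp_plus. apply Rle_trans with (exp (- (b / 2))); [apply exp_le_mono; nra|].
  rewrite exp_Ropp. assert (T := exp_ineq1_le (b / 2)). apply Rle_trans with (/ (b / 2)); [apply Rinv_le_contravar; lra|].
  replace q with (/ (/ q)) by (apply Rinv_inv). apply Rinv_le_contravar; [apply Rinv_0_lt_compat; auto|]. unfold Rdiv in Bq. lra.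
Qed.

(** The three error terms of [bad_cells_count] are each made at most [eps]: the first by [kap], the
    ratio of M to K; the second by [b] and large K; the third by large g(K). *)
Lemma few_bad_cells : (forall k : Z, GRH_Xi k) -> forall g : R -> R, (forall M : R, exists K0, 2 <= K0 /\ forall K, K0 <= K -> M <= g K) ->
  forall eps, 0 < eps -> exists K0, 2 <= K0 /\ forall K, K0 <= K -> exists N : nat, 0 < INR N /\
    3 / 4 * INR (length (bad_cells K (K * (ln K) ^ 2 * g K) N)) <= INR N * (3 * eps).
Proof.
  intros HG g Hg eps He. destruct (GRH_Ldata HG) as (BB & F & f & HL). destruct (smoothed_sums BB F f HL) as (C2 & c0 & HC2 & Hc0 & HSm).
  destruct (nonprime_mass (Ld_W _ _ _ HL)) as (C3 & HC3 & HNP).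
  destruct (gaussian_tail_small (c0 * eps / (8 * C2))) as (b & Hb & Hbq); [positive|].
  (* 6/(M/(6K))^2 = 216 (K/M)^2 is at most 216/kap^2, hence at most [eps]. *)
  set (kap := 216 / eps + 1). assert (Hk0 : 0 < 216 / eps) by positive. assert (Hkap : 1 <= kap) by (unfold kap; lra).
  assert (Hlk : 0 <= ln (2 * kap + 5)) by (rewrite <- ln_1; apply ln_le; lra). set (C4 := C2 * (ln (2 * kap + 5) + 1) + 1). 
  (* The size of g(K) at which the fluctuation term T3 drops to [eps]. *)
  set (G1 := 16 * (2 * kap + 3) * C4 ^ 2 * exp (b + 2) / (c0 ^ 2 * eps)). assert (Pc : 0 < c0 ^ 2) by (apply pow_lt; auto).
  (* A lower bound for r, the square root of E: it lets c0 E absorb C2 + 1, and makes the proper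
     prime powers, of size O(r), negligible against E. *)
  set (r1 := 1 + 2 * (C2 + 1) / c0 + 12 * C3 / (c0 * eps)). assert (R1 : 0 < 2 * (C2 + 1) / c0) by positive.
  assert (Hce : 0 < c0 * eps) by positive. assert (R2 : 0 < 12 * C3 / (c0 * eps)) by positive.
  destruct (Hg (Rmax 1 G1)) as (K1 & HK1 & Hg1).
  exists (Rmax K1 (exp (4 * r1 + 2 + b))). split; [eapply Rle_trans; [exact HK1|apply Rmax_l]|]. intros K HK.
  assert (Kg := Rle_trans _ _ _ (Rmax_l _ _) HK). assert (Ke := Rle_trans _ _ _ (Rmax_r _ _) HK). specialize (Hg1 K Kg).
  assert (g1' := Rle_trans _ _ _ (Rmax_l _ _) Hg1). assert (gG := Rle_trans _ _ _ (Rmax_r _ _) Hg1).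
  assert (LK : 4 * r1 + 2 + b <= ln K) by (rewrite <- (ln_exp (4 * r1 + 2 + b)); apply ln_le; [apply exp_pos|auto]).
  assert (Hr1 : 1 <= r1) by (unfold r1; lra). set (X := K * ln K ^ 2 * g K). assert (Hl2 : 1 <= ln K ^ 2) by nra.
  assert (XK : K <= X) by (unfold X; assert (K * 1 <= K * ln K ^ 2) by (apply Rmult_le_compat_l; lra); nra).
  (* Thus Y = e^L and X = Y e^b: the factor e^b is room for norms beyond Y, where the Gaussian has
     not yet decayed. *)
  set (L := ln X - b). assert (HLl : 4 * r1 + 2 <= L) by (unfold L; assert (ln K <= ln X) by (apply ln_le; lra); lra).
  assert (EX : exp (L + b) = X) by (unfold L; replace (ln X - b + b) with (ln X) by ring; apply exp_ln; lra).
  (* With this sigma E is e^(L/2 - 1), so E^2 is Y up to the constant e^2. *)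
  set (sigma := 1 / 2 + / L). assert (IL : 0 < / L) by positive.
  assert (IL4 : / L <= 1 / 4) by (replace (1 / 4) with (/ 4) by field; apply Rinv_le_contravar; lra).
  assert (Hs : 1 / 2 < sigma <= 3 / 4) by (unfold sigma; lra). set (r := exp ((L / 2 - 1) / 2)). set (E := exp (L * (1 - sigma))).
  assert (EE : E = r * r) by (unfold E, r; rewrite <- exp_plus; f_equal; unfold sigma; field; lra).
  assert (rr : r1 <= r) by (unfold r; assert (T := exp_ineq1_le ((L / 2 - 1) / 2)); lra). assert (Er : r <= E) by (rewrite EE; nra).
  assert (Ec : 2 * (C2 + 1) <= c0 * E).
  { apply Rle_trans with (2 * (C2 + 1) / c0 * c0); [right; field; lra|]. rewrite Rmult_comm. apply Rmult_le_compat_l; unfold r1 in *; lra. }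
  assert (Rc : 12 * C3 <= c0 * eps * r).
  { apply Rle_trans with (12 * C3 / (c0 * eps) * (c0 * eps)); [right; field; split; lra|]. rewrite Rmult_comm. apply Rmult_le_compat_l; unfold r1 in *; lra. }
  (* N >= 4K makes the cells narrow compared with the arcs; N > 2M is what Parseval requires. *)
  destruct (nat_above (kap * K)) as (M & M1 & M2); [nra|]. destruct (nat_above (4 * K + 2 * INR M + 1)) as (N & N1 & N2); [assert (P := pos_INR M); lra|].
  assert (KK : K <= kap * K) by nra. assert (HM0 : (0 < M)%nat) by (apply INR_lt; simpl; lra).
  assert (HMN : (2 * M < N)%nat) by (apply INR_lt; rewrite mult_INR; simpl (INR 2); lra).
  set (S := fun k => epsilon (inhabits (RtoC 0)) (fun S => is_sum (fun x => RtoC (wt sigma L x) * uz (gC x) ^ k)%C S /\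
    (k <> 0%nat -> Cmod S <= C2 * ln (INR k + 3)) /\ (k = 0%nat -> c0 * exp (L * (1 - sigma)) - C2 <= fst S <= C2 * exp (L * (1 - sigma)) + C2))).
  assert (HS : forall k, is_sum (fun x => RtoC (wt sigma L x) * uz (gC x) ^ k)%C (S k) /\
    (k <> 0%nat -> Cmod (S k) <= C2 * ln (INR k + 3)) /\ (k = 0%nat -> c0 * exp (L * (1 - sigma)) - C2 <= fst (S k) <= C2 * exp (L * (1 - sigma)) + C2)).
  { intros k. unfold S. apply epsilon_spec, HSm; auto. lra. }
  set (s0 := c0 * E - C2). set (s0' := 2 * C2 * E * exp (b / 2)). set (B := C2 * ln (2 * INR M + 3) + 1).
  exists N. split; [lra|]. fold X. rewrite <- EX.
  eapply Rle_trans; [apply (bad_cells_count C3 sigma L S HNP ltac:(lra) (fun k => proj1 (HS k)) b K s0 s0' B N M Hb); auto|].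
  - lra.
  - lra.
  - split; [unfold s0; lra|]. destruct (HS 0%nat) as (_ & _ & Q). apply Q; auto.
  - intros k Hk. destruct (HS k) as (_ & Q & _). specialize (Q ltac:(lia)). assert (C2 * ln (INR k + 3) <= C2 * ln (2 * INR M + 3)); [|unfold B; lra].
    apply Rmult_le_compat_l; [lra|]. apply ln_le; [assert (P := pos_INR k); lra|]. assert (P : INR k <= INR (2 * M)) by (apply le_INR; lia). rewrite mult_INR in P. simpl (INR 2) in P. lra.
  - destruct (HSm 0%nat sigma (L + b) Hs ltac:(lra)) as (T & HT & _ & Q). exists T. split; [eapply is_sum_ext; [|exact HT]; intros x; simpl; ring|].
    destruct (Q eq_refl) as [_ Q2]. eapply Rle_trans; [exact Q2|]. unfold s0'.
    assert (E1 : exp ((L + b) * (1 - sigma)) <= E * exp (b / 2)) by (unfold E; rewrite <- exp_plus; apply exp_le_mono; nra).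
    assert (E2 : 1 <= exp (b / 2)) by (rewrite <- exp_0; apply exp_le_mono; lra). assert (E3 : 1 <= E * exp (b / 2)) by nra.
    assert (C2 * exp ((L + b) * (1 - sigma)) <= C2 * (E * exp (b / 2))) by (apply Rmult_le_compat_l; lra).
    assert (C2 * 1 <= C2 * (E * exp (b / 2))) by (apply Rmult_le_compat_l; lra). lra.
  - apply Rmult_le_compat_l; [lra|]. assert (Hden : c0 * E / 2 <= s0 - 1) by (unfold s0; lra).
    assert (T1 : 6 / (INR M * / (6 * K)) ^ 2 <= eps).
    { assert (Hq : kap / 6 <= INR M * / (6 * K)).
      { replace (kap / 6) with (kap * K * / (6 * K)) by (field; lra). apply Rmult_le_compat_r; [left; positive|lra]. }
      assert (Hq2 : (kap / 6) ^ 2 <= (INR M * / (6 * K)) ^ 2) by (apply pow_incr; lra).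
      assert (kap <= kap ^ 2) by nra. assert (eps * kap = 216 + eps) by (unfold kap; field; lra).
      assert (eps * kap <= eps * kap ^ 2) by (apply Rmult_le_compat_l; lra).
      apply div_le_of_le; [apply Rlt_le_trans with ((kap / 6) ^ 2); auto; apply pow_lt; lra|].
      apply Rle_trans with (eps * (kap / 6) ^ 2); [|apply Rmult_le_compat_l; lra]. simpl in *. lra. }
    assert (T2 : (exp (- (b ^ 2 / 4)) * s0' + exp (L / 4 + 1 / 16) * C3) / (s0 - 1) <= eps).
    { apply div_le_of_le; [lra|]. apply Rle_trans with (eps * (c0 * E / 2)); [|apply Rmult_le_compat_l; lra].
      assert (A1 : exp (- (b ^ 2 / 4)) * s0' <= eps * (c0 * E / 4)).
      { unfold s0'. replace (exp (- (b ^ 2 / 4)) * (2 * C2 * E * exp (b / 2))) with (2 * C2 * E * (exp (- (b ^ 2 / 4)) * exp (b / 2))) by ring.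
        apply Rle_trans with (2 * C2 * E * (c0 * eps / (8 * C2))); [apply Rmult_le_compat_l; [|auto]; repeat apply Rmult_le_pos; lra|right; field; lra]. }
      assert (A2 : exp (L / 4 + 1 / 16) * C3 <= eps * (c0 * E / 4)).
      { assert (exp (L / 4 + 1 / 16) <= 3 * r).
        { replace (L / 4 + 1 / 16) with (9 / 16 + (L / 2 - 1) / 2) by field. rewrite exp_plus. fold r. apply Rmult_le_compat_r; [lra|].
          eapply Rle_trans; [|apply exp_le_3]. apply exp_le_mono; lra. }
        apply Rle_trans with (3 * r * C3); [apply Rmult_le_compat_r; lra|].
        assert (12 * C3 * r <= c0 * eps * r * r) by (apply Rmult_le_compat_r; lra). rewrite EE. lra. }
      lra. }
    (* Here the shape of X is used: M is of order K, B of order ln K and s0^2 of order X = K (ln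
       K)^2 g(K), so the quotient is O(1/g(K)). *)
    assert (T3 : 4 * INR (Datatypes.S (2 * M)) * B ^ 2 / (s0 - 1) ^ 2 <= eps).
    { assert (HE2 : E * E * exp (b + 2) = X).
      { rewrite <- EX. unfold E. rewrite <- !exp_plus. f_equal. unfold sigma. field. lra. }
      apply div_le_of_le; [apply pow_lt; lra|]. apply Rle_trans with (eps * (c0 * E / 2) ^ 2); [|apply Rmult_le_compat_l; [lra|apply pow_incr; lra]].
      assert (HB : 0 <= B <= C4 * ln K).
      { unfold B, C4. assert (0 <= ln (2 * INR M + 3)) by (rewrite <- ln_1; apply ln_le; lra).
        assert (ln (2 * INR M + 3) <= (ln (2 * kap + 5) + 1) * ln K).
        { apply Rle_trans with (ln ((2 * kap + 5) * K)); [apply ln_le; lra|]. rewrite ln_mult by lra. nra. }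
        split; [nra|]. assert (C2 * ln (2 * INR M + 3) <= C2 * ((ln (2 * kap + 5) + 1) * ln K)) by (apply Rmult_le_compat_l; lra). lra. }
      assert (HB2 : B ^ 2 <= C4 ^ 2 * ln K ^ 2) by (rewrite <- Rpow_mult_distr; apply pow_incr; lra).
      assert (HD : INR (Datatypes.S (2 * M)) <= (2 * kap + 3) * K) by (rewrite S_INR, mult_INR; simpl (INR 2); lra).
      apply Rle_trans with (4 * ((2 * kap + 3) * K) * (C4 ^ 2 * ln K ^ 2)).
      - apply Rmult_le_compat; [apply Rmult_le_pos; [lra|apply pos_INR]|apply pow2_ge_0|lra|auto].
      - apply Rmult_le_reg_r with (4 * exp (b + 2)); [assert (P := exp_pos (b + 2)); lra|].
        replace (eps * (c0 * E / 2) ^ 2 * (4 * exp (b + 2))) with (c0 ^ 2 * eps * (E * E * exp (b + 2))) by field. rewrite HE2. unfold X.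
        replace (4 * ((2 * kap + 3) * K) * (C4 ^ 2 * ln K ^ 2) * (4 * exp (b + 2))) with (c0 ^ 2 * eps * (K * ln K ^ 2 * G1)) by (unfold G1; field; split; lra).
        apply Rmult_le_compat_l; [apply Rmult_le_pos; lra|]. apply Rmult_le_compat_l; [apply Rmult_le_pos; lra|auto]. }
    lra.
Qed.

Lemma cell_exists (N : nat) (theta : R) : 0 < INR N -> 0 <= theta < PI / 2 -> exists j, (j < N)%nat /\ cell N j theta.
Proof.
  intros HN Ht. set (q := theta / (PI / 2 / INR N)). assert (Pq : 0 < PI / 2 / INR N) by positive.
  assert (E : theta = q * (PI / 2 / INR N)) by (unfold q; field; split; lra).
  destruct (nfloor_ex q) as [j [H1 H2]]; [unfold q; apply Rmult_le_pos; [lra|left; apply Rinv_0_lt_compat; auto]|]. exists j. split.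
  - apply INR_lt. apply Rle_lt_trans with q; auto. apply Rmult_lt_reg_r with (PI / 2 / INR N); auto. rewrite <- E. replace (INR N * (PI / 2 / INR N)) with (PI / 2) by (field; lra). lra.
  - unfold cell. rewrite S_INR. replace (PI / 2 * INR j / INR N) with (INR j * (PI / 2 / INR N)) by (field; lra).
    replace (PI / 2 * (INR j + 1) / INR N) with ((INR j + 1) * (PI / 2 / INR N)) by (field; lra). rewrite E. split; [apply Rmult_le_compat_r|apply Rmult_lt_compat_r]; lra.
Qed.

(** Each bad cell is widened by pi/(4N) on both sides, so that open intervals cover it, at the price
    of doubling its length pi/(2N). Indices beyond the list get the empty interval with both ends
    0. *)
Lemma cells_outer_measure (K X eps : R) (N : nat) : 0 < INR N -> INR (length (bad_cells K X N)) * (PI / INR N) < eps -> outer_measure_lt (bad_set K X) eps.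
Proof.
  intros HN Heps. assert (P := PI_RGT_0). set (J := bad_cells K X N) in *. set (h := PI / 4 / INR N). assert (Hh : 0 < h) by positive.
  set (lo := fun n => if lt_dec n (length J) then PI / 2 * INR (nth n J 0%nat) / INR N - h else 0).
  set (hi := fun n => if lt_dec n (length J) then PI / 2 * INR (S (nth n J 0%nat)) / INR N + h else 0).
  assert (D : forall n, hi n - lo n = if lt_dec n (length J) then PI / INR N else 0).
  { intros n. unfold hi, lo. destruct (lt_dec n (length J)); [|ring]. rewrite S_INR. unfold h. field. lra. }
  exists lo, hi, (INR (length J) * (PI / INR N)). split; [|split; [|split]]; auto.
  - intros n. assert (Q := D n). destruct (lt_dec n (length J)); [assert (0 < PI / INR N) by positive|]; lra.
  - intros theta Ht. destruct (cell_exists N theta HN (proj1 Ht)) as (j & Hj & Hc).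
    assert (HjJ : In j J) by (apply filter_In; split; [apply in_seq; lia|apply test_true; eauto]).
    destruct (In_nth J j 0%nat HjJ) as (n & Hn & En). exists n. unfold lo, hi. destruct (lt_dec n (length J)); [|contradiction].
    rewrite En. destruct Hc. lra.
  - intros e He. exists (length J). intros n Hn. rewrite sum_f_R0_rsum.
    rewrite (rsum_same_support (fun n => hi n - lo n) (seq 0 (length J)) (seq 0 (S n))); [|apply seq_NoDup|apply seq_NoDup| |].
    + rewrite (rsum_ext _ (fun _ => PI / INR N)), rsum_const, length_seq; [unfold R_dist; rewrite Rminus_diag, Rabs_R0; auto|].
      intros m Hm. apply in_seq in Hm. rewrite D. destruct (lt_dec m (length J)); [auto|lia].
    + intros m Hm. apply in_seq in Hm. apply in_seq. lia.
    + intros m _ Hm. rewrite D. destruct (lt_dec m (length J)); auto. exfalso. apply Hm, in_seq. lia.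
Qed.

Theorem theorem1p1 :
  (forall k : Z, GRH_Xi k) ->
  forall g : R -> R,
    (forall K, 2 <= K -> 0 < g K) ->
    (forall M : R, exists K0, 2 <= K0 /\ forall K, K0 <= K -> M <= g K) ->
    forall eps : R, 0 < eps ->
      exists K0 : R, 2 <= K0 /\ forall K : R, K0 <= K ->
        outer_measure_lt (bad_set K (K * (ln K) ^ 2 * g K)) eps.
Proof.
  (* Three quarters of the count is at most 3 N eps/32, so at most N eps/8 cells are bad. Each costs
     pi/N <= 4/N, in total at most eps/2. *)
  intros HG g _ Hg eps He. destruct (few_bad_cells HG g Hg (eps / 32) ltac:(lra)) as (K0 & HK0 & H).
  exists K0. split; auto. intros K HK. destruct (H K HK) as (N & HN & HJ). apply (cells_outer_measure K _ eps N HN).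
  assert (P4 := PI_4). assert (P := PI_RGT_0). set (n := INR (length (bad_cells K (K * ln K ^ 2 * g K) N))) in *.
  replace (n * (PI / INR N)) with (n * PI / INR N) by (field; lra).
  apply Rmult_lt_reg_r with (INR N); auto. unfold Rdiv. rewrite Rmult_assoc, Rinv_l, Rmult_1_r by lra.
  assert (0 < INR N * eps) by positive.
  apply Rle_lt_trans with (INR N * (eps / 8) * 4); [|lra]. apply Rmult_le_compat; try lra. apply pos_INR.
Qed.
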